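(* Let $p>1$ with Hölder conjugate $p'=p/(p-1)$, let $\theta\in[0,1]$, $\bar\theta=1-\theta$, and let $f,g\in L^p(\gamma)$ be smooth functions. Then, as $t\to0^+$, \[ \|P_tf\|_{L^q(\gamma)}^{\bar\theta}\,\|P_tg\|_{L^q(\gamma)}^{\theta}\le \exp\Big(-\frac{2t}{p\,p'}E_{p,\theta}(f,g)+o(t)\Big)\,\|f\|_{L^p(\gamma)}^{\bar\theta}\,\|g\|_{L^p(\gamma)}^{\theta} \] for all $q\ge p$ such that $q\le 1+(p-1)e^{2t}$.
   Context: $\gamma$ is the standard Gaussian measure on $\mathbb{R}^d$ with density $\phi(x)=(2\pi)^{-d/2}e^{-|x|^2/2}$. The Ornstein–Uhlenbeck semigroup is $P_tf(x)=\int_{\mathbb{R}^d}f\big(e^{-t}x+(1-e^{-2t})^{1/2}y\big)\,d\gamma(y)$. For a random vector $Z$ with density $h$ (w.r.t. Lebesgue), $D(Z):=\int h\log\frac{h}{\phi}$. For $f,g\in L^p(\gamma)$, let $X$ be the random vector whose density with respect to $\gamma$ is proportional to $|f|^p$, and $Y$ the random vector whose density with respect to $\gamma$ is proportional to $|g|^p$; set $\hat X=X-\mathbb{E}X$, $\hat Y=Y-\mathbb{E}Y$ (taken independent), and define $E_{p,\theta}(f,g):=\theta D(\hat X)+\bar\theta D(\hat Y)-D(\sqrt\theta\hat X+\sqrt{\bar\theta}\hat Y)$.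
   Formalization: The formal theorem assumes that f and g are not a.e. zero, that X and Y have finite means, and that E_{p,θ}(f,g) is a finite real number; when E is +∞ the stated inequality is false, and otherwise E is undefined. *)

(* Defs.v *)
From HB Require Import structures.
From mathcomp Require Import all_boot all_order all_algebra.
From mathcomp Require Import all_classical all_reals all_analysis.
Set Implicit Arguments. Unset Strict Implicit. Unset Printing Implicit Defensive.
Import Order.TTheory GRing.Theory Num.Theory.
Import numFieldNormedType.Exports.
Local Open Scope classical_set_scope.
Local Open Scope ring_scope.

Section gauss.
Context {R : realType}.
Local Open Scope ereal_scope.

(* integral against the standard Gaussian measure on R^d, defined as the
   iterated integral against the one-dimensional standard normal law *)
Fixpoint gint_tuple (d : nat) : (d.-tuple R -> \bar R) -> \bar R :=
  match d with
  | 0 => fun F => F [tuple]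
  | d'.+1 => fun F =>
      \int[normal_prob (0:R) 1]_x gint_tuple (fun v : d'.-tuple R => F [tuple of x :: v])
  end.

Definition row_of_tuple (d : nat) (t : d.-tuple R) : 'rV[R]_d := \row_i tnth t i.

Definition gint (d : nat) (F : 'rV[R]_d -> \bar R) : \bar R :=
  gint_tuple (fun t => F (row_of_tuple t)).

Definition gmeasurable (d : nat) (h : 'rV[R]_d -> R) : Prop :=
  measurable_fun [set: d.-tuple R] (fun t => h (row_of_tuple t)).

Definition gaussLnorm (d : nat) (p : R) (F : 'rV[R]_d -> \bar R) : \bar R :=
  poweR (gint (fun x => poweR `|F x| p)) p^-1.

Definition OU (d : nat) (t : R) (f : 'rV[R]_d -> R) (x : 'rV[R]_d) : \bar R :=
  gint (fun y => (f (expR (- t) *: x + Num.sqrt (1 - expR (- (2 * t))) *: y))%:E).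

(* density w.r.t. gamma of the random vector associated with f: |f|^p / ||f||_p^p *)
Definition pdens (d : nat) (p : R) (f : 'rV[R]_d -> R) (x : 'rV[R]_d) : R :=
  (`|f x| `^ p) / fine (gint (fun y => (`|f y| `^ p)%:E)).

Definition gmean (d : nat) (rho : 'rV[R]_d -> R) : 'rV[R]_d :=
  \row_i fine (gint (fun x => (x 0 i * rho x)%:E)).

(* A law on R^d is given by its expectation functional E[h(Z)] on
   nonnegative measurable test functions h.  rho is a density w.r.t. gamma. *)
Definition is_gdensity (d : nat) (Ex : ('rV[R]_d -> R) -> \bar R)
    (rho : 'rV[R]_d -> R) : Prop :=
  gmeasurable rho /\ (forall x, (0 <= rho x)%R) /\
  forall h : 'rV[R]_d -> R, gmeasurable h -> (forall x, (0 <= h x)%R) ->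
    Ex h = gint (fun x => (rho x * h x)%:E).

(* relative entropy D(Z) = int h log (h/phi) dx = int rho log rho dgamma,
   where rho = h/phi is the density of Z w.r.t. gamma *)
Definition Dent (d : nat) (Ex : ('rV[R]_d -> R) -> \bar R) : \bar R :=
  match pselect (exists rho, is_gdensity Ex rho) with
  | left H => let rho := projT1 (cid H) in
              gint (fun x => (rho x * ln (rho x))%:E)
  | right _ => +oo
  end.

(* laws of hat X = X - E X, and of sqrt(th) hatX + sqrt(1-th) hatY
   (hatX, hatY independent) *)
Definition law_hat (d : nat) (p : R) (f : 'rV[R]_d -> R) :
    ('rV[R]_d -> R) -> \bar R :=
  fun h => gint (fun x => (pdens p f x * h (x - gmean (pdens p f)))%:E).

Definition law_mix (d : nat) (p th : R) (f g : 'rV[R]_d -> R) :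
    ('rV[R]_d -> R) -> \bar R :=
  fun h => gint (fun x => gint (fun y =>
    (pdens p f x * pdens p g y *
     h (Num.sqrt th *: (x - gmean (pdens p f))
        + Num.sqrt (1 - th) *: (y - gmean (pdens p g))))%:E)).

Definition Ept (d : nat) (p th : R) (f g : 'rV[R]_d -> R) : \bar R :=
  th%:E * Dent (law_hat p f) + (1 - th)%:E * Dent (law_hat p g)
  - Dent (law_mix p th f g).

End gauss.

Section smooth.
Context {R : realType}.
Fixpoint iderive (d : nat) (vs : seq 'rV[R]_d) (f : 'rV[R]_d -> R) : 'rV[R]_d -> R :=
  match vs with
  | [::] => f
  | v :: vs' => fun x => 'D_v (iderive vs' f) x
  end.
Definition smooth (d : nat) (f : 'rV[R]_d -> R) : Prop :=
  forall (vs : seq 'rV[R]_d) (x : 'rV[R]_d), differentiable (iderive vs f) x.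
End smooth.

(* Main.v *)
(** Normalise f in L^p and let rho = |f|^p phi be the Lebesgue density of X.  By
    Mehler's formula P_t f is, up to Gaussian factors, a smoothing of rho^(1/p)
    at a scale s with s^2 ~ 2t.  The Jensen gap of z^p and Fatou's lemma give,
    for the critical exponent q(t) = 1 + (p - 1) e^(2t),
      limsup_(t -> 0+) (1/t) ln ||P_t f||_q(t) <= kap (D(X) - M/2 + d - J/2),
    where kap = 2/(p p'), M is the second moment and J the Fisher information;
    both D - M/2 and J are invariant under translation, so X may be centred.

    Put c = sqrt th, s = sqrt (1 - th) and apply the logarithmic Sobolev
    inequality in w to rho_X(cz + sw) rho_Y(sz - cw), for each z.  Integrating
    over z, the cross terms vanish because Y is centred, and
      D(X) + D(Y) + d <= D(cX + sY) + (1/2) (s^2 (M_X + J_X) + c^2 (M_Y + J_Y)).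
    Hence the combination of the two rates with weights 1 - th and th is at most
    - kap E.  If a Fisher information is infinite, the corresponding rate is
    - oo and the other factor is bounded by hypercontractivity.  For th = 0 or 1,
    E = 0 and the claim is Nelson's hypercontractivity, which follows from the
    same rate: by the logarithmic Sobolev inequality ln ||P_t f||_q(t) has
    nonpositive upper Dini derivative when f is bounded and bounded below. *)

Require Import Defs.
From HB Require Import structures.
From mathcomp Require Import all_boot all_order all_algebra.
From mathcomp Require Import all_classical all_reals all_analysis.
From mathcomp Require Import measurable_realfun.
From mathcomp Require Import ring lra.
Set Implicit Arguments. Unset Strict Implicit. Unset Printing Implicit Defensive.
Import Order.TTheory GRing.Theory Num.Theory.
Import numFieldNormedType.Exports.
Local Open Scope classical_set_scope.
Local Open Scope ring_scope.
Local Opaque integral.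

(** * Product measures on row vectors *)

(** The norm is never differentiated in t: rho may vanish and its Fisher information may be
    infinite. Only an upper bound for the rate is wanted, and it comes by contraposition: if the
    q(t)-norm is at least e^(t lam) along some t_n -> 0, Fatou's lemma bounds the Fisher information
    in terms of lam. Fatou's lemma asks for nonnegative integrands, and this shapes the whole
    development: entropies are integrals of a ln (a/b) - a + b, x ln x is split into [lnp] and
    [lnm], and identities between signed integrals are proved by moving negative parts to the other
    side. The critical exponent is the one for which the Gaussian factors of Mehler's formula cancel
    exactly and leave a Lebesgue norm of the smoothed rho^(1/p). In the smoothed rho minus the q-th
    power of its smoothed root, divided by s^2, the Jensen gap contributes (p - 1)/(2p) |grad rho|^2
    / rho and the growth of the exponent - (p - 1)/p rho ln rho. Since q t lam ~ s^2 p lam / 2, the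
    common factor (p - 1)/p turns into kap = 2 (p - 1)/p^2. *)

Section measurable_row.
Context {R : realType} (d : nat).

Let coors : 'I_d -> 'rV[R]_d -> measurableTypeR R := fun i x => x 0 i.

Let row_set0 : g_sigma_preimage coors set0.
Proof. exact: sigma_algebra0. Qed.

Let row_setC A : g_sigma_preimage coors A -> g_sigma_preimage coors (~` A).
Proof. exact: sigma_algebraC. Qed.

Let row_bigcup (F : _^nat) : (forall i, g_sigma_preimage coors (F i)) ->
  g_sigma_preimage coors (\bigcup_i (F i)).
Proof. exact: sigma_algebra_bigcup. Qed.

(* The sigma-algebra on 'rV generated by the coordinates. *)
HB.instance Definition _ := @isMeasurable.Build default_measure_display
  'rV[R]_d (g_sigma_preimage coors) row_set0 row_setC row_bigcup.

Lemma measurable_coord (i : 'I_d) :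
  measurable_fun [set: 'rV[R]_d] (fun x : 'rV[R]_d => x 0 i).
Proof.
move=> _ Y mY; rewrite setTI; apply: sub_sigma_algebra => /=.
rewrite -bigcup_seq/=; exists i => /=; first by rewrite mem_index_enum.
by exists Y => //; rewrite setTI.
Qed.

Lemma measurable_rowP d1 (T1 : measurableType d1) (f : T1 -> 'rV[R]_d) :
  (forall i, measurable_fun [set: T1] (fun x => f x 0 i)) ->
  measurable_fun [set: T1] f.
Proof.
move=> mf.
suff H : g_sigma_preimage (fun i x => coors i (f x)) `<=` measurable.
  move=> _ A mA; rewrite setTI; apply: H.
  rewrite (_ : (fun i x => _) = (fun i => coors i \o f))//.
  by rewrite g_sigma_preimage_comp; exists A => //; rewrite setTI.
apply: smallest_sub; first exact: sigma_algebra_measurable.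
rewrite -bigcup_seq => A /= [i _ [B mB <-]].
exact: mf.
Qed.
End measurable_row.

Section row_lemmas.
Context {R : realType}.

Lemma measurable_row_of_tuple d :
  measurable_fun [set: d.-tuple R] (@row_of_tuple R d).
Proof.
apply: measurable_rowP => i.
under eq_fun do rewrite mxE.
exact: measurable_tnth.
Qed.

Definition tuple_of_row d (x : 'rV[R]_d) : d.-tuple R := [tuple x 0 i | i < d].

Lemma tuple_of_rowK d : cancel (@tuple_of_row d) (@row_of_tuple R d).
Proof. by move=> x; apply/rowP => i; rewrite mxE /tuple_of_row tnth_mktuple. Qed.

(** Bridge from the tuples of the statement to row vectors: the two are exchanged by a bijection
    that is measurable in both directions. *)
Lemma gmeasurableE d (h : 'rV[R]_d -> R) :
  gmeasurable h <-> measurable_fun [set: 'rV[R]_d] h.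
Proof.
split=> mh; last by apply: measurableT_comp => //; exact: measurable_row_of_tuple.
rewrite (_ : h = (fun t => h (row_of_tuple t)) \o @tuple_of_row d); last first.
  by apply/funext => x /=; rewrite tuple_of_rowK.
apply: measurableT_comp => //; apply/measurable_fun_tnthP => i.
suff : measurable_fun [set: 'rV[R]_d] (fun x : 'rV[R]_d => x 0 i).
  by congr measurable_fun; apply/funext => x /=; rewrite /tuple_of_row tnth_mktuple.
exact: measurable_coord.
Qed.

(** Cons for row vectors, mirroring the [x :: v] of the recursion that defines the Gaussian
    integral; inductions on the dimension go through it. *)
Definition consr d (x : R) (v : 'rV[R]_d) : 'rV[R]_d.+1 :=
  \row_i (if unlift ord0 i is Some j then v 0 j else x).

Lemma consr0 d x (v : 'rV[R]_d) : consr x v 0 ord0 = x.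
Proof. by rewrite mxE unlift_none. Qed.

Lemma consrS d x (v : 'rV[R]_d) i : consr x v 0 (lift ord0 i) = v 0 i.
Proof. by rewrite mxE liftK. Qed.

Lemma consrP d (u v : 'rV[R]_d.+1) : u 0 ord0 = v 0 ord0 ->
  (forall i, u 0 (lift ord0 i) = v 0 (lift ord0 i)) -> u = v.
Proof.
move=> h0 hS; apply/rowP => i.
by have [j ->|->] := unliftP ord0 i.
Qed.

Lemma consrD d x y (u v : 'rV[R]_d) : consr x u + consr y v = consr (x + y) (u + v).
Proof. by apply: consrP => [|i]; rewrite !(mxE, unlift_none, liftK). Qed.

Lemma consrZ d a x (u : 'rV[R]_d) : a *: consr x u = consr (a * x) (a *: u).
Proof. by apply: consrP => [|i]; rewrite !(mxE, unlift_none, liftK). Qed.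

Lemma consr_eta d (u : 'rV[R]_d.+1) :
  u = consr (u 0 ord0) (\row_i u 0 (lift ord0 i)).
Proof. by apply: consrP => [|i]; rewrite !(mxE, unlift_none, liftK). Qed.

Lemma row_of_tuple_cons d x (v : d.-tuple R) :
  row_of_tuple [tuple of x :: v] = consr x (row_of_tuple v).
Proof. by apply: consrP => [|i]; rewrite !(mxE, unlift_none, liftK)// tnthS. Qed.

Lemma measurable_consr d1 (T1 : measurableType d1) d (f : T1 -> R) (g : T1 -> 'rV[R]_d) :
  measurable_fun [set: T1] f -> measurable_fun [set: T1] g ->
  measurable_fun [set: T1] (fun x => consr (f x) (g x)).
Proof.
move=> mf mg; apply: measurable_rowP => i.
have [j ->|->] := unliftP ord0 i.
  under eq_fun do rewrite consrS.
  by apply: (measurableT_comp (measurable_coord j)).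
by under eq_fun do rewrite consr0.
Qed.

Lemma measurable_consr2 d :
  measurable_fun [set: measurableTypeR R * 'rV[R]_d] (fun z => consr z.1 z.2).
Proof. exact: measurable_consr. Qed.

Lemma measurable_rowD d1 (T1 : measurableType d1) d (f g : T1 -> 'rV[R]_d) :
  measurable_fun [set: T1] f -> measurable_fun [set: T1] g ->
  measurable_fun [set: T1] (fun x => f x + g x).
Proof.
move=> mf mg; apply: measurable_rowP => i.
under eq_fun do rewrite mxE.
by apply: measurable_funD; apply: (measurableT_comp (measurable_coord i)).
Qed.

Lemma measurable_rowZ d1 (T1 : measurableType d1) d a (f : T1 -> 'rV[R]_d) :
  measurable_fun [set: T1] f -> measurable_fun [set: T1] (fun x => a *: f x).
Proof.
move=> mf; apply: measurable_rowP => i.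
under eq_fun do rewrite mxE.
by apply: measurable_funM => //; apply: (measurableT_comp (measurable_coord i)).
Qed.
End row_lemmas.

Section product_power.
Context {R : realType} (m : {sigma_finite_measure set (measurableTypeR R) -> \bar R}).

Section step.
Context d (nu : {sigma_finite_measure set 'rV[R]_d -> \bar R}).

Let consp (z : measurableTypeR R * 'rV[R]_d) : 'rV[R]_d.+1 := consr z.1 z.2.

Let mconsp : measurable_fun setT consp.
Proof. exact: measurable_consr. Qed.

Let pf : {measure set 'rV[R]_d.+1 -> \bar R} :=
  measure_function_pushforward__canonical__measure_function_Measure (m \x nu)%E mconsp.

Definition consm : set 'rV[R]_d.+1 -> \bar R := pushforward (m \x nu)%E consp.

HB.instance Definition _ := isMeasure.Build _ _ _ consm
  (measure0 pf) (measure_ge0 pf) (@measure_semi_sigma_additive _ _ _ pf).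

Let sigma_finite_consm : sigma_finite setT consm.
Proof.
have /sigma_finiteP[F [TF ndF Foo]] := sigma_finiteT m.
have /sigma_finiteP[G [TG ndG Goo]] := sigma_finiteT nu.
(* Inverse of [consp]: the exhausting sets have to live in row vectors, so products of exhausting
   sets are pulled back along it. *)
pose un (u : 'rV[R]_d.+1) : measurableTypeR R * 'rV[R]_d :=
  (u 0 ord0, \row_i u 0 (lift ord0 i)).
have mun : measurable_fun setT un.
  apply: measurable_fun_pair; first exact: measurable_coord.
  by apply: measurable_rowP => i; under eq_fun do rewrite mxE; exact: measurable_coord.
exists (fun n => un @^-1` (F n `*` G n)).
  rewrite -preimage_bigcup (_ : \bigcup_n _ = setT) ?preimage_setT//.
  rewrite -setXTT TF TG predeqE => -[x y]; split.
    by move=> [n _ []/= ? ?]; split; exists n.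
  move=> [/= [n _ Fnx] [k _ Gky]]; exists (maxn n k) => //; split.
  - by move: x Fnx; exact/subsetPset/ndF/leq_maxl.
  - by move: y Gky; exact/subsetPset/ndG/leq_maxr.
move=> k; have [mF Fk] := Foo k; have [mG Gk] := Goo k; split.
  by rewrite -[X in measurable X]setTI; apply: mun => //; exact: measurableX.
rewrite /consm /pushforward -comp_preimage (_ : un \o _ = id).
  by rewrite preimage_id product_measure1E// lte_mul_pinfty// ge0_fin_numE.
apply/funext => -[x v]/=; rewrite /un /consp consr0; congr pair.
by apply/rowP => i; rewrite mxE consrS.
Qed.

HB.instance Definition _ := Measure_isSigmaFinite.Build _ _ _ consm sigma_finite_consm.

Lemma integral_consm (F : 'rV[R]_d.+1 -> \bar R) : measurable_fun setT F ->
  (forall x, 0 <= F x)%E ->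
  (\int[consm]_x F x = \int[m]_x \int[nu]_v F (consr x v))%E.
Proof.
move=> mF F0.
rewrite /consm ge0_integral_pushforward//=.
by rewrite preimage_setT fubini_tonelli1//=; exact: measurableT_comp.
Qed.
End step.

Definition dirac0 : set 'rV[R]_0 -> \bar R := dirac (0 : 'rV[R]_0).
HB.instance Definition _ := Measure.on dirac0.
HB.instance Definition _ := SigmaFiniteMeasure.on dirac0.

Fixpoint powm d : {sigma_finite_measure set 'rV[R]_d -> \bar R} :=
  match d with
  | 0%N => dirac0
  | d'.+1 => consm (powm d')
  end.

Lemma integral_powm0 (F : 'rV[R]_0 -> \bar R) : measurable_fun setT F ->
  (\int[powm 0]_x F x)%E = F 0.
Proof. by move=> mF; rewrite /= integral_dirac// diracT mul1e. Qed.

Lemma integral_powmS d (F : 'rV[R]_d.+1 -> \bar R) : measurable_fun setT F ->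
  (forall x, 0 <= F x)%E ->
  (\int[powm d.+1]_x F x = \int[m]_x \int[powm d]_v F (consr x v))%E.
Proof. exact: integral_consm. Qed.
End product_power.

(** * Integration against a density and affine changes of variables *)

Section density.
Local Open Scope ereal_scope.
Context d (T : measurableType d) (R : realType).
Variables (nu mu : {measure set T -> \bar R}) (g : T -> R).
Hypothesis mg : measurable_fun setT g.
Hypothesis g0 : forall x, (0 <= g x)%R.
Hypothesis nuE : forall A, measurable A -> nu A = \int[mu]_(x in A) (g x)%:E.

Import HBNNSimple.

(** Both sides agree on simple functions, by [nuE] on each level set, and pass to the limit by
    monotone convergence. *)
Lemma ge0_integral_density (f : T -> \bar R) : measurable_fun setT f ->
  (forall x, 0 <= f x) ->
  \int[nu]_x f x = \int[mu]_x (f x * (g x)%:E).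
Proof.
move=> mf f0; pose f_ := nnsfun_approx measurableT mf.
have mgE : measurable_fun setT (EFin \o g) by exact/measurable_EFinP.
have cvf x : (f_ n x)%:E @[n --> \oo] --> f x.
  by apply: cvg_nnsfun_approx => // y _; exact: f0.
transitivity (limn (fun n => \int[nu]_x (f_ n x)%:E)).
  rewrite -monotone_convergence//=.
  - by apply: eq_integral => x _; apply/esym/cvg_lim => //; exact: cvf.
  - by move=> n; exact/measurable_EFinP/measurable_funTS.
  - by move=> n x _; rewrite lee_fin.
  - by move=> x _ a b ab; rewrite lee_fin//; exact/lefP/nd_nnsfun_approx.
transitivity (limn (fun n => \int[mu]_x ((f_ n x)%:E * (g x)%:E))).
  congr (limn _); apply/funext => n.
  transitivity (\sum_(k \in range (f_ n)) k%:E * nu (f_ n @^-1` [set k])).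
    by rewrite integralT_nnsfun sintegralE.
  transitivity (\sum_(k \in range (f_ n))
     \int[mu]_x ((k * \1_(f_ n @^-1` [set k]) x * g x)%:E)).
    apply: eq_fsbigr => r /[!inE] -[y _ fyr].
    have r0 : (0 <= r)%R by rewrite -fyr.
    rewrite nuE//; under [RHS]eq_integral do rewrite -mulrA EFinM.
    rewrite ge0_integralZl//=; last first.
    - by move=> x _; rewrite lee_fin mulr_ge0.
    - by apply/measurable_EFinP; exact: measurable_funM.
    congr (_ * _); rewrite [LHS]integral_mkcond; apply: eq_integral => x _.
    rewrite patchE indicE; case: ifPn => // _; first by rewrite mul1r.
    by rewrite mul0r.
  rewrite -ge0_integral_fsum//=.
  - apply: eq_integral => x _.
    rewrite (fimfunE (f_ n) x) -fsumEFin// ge0_mule_fsuml//.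
    by move=> r; exact: nnfun_muleindic_ge0.
  - by move=> r; apply/measurable_EFinP; do 2 apply: measurable_funM => //.
  - move=> r x _; rewrite EFinM mule_ge0 ?lee_fin//.
    exact: (nnfun_muleindic_ge0 (f_ n) r x).
rewrite -monotone_convergence//=.
- apply: eq_integral => x _; apply/cvg_lim => //; apply: cvgeZr => //; exact: cvf.
- move=> n; apply: emeasurable_funM => //.
  by apply/measurable_EFinP/measurable_funTS.
- by move=> n x _; rewrite -EFinM lee_fin mulr_ge0.
- move=> x _ a b ab; rewrite -!EFinM lee_fin ler_wpM2r//.
  exact/lefP/nd_nnsfun_approx.
Qed.
End density.

Section lebesgue_affine.
Context {R : realType}.
Local Notation mu := (@lebesgue_measure R).

Section scale.
Variables (a : {posnum R}) (b : R).
Let T (x : measurableTypeR R) : measurableTypeR R := a%:num * x + b.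
Let mT : measurable_fun setT T.
Proof. by apply: measurable_funD => //; exact: measurable_funM. Qed.
Let pf : {measure set (measurableTypeR R) -> \bar R} :=
  measure_function_pushforward__canonical__measure_function_Measure mu mT.

(** Uniqueness of Lebesgue measure reduces the claim to half-open intervals. *)
Lemma lebesgue_measure_affine A : measurable A ->
  mu A = mscale (NngNum (ltW [gt0 of a%:num])) pf A.
Proof.
move=> mA; apply: lebesgue_measure_unique => //= _ [[u v]] _ <-.
rewrite /mscale/= /pushforward.
have -> : T @^-1` `]u, v] = `](u - b) / a%:num, (v - b) / a%:num]%classic.
  apply/seteqP; split=> x /=; rewrite !in_itv/= /T ltr_pdivrMr// ler_pdivlMr//;
    rewrite ltrBlDr lerBrDr (mulrC x); exact.
rewrite !lebesgue_measure_itv/= !lte_fin ltr_pM2r// ltrD2r.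
case: ifPn => uv; last by rewrite mule0.
by rewrite -!EFinB -EFinM; congr EFin; field.
Qed.

Lemma ge0_integral_affine0 (f : R -> \bar R) : measurable_fun setT f ->
  (forall x, 0 <= f x)%E ->
  (a%:num%:E * \int[mu]_x f (a%:num * x + b)%R = \int[mu]_x f x)%E.
Proof.
move=> mf f0.
transitivity (\int[mscale (NngNum (ltW [gt0 of a%:num])) pf]_x f x)%E; last first.
  by apply: eq_measure_integral => A mA _; first [exact: lebesgue_measure_affine|exact/esym/lebesgue_measure_affine].
rewrite ge0_integral_mscale//=; congr (_ * _)%E.
by rewrite ge0_integral_pushforward.
Qed.
End scale.

Lemma ge0_integral_affine (a b : R) (f : R -> \bar R) : 0 < a ->
  measurable_fun setT f -> (forall x, 0 <= f x)%E ->
  (a%:E * \int[mu]_x f (a * x + b)%R = \int[mu]_x f x)%E.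
Proof. by move=> a0 mf f0; exact: (@ge0_integral_affine0 (PosNum a0) b). Qed.

Lemma ge0_integral_oppr (f : R -> \bar R) :
  measurable_fun setT f -> (forall x, 0 <= f x)%E ->
  (\int[mu]_x f (- x)%R = \int[mu]_x f x)%E.
Proof.
move=> mf f0.
have mN : measurable_fun setT (-%R : measurableTypeR R -> measurableTypeR R) by [].
pose pf : {measure set (measurableTypeR R) -> \bar R} :=
  measure_function_pushforward__canonical__measure_function_Measure mu mN.
transitivity (\int[pf]_x f x)%E; first by rewrite ge0_integral_pushforward.
by apply: eq_measure_integral => A mA _; rewrite -[RHS]lebesgue_measureN.
Qed.
End lebesgue_affine.

Section leb_gam.
Context {R : realType}.
Local Open Scope ereal_scope.
Local Notation mu := (@lebesgue_measure R).

Definition leb d := powm mu d.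
Definition gam d := powm (normal_prob (0 : R) 1) d.

Definition phi d (x : 'rV[R]_d) : R := (\prod_i normal_pdf 0 1 (x 0%R i))%R.

Lemma phi_cons d x (v : 'rV[R]_d) : phi (consr x v) = (normal_pdf 0 1 x * phi v)%R.
Proof.
rewrite /phi big_ord_recl consr0; congr (_ * _)%R.
by apply: eq_bigr => i _; rewrite consrS.
Qed.

Lemma normal_pdf01E (x : R) :
  normal_pdf 0 1 x = ((Num.sqrt (2 * pi))^-1 * expR (- x ^+ 2 / 2))%R.
Proof.
rewrite normal_pdfE ?oner_neq0// /normal_peak /normal_fun expr1n mul1r subr0.
by rewrite mulr_natl.
Qed.

Lemma normal_pdf01_gt0 (x : R) : (0 < normal_pdf 0 1 x)%R.
Proof. by rewrite normal_pdf01E mulr_gt0 ?expR_gt0// invr_gt0 sqrtr_gt0 mulr_gt0 ?pi_gt0. Qed.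

Lemma phi_gt0 d (x : 'rV[R]_d) : (0 < phi x)%R.
Proof. by apply: prodr_gt0 => i _; exact: normal_pdf01_gt0. Qed.

Lemma phi_ge0 d (x : 'rV[R]_d) : (0 <= phi x)%R. Proof. exact/ltW/phi_gt0. Qed.

Lemma measurable_phi d : measurable_fun setT (@phi d).
Proof.
rewrite (_ : @phi d = fun x => \prod_(i <- index_enum 'I_d) normal_pdf 0 1 (x 0%R i))%R//.
apply: measurable_prod => i _.
apply: (measurableT_comp _ (measurable_coord i)).
exact: measurable_normal_pdf.
Qed.

Lemma measurable_consl d (F : 'rV[R]_d.+1 -> \bar R) x : measurable_fun setT F ->
  measurable_fun setT (fun v => F (consr x v)).
Proof. by move=> mF; apply: measurableT_comp => //; exact: measurable_consr. Qed.

Lemma measurable_powm_cons (m : {sigma_finite_measure set (measurableTypeR R) -> \bar R}) d (F : 'rV[R]_d.+1 -> \bar R) : measurable_fun setT F ->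
  (forall x, 0 <= F x) ->
  measurable_fun setT (fun x => \int[powm m d]_v F (consr x v)).
Proof.
move=> mF F0.
apply: (@measurable_fun_fubini_tonelli_F _ _ _ _ R (powm m d) (fun z => F (consr z.1 z.2))) => //=.
by apply: measurableT_comp => //; exact: measurable_consr.
Qed.

Lemma ge0_integral_normal (f : R -> \bar R) : measurable_fun setT f ->
  (forall x, 0 <= f x) ->
  \int[normal_prob 0 1]_x f x = \int[mu]_x (f x * (normal_pdf 0 1 x)%:E).
Proof.
move=> mf f0; apply: ge0_integral_density => //=.
- exact: measurable_normal_pdf.
- by move=> x; exact: normal_pdf_ge0.
Qed.

Lemma ge0_integral_gam d (f : 'rV[R]_d -> \bar R) : measurable_fun setT f ->
  (forall x, 0 <= f x) ->
  \int[gam d]_x f x = \int[leb d]_x (f x * (phi x)%:E).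
Proof.
rewrite /gam /leb; elim: d f => [|d IH] f mf f0.
  rewrite !integral_powm0//; first by rewrite /phi big_ord0 mule1.
  by apply: emeasurable_funM => //; apply/measurable_EFinP; exact: measurable_phi.
have mfp : measurable_fun setT (fun x => f x * (phi x)%:E).
  by apply: emeasurable_funM => //; apply/measurable_EFinP; exact: measurable_phi.
have fp0 x : 0 <= f x * (phi x)%:E by rewrite mule_ge0// lee_fin phi_ge0.
rewrite !integral_powmS// ge0_integral_normal//; first last.
- by move=> x; apply: integral_ge0.
- exact: measurable_powm_cons.
apply: eq_integral => x _.
rewrite IH//; last exact: measurable_consl.
rewrite -ge0_integralZr//.
- by apply: eq_integral => v _; rewrite phi_cons EFinM muleA muleAC.
- by apply: emeasurable_funM; [exact: measurable_consl|apply/measurable_EFinP; exact: measurable_phi].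
- by move=> v _; rewrite mule_ge0// lee_fin phi_ge0.
- by rewrite lee_fin ltW// normal_pdf01_gt0.
Qed.

Lemma gamT d : gam d setT = 1.
Proof.
suff : \int[gam d]_x 1 = 1 by rewrite integral_cst// mul1e.
rewrite /gam; elim: d => [|d IH]; first by rewrite integral_powm0.
rewrite integral_powmS//; under eq_integral do rewrite IH.
by rewrite integral_cst//= probability_setT mul1e.
Qed.

(** For nonnegative integrands the iterated integral of the statement is an integral against a
    genuine product measure, so that all the tools of integration apply. Signed integrands are
    brought back to this case by [gint_lower] and [gint_sub]. *)
Lemma gintE d (F : 'rV[R]_d -> \bar R) : measurable_fun setT F ->
  (forall x, 0 <= F x) -> gint F = \int[gam d]_x F x.
Proof.
rewrite /gint /gam; elim: d F => [|d IH] F mF F0.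
  by rewrite integral_powm0//=; congr F; apply/rowP => -[].
rewrite integral_powmS//=; apply: eq_integral => x _.
rewrite -IH//; last exact: measurable_consl.
by congr gint_tuple; apply/funext => v; rewrite row_of_tuple_cons.
Qed.

Lemma ge0_leb_affine d (a : R) (b : 'rV[R]_d) (f : 'rV[R]_d -> \bar R) : (0 < a)%R ->
  measurable_fun setT f -> (forall x, 0 <= f x) ->
  (a ^+ d)%:E * \int[leb d]_x f (a *: x + b)%R = \int[leb d]_x f x.
Proof.
move=> a0; rewrite /leb.
have mab n (b' : 'rV[R]_n) : measurable_fun setT (fun x : 'rV[R]_n => a *: x + b')%R.
  by apply: measurable_rowD => //; exact: measurable_rowZ.
elim: d b f => [|d IH] b f mf f0.
  rewrite !integral_powm0//; first by rewrite mul1e; congr f; apply/rowP => -[].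
  exact: (measurableT_comp mf (mab 0%N b)).
rewrite !integral_powmS//; last by apply: measurableT_comp => //; exact: mab.
have := @ge0_integral_affine _ a (b 0%R ord0) (fun x => \int[powm mu d]_v f (consr x v)) a0
  (measurable_powm_cons mu mf f0) (fun x => integral_ge0 _ (fun v _ => f0 _)).
apply: etrans.
rewrite exprS EFinM -muleA; congr (_ * _).
rewrite -ge0_integralZl//; first last.
- by rewrite lee_fin exprn_ge0// ltW.
- by move=> x _; exact: integral_ge0.
- by apply: (@measurable_powm_cons mu d (fun x => f (a *: x + b)%R)) => //; exact: (measurableT_comp mf (mab _ b)).
apply: eq_integral => x _.
rewrite -(IH (\row_i b 0%R (lift ord0 i))%R (fun v => f (consr (a * x + b 0 ord0)%R v)))//; last exact: (measurable_consl (a * x + b 0 ord0)%R mf).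
congr (_ * _); apply: eq_integral => v _; congr f.
by rewrite consrZ [X in (_ + X)%R]consr_eta consrD.
Qed.

Lemma ge0_leb_opp d (f : 'rV[R]_d -> \bar R) :
  measurable_fun setT f -> (forall x, 0 <= f x) ->
  \int[leb d]_x f (- x)%R = \int[leb d]_x f x.
Proof.
rewrite /leb.
have mab n : measurable_fun setT (fun x : 'rV[R]_n => - x)%R.
  by under eq_fun do rewrite -scaleN1r; exact: measurable_rowZ.
elim: d f => [|d IH] f mf f0.
  rewrite !integral_powm0//; first by congr f; apply/rowP => -[].
  exact: (measurableT_comp mf (mab 0%N)).
rewrite !integral_powmS//; last by apply: measurableT_comp => //; exact: mab.
have := @ge0_integral_oppr _ (fun x => \int[powm mu d]_v f (consr x v))
  (measurable_powm_cons mu mf f0) (fun x => integral_ge0 _ (fun v _ => f0 _)).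
apply: etrans.
apply: eq_integral => x _.
rewrite -(IH (fun v => f (consr (- x)%R v)))//; last exact: (measurable_consl (- x)%R mf).
apply: eq_integral => v _; congr f.
by rewrite -scaleN1r consrZ mulN1r scaleN1r.
Qed.
End leb_gam.

(** * Borel measurability on row vectors *)

Section measurability_tools.
Context {R : realType}.

Lemma measurable_invr : measurable_fun [set: R] (@GRing.inv R).
Proof.
have -> : [set: R] = [set~ 0] `|` [set 0] by rewrite setUC setUv.
apply/measurable_funU => //; first exact: measurableC.
split; last exact: measurable_fun_set1.
apply: open_continuous_measurable_fun; first by rewrite openC; exact: closed_eq.
by move=> x; rewrite inE/= => /eqP x0; exact: inv_continuous.
Qed.

Lemma measurable_funV d (T : measurableType d) (f : T -> R) :
  measurable_fun setT f -> measurable_fun setT (fun x => (f x)^-1).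
Proof. by move=> mf; exact: (measurableT_comp measurable_invr). Qed.

(** The sigma-algebra is generated by the coordinates, so an open set has to be exhibited as a
    countable union of measurable boxes: those with rational centre and radius 1/(n + 1) that it
    contains. *)
Lemma continuous_measurable_row d (f : 'rV[R]_d -> R) :
  continuous f -> measurable_fun setT f.
Proof.
move=> /continuousP cf; apply: (measurability _ (RGenOInfty.measurableE R)).
move=> _ [_ [a ->] <-]; rewrite setTI.
set O := f @^-1` _.
have oO : open O by exact/cf/interval_open.
pose B (q : 'rV[rat]_d) (n : nat) : set 'rV[R]_d :=
  [set x | forall i, `|x 0 i - ratr (q 0 i)| < n.+1%:R^-1].
have mB q n : measurable (B q n).
  rewrite (_ : B q n = \bigcap_(i in [set: 'I_d])
    ((fun x : 'rV[R]_d => `|x 0 i - ratr (q 0 i)|) @^-1` `]-oo, n.+1%:R^-1[)); last first.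
    apply/seteqP; split=> x.
      by move=> Bx i _ /=; rewrite in_itv/=.
    by move=> Bx i; have := Bx i I; rewrite /= in_itv.
  apply: fin_bigcap_measurable => // i _; rewrite -[X in measurable X]setTI.
  have : measurable_fun setT (fun x : 'rV[R]_d => `|x 0 i - ratr (q 0 i)|).
    apply: measurableT_comp => //; apply: measurable_funB => //.
    exact: measurable_coord.
  exact.
have -> : O = \bigcup_(q : 'rV[rat]_d) \bigcup_(n in [set n | B q n `<=` O]) B q n.
  apply/seteqP; split=> [x Ox|x [q _ [n + Bx]]]; last exact.
  have /nbhs_ballP[e /= e0 xe] : nbhs x O by exact: open_nbhs_nbhs.
  have e20 : 0 < e / 2 by rewrite divr_gt0.
  have [n _ /(_ n (leqnn n)) /= n1] := near_infty_natSinv_lt (PosNum e20).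
  have /choice[q qx] : forall i : 'I_d, exists q : rat,
      ratr q \in `]x 0 i - n.+1%:R^-1, x 0 i + n.+1%:R^-1[.
    by move=> i; apply: rat_in_itvoo; rewrite ltrBlDr -addrA ltrDl addr_gt0.
  have qx' i : `|x 0 i - ratr (q i)| < n.+1%:R^-1.
    by have := qx i; rewrite in_itv/= ltr_distlC.
  exists (\row_i q i) => //; exists n => /=; last first.
    by move=> i; rewrite mxE.
  move=> y By; apply: xe; rewrite /ball/= /mx_ball; split=> // i j.
  rewrite !ord1 /ball/= (le_lt_trans (ler_distD (ratr (q j)) _ _))//.
  rewrite [ltRHS](splitr e) ltrD// ?(lt_trans (qx' j))//.
  by have := By j; rewrite mxE distrC => /lt_trans; exact.
apply: countable_bigcupT_measurable => // q.
exact: bigcup_measurable.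
Qed.

Lemma measurable_rowB d1 (T1 : measurableType d1) d (f g : T1 -> 'rV[R]_d) :
  measurable_fun [set: T1] f -> measurable_fun [set: T1] g ->
  measurable_fun [set: T1] (fun x => f x - g x)%R.
Proof.
move=> mf mg; apply: measurable_rowP => i.
under eq_fun do rewrite !mxE.
by apply: measurable_funB; apply: (measurableT_comp (measurable_coord i)).
Qed.

End measurability_tools.

Ltac meas1 :=
  match goal with
  | H : measurable_fun setT ?f |- measurable_fun setT ?f => exact: H
  | H : forall i, measurable_fun setT (?f i) |- measurable_fun setT (?f _) => exact: H
  | |- measurable_fun setT (EFin \o _) => apply/measurable_EFinP
  | |- measurable_fun setT (fun x => (_)%:E) => apply/measurable_EFinP
  | |- measurable_fun setT (fun x => (@?f x + @?g x)%E) => apply: (@emeasurable_funD _ _ _ setT f g)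
  | |- measurable_fun setT (fun x => (@?f x * @?g x)%E) => apply: (@emeasurable_funM _ _ _ setT f g)
  | |- measurable_fun setT (fun x => @fun_of_matrix _ _ _ (@?f x) _ _) => apply: (measurableT_comp (measurable_coord _))
  | |- measurable_fun setT (fun x => _ *: @?f x) => apply: (@measurable_rowZ _ _ _ _ _ f)
  | |- measurable_fun setT (fun x => @?f x - @?g x) => first [apply: (@measurable_rowB _ _ _ _ f g) | apply: (@measurable_funB _ _ _ setT f g)]
  | |- measurable_fun setT (fun x => - @?f x) => apply: (@measurable_funN _ _ _ setT f)
  | |- measurable_fun setT (fun x => @?f x + @?g x) => first [apply: (@measurable_rowD _ _ _ _ f g) | apply: (@measurable_funD _ _ _ setT f g)]
  | |- measurable_fun setT (fun x => @?f x * @?g x) => apply: (@measurable_funM _ _ _ setT f g)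
  | |- measurable_fun setT (fun x => (@?f x)^-1) => apply: measurable_funV
  | |- measurable_fun setT (fun x => (@?f x) ^+ _) => apply: measurable_funX
  | |- measurable_fun setT (fun x => expR (@?f x)) => apply: (measurableT_comp (@measurable_expR _))
  | |- measurable_fun setT (fun x => ln (@?f x)) => apply: (measurableT_comp (@measurable_ln _))
  | |- measurable_fun setT (fun x => (@?f x) `^ ?p) => apply: (measurableT_comp (@measurable_powR _ p))
  | |- measurable_fun setT (fun x => `| @?f x |) => apply: (measurableT_comp (@normr_measurable _ setT))
  | |- measurable_fun setT (fun x => phi (@?f x)) => apply: (measurableT_comp (@measurable_phi _ _))
  | |- measurable_fun setT (fun x => Num.max (@?f x) (@?g x)) => apply: (@measurable_maxr _ _ _ setT f g)
  | |- measurable_fun setT (fun x => Num.min (@?f x) (@?g x)) => apply: (@measurable_minr _ _ _ setT f g)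
  | |- measurable_fun setT (@phi _ _) => exact: measurable_phi
  | H : measurable_fun setT ?f |- measurable_fun setT (fun x => ?f (@?g x)) => apply: (measurableT_comp H)
  | H : measurable_fun setT ?f |- measurable_fun setT (?f \o _) => apply: (measurableT_comp H)
  | |- measurable_fun setT (fun x => (@?f x, @?g x)) => apply: (@measurable_fun_pair _ _ _ _ _ _ f g)
  | |- measurable_fun setT (fun x => (@?f x).1) => apply: (measurableT_comp measurable_fst)
  | |- measurable_fun setT (fun x => (@?f x).2) => apply: (measurableT_comp measurable_snd)
  | |- measurable_fun setT (fun x => consr _ _) => apply: measurable_consr
  | |- measurable_fun setT _ => by []
  | |- measurable_fun setT (fun x => bigop.body _ _ _) => apply: measurable_sum => ?
  end.
Ltac meas := repeat meas1.

(** * The Gaussian density and its invariance under reflections *)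

Section phi_theory.
Context {R : realType}.
Local Open Scope ereal_scope.
Local Notation mu := (@lebesgue_measure R).

Definition sqn d (x : 'rV[R]_d) : R := (\sum_i x 0%R i ^+ 2)%R.
Definition Kd d : R := ((Num.sqrt (2 * pi))^-1 ^+ d)%R.

Lemma sqn_ge0 d (x : 'rV[R]_d) : (0 <= sqn x)%R.
Proof. by apply: sumr_ge0 => i _; exact: sqr_ge0. Qed.

Lemma Kd_gt0 d : (0 < Kd d)%R.
Proof. by rewrite exprn_gt0// invr_gt0 sqrtr_gt0 mulr_gt0// pi_gt0. Qed.

Lemma phiE d (x : 'rV[R]_d) : phi x = (Kd d * expR (- sqn x / 2))%R.
Proof.
rewrite /phi /sqn -sumrN mulr_suml expR_sum.
under eq_bigr do rewrite normal_pdf01E.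
by rewrite big_split/= prodr_const card_ord.
Qed.

Lemma measurable_sqn d : measurable_fun setT (@sqn d).
Proof. by rewrite /sqn; meas. Qed.

Lemma phi_le d (x : 'rV[R]_d) : (phi x <= Kd d)%R.
Proof.
rewrite phiE ler_piMr ?(ltW (Kd_gt0 d))// -expR0 ler_expR.
by rewrite mulNr oppr_le0 divr_ge0// sqn_ge0.
Qed.

Lemma leb_tonelli d d' (f : 'rV[R]_d * 'rV[R]_d' -> \bar R) : measurable_fun setT f ->
  (forall z, 0 <= f z) ->
  \int[leb d]_x \int[leb d']_y f (x, y) = \int[leb d']_y \int[leb d]_x f (x, y).
Proof. exact: fubini_tonelli. Qed.

Lemma pmule_inj (a : R) (x y : \bar R) : (0 < a)%R -> a%:E * x = a%:E * y -> x = y.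
Proof.
move=> a0 axy; rewrite -[x]mul1e -[y]mul1e -(mulVf (lt0r_neq0 a0)) EFinM.
by rewrite -!muleA axy.
Qed.

(** The orthogonal map factors into affine changes of one vector at a time: x = c z + s w for fixed
    w, then y = (s/c) x - w/c for fixed x. The Jacobians c^d and c^-d cancel. A reflection is
    preferred to a rotation because it is its own inverse. *)
Lemma leb_reflection d (c s : R) (k : 'rV[R]_d * 'rV[R]_d -> \bar R) :
  (0 < c)%R -> (c ^+ 2 + s ^+ 2 = 1)%R -> measurable_fun setT k -> (forall z, 0 <= k z) ->
  \int[leb d]_z \int[leb d]_w k (c *: z + s *: w, s *: z - c *: w)%R =
  \int[leb d]_x \int[leb d]_y k (x, y).
Proof.
move=> c0 cs1 mk k0.
have c0' : (c != 0)%R by rewrite gt_eqF.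
have mT1 : measurable_fun setT (fun z : 'rV[R]_d * 'rV[R]_d => k (c *: z.1 + s *: z.2, s *: z.1 - c *: z.2)%R) by meas.
have mT2 : measurable_fun setT (fun z : 'rV[R]_d * 'rV[R]_d => k (z.1, (s / c) *: z.1 - c^-1 *: z.2)%R) by meas.
apply: (etrans (leb_tonelli mT1 (fun z => k0 _))) => /=.
have H w : (c ^+ d)%:E * \int[leb d]_z k (c *: z + s *: w, s *: z - c *: w)%R =
    \int[leb d]_x k (x, (s / c) *: x - c^-1 *: w)%R.
  have mw : measurable_fun setT (fun x : 'rV[R]_d => k (x, (s / c) *: x - c^-1 *: w)%R) by meas.
  apply: (etrans _ (ge0_leb_affine (s *: w) c0 mw (fun z => k0 _))).
  congr (_ * _)%E; apply: eq_integral => z _; congr (k (_, _)).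
  rewrite scalerDr !scalerA divfK// -addrA -scalerBl; congr (_ + _)%R.
  rewrite -scaleNr; congr (_ *: _)%R.
  have -> : (s / c * s - c^-1 = (s ^+ 2 - 1) / c)%R by field.
  by rewrite -cs1; field.
apply: (pmule_inj (exprn_gt0 d c0)); rewrite -ge0_integralZl//; first last.
- by rewrite lee_fin exprn_ge0// ltW.
- by move=> w _; exact: integral_ge0.
- exact: (measurable_fun_fubini_tonelli_G _ mT1 (fun z => k0 _)).
under eq_integral do rewrite H.
apply: (etrans (esym (leb_tonelli mT2 (fun z => k0 _)))) => /=.
rewrite -ge0_integralZl//; first last.
- by rewrite lee_fin exprn_ge0// ltW.
- by move=> w _; exact: integral_ge0.
- exact: measurable_fun_fubini_tonelli_F.
apply: eq_integral => x _.
have m1 : measurable_fun setT (fun y : 'rV[R]_d => k (x, (s / c) *: x - c^-1 *: y)%R) by meas.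
have m2 : measurable_fun setT (fun y : 'rV[R]_d => k (x, y)) by meas.
have c10 : (0 < c^-1)%R by rewrite invr_gt0.
rewrite -(ge0_leb_opp m1 (fun z => k0 _)) -(ge0_leb_affine ((s / c) *: x) c10 m2 (fun z => k0 _)).
rewrite muleA -EFinM -exprMn divff// expr1n mul1e.
by apply: eq_integral => y _; rewrite scalerN opprK addrC.
Qed.

Lemma sqn_reflection d (c s : R) (z w : 'rV[R]_d) : (c ^+ 2 + s ^+ 2 = 1)%R ->
  (sqn (c *: z + s *: w) + sqn (s *: z - c *: w) = sqn z + sqn w)%R.
Proof.
move=> cs1; rewrite /sqn -!big_split/=; apply: eq_bigr => i _; rewrite !mxE.
transitivity ((c ^+ 2 + s ^+ 2) * (z 0 i ^+ 2 + w 0 i ^+ 2))%R; first by ring.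
by rewrite cs1 mul1r.
Qed.

Lemma phi_reflection d (c s : R) (z w : 'rV[R]_d) : (c ^+ 2 + s ^+ 2 = 1)%R ->
  (phi (c *: z + s *: w) * phi (s *: z - c *: w) = phi z * phi w)%R.
Proof.
move=> cs1; rewrite !phiE.
rewrite mulrACA [RHS]mulrACA -!expRD -!mulrDl -!opprD sqn_reflection//.
Qed.

Lemma gam_reflection d (c s : R) (k : 'rV[R]_d * 'rV[R]_d -> \bar R) :
  (0 < c)%R -> (c ^+ 2 + s ^+ 2 = 1)%R -> measurable_fun setT k -> (forall z, 0 <= k z) ->
  \int[gam d]_z \int[gam d]_w k (c *: z + s *: w, s *: z - c *: w)%R =
  \int[gam d]_x \int[gam d]_y k (x, y).
Proof.
move=> c0 cs1 mk k0.
have E (h : 'rV[R]_d * 'rV[R]_d -> \bar R) : measurable_fun setT h -> (forall z, 0 <= h z) ->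
    \int[gam d]_z \int[gam d]_w h (z, w) =
    \int[leb d]_z \int[leb d]_w (h (z, w) * (phi z * phi w)%:E).
  move=> mh h0.
  rewrite ge0_integral_gam//; first last.
  - by move=> x; exact: integral_ge0.
  - exact: measurable_fun_fubini_tonelli_F.
  apply: eq_integral => z _; rewrite ge0_integral_gam//; last by meas.
  rewrite -ge0_integralZr//.
  - by apply: eq_integral => w _; rewrite EFinM muleA muleAC -muleA (muleC (phi w)%:E) muleA.
  - by meas.
  - by move=> w _; rewrite mule_ge0// lee_fin phi_ge0.
  - by rewrite lee_fin phi_ge0.
have mK : measurable_fun setT (fun z : 'rV[R]_d * 'rV[R]_d => k z * (phi z.1 * phi z.2)%:E) by meas.
have K0 z : 0 <= k z * (phi z.1 * phi z.2)%:E.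
  by rewrite mule_ge0// lee_fin mulr_ge0// phi_ge0.
have mT : measurable_fun setT (fun z : 'rV[R]_d * 'rV[R]_d => k (c *: z.1 + s *: z.2, s *: z.1 - c *: z.2)%R) by meas.
apply: (etrans (E _ mT (fun z => k0 _))); apply: (etrans _ (esym (E k mk k0))).
apply: (etrans _ (leb_reflection c0 cs1 mK K0)).
apply: eq_integral => z _; apply: eq_integral => w _ /=.
by rewrite phi_reflection.
Qed.

End phi_theory.

(** * The logarithmic Sobolev inequality *)

Section transport.
Context {R : realType}.
Local Notation mu := (@lebesgue_measure R).

Section cdf_density.
Variable h : R -> R.
Hypothesis ch : continuous h.
Hypothesis h0 : forall x, 0 < h x.
Hypothesis h1 : (\int[mu]_x (h x)%:E = 1)%E.

Let mh : measurable_fun setT h. Proof. exact: continuous_measurable_fun. Qed.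

Let G (x : R) : R := (\int[mu]_(t in `]-oo, x]) h t)%R.

Let intT : mu.-integrable setT (EFin \o h).
Proof.
apply/integrableP; split; first exact/measurable_EFinP.
under eq_integral do rewrite /= ger0_norm ?(ltW (h0 _))//.
by rewrite h1 ltry.
Qed.

Let int_sub (A : set R) : measurable A -> mu.-integrable A (EFin \o h).
Proof. by move=> mA; exact: integrableS intT. Qed.

Let int_fin (A : set R) : measurable A -> (\int[mu]_(t in A) (h t)%:E \is a fin_num)%E.
Proof. by move=> mA; apply: integrable_fin_num => //; exact: int_sub. Qed.

Let int_split (A : set R) : measurable A ->
  \int[mu]_(t in A) h t + \int[mu]_(t in ~` A) h t = 1.
Proof.
move=> mA; rewrite /Rintegral -fineD ?int_fin//; last exact: measurableC.
rewrite -ge0_integral_setU//=.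
- by rewrite setUv h1.
- exact: measurableC.
- by rewrite setUv; exact/measurable_EFinP.
- by move=> x _; rewrite lee_fin ltW.
- by apply/disj_setPS; rewrite setICr.
Qed.

Let int_ge0 (A : set R) : 0 <= \int[mu]_(t in A) h t.
Proof. by apply: Rintegral_ge0 => x _; exact: ltW. Qed.

Lemma is_derive_cdf (x : R) : is_derive x 1 G (h x).
Proof.
have [|||dG GE] := @continuous_FTC1 R h -oo%O x (x + 1) _ _ _ (@ch x).
- by rewrite ltrDl.
- exact: int_sub.
- exact: ltNyr.
- by apply: DeriveDef; [exact: dG|rewrite -derive1E; exact: GE].
Qed.

Let continuous_cdf : continuous G.
Proof.
move=> x; apply/differentiable_continuous/derivable1_diffP.
by have [] := is_derive_cdf x.
Qed.

Lemma cdf_lt : {homo G : x y / x < y}.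
Proof.
move=> x y xy.
have [|c _ GE] := @MVT R G h x y xy (fun z _ => is_derive_cdf z).
  exact: continuous_subspaceT.
by rewrite -subr_gt0 GE mulr_gt0 ?subr_gt0.
Qed.

Let cdf_le1 x : G x <= 1.
Proof. by rewrite -(int_split (measurable_itv `]-oo, x])) lerDl. Qed.

Lemma cdf_inj : injective G.
Proof.
move=> x y Gxy; apply/eqP; rewrite eq_le !leNgt; apply/andP; split; apply/negP.
  by move=> /cdf_lt; rewrite Gxy ltxx.
by move=> /cdf_lt; rewrite Gxy ltxx.
Qed.

Lemma cdf_itv x : 0 < G x < 1.
Proof.
apply/andP; split.
  by apply: le_lt_trans (cdf_lt (_ : x - 1 < x)); rewrite ?int_ge0// gtrBl.
by apply: lt_le_trans (cdf_lt (_ : x < x + 1)) (cdf_le1 _); rewrite ltrDl.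
Qed.

(** Integrals over sets that exhaust the line converge to the total mass 1, so any smaller level is
    passed. This serves both tails of the distribution function. *)
Let cdf_large (F : (set R)^nat) (w : R) : nondecreasing_seq F -> (forall i, measurable (F i)) ->
  \bigcup_i F i = setT -> w < 1 -> exists n, w < \int[mu]_(t in F n) h t.
Proof.
move=> ndF mF FT w1; apply/not_existsP => H.
have : (\int[mu]_(t in F n) (h t)%:E @[n --> \oo] --> \int[mu]_(t in \bigcup_n F n) (h t)%:E)%E.
  apply: ge0_nondecreasing_set_cvg_integral => // [i|i x _].
  - by apply/measurable_EFinP; exact: measurable_funTS.
  - by rewrite lee_fin ltW.
rewrite FT h1 => cv.
have : ((limn (fun n => \int[mu]_(t in F n) (h t)%:E)) <= w%:E)%E.
  apply: lime_le; first by apply/cvg_ex; exists 1%E.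
  near=> n; have /negP := H n; rewrite -leNgt.
  by rewrite -lee_fin fineK// int_fin.
by rewrite (cvg_lim _ cv)// lee_fin leNgt w1.
Unshelve. all: by end_near. Qed.

Lemma cdf_surj v : 0 < v < 1 -> exists x, G x = v.
Proof.
move=> /andP[v0 v1].
have [n vn] : exists n : nat, v < G n%:R.
  apply: (@cdf_large (fun n => `]-oo, n%:R]%classic)) => //.
  - by move=> a b ab; apply/subsetPset/subset_itvl; rewrite bnd_simp ler_nat.
  - apply/seteqP; split=> // x _; exists (Num.truncn `|x|).+1 => //=.
    by rewrite in_itv/= (le_trans (ler_norm _))// ltW// truncnS_gt.
have [m vm] : exists m : nat, G (- m%:R) < v.
  have [||||m] := @cdf_large (fun n => `](- n%:R), +oo[%classic) (1 - v).
  - by move=> a b ab; apply/subsetPset/subset_itvr; rewrite bnd_simp lerN2 ler_nat.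
  - by [].
  - apply/seteqP; split=> // x _; exists (Num.truncn `|x|).+1 => //=.
    by rewrite in_itv/= andbT ltrNl (le_lt_trans (ler_norm _))// normrN truncnS_gt.
  - by rewrite gtrBl.
  move=> H; exists m; move: H.
  by have := int_split (measurable_itv `]-oo, (- m%:R)]); rewrite setCitvl /G; lra.
have mn : - m%:R <= n%:R :> R by rewrite (@le_trans _ _ 0)// oppr_le0.
have [||c _ Gc] := @IVT R G (- m%:R) n%:R v mn.
- exact: continuous_subspaceT.
- have Gmn : G (- m%:R) <= G n%:R by apply/ltW/(lt_trans vm).
  by rewrite min_l// max_r// !ltW.
by exists c.
Qed.
End cdf_density.

(** T is K^-1 o G for the distribution functions G of h and K of k; the rule for inverse functions
    gives T' = h / (k o T). *)
Lemma monotone_transport (h k : R -> R) : continuous h -> continuous k ->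
  (forall x, 0 < h x) -> (forall x, 0 < k x) ->
  (\int[mu]_x (h x)%:E = 1)%E -> (\int[mu]_x (k x)%:E = 1)%E ->
  exists T : R -> R, forall x : R, is_derive x 1 T (h x / k (T x)).
Proof.
move=> ch ck h0 k0 h1 k1.
pose G x : R := \int[mu]_(t in `]-oo, x]) h t.
pose K x : R := \int[mu]_(t in `]-oo, x]) k t.
have /choice[T TE] : forall x, exists y, K y = G x.
  by move=> x; apply: cdf_surj => //; exact: cdf_itv.
have Kinj : injective K by exact: cdf_inj.
pose S v : R := xget 0 [set y | K y = v].
have KK y : S (K y) = y.
  rewrite /S; case: xgetP => [z _ /= /Kinj//|/(_ y)/=].
  by move=> /(_ erefl).
have TS : T = S \o G by apply/funext => x /=; rewrite -TE KK.
exists T => x.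
have dS : is_derive (G x) 1 S (k (T x))^-1.
  rewrite -TE; apply: is_derive_inverse.
  - by near=> y; exact: KK.
  - near=> y; apply/differentiable_continuous/derivable1_diffP.
    by have [] := is_derive_cdf ck k0 k1 y.
  - exact: is_derive_cdf.
  - by rewrite gt_eqF.
have := is_derive1_comp dS (is_derive_cdf ch h0 h1 x).
by rewrite -TS mulrC.
Unshelve. all: by end_near. Qed.
End transport.

(* The (nonnegative) integrand of relative entropy, locked because the
   integral lemmas on sums would otherwise match its terms one by one. *)
HB.lock Definition kl (R : realType) (a b : R) : R := a * ln (a / b) - a + b.

(** * The integrand of relative entropy *)

Section kl.
Context {R : realType}.
Implicit Types a b : R.

Lemma ln_le_sub1 a : 0 < a -> ln a <= a - 1.
Proof.
by move=> a0; have := @le_ln1Dx R (a - 1); rewrite addrCA subrr addr0; apply; lra.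
Qed.

Lemma klE a b : 0 <= a -> 0 < b -> kl a b = a * (ln a - ln b) - a + b.
Proof.
rewrite kl.unlock le_eqVlt => /predU1P[<-|a0] b0; first by rewrite !mul0r.
by rewrite ln_div.
Qed.

Lemma kl0 b : kl 0 b = b.
Proof. by rewrite kl.unlock mul0r subr0 add0r. Qed.

(** Fenchel-Young inequality for relative entropy, with equality at y = ln (a/b). The choice y = 0
    gives nonnegativity, an optimised constant y gives Jensen's inequality, and y proportional to
    |x|^2 controls second moments. *)
Lemma kl_ge_tangent a b y : 0 <= a -> 0 < b -> a * y - b * (expR y - 1) <= kl a b.
Proof.
rewrite le_eqVlt => /predU1P[<- b0|a0 b0].
  by rewrite kl0 mul0r sub0r; have := mulr_gt0 b0 (expR_gt0 y); lra.
have := ln_le_sub1 (mulr_gt0 (divr_gt0 b0 a0) (expR_gt0 y)).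
rewrite lnM ?posrE ?divr_gt0 ?expR_gt0// expRK ln_div// klE ?(ltW a0)//.
move=> /(ler_wpM2l (ltW a0)); rewrite mulrBr mulrA (mulrC a (b / a)) divfK ?gt_eqF//.
by nra.
Qed.

Lemma kl_ge0 a b : 0 <= a -> 0 < b -> 0 <= kl a b.
Proof.
by move=> a0 b0; have := kl_ge_tangent 0 a0 b0; rewrite expR0 subrr !mulr0 subrr.
Qed.

Lemma measurable_kl d (T : measurableType d) (f g : T -> R) :
  measurable_fun setT f -> measurable_fun setT g ->
  measurable_fun setT (fun x => kl (f x) (g x)).
Proof. by move=> mf mg; rewrite kl.unlock; meas. Qed.

(** Squeeze between -2 sqrt x and x (x - 1); the lower bound is ln z <= z - 1 at z = 1 / sqrt x. *)
Lemma xlnx_cvg0 (u : R^nat) : (forall n, 0 < u n) -> u @ \oo --> 0 ->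
  u n * ln (u n) @[n --> \oo] --> (0 : R).
Proof.
move=> u0 cu.
have cs : Num.sqrt (u n) @[n --> \oo] --> (0 : R).
  by rewrite -[X in _ --> X]sqrtr0; exact: (cvg_comp _ _ cu (@sqrt_continuous _ _)).
have H (x : R) : 0 < x -> - 2 * Num.sqrt x <= x * ln x.
  move=> x0; have s0 : 0 < Num.sqrt x by rewrite sqrtr_gt0.
  have -> : x * ln x = 2 * (x * ln (Num.sqrt x)).
    by rewrite -{2}(sqr_sqrtr (ltW x0)) lnXn// mulr_natl; ring.
  have := @ln_le_sub1 (Num.sqrt x)^-1; rewrite invr_gt0 => /(_ s0).
  rewrite lnV// => h.
  have : x * - ln (Num.sqrt x) <= x * ((Num.sqrt x)^-1 - 1) by rewrite ler_pM2l.
  rewrite -[X in _ <= X * _ -> _](sqr_sqrtr (ltW x0)) mulrBr expr2 mulfK ?gt_eqF//.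
  have := mulr_gt0 s0 s0; lra.
have c1 : - 2 * Num.sqrt (u n) @[n --> \oo] --> (0 : R).
  by rewrite -[X in _ --> X](mulr0 (- 2)); apply: cvgMr.
have c2 : u n * (u n - 1) @[n --> \oo] --> (0 : R).
  by rewrite -[X in _ --> X](mul0r (0 - 1)); apply: cvgM => //; apply: cvgB => //; exact: cvg_cst.
apply: (squeeze_cvgr _ c1 c2); near=> n; rewrite H//=.
by rewrite ler_pM2l// ln_le_sub1.
Unshelve. all: by end_near. Qed.

(** The limit a may be 0: there [ln] takes a default value, but x ln x still tends to 0. *)
Lemma kl_cvg (u v : R^nat) a b : 0 <= a -> 0 < b -> (forall n, 0 < u n) ->
  u @ \oo --> a -> v @ \oo --> b -> (forall n, 0 < v n) ->
  kl (u n) (v n) @[n --> \oo] --> kl a b.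
Proof.
move=> a0 b0 u0 cu cv v0.
rewrite klE//; under eq_fun do rewrite klE ?(ltW (u0 _))// mulrBr.
have clv : ln (v n) @[n --> \oo] --> ln b.
  exact: (cvg_comp _ _ cv (continuous_ln b0)).
have culu : u n * ln (u n) @[n --> \oo] --> a * ln a.
  move: a0; rewrite le_eqVlt => /predU1P[a0|a0].
    by rewrite -a0 mul0r; apply: xlnx_cvg0 => //; rewrite a0.
  by apply: cvgM => //; exact: (cvg_comp _ _ cu (continuous_ln a0)).
rewrite mulrBr.
apply: cvgD => //; apply: cvgB => //; apply: cvgB => //.
exact: cvgM.
Qed.

End kl.

(** * Dimension one, positive densities *)

Section lsi1.
Context {R : realType}.
Local Notation mu := (@lebesgue_measure R).
Local Notation g1 := (normal_pdf (0 : R) 1).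

Lemma is_derive_normal_pdf (x : R) : is_derive x 1 g1 (- x * g1 x).
Proof.
rewrite (_ : g1 = fun x => (Num.sqrt (2 * pi))^-1 * expR (- x ^+ 2 / 2)); last first.
  by apply/funext => y; rewrite normal_pdf01E.
have d0 := is_deriveZ (- 2^-1) (is_deriveM (is_derive_id x 1) (is_derive_id x (1 : R))).
have d1 : is_derive x 1 (fun x : R => - x ^+ 2 / 2) (- x).
  rewrite (_ : (fun y : R => _) = - 2^-1 \*: (id * id)).
    by apply: (is_derive_eq d0); rewrite /GRing.scale/=; field.
  by apply/funext => y; rewrite /= /GRing.scale/= !fctE; ring.
have d2 := @is_derive1_comp R expR (fun x => - x ^+ 2 / 2) x _ _ (is_derive_expR _) d1.
have d3 := is_deriveZ (Num.sqrt (2 * pi))^-1 d2.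
by apply: (is_derive_eq d3); rewrite /GRing.scale/=; ring.
Qed.

Lemma continuous_is_derive (f df : R -> R) :
  (forall x : R, is_derive x 1 f (df x)) -> continuous f.
Proof.
move=> H x; apply/differentiable_continuous/derivable1_diffP.
by have [] := H x.
Qed.

Lemma g1_gt0 (x : R) : 0 < g1 x. Proof. exact: normal_pdf01_gt0. Qed.

Section pos.
Variables (r dr : R -> R) (m : R).
Hypothesis dr_r : forall x : R, is_derive x 1 r (dr x).
Hypothesis cdr : continuous dr.
Hypothesis r0 : forall x, 0 < r x.
Hypothesis m0 : 0 < m.
Hypothesis rm : (\int[mu]_x (r x)%:E = m%:E)%E.

Let cr : continuous r. Proof. exact: continuous_is_derive dr_r. Qed.
Let mr : measurable_fun setT r. Proof. exact: continuous_measurable_fun. Qed.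
Let mdr : measurable_fun setT dr. Proof. exact: continuous_measurable_fun. Qed.
Let cg1 : continuous g1. Proof. exact: continuous_is_derive is_derive_normal_pdf. Qed.
Let mg1 : measurable_fun setT g1. Proof. exact: continuous_measurable_fun. Qed.

(** Integrands of the two sides, both nonnegative. Pointwise L <= U + (r T)' holds for the transport
    map T, so it only remains to see that the total derivative (r T)' integrates to something
    negligible. The terms 2 r and m g1 account for the mass m on the left of the final
    inequality. *)
Let L x := kl (r x) (m * g1 x) + 2 * r x.
Let U x := 2^-1 * (x ^+ 2 * r x) + 2^-1 * (dr x ^+ 2 / r x) + m * g1 x.

Let L0 x : 0 <= L x.
Proof. by rewrite addr_ge0// ?mulr_ge0// ?(ltW (r0 _))// kl_ge0 ?(ltW (r0 _))// mulr_gt0 ?g1_gt0. Qed.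
Let U0 x : 0 <= U x.
Proof.
have := r0 x; have := g1_gt0 x => gx rx.
have a1 : 0 <= x ^+ 2 * r x by rewrite mulr_ge0 ?sqr_ge0 ?ltW.
have a2 : 0 <= dr x ^+ 2 / r x by rewrite divr_ge0 ?sqr_ge0 ?ltW.
have a3 : 0 <= m * g1 x by rewrite mulr_ge0 ?ltW.
rewrite /U; lra.
Qed.
Let mL : measurable_fun setT L.
Proof. by apply: measurable_funD; [apply: measurable_kl|]; meas. Qed.
Let mU : measurable_fun setT U. Proof. by rewrite /U; meas. Qed.

(* T transports r / m to the standard normal law, i.e. r = m T' g1(T), and the
   boundary terms of G = r T vanish along suitable sequences. *)
Lemma lsi1_pos_aux : (\int[mu]_x (L x)%:E <= \int[mu]_x (U x)%:E)%E.
Proof.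
have [||||||T dT] := @monotone_transport R (fun x => m^-1 * r x) g1.
- by move=> x; apply: cvgMr; exact: cr.
- exact: cg1.
- by move=> x; rewrite mulr_gt0 ?invr_gt0.
- exact: g1_gt0.
- under eq_integral do rewrite EFinM.
  rewrite ge0_integralZl//=.
  + by rewrite rm -EFinM mulVf ?gt_eqF.
  + exact/measurable_EFinP.
  + by move=> x _; rewrite lee_fin ltW.
  + by rewrite lee_fin invr_ge0 ltW.
- exact: integral_normal_pdf.
pose dTx x := m^-1 * r x / g1 (T x).
pose G x := r x * T x.
pose dG x := dr x * T x + r x * dTx x.
have cT : continuous T by exact: continuous_is_derive dT.
have dGP (x : R) : is_derive x 1 G (dG x).
  by apply: (is_derive_eq (is_deriveM (dr_r x) (dT x))); rewrite /GRing.scale/= /dG /dTx addrC mulrC.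
have cdG : continuous dG.
  move=> x; apply: cvgD; apply: cvgM; [exact: cdr|exact: cT|exact: cr|].
  apply: cvgM; first by apply: cvgMr; exact: cr.
  apply: cvgV; first by rewrite gt_eqF// g1_gt0.
  exact: (cvg_comp _ _ (cT x) (@cg1 (T x))).
have ptw x : L x <= U x + dG x.
  have rx := r0 x.
  have dT0 : 0 < dTx x by rewrite /dTx divr_gt0 ?g1_gt0// mulr_gt0// invr_gt0.
  have lnr : ln (r x) - ln (m * g1 x) = ln (dTx x) + (x ^+ 2 - T x ^+ 2) / 2.
    have -> : r x = m * dTx x * g1 (T x).
      by rewrite /dTx; field; rewrite !gt_eqF// g1_gt0.
    rewrite !normal_pdf01E; set C := (Num.sqrt _)^-1.
    have C0 : 0 < C by rewrite invr_gt0 sqrtr_gt0 mulr_gt0// pi_gt0.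
    have E0 y : 0 < C * expR y by rewrite mulr_gt0 ?expR_gt0.
    rewrite (lnM (mulr_gt0 m0 dT0 : _ \is Num.pos) (E0 _ : _ \is Num.pos)).
    rewrite (lnM (m0 : _ \is Num.pos) (dT0 : _ \is Num.pos)).
    rewrite (lnM (m0 : _ \is Num.pos) (E0 _ : _ \is Num.pos)).
    rewrite !(lnM (C0 : _ \is Num.pos) (expR_gt0 _ : _ \is Num.pos)) !expRK.
    by field.
  have lnd := ln_le_sub1 dT0.
  (* Completing the square: once ln T' <= T' - 1 is used, the right side exceeds the left by exactly
     this quantity. *)
  have sq : 0 <= (dr x + r x * T x) ^+ 2 / (2 * r x).
    by rewrite divr_ge0 ?sqr_ge0// mulr_ge0// ltW.
  have sqE : (dr x + r x * T x) ^+ 2 / (2 * r x) =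
     2^-1 * (dr x ^+ 2 / r x) + dr x * T x + r x * T x ^+ 2 / 2.
    by field; rewrite gt_eqF.
  rewrite sqE in sq.
  rewrite /L klE ?(ltW rx) ?mulr_gt0 ?g1_gt0// lnr.
  have := ler_wpM2l (ltW rx) lnd.
  rewrite /U /dG; lra.
have intab a b : a < b -> (\int[mu]_(x in `[a, b]) (L x)%:E <= \int[mu]_x (U x)%:E + (G b - G a)%:E)%E.
  move=> ab.
  have cc (f : R -> R) : continuous f -> mu.-integrable `[a, b] (EFin \o f).
    move=> cf; apply: continuous_compact_integrable; first exact: segment_compact.
    exact: continuous_subspaceT.
  have idG := cc _ cdG.
  have FTC : (\int[mu]_(x in `[a, b]) (dG x)%:E = (G b - G a)%:E)%E.
    rewrite (continuous_FTC2 (F := G) ab) ?EFinB//.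
    - exact: continuous_subspaceT.
    - have cG := continuous_is_derive dGP.
      split=> [x _||]; first by have [] := dGP x.
      + by apply: cvg_at_right_filter; exact: cG.
      + by apply: cvg_at_left_filter; exact: cG.
    - by move=> x _; rewrite derive1E; have [] := dGP x.
  have cU : continuous U.
    move=> x; apply: cvgD; last by apply: cvgMr; exact: cg1.
    apply: cvgD; apply: cvgMr; apply: cvgM; try exact: cr.
    + exact: exprn_continuous.
    + exact: (cvg_comp _ _ (@cdr x) (@exprn_continuous _ 2 _)).
    + by apply: cvgV; [rewrite gt_eqF|exact: cr].
  apply: (@le_trans _ _ (\int[mu]_(x in `[a, b]) ((U x)%:E + (dG x)%:E))%E).
    apply: ge0_le_integral => //=.
    - by move=> x _; rewrite lee_fin.
    - by apply/measurable_EFinP; exact: measurable_funTS.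
    - apply/measurable_EFinP; apply: measurable_funTS.
      by apply: measurable_funD => //; exact: continuous_measurable_fun.
    - by move=> x _; rewrite -EFinD lee_fin.
  rewrite integralD//; last exact: cc.
  rewrite FTC leeD2r//; apply: ge0_subset_integral => //.
  - exact/measurable_EFinP.
  - by move=> x _; rewrite lee_fin.
pose pk := normal_peak (1 : R).
(* The product r T need not tend to 0 at infinity. But (g1 o T)' = - r T / m, and g1 lies between 0
   and [pk]; by the mean value theorem every interval of length l contains a point where |r T| <= m
   pk / l. *)
have small (a b : R) : a < b -> exists2 c, c \in `]a, b[ & `|G c| <= m * pk / (b - a).
  move=> ab.
  have dgT (x : R) : is_derive x 1 (g1 \o T) (- (G x / m)).
    apply: (is_derive_eq (@is_derive1_comp R g1 T x _ _ (is_derive_normal_pdf (T x)) (dT x))).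
    rewrite /G; field.
    by rewrite !gt_eqF// g1_gt0.
  have [|c cab E] := @MVT R (g1 \o T) (fun x => - (G x / m)) a b ab (fun x _ => dgT x).
    by apply: continuous_subspaceT; exact: continuous_is_derive dgT.
  exists c => //.
  have ba : 0 < b - a by rewrite subr_gt0.
  rewrite ler_pdivlMr// -[X in _ * X](gtr0_norm ba) -normrM.
  have -> : G c * (b - a) = - m * ((g1 \o T) b - (g1 \o T) a).
    by rewrite E; field; rewrite gt_eqF.
  rewrite normrM normrN (gtr0_norm m0) ler_wpM2l ?(ltW m0)//.
  have ub x := @normal_pdf_ub R 0 1 x (oner_neq0 _).
  have := ub (T a); have := ub (T b); have := g1_gt0 (T a); have := g1_gt0 (T b).
  by rewrite /= -/pk ler_norml; lra.
have cvL : (\int[mu]_(x in `[(- n%:R)%R, n%:R]) (L x)%:E @[n --> \oo] -->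
    \int[mu]_(x in \bigcup_n `[(- n%:R)%R, n%:R]%classic) (L x)%:E)%E.
  apply: ge0_nondecreasing_set_cvg_integral => //.
  - by move=> i j ij; apply/subsetPset/subset_itv; rewrite bnd_simp ?lerN2 ler_nat.
  - by move=> i; apply/measurable_EFinP; exact: measurable_funTS.
  - by move=> i x _; rewrite lee_fin.
have UT : \bigcup_n `[(- n%:R), n%:R]%classic = [set: R].
  apply/seteqP; split=> // x _; exists (Num.truncn `|x|).+1 => //=.
  by rewrite in_itv/= -ler_norml ltW// truncnS_gt.
rewrite UT in cvL; rewrite -(cvg_lim _ cvL)//.
have [->|] := eqVneq (\int[mu]_x (U x)%:E)%E +oo%E; first by rewrite leey.
rewrite -ltey => Uoo.
have Ufin : (\int[mu]_x (U x)%:E)%E \is a fin_num.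
  by rewrite ge0_fin_numE// integral_ge0// => x _; rewrite lee_fin.
apply/lee_addgt0Pr => e e0.
apply: lime_le; first by apply/cvg_ex; eexists; exact: cvL.
have eC : 0 < e / (2 * m * pk).
  by rewrite divr_gt0// !mulr_gt0// normal_peak_gt0.
have [N _ HN] := near_infty_natSinv_lt (PosNum eC).
near=> n.
have n0 : (0 < n)%N by near: n; exact: nbhs_infty_gt.
have nN : (N <= n.-1)%N by rewrite -ltnS prednK//; near: n; exact: nbhs_infty_gt.
have n0R : 0 < n%:R :> R by rewrite ltr0n.
(* The end points are taken in ]n, 2n[ and ]-2n, -n[, where |G| <= m pk / n; the constant [eC] was
   chosen so that the two boundary terms together stay below e. *)
have [|b bn Gb] := small n%:R (n%:R + n%:R); first by rewrite ltrDl.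
have [|a an Ga] := small (- (n%:R + n%:R)) (- n%:R).
  by rewrite ltrN2 ltrDl.
move: bn an; rewrite !in_itv/= => /andP[bn1 bn2] /andP[an1 an2].
apply: le_trans (le_trans (intab a b _) _).
- apply: ge0_subset_integral => //.
  + by apply/measurable_EFinP; exact: measurable_funTS.
  + by move=> x _; rewrite lee_fin.
  + by apply: subset_itv; rewrite bnd_simp ltW.
- by rewrite (lt_trans an2)// (lt_trans _ bn1)// (lt_trans _ n0R)// oppr_lt0.
rewrite leeD2lE// lee_fin.
have := HN n.-1 nN; rewrite /= prednK// => h.
have pk0 : 0 < pk by rewrite normal_peak_gt0.
have e2 : 2 * (m * pk / n%:R) < e.
  have -> : 2 * (m * pk / n%:R) = n%:R^-1 * (2 * m * pk) by ring.
  by rewrite -ltr_pdivlMr// !mulr_gt0.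
rewrite addrK in Gb; rewrite opprK addrC addrK in Ga.
move: Ga Gb; rewrite !ler_norml; lra.
Unshelve. all: by end_near. Qed.

Lemma lsi1_pos : (\int[mu]_x (kl (r x) (m * g1 x))%:E + m%:E <=
  2^-1%:E * (\int[mu]_x (x ^+ 2 * r x)%:E + \int[mu]_x (dr x ^+ 2 / r x)%:E))%E.
Proof.
have kl0' x : 0 <= kl (r x) (m * g1 x).
  by rewrite kl_ge0 ?(ltW (r0 _))// mulr_gt0 ?g1_gt0.
have A1 x : 0 <= x ^+ 2 * r x by rewrite mulr_ge0 ?sqr_ge0 ?(ltW (r0 _)).
have A2 x : 0 <= dr x ^+ 2 / r x by rewrite divr_ge0 ?sqr_ge0 ?(ltW (r0 _)).
have A3 x : 0 <= m * g1 x by rewrite mulr_ge0 ?(ltW m0)// ltW// g1_gt0.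
have mkl : measurable_fun setT (fun x => kl (r x) (m * g1 x)).
  by apply: measurable_kl; meas.
have := lsi1_pos_aux; rewrite /L /U.
under eq_integral do rewrite EFinD (EFinM 2).
rewrite ge0_integralD//=; first last.
- by meas.
- by move=> x _; rewrite mule_ge0// lee_fin// ltW.
- exact/measurable_EFinP.
- by move=> x _; rewrite lee_fin.
rewrite ge0_integralZl//=; first last.
- by move=> x _; rewrite lee_fin ltW.
- exact/measurable_EFinP.
rewrite rm.
have -> : (\int[mu]_x (2^-1 * (x ^+ 2 * r x) + 2^-1 * (dr x ^+ 2 / r x) + m * g1 x)%:E =
  2^-1%:E * (\int[mu]_x (x ^+ 2 * r x)%:E + \int[mu]_x (dr x ^+ 2 / r x)%:E) + m%:E)%E.
  under eq_integral do rewrite EFinD -mulrDr.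
  rewrite ge0_integralD//=; first last.
  - by meas.
  - by move=> x _; rewrite lee_fin.
  - by meas.
  - by move=> x _; rewrite lee_fin; have := A1 x; have := A2 x; lra.
  congr (_ + _)%E.
    under eq_integral do rewrite EFinM.
    rewrite ge0_integralZl//=; first last.
    - by move=> x _; rewrite lee_fin addr_ge0.
    - by meas.
    congr (_ * _)%E; under eq_integral do rewrite EFinD.
    rewrite ge0_integralD//=.
    - by move=> x _; rewrite lee_fin.
    - by meas.
    - by move=> x _; rewrite lee_fin.
    - by meas.
  under eq_integral do rewrite EFinM.
  rewrite ge0_integralZl//=; first last.
  - by rewrite lee_fin ltW.
  - by move=> x _; rewrite lee_fin ltW// g1_gt0.
  - exact/measurable_EFinP.
  by rewrite integral_normal_pdf mule1.
have -> : (2%:E * m%:E = m%:E + m%:E)%E by rewrite -EFinM -EFinD mulr_natl mulr2n.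
by rewrite addeA leeD2rE.
Qed.
End pos.

End lsi1.

Ltac nneg := repeat first
  [ done | solve [apply: ltW; done] | exact: sqr_ge0 | exact: expR_ge0 | exact: expR_gt0 | exact: phi_gt0
  | exact: phi_ge0 | exact: powR_ge0 | exact: normr_ge0 | exact: normal_pdf_ge0
  | exact: normal_pdf01_gt0 | exact: sqn_ge0 | exact: Kd_gt0
  | match goal with
    | |- is_true (0 <= _ + _)%R => apply: addr_ge0
    | |- is_true (0 <= _ * _)%R => apply: mulr_ge0
    | |- is_true (0 <= _^-1)%R => rewrite invr_ge0
    | |- is_true (0 < _ * _)%R => apply: mulr_gt0
    | |- is_true (0 < _^-1)%R => rewrite invr_gt0
    | |- is_true (0 <= _)%R => apply: ltW; solve [done | exact: Kd_gt0 | nneg]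
    end ].

Lemma adde_fin_eq (R : realDomainType) (X Y : \bar R) (a b : R) :
  (X + a%:E = Y + b%:E -> X = Y + (b - a)%:E)%E.
Proof. by move=> E; rewrite EFinB addeA -E addeK. Qed.

(** * Fatou bounds, chain rule and Jensen's inequality for relative entropy *)

Section integral_tools.
Context d (T : measurableType d) (R : realType) (mu : {measure set T -> \bar R}).
Local Open Scope ereal_scope.

(** Fatou's lemma with pointwise and integral bounds stated up to an arbitrary e > 0, the form in
    which the later limits are available. *)
Lemma fatou_bound (f_ : nat -> T -> R) (f : T -> R) (B : R) :
  (forall n, measurable_fun setT (f_ n)) -> (forall n x, 0 <= f_ n x)%R ->
  measurable_fun setT f -> (forall x, 0 <= f x)%R ->
  (forall x e, (0 < e)%R -> \forall n \near \oo, (f x - e <= f_ n x)%R) ->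
  (forall e, (0 < e)%R -> \forall n \near \oo, \int[mu]_x (f_ n x)%:E <= (B + e)%:E) ->
  \int[mu]_x (f x)%:E <= B%:E.
Proof.
move=> mf_ f_0 mf f0 lb ub; apply/lee_addgt0Pr => e e0.
apply: (@le_trans _ _ (\int[mu]_x limn_einf (fun n => (f_ n x)%:E))).
  apply: ge0_le_integral => //=.
  - by move=> x _; rewrite lee_fin.
  - exact/measurable_EFinP.
  - rewrite /limn_einf; apply: measurableT_comp => //.
    by apply: measurable_fun_limn_esup => n; apply: measurableT_comp => //; exact/measurable_EFinP.
  - move=> x _; rewrite limn_einf_lim; apply/lee_subgt0Pr => a a0.
    apply: lime_ge; first exact: is_cvg_einfs.
    have [N _ HN] := lb x a a0; near=> n.
    apply: le_ereal_inf_tmp => _ [k /= nk <-]; rewrite -EFinB lee_fin.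
    apply: HN => /=; apply: leq_trans nk.
    by near: n; exists N.
apply: (le_trans (fatou _ _ _ _)) => //=.
- by move=> n; exact/measurable_EFinP.
- by move=> n x _; rewrite lee_fin.
rewrite limn_einf_lim -EFinD; apply: lime_le; first exact: is_cvg_einfs.
near=> n; have [N _ HN] := ub e e0.
apply: (@le_trans _ _ (\int[mu]_x (f_ (maxn n N) x)%:E)).
  by apply: ereal_inf_lbound; exists (maxn n N) => //=; rewrite leq_maxl.
by apply: HN; rewrite /= leq_maxr.
Unshelve. all: by end_near. Qed.

Lemma ge0_integral_fin_ae (M : T -> \bar R) : measurable_fun setT M ->
  (forall x, 0 <= M x) -> \int[mu]_x M x < +oo ->
  {ae mu, forall x, M x \is a fin_num}.
Proof.
move=> mM M0 Moo.
have : mu.-integrable setT M.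
  by apply/integrableP; split=> //; under eq_integral do rewrite gee0_abs//.
by move=> /integrable_ae H; apply: filterS (H measurableT) => x; exact.
Qed.

Lemma ge0_integral0_ae (f : T -> R) : measurable_fun setT f ->
  (forall x, 0 <= f x)%R -> \int[mu]_x (f x)%:E = 0 -> {ae mu, forall x, f x = 0%R}.
Proof.
move=> mf f0 If.
have mfE : measurable_fun setT (EFin \o f) by exact/measurable_EFinP.
have [/(_ _) H _] := ae_eq_integral_abs mu measurableT mfE.
have {}H : ae_eq mu setT (EFin \o f) (cst 0).
  by apply: H; rewrite -If; apply: eq_integral => x _ /=; rewrite ger0_norm.
by apply: filterS H => x /(_ I) /= [].
Qed.

Lemma ge0_ae_le (f g : T -> \bar R) : measurable_fun setT f -> measurable_fun setT g ->
  (forall x, 0 <= f x) -> (forall x, 0 <= g x) -> {ae mu, forall x, f x <= g x} ->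
  \int[mu]_x f x <= \int[mu]_x g x.
Proof.
move=> mf mg f0 g0 fg; apply: ae_ge0_le_integral => //.
by apply: filterS fg => x fgx _.
Qed.

Lemma ge0_integralZ (k : R) (f : T -> R) : measurable_fun setT f ->
  (forall x, 0 <= f x)%R -> (0 <= k)%R ->
  \int[mu]_x (k * f x)%:E = k%:E * \int[mu]_x (f x)%:E.
Proof.
move=> mf f0 k0; under eq_integral do rewrite EFinM.
rewrite ge0_integralZl//; first exact/measurable_EFinP.
by move=> x _; rewrite lee_fin.
Qed.

Lemma ge0_integralDr (f g : T -> R) : measurable_fun setT f -> measurable_fun setT g ->
  (forall x, 0 <= f x)%R -> (forall x, 0 <= g x)%R ->
  \int[mu]_x (f x + g x)%:E = \int[mu]_x (f x)%:E + \int[mu]_x (g x)%:E.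
Proof.
move=> mf mg f0 g0; under eq_integral do rewrite EFinD.
rewrite ge0_integralD//.
- by move=> x _; rewrite lee_fin.
- exact/measurable_EFinP.
- by move=> x _; rewrite lee_fin.
- exact/measurable_EFinP.
Qed.

Lemma ge0_integralDe (f g : T -> \bar R) : measurable_fun setT f -> measurable_fun setT g ->
  (forall x, 0 <= f x) -> (forall x, 0 <= g x) ->
  \int[mu]_x (f x + g x) = \int[mu]_x f x + \int[mu]_x g x.
Proof. by move=> mf mg f0 g0; rewrite ge0_integralD. Qed.

Lemma ge0_integralZe (k : R) (f : T -> \bar R) : measurable_fun setT f ->
  (forall x, 0 <= f x) -> (0 <= k)%R ->
  \int[mu]_x (k%:E * f x) = k%:E * \int[mu]_x f x.
Proof. by move=> mf f0 k0; rewrite ge0_integralZl. Qed.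

Lemma ge0_integral_real_ge0 (f : T -> R) : (forall x, 0 <= f x)%R ->
  0 <= \int[mu]_x (f x)%:E.
Proof. by move=> f0; apply: integral_ge0 => x _; rewrite lee_fin. Qed.

Lemma ge0_le_integralr (f g : T -> R) : measurable_fun setT f -> measurable_fun setT g ->
  (forall x, 0 <= f x)%R -> (forall x, f x <= g x)%R ->
  \int[mu]_x (f x)%:E <= \int[mu]_x (g x)%:E.
Proof.
move=> mf mg f0 fg; apply: ge0_le_integral => //=.
- by move=> x _; rewrite lee_fin.
- exact/measurable_EFinP.
- exact/measurable_EFinP.
- by move=> x _; rewrite lee_fin.
Qed.

Section kl_integral.
Variables (r : T -> R) (M : R).
Hypotheses (mr : measurable_fun setT r) (r0 : forall x, (0 <= r x)%R)
  (rM : \int[mu]_x (r x)%:E = M%:E).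

Let M0 : (0 <= M)%R.
Proof. by rewrite -lee_fin -rM; exact: ge0_integral_real_ge0. Qed.

(** Pointwise, kl r (b g) - kl r (M g) = r (ln M - ln b) + (b - M) g, and the right side integrates
    to [kl M b]. The number ln M - ln b is split into its positive and negative parts, so that only
    nonnegative functions are integrated and the entropies may be infinite. The case M = 0 is
    separate because [kl] with second argument 0 has no meaning. *)
Lemma kl_chain (g : T -> R) (b : R) : measurable_fun setT g ->
  (forall x, 0 < g x)%R -> \int[mu]_x (g x)%:E = 1 -> (0 < b)%R ->
  \int[mu]_x (kl (r x) (b * g x))%:E =
  (if M == 0%R then 0 else \int[mu]_x (kl (r x) (M * g x))%:E) + (kl M b)%:E.
Proof.
move=> mg g0 g1 b0.
have gle x : (0 <= g x)%R := ltW (g0 x).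
case: eqVneq => [ME|Mneq].
  rewrite add0e ME kl0 -[RHS]mule1 -g1.
  rewrite -ge0_integralZ ?(ltW b0)//; apply: ge0_ae_eq_integral => //=.
  - by apply/measurable_EFinP; apply: measurable_kl; meas.
  - by apply/measurable_EFinP; meas.
  - by move=> x _; rewrite lee_fin kl_ge0// mulr_gt0.
  - by move=> x _; rewrite lee_fin mulr_ge0// ltW.
  - have := ge0_integral0_ae mr r0; rewrite rM ME => /(_ erefl).
    by apply: filterS => x rx _; rewrite rx kl0.
have Mgt : (0 < M)%R by rewrite lt0r Mneq.
pose y := (ln M - ln b)%R.
pose yp := Num.max y 0%R; pose yn := Num.max (- y)%R 0%R.
have yp0 : (0 <= yp)%R by rewrite le_max lexx orbT.
have yn0 : (0 <= yn)%R by rewrite le_max lexx orbT.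
have yE : (y = yp - yn)%R by rewrite /yp /yn; case: (leP y 0%R) => h; case: (leP (- y)%R 0%R) => h'; lra.
have mk c : measurable_fun setT (fun x => kl (r x) (c * g x)) by apply: measurable_kl; meas.
have k0 c x : (0 < c)%R -> (0 <= kl (r x) (c * g x))%R by move=> c0; rewrite kl_ge0// mulr_gt0.
have : \int[mu]_x (kl (r x) (b * g x) + (yn * r x + M * g x))%:E =
       \int[mu]_x (kl (r x) (M * g x) + (yp * r x + b * g x))%:E.
  apply: eq_integral => x _; congr EFin.
  rewrite !klE ?mulr_gt0// !lnM ?posrE//.
  have : (yp = ln M - ln b + yn)%R by rewrite -/y yE; ring.
  by move=> ->; ring.
rewrite !ge0_integralDr//; try by [meas|move=> x; rewrite ?addr_ge0 ?mulr_ge0// ?(ltW Mgt) ?(ltW b0)|move=> x; exact: k0].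
rewrite !ge0_integralZ ?(ltW Mgt) ?(ltW b0)// rM g1 !mule1.
have kf : kl M b = (y * M - M + b)%R by rewrite klE// mulrC.
move: (\int[mu]_x (kl (r x) (b * g x))%:E) (\int[mu]_x (kl (r x) (M * g x))%:E) => X Y.
rewrite -!EFinM -!EFinD kf yE.
by move=> /adde_fin_eq ->; congr (_ + _%:E); lra.
Qed.

(** The tangent inequality with a constant slope y is integrated and y is then optimised, at y = ln
    (M / (m b)). The function N may vanish, but only where r does. *)
Lemma kl_jensen (N : T -> R) (m b : R) : measurable_fun setT N ->
  (forall x, 0 <= N x)%R -> (forall x, N x = 0 -> r x = 0)%R ->
  \int[mu]_x (N x)%:E = m%:E -> (0 < m)%R -> (0 < b)%R ->
  (kl M (m * b))%:E <= \int[mu]_x (kl (r x) (N x * b))%:E.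
Proof.
move=> mN N0 Nr NE m0 b0.
have mk : measurable_fun setT (fun x => kl (r x) (N x * b)) by apply: measurable_kl; meas.
have k0 x : (0 <= kl (r x) (N x * b))%R.
  have [Nx|Nx] := eqVneq (N x) 0%R; first by rewrite (Nr _ Nx) Nx mul0r kl0.
  by rewrite kl_ge0// mulr_gt0// lt0r Nx N0.
have key (y : R) : (M * y - m * b * (expR y - 1))%:E <= \int[mu]_x (kl (r x) (N x * b))%:E.
  pose yp := Num.max y 0%R; pose yn := Num.max (- y)%R 0%R.
  have yp0 : (0 <= yp)%R by rewrite le_max lexx orbT.
  have yn0 : (0 <= yn)%R by rewrite le_max lexx orbT.
  have yE : (y = yp - yn)%R by rewrite /yp /yn; case: (leP y 0%R) => h; case: (leP (- y)%R 0%R) => h'; lra.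
  have : \int[mu]_x (yp * r x + b * N x)%:E <=
         \int[mu]_x (kl (r x) (N x * b) + (yn * r x + b * expR y * N x))%:E.
    apply: ge0_le_integralr; try by meas.
    - by move=> x; rewrite addr_ge0// mulr_ge0// ltW.
    - move=> x.
      have [Nx|Nx] := eqVneq (N x) 0%R.
        by rewrite (Nr _ Nx) Nx mul0r kl0 !mulr0 !addr0.
      have Nb : (0 < N x * b)%R by rewrite mulr_gt0// lt0r Nx N0.
      have := kl_ge_tangent y (r0 x) Nb; rewrite {1}yE; lra.
  have e0 : (0 <= b * expR y)%R by rewrite mulr_ge0 ?expR_ge0// ltW.
  rewrite !ge0_integralDr//; try by [meas|move=> x; rewrite ?addr_ge0 ?mulr_ge0// ?(ltW b0)|move=> x; exact: k0].
  rewrite !ge0_integralZ ?(ltW b0)// rM NE.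
  rewrite -!EFinM -!EFinD -leeBlDr// -EFinB; apply: le_trans.
  have My : (M * y = M * yp - M * yn)%R by rewrite -mulrBr -yE.
  rewrite lee_fin; lra.
have mb : (0 < m * b)%R by rewrite mulr_gt0.
move: M0; rewrite le_eqVlt => /predU1P[M00|Mgt].
  (* For M = 0 the optimal slope is -oo; y = ln (e / (m b)) loses no more than e. *)
  rewrite -M00 kl0; apply/lee_addgt0Pr => e e0.
  have := key (ln (e / (m * b))); rewrite -M00 mul0r sub0r lnK ?posrE ?divr_gt0//.
  rewrite mulrBr mulrCA divff ?gt_eqF// !mulr1 opprB EFinB.
  by rewrite leeBlDr.
have := key (ln (M / (m * b))); rewrite lnK ?posrE ?divr_gt0//.
rewrite mulrBr mulrCA divff ?gt_eqF// !mulr1; congr (_ <= _); congr EFin.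
by rewrite kl.unlock; ring.
Qed.
End kl_integral.
End integral_tools.

Section lsi1_general.
Context {R : realType}.
Local Notation mu := (@lebesgue_measure R).
Local Notation g1 := (normal_pdf (0 : R) 1).
Local Open Scope ereal_scope.

Lemma continuous_integral0 (f : R -> R) : continuous f -> (forall x, 0 <= f x)%R ->
  \int[mu]_x (f x)%:E = 0 -> forall x, f x = 0%R.
Proof.
move=> cf f0 If x; apply/eqP/negPn/negP => fx.
have fx0 : (0 < f x)%R by rewrite lt0r fx f0.
have /nbhs_ballP[e /= e0 xe] : \forall y \near x, (f x / 2 < f y)%R.
  have /cvgrPdist_lt/(_ (f x / 2)%R) := cf x.
  rewrite divr_gt0// => /(_ isT); apply: filterS => y.
  by rewrite ltr_distlC => /andP[+ _]; lra.
have : \int[mu]_(y in ball x e) (f x / 2)%:E <= \int[mu]_y (f y)%:E.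
  apply: (@le_trans _ _ (\int[mu]_(y in ball x e) (f y)%:E)).
    apply: ge0_le_integral => //=.
    - exact: measurable_ball.
    - by move=> y _; rewrite lee_fin divr_ge0.
    - by apply/measurable_EFinP/measurable_funTS; exact: continuous_measurable_fun.
    - by move=> y xy; rewrite lee_fin ltW// xe.
  apply: ge0_subset_integral => //=.
  - exact: measurable_ball.
  - by apply/measurable_EFinP; exact: continuous_measurable_fun.
  - by move=> y _; rewrite lee_fin.
rewrite If integral_cst//=; last exact: measurable_ball.
rewrite lebesgue_measure_ball ?(ltW e0)// -EFinM lee_fin leNgt.
by rewrite mulr_gt0 ?divr_gt0// mulrn_wgt0.
Qed.

(** Since x^2 / 4 <= e^(x^2 / 4), the integrand is at most 4 times an unnormalised Gaussian of
    variance 2, whose integral is found by scaling. *)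
Lemma normal_second_moment : \int[mu]_x (x ^+ 2 * g1 x)%:E < +oo.
Proof.
have s0 : (0 < Num.sqrt (2^-1) :> R)%R by rewrite sqrtr_gt0 invr_gt0.
have mg : measurable_fun setT g1 by exact: measurable_normal_pdf.
have key : (Num.sqrt (2^-1) : R)%:E * \int[mu]_x (g1 (Num.sqrt 2^-1 * x + 0)%R)%:E = 1.
  rewrite (ge0_integral_affine (f := EFin \o g1) 0 s0).
  - exact: integral_normal_pdf.
  - exact/measurable_EFinP.
  - by move=> x; rewrite lee_fin ltW// g1_gt0.
apply: (@le_lt_trans _ _ (4%:E * \int[mu]_x (g1 (Num.sqrt 2^-1 * x + 0)%R)%:E)).
  rewrite -ge0_integralZ//; last 2 first.
  - by meas.
  - by move=> x; rewrite ltW// g1_gt0.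
  apply: ge0_le_integralr; try by meas.
  - by move=> x; rewrite mulr_ge0 ?sqr_ge0// ltW// g1_gt0.
  move=> x; rewrite addr0 !normal_pdf01E mulrCA [leRHS]mulrCA.
  rewrite ler_wpM2l ?invr_ge0 ?sqrtr_ge0// exprMn sqr_sqrtr ?invr_ge0//.
  have -> : (- x ^+ 2 / 2 = - x ^+ 2 / 4 + (- x ^+ 2 / 4))%R by field.
  have -> : (- (2^-1 * x ^+ 2) / 2 = - x ^+ 2 / 4)%R by field.
  rewrite expRD mulrA ler_wpM2r ?expR_ge0// mulNr expRN.
  have := expR_ge1Dx (x ^+ 2 / 4); have := expR_gt0 (x ^+ 2 / 4) => e0 h.
  by rewrite ler_pdivrMr//; lra.
have : \int[mu]_x (g1 (Num.sqrt 2^-1 * x + 0)%R)%:E < +oo.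
  rewrite ltey; apply/eqP => E; move: key; rewrite E gt0_muley ?lte_fin//.
by move=> h; rewrite lte_mul_pinfty.
Qed.

(** The positive case is applied to r + ep g1 and ep tends to 0. The perturbation raises the second
    moment and the Fisher information by at most ep C, the latter by joint convexity of a^2 / u; the
    entropy passes to the limit by Fatou's lemma. *)
Lemma lsi1 (r dr : R -> R) (m : R) :
  (forall x : R, is_derive x 1%R r (dr x)) -> continuous dr -> (forall x, 0 <= r x)%R ->
  \int[mu]_x (r x)%:E = m%:E ->
  \int[mu]_x (kl (r x) (m * g1 x))%:E + m%:E <=
  2^-1%:E * (\int[mu]_x (x ^+ 2 * r x)%:E + \int[mu]_x (dr x ^+ 2 / r x)%:E).
Proof.
move=> dr_r cdr r0 rm.
have cr : continuous r by exact: continuous_is_derive dr_r.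
have mr : measurable_fun setT r by exact: continuous_measurable_fun.
have mdr : measurable_fun setT dr by exact: continuous_measurable_fun.
have mg1 : measurable_fun setT g1 by exact: measurable_normal_pdf.
have g10 x : (0 <= g1 x)%R := ltW (g1_gt0 x).
have A1 x : (0 <= x ^+ 2 * r x)%R by rewrite mulr_ge0 ?sqr_ge0.
have A2 x : (0 <= dr x ^+ 2 / r x)%R by rewrite divr_ge0 ?sqr_ge0.
have m0 : (0 <= m)%R by rewrite -lee_fin -rm ge0_integral_real_ge0.
set X := \int[mu]_x (x ^+ 2 * r x)%:E; set Y := \int[mu]_x (dr x ^+ 2 / r x)%:E.
have X0 : 0 <= X by exact: ge0_integral_real_ge0.
have Y0 : 0 <= Y by exact: ge0_integral_real_ge0.
move: m0; rewrite le_eqVlt => /predU1P[mE|m0].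
  have rz : forall x, r x = 0%R by apply: continuous_integral0 => //; rewrite rm -mE.
  rewrite -mE adde0; under eq_integral do rewrite rz mul0r kl0.
  by rewrite integral0_eq// mule_ge0// adde_ge0.
have [XYoo|] := eqVneq (X + Y) +oo; first by rewrite XYoo gt0_muley ?leey// lte_fin invr_gt0.
rewrite -ltey => XYoo.
have [Xf Yf] : X \is a fin_num /\ Y \is a fin_num.
  by apply/andP; rewrite -fin_numD ge0_fin_numE// adde_ge0.
have Cf : \int[mu]_x (x ^+ 2 * g1 x)%:E \is a fin_num.
  rewrite ge0_fin_numE ?normal_second_moment// ge0_integral_real_ge0// => x.
  by rewrite mulr_ge0 ?sqr_ge0.
set C := fine (\int[mu]_x (x ^+ 2 * g1 x)%:E).
have CE : \int[mu]_x (x ^+ 2 * g1 x)%:E = C%:E by rewrite fineK.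
(* A zero of r >= 0 is a minimum, so the derivative vanishes there and the convention x / 0 = 0
   gives the Fisher integrand a sensible value. *)
have dr0 x : r x = 0%R -> dr x = 0%R.
  move=> rx.
  have := @derive1_at_min R r (x - 1)%R (x + 1)%R x _ _ _ _.
  have [_ <-] := dr_r x; move=> [].
  - by lra.
  - by move=> t _; have [] := dr_r t.
  - by rewrite in_itv/=; lra.
  - by move=> t _; rewrite rx.
  - by [].
pose ep n : R := (n.+1%:R^-1)%R.
have ep0 n : (0 < ep n)%R by rewrite invr_gt0.
have main n : \int[mu]_x (kl (r x + ep n * g1 x) ((m + ep n) * g1 x))%:E <=
   (2^-1 * (fine X + fine Y) - m + ep n * C)%:E.
  have dn (x : R) : is_derive x 1%R (fun x => r x + ep n * g1 x)%R (dr x + ep n * (- x * g1 x))%R.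
    have dg := @is_deriveZ _ _ _ _ (ep n) _ _ _ (is_derive_normal_pdf x).
    exact: (is_deriveD (dr_r x) dg).
  have cn : continuous (fun x => dr x + ep n * (- x * g1 x))%R.
    move=> x; apply: cvgD; first exact: cdr.
    apply: cvgMr; apply: cvgM; first by apply: cvgN; exact: cvg_id.
    exact: continuous_is_derive is_derive_normal_pdf _.
  have pn x : (0 < r x + ep n * g1 x)%R.
    by rewrite ltr_wpDl// mulr_gt0// g1_gt0.
  have In : \int[mu]_x (r x + ep n * g1 x)%:E = (m + ep n)%:E.
    rewrite ge0_integralDr//; last 2 first.
    - by meas.
    - by move=> x; rewrite mulr_ge0// ltW.
    by rewrite ge0_integralZ ?(ltW (ep0 n))// rm integral_normal_pdf mule1.
  have := lsi1_pos dn cn pn (addr_gt0 m0 (ep0 n)) In.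
  have le1 : \int[mu]_x (x ^+ 2 * (r x + ep n * g1 x))%:E = X + (ep n * C)%:E.
    under eq_integral do rewrite mulrDr (mulrCA _ (ep n)).
    rewrite ge0_integralDr//; try by meas.
    - rewrite ge0_integralZ ?(ltW (ep0 n)) ?CE//; try by meas.
      by move=> x; rewrite mulr_ge0 ?sqr_ge0.
    - by move=> x; nneg.
  have le2 : \int[mu]_x ((dr x + ep n * (- x * g1 x)) ^+ 2 / (r x + ep n * g1 x))%:E <=
     Y + (ep n * C)%:E.
    have -> : Y + (ep n * C)%:E = \int[mu]_x (dr x ^+ 2 / r x + ep n * (x ^+ 2 * g1 x))%:E.
      rewrite ge0_integralDr//; try by meas.
      - rewrite ge0_integralZ ?(ltW (ep0 n)) ?CE//; try by meas.
        by move=> x; rewrite mulr_ge0 ?sqr_ge0.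
      - by move=> x; nneg.
    apply: ge0_le_integralr; try by meas.
    - by move=> x; rewrite divr_ge0 ?sqr_ge0// ltW.
    move=> x; have en := mulr_gt0 (ep0 n) (g1_gt0 x).
    rewrite ler_pdivrMr//.
    have [rx|rx] := eqVneq (r x) 0%R.
      rewrite rx (dr0 _ rx) !add0r expr0n/= mul0r add0r.
      rewrite le_eqVlt; apply/orP; left; apply/eqP; ring.
    have rx0 : (0 < r x)%R by rewrite lt0r rx r0.
    rewrite -subr_ge0.
    (* The defect in (a + b)^2 / (u + v) <= a^2 / u + b^2 / v is a perfect square. *)
    have -> : ((dr x ^+ 2 / r x + ep n * (x ^+ 2 * g1 x)) * (r x + ep n * g1 x) -
       (dr x + ep n * (- x * g1 x)) ^+ 2 = (ep n * g1 x) * ((dr x + x * r x) ^+ 2 / r x))%R.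
      by field.
    by rewrite mulr_ge0 ?(ltW en)// divr_ge0 ?sqr_ge0// ltW.
  move=> /le_trans /(_ (_ : _ <= 2^-1%:E * (X + (ep n * C)%:E + (Y + (ep n * C)%:E)))).
  rewrite le1; move=> /(_ (lee_wpmul2l _ (leeD2l _ le2))); rewrite lee_fin invr_ge0 => /(_ (ler0n _ _)).
  rewrite -(fineK Xf) -(fineK Yf) -!EFinD -EFinM.
  rewrite -leeBrDr// -EFinB => /le_trans; apply; rewrite lee_fin.
  have := ep0 n; lra.
have : \int[mu]_x (kl (r x) (m * g1 x))%:E <= (2^-1 * (fine X + fine Y) - m)%:E.
  have cep : ep @ \oo --> (0 : R)%R by exact: cvg_harmonic.
  apply: (@fatou_bound _ _ _ mu (fun n x => kl (r x + ep n * g1 x) ((m + ep n) * g1 x))%R).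
  - by move=> n; apply: measurable_kl; meas.
  - move=> n x; apply: kl_ge0; first by rewrite addr_ge0// mulr_ge0// ltW.
    by rewrite mulr_gt0 ?g1_gt0// addr_gt0.
  - by apply: measurable_kl; meas.
  - by move=> x; apply: kl_ge0 => //; rewrite mulr_gt0 ?g1_gt0.
  - move=> x e e0.
    have : (kl (r x + ep n * g1 x) ((m + ep n) * g1 x) @[n --> \oo] --> kl (r x) (m * g1 x))%R.
      apply: kl_cvg => //.
      - by rewrite mulr_gt0 ?g1_gt0.
      - by move=> n; rewrite ltr_wpDl// mulr_gt0 ?g1_gt0.
      - have h : (ep n * g1 x @[n --> \oo] --> 0 * g1 x)%R.
          by apply: cvgM; [exact: cep|exact: cvg_cst].
        rewrite mul0r in h; have := cvgD (cvg_cst (r x)) h.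
        by rewrite addr0; exact.
      - have h : ((m + ep n) * g1 x @[n --> \oo] --> (m + 0) * g1 x)%R.
          by apply: cvgM; [apply: cvgD; [exact: cvg_cst|exact: cep]|exact: cvg_cst].
        by rewrite addr0 in h.
      - by move=> n; rewrite mulr_gt0 ?g1_gt0// addr_gt0.
    move=> /cvgrPdist_le/(_ e e0); apply: filterS => n.
    by rewrite ler_distlC => /andP[].
  - move=> e e0.
    have C0 : (0 <= C)%R.
      rewrite -lee_fin -CE ge0_integral_real_ge0// => x.
      by rewrite mulr_ge0 ?sqr_ge0.
    have C1 : (0 < C + 1)%R by lra.
    have /cvgrPdist_le/(_ (e / (C + 1))%R) := cep.
    rewrite divr_gt0// => /(_ isT); apply: filterS => n.
    rewrite sub0r normrN gtr0_norm// ler_pdivlMr// => h.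
    apply: (le_trans (main n)); rewrite lee_fin.
    have := ep0 n; lra.
rewrite -(fineK Xf) -(fineK Yf) -!EFinD -EFinM.
by move=> h; rewrite -leeBrDr// -EFinB (le_trans h)// lee_fin; lra.
Qed.
End lsi1_general.

Ltac meas2 :=
  match goal with
  | |- measurable_fun setT (fun x => sqn (@?f x)) => apply: (measurableT_comp (@measurable_sqn _ _))
  | H : forall i, measurable_fun setT (?f i) |- measurable_fun setT (fun x => ?f ?i (@?g x)) => apply: (measurableT_comp (H i))
  | |- measurable_fun setT (@sqn _ _) => exact: measurable_sqn
  | |- measurable_fun setT (fun x => normal_pdf ?m ?s (@?f x)) => apply: (measurableT_comp (@measurable_normal_pdf _ m s))
  | |- measurable_fun setT (normal_pdf _ _) => exact: measurable_normal_pdf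
  | |- measurable_fun setT (fun x => kl (@?f x) (@?g x)) => apply: (@measurable_kl _ _ _ f g)
  end.
Ltac meas ::= repeat first [meas2 | meas1].

Lemma ae_imp d (T : measurableType d) (R : realType) (mu : {measure set T -> \bar R})
  (P Q : T -> Prop) : {ae mu, forall x, P x} -> (forall x, P x -> Q x) ->
  {ae mu, forall x, Q x}.
Proof. by move=> aeP PQ; apply: filterS aeP => x; exact: PQ. Qed.

(** * Tensorisation to dimension d *)

Section lsi.
Context {R : realType}.
Local Notation mu := (@lebesgue_measure R).
Local Open Scope ereal_scope.

(** C^1 along the coordinate axes only. This is what the one-dimensional inequality consumes, and it
    is inherited by the functions obtained by fixing the first coordinate. *)
Definition line_C1 d (r : 'rV[R]_d -> R) (D : 'I_d -> 'rV[R]_d -> R) : Prop :=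
  [/\ measurable_fun setT r, forall i, measurable_fun setT (D i),
      forall i x (s : R), is_derive s 1%R (fun s : R => r (x + s *: delta_mx 0%R i)%R)
        (D i (x + s *: delta_mx 0%R i)%R) &
      forall i x, continuous (fun s : R => D i (x + s *: delta_mx 0%R i)%R)].

Lemma consr_delta_lift d x (v : 'rV[R]_d) (s : R) i :
  (consr x v + s *: delta_mx 0 (lift ord0 i) = consr x (v + s *: delta_mx 0 i))%R.
Proof.
apply: consrP => [|j]; rewrite !(mxE, unlift_none, liftK)/=.
  by rewrite mulr0 addr0.
by rewrite (inj_eq (@lift_inj _ _)).
Qed.

Lemma consr_delta0 d x (v : 'rV[R]_d) (s : R) :
  (consr x v + s *: delta_mx 0 ord0 = consr (x + s) v)%R.
Proof.
apply: consrP => [|j]; rewrite !(mxE, unlift_none, liftK)/=.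
  by rewrite mulr1.
by rewrite mulr0 addr0.
Qed.

Lemma line_C1_tail d (r : 'rV[R]_d.+1 -> R) D x : line_C1 r D ->
  line_C1 (fun v => r (consr x v)) (fun i v => D (lift ord0 i) (consr x v)).
Proof.
move=> [mr mD dr cD]; split.
- by apply: (measurableT_comp mr); exact: measurable_consr.
- by move=> i; apply: (measurableT_comp (mD _)); exact: measurable_consr.
- move=> i v s; have := dr (lift ord0 i) (consr x v) s.
  by under eq_fun do rewrite consr_delta_lift; rewrite consr_delta_lift.
- move=> i v; have := cD (lift ord0 i) (consr x v).
  by under eq_fun do rewrite consr_delta_lift.
Qed.

Lemma line_C1_head d (r : 'rV[R]_d.+1 -> R) D v : line_C1 r D ->
  (forall x : R, is_derive x 1%R (fun x => r (consr x v)) (D ord0 (consr x v))) /\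
  continuous (fun x => D ord0 (consr x v)).
Proof.
move=> [mr mD dr cD]; split.
- move=> x; have := dr ord0 (consr 0%R v) x.
  under eq_fun do rewrite consr_delta0 add0r.
  by rewrite consr_delta0 add0r.
- have := cD ord0 (consr 0%R v).
  by under eq_fun do rewrite consr_delta0 add0r.
Qed.

Lemma sqn_cons d x (v : 'rV[R]_d) : (sqn (consr x v) = x ^+ 2 + sqn v)%R.
Proof.
rewrite /sqn big_ord_recl consr0; congr (_ + _)%R.
by apply: eq_bigr => i _; rewrite consrS.
Qed.

Lemma integral_phi d : \int[leb d]_x (phi x)%:E = 1 :> \bar R.
Proof.
have := gamT d => H; have : \int[gam d]_x 1 = 1 :> \bar R.
  by rewrite integral_cst// mul1e; exact: H.
rewrite ge0_integral_gam//.
by move=> <-; apply: eq_integral => x _; rewrite mul1e.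
Qed.

Lemma integral_lebS d (F : 'rV[R]_d.+1 -> R) : measurable_fun setT F ->
  (forall x, 0 <= F x)%R ->
  \int[leb d.+1]_x (F x)%:E = \int[mu]_x \int[leb d]_v (F (consr x v))%:E.
Proof.
move=> mF F0; rewrite /leb integral_powmS//; by [meas|move=> x; rewrite lee_fin].
Qed.

Lemma integral_lebSC d (F : 'rV[R]_d.+1 -> R) : measurable_fun setT F ->
  (forall x, 0 <= F x)%R ->
  \int[leb d.+1]_x (F x)%:E = \int[leb d]_v \int[mu]_x (F (consr x v))%:E.
Proof.
move=> mF F0; rewrite integral_lebS//.
have mF2 : measurable_fun setT (fun z : measurableTypeR R * 'rV[R]_d => (F (consr z.1 z.2))%:E).
  by apply/measurable_EFinP; apply: (measurableT_comp mF); exact: measurable_consr.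
by apply: (fubini_tonelli _ mF2) => z; rewrite lee_fin.
Qed.

(** Induction on d, with x the first coordinate and v the others. The chain rule splits the entropy
    into that of the sections r(x, .), covered by the induction hypothesis, and that of the marginal
    M. The marginal is never differentiated: by Jensen's inequality its entropy is at most an
    average over v of the entropies of the sections r(., v), to which the one-dimensional inequality
    applies. *)
Lemma lsi d (r : 'rV[R]_d -> R) (D : 'I_d -> 'rV[R]_d -> R) (m : R) :
  line_C1 r D -> (forall x, 0 <= r x)%R -> \int[leb d]_x (r x)%:E = m%:E -> (0 < m)%R ->
  \int[leb d]_x (kl (r x) (m * phi x))%:E + (d%:R * m)%:E <=
  2^-1%:E * (\int[leb d]_x (sqn x * r x)%:E +
             \sum_(i < d) \int[leb d]_x (D i x ^+ 2 / r x)%:E).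
Proof.
elim: d r D m => [|d IH] r D m rD r0 rm m0.
  have [mr mD dr cD] := rD.
  have mk : measurable_fun setT (fun x : 'rV[R]_0 => kl (r x) (m * phi x)) by apply: measurable_kl; meas.
  have ms : measurable_fun setT (fun x : 'rV[R]_0 => (sqn x * r x)%R) by meas.
  rewrite big_ord0 adde0 mul0r adde0.
  move: rm; rewrite /leb !integral_powm0//; try by apply/measurable_EFinP.
  move=> [->]; rewrite /phi big_ord0 mulr1 /sqn big_ord0 mul0r mule0.
  by rewrite klE ?(ltW m0)// subrr mulr0 sub0r addNr.
have [mr mD dr cD] := rD.
have mrE : measurable_fun setT (EFin \o r) by exact/measurable_EFinP.
have mr2 : measurable_fun setT (fun z : measurableTypeR R * 'rV[R]_d => r (consr z.1 z.2)).
  by apply: (measurableT_comp mr); exact: measurable_consr.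
have mrv x : measurable_fun setT (fun v => r (consr x v)) by case: (line_C1_tail x rD).
have mrx v : measurable_fun setT (fun x => r (consr x v)).
  by apply: (measurableT_comp mr); apply: measurable_consr.
pose ME (x : R) := \int[leb d]_v (r (consr x v))%:E.
pose NE v := \int[mu]_x (r (consr x v))%:E.
have mME : measurable_fun setT ME.
  by apply: (@measurable_powm_cons R mu d (EFin \o r)) => // x; rewrite lee_fin.
have mNE : measurable_fun setT NE.
  apply: (@measurable_fun_fubini_tonelli_G _ _ _ _ R mu (fun z : measurableTypeR R * 'rV[R]_d => (r (consr z.1 z.2))%:E)).
    by meas.
  by move=> z; rewrite lee_fin.
have ME0 x : 0 <= ME x by apply: ge0_integral_real_ge0.
have NE0 v : 0 <= NE v by apply: ge0_integral_real_ge0.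
have IM : \int[mu]_x ME x = m%:E by rewrite -rm integral_lebS.
have IN : \int[leb d]_v NE v = m%:E by rewrite -rm integral_lebSC.
have Mae : {ae mu, forall x, ME x \is a fin_num}.
  by apply: ge0_integral_fin_ae => //; rewrite IM ltry.
have Nae : {ae leb d, forall v, NE v \is a fin_num}.
  by apply: ge0_integral_fin_ae => //; rewrite IN ltry.
pose bad := NE @^-1` [set +oo].
have mbad : measurable bad by rewrite -[X in measurable X]setTI; exact: mNE.
(* Where the marginal in v is infinite, [fine] returns 0. The indicator makes N equal to 1 on this
   null set, so that N v = 0 still forces the whole section to vanish, as [kl_jensen] requires. *)
pose M x := fine (ME x); pose N v := (fine (NE v) + \1_bad v)%R.
have mM : measurable_fun setT M by exact: measurableT_comp.
have mN : measurable_fun setT N.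
  by apply: measurable_funD; [exact: measurableT_comp|exact: measurable_indic].
have M0 x : (0 <= M x)%R by rewrite fine_ge0.
have N0 v : (0 <= N v)%R by rewrite addr_ge0// fine_ge0.
have NEN v : NE v \is a fin_num -> NE v = (N v)%:E.
  move=> fv; rewrite /N indicE memNset ?addr0 ?fineK// /bad /= => E.
  by rewrite E in fv.
have IMr : \int[mu]_x (M x)%:E = m%:E.
  rewrite -IM; apply: ge0_ae_eq_integral => //.
  - by meas.
  - by move=> x _; rewrite lee_fin.
  - by apply: (ae_imp Mae) => x fx _; rewrite fineK.
have INr : \int[leb d]_v (N v)%:E = m%:E.
  rewrite -IN; apply: ge0_ae_eq_integral => //.
  - by meas.
  - by move=> x _; rewrite lee_fin.
  - by apply: (ae_imp Nae) => v fv _; rewrite NEN.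
have Nr x v : N v = 0%R -> r (consr x v) = 0%R.
  move=> Nv; have [d1 _] := line_C1_head v rD.
  apply: (@continuous_integral0 R (fun x => r (consr x v))) => //.
    exact: continuous_is_derive d1.
  rewrite -/(NE v); case: (boolP (NE v \is a fin_num)) => [/NEN ->|].
    by rewrite Nv.
  rewrite ge0_fin_numE// -leNgt leye_eq => /eqP NEv.
  move: Nv; rewrite /N NEv /= add0r indicE mem_set// => /eqP.
  by rewrite oner_eq0.
have mI (G : measurableTypeR R * 'rV[R]_d -> R) : measurable_fun setT G ->
    (forall z, 0 <= G z)%R -> measurable_fun setT (fun x => \int[leb d]_v (G (x, v))%:E).
  move=> mG G0; apply: (@measurable_fun_fubini_tonelli_F _ _ _ _ R (leb d) (EFin \o G)).
    exact/measurable_EFinP.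
  by move=> z; rewrite lee_fin.
have mI' (G : measurableTypeR R * 'rV[R]_d -> R) : measurable_fun setT G ->
    (forall z, 0 <= G z)%R -> measurable_fun setT (fun v => \int[mu]_x (G (x, v))%:E).
  move=> mG G0; apply: (@measurable_fun_fubini_tonelli_G _ _ _ _ R mu (EFin \o G)).
    exact/measurable_EFinP.
  by move=> z; rewrite lee_fin.
have mpdf : measurable_fun setT (normal_pdf (0 : R) 1) by exact: measurable_normal_pdf.
have mphi := @measurable_phi R d.
have mD2 i : measurable_fun setT (fun z : measurableTypeR R * 'rV[R]_d => D i (consr z.1 z.2)).
  by apply: (measurableT_comp (mD i)); exact: measurable_consr.
pose X z := kl (r (consr z.1 z.2)) (m * (normal_pdf 0 1 z.1 * phi z.2)).
pose E2 z := (sqn z.2 * r (consr z.1 z.2))%R.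
pose E1 z := (z.1 ^+ 2 * r (consr z.1 z.2))%R.
pose J i z := (D i (consr z.1 z.2) ^+ 2 / r (consr z.1 z.2))%R.
pose Y z := kl (r (consr z.1 z.2)) (N z.2 * normal_pdf 0 1 z.1).
have X0 z : (0 <= X z)%R by apply: kl_ge0 => //; nneg.
have E10 z : (0 <= E1 z)%R by rewrite /E1; nneg.
have E20 z : (0 <= E2 z)%R by rewrite /E2; nneg.
have J0 i z : (0 <= J i z)%R by rewrite /J; nneg.
have Y0 z : (0 <= Y z)%R.
  have [Nz|Nz] := eqVneq (N z.2) 0%R; first by rewrite /Y Nr// Nz mul0r kl0.
  by rewrite /Y kl_ge0// mulr_gt0// ?g1_gt0// lt0r Nz N0.
have mX : measurable_fun setT X by rewrite /X; meas.
have mE1 : measurable_fun setT E1 by rewrite /E1; meas.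
have mE2 : measurable_fun setT E2 by rewrite /E2; meas.
have mJ i : measurable_fun setT (J i) by rewrite /J; meas.
have mY : measurable_fun setT Y by rewrite /Y; meas.
pose K x := kl (M x) (m * normal_pdf 0 1 x).
have K0 x : (0 <= K x)%R by apply: kl_ge0 => //; nneg.
have mK : measurable_fun setT K by rewrite /K; meas.
pose A x := \int[leb d]_v (E2 (x, v))%:E + \sum_(i < d) \int[leb d]_v (J (lift ord0 i) (x, v))%:E.
have I0 (G : measurableTypeR R * 'rV[R]_d -> R) x : (forall z, 0 <= G z)%R ->
    0 <= \int[leb d]_v (G (x, v))%:E by move=> G0; exact: ge0_integral_real_ge0.
have I0' (G : measurableTypeR R * 'rV[R]_d -> R) v : (forall z, 0 <= G z)%R ->
    0 <= \int[mu]_x (G (x, v))%:E by move=> G0; exact: ge0_integral_real_ge0.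
have A0 x : 0 <= A x by rewrite adde_ge0 ?I0// sume_ge0// => i _; exact: (I0 _ _ (J0 _)).
have mA : measurable_fun setT A.
  apply: emeasurable_funD; first exact: mI.
  by apply: emeasurable_sum => i; exact: (mI _ (mJ _) (J0 _)).
have hf0 : 0 <= (2^-1 : R)%:E by rewrite lee_fin invr_ge0.
have dR0 : (0 <= d%:R :> R)%R by [].
have step1 : {ae mu, forall x, \int[leb d]_v (X (x, v))%:E + (d%:R * M x)%:E <=
    2^-1%:E * A x + (K x)%:E}.
  apply: (ae_imp Mae) => x fx.
  have rx : \int[leb d]_v (r (consr x v))%:E = (M x)%:E by rewrite fineK.
  have b0 : (0 < m * normal_pdf 0 1 x)%R by nneg.
  have := kl_chain (mrv x) (fun v => r0 _) rx mphi (@phi_gt0 R d) (integral_phi d) b0.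
  rewrite /X /=; under eq_integral do rewrite -mulrA.
  move=> ->; rewrite -/(K x); case: eqVneq => [Mx|Mx].
    by rewrite add0e Mx mulr0 adde0 leeDr// mule_ge0.
  rewrite addeAC leeD2r//.
  apply: IH => //; last by rewrite lt0r Mx M0.
  exact: line_C1_tail.
have step2 : {ae leb d, forall v, \int[mu]_x (Y (x, v))%:E + (N v)%:E <=
    2^-1%:E * (\int[mu]_x (E1 (x, v))%:E + \int[mu]_x (J ord0 (x, v))%:E)}.
  apply: (ae_imp Nae) => v fv.
  have [d1 c1] := line_C1_head v rD.
  exact: (@lsi1 R (fun x => r (consr x v)) (fun x => D ord0 (consr x v)) (N v) d1 c1 (fun x => r0 _) (NEN v fv)).
(* For each x, Jensen's inequality in v compares the entropy of M(x) with those of the sections r(.,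
   v) relative to N(v) g1. *)
have step3 : \int[mu]_x (K x)%:E <= \int[mu]_x \int[leb d]_v (Y (x, v))%:E.
  apply: ge0_ae_le.
  - exact/measurable_EFinP.
  - exact: mI.
  - by move=> x; rewrite lee_fin.
  - by move=> x; exact: I0.
  - apply: (ae_imp Mae) => x fx.
    apply: (kl_jensen (mrv x) (fun v => r0 _)) => //.
    + by rewrite fineK.
    + by move=> v; exact: Nr.
    + exact: g1_gt0.
have mKE : measurable_fun setT (fun x => (K x)%:E) by exact/measurable_EFinP.
have mIX := mI _ mX X0.
have mM2 : measurable_fun setT (fun x => (d%:R * M x)%:E).
  by apply/measurable_EFinP; exact: measurable_funM.
have mhA : measurable_fun setT (fun x => (2^-1)%:E * A x) by exact: emeasurable_funM.
have hA0 x : 0 <= (2^-1)%:E * A x by rewrite mule_ge0.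
have dM0 x : 0 <= (d%:R * M x)%:E by rewrite lee_fin mulr_ge0.
have KE0 x : 0 <= (K x)%:E by rewrite lee_fin.
have h0 : (0 <= 2^-1 :> R)%R by rewrite invr_ge0.
have int1 : \int[mu]_x \int[leb d]_v (X (x, v))%:E + (d%:R * m)%:E <=
    2^-1%:E * \int[mu]_x A x + \int[mu]_x (K x)%:E.
  have : \int[mu]_x (\int[leb d]_v (X (x, v))%:E + (d%:R * M x)%:E) <=
      \int[mu]_x (2^-1%:E * A x + (K x)%:E).
    apply: (ge0_ae_le (emeasurable_funD mIX mM2) (emeasurable_funD mhA mKE)) => //.
    - by move=> x; rewrite adde_ge0 ?I0.
    - by move=> x; rewrite adde_ge0.
  rewrite (ge0_integralDe mu mIX mM2 (fun x => I0 _ x X0) dM0).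
  rewrite (ge0_integralDe mu mhA mKE hA0 KE0) (ge0_integralZe mu mA A0 h0).
  by rewrite (ge0_integralZ mu mM M0 dR0) IMr -EFinM.
have mIY := mI' _ mY Y0; have mIE1 := mI' _ mE1 E10; have mIJ := mI' _ (mJ ord0) (J0 ord0).
have NE0' v : 0 <= (N v)%:E by rewrite lee_fin.
have mNE' : measurable_fun setT (fun v => (N v)%:E) by exact/measurable_EFinP.
have mEJ := emeasurable_funD mIE1 mIJ.
have EJ0 v : 0 <= \int[mu]_x (E1 (x, v))%:E + \int[mu]_x (J ord0 (x, v))%:E.
  by rewrite adde_ge0 ?I0'.
have int2 : \int[leb d]_v \int[mu]_x (Y (x, v))%:E + m%:E <=
    2^-1%:E * (\int[leb d]_v \int[mu]_x (E1 (x, v))%:E +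
               \int[leb d]_v \int[mu]_x (J ord0 (x, v))%:E).
  have : \int[leb d]_v (\int[mu]_x (Y (x, v))%:E + (N v)%:E) <=
     \int[leb d]_v (2^-1%:E * (\int[mu]_x (E1 (x, v))%:E + \int[mu]_x (J ord0 (x, v))%:E)).
    apply: (ge0_ae_le (emeasurable_funD mIY mNE')) => //.
    - exact: emeasurable_funM.
    - by move=> v; rewrite adde_ge0 ?I0'.
    - by move=> v; rewrite mule_ge0.
  rewrite (ge0_integralDe (leb d) mIY mNE' (fun v => I0' _ v Y0) NE0') INr.
  rewrite (ge0_integralZe (leb d) mEJ EJ0 h0).
  by rewrite (ge0_integralDe (leb d) mIE1 mIJ (fun v => I0' _ v E10) (fun v => I0' _ v (J0 ord0))).
have mJl i : measurable_fun setT (fun x => \int[leb d]_v (J (lift ord0 i) (x, v))%:E).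
  exact: (mI _ (mJ _) (J0 _)).
have IA : \int[mu]_x A x = \int[mu]_x \int[leb d]_v (E2 (x, v))%:E +
    \sum_(i < d) \int[leb d.+1]_x (D (lift ord0 i) x ^+ 2 / r x)%:E.
  have mS : measurable_fun setT (fun x => \sum_(i < d) \int[leb d]_v (J (lift ord0 i) (x, v))%:E).
    by apply: emeasurable_sum => i; exact: mJl.
  rewrite (ge0_integralDe mu (mI _ mE2 E20) mS (fun x => I0 _ x E20)); last first.
    by move=> x; rewrite sume_ge0// => i _; exact: (I0 _ _ (J0 _)).
  congr (_ + _); rewrite ge0_integral_sum//=.
    apply: eq_bigr => i _; rewrite integral_lebS//; first by meas.
    by move=> x; nneg.
  by move=> i x _; exact: (I0 _ _ (J0 _)).
have mlast : measurable_fun setT (fun x : 'rV[R]_d.+1 => kl (r x) (m * phi x)).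
  by meas.
rewrite integral_lebS//; last by move=> x; apply: kl_ge0 => //; nneg.
have -> : \int[mu]_x \int[leb d]_v (kl (r (consr x v)) (m * phi (consr x v)))%:E =
   \int[mu]_x \int[leb d]_v (X (x, v))%:E.
  by apply: eq_integral => x _; apply: eq_integral => v _; rewrite /X phi_cons.
have -> : \int[leb d.+1]_x (sqn x * r x)%:E =
   \int[leb d]_v \int[mu]_x (E1 (x, v))%:E + \int[mu]_x \int[leb d]_v (E2 (x, v))%:E.
  transitivity (\int[leb d.+1]_x (x 0%R ord0 ^+ 2 * r x + (sqn x - x 0%R ord0 ^+ 2) * r x)%:E).
    by apply: eq_integral => x _; congr EFin; ring.
  have s0 (x : 'rV[R]_d.+1) : (0 <= sqn x - x 0%R ord0 ^+ 2)%R.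
    by rewrite [x]consr_eta sqn_cons consr0 addrAC subrr add0r sqn_ge0.
  rewrite ge0_integralDr//; try by [meas|move=> x; nneg].
  rewrite integral_lebSC//; [|by meas|by move=> x; nneg].
  rewrite integral_lebS//; [|by meas|by move=> x; nneg].
  congr (_ + _); apply: eq_integral => x _; apply: eq_integral => v _.
    by rewrite consr0.
  by rewrite sqn_cons consr0 addrAC subrr add0r.
rewrite big_ord_recl integral_lebSC//; [|by meas|by move=> x; nneg].
apply: (@le_trans _ _ (\int[mu]_x \int[leb d]_v (X (x, v))%:E + (d%:R * m)%:E + m%:E)).
  by rewrite -addeA -EFinD -natr1 mulrDl mul1r.
apply: (le_trans (leeD2r _ int1)).
apply: (@le_trans _ _ (2^-1%:E * \int[mu]_x A x + (\int[mu]_x \int[leb d]_v (Y (x, v))%:E + m%:E))).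
  rewrite -[leLHS]addeA; apply: leeD2l; apply: leeD2r; exact: step3.
have tonY : \int[mu]_x \int[leb d]_v (Y (x, v))%:E = \int[leb d]_v \int[mu]_x (Y (x, v))%:E.
  have mYE : measurable_fun setT (fun z : measurableTypeR R * 'rV[R]_d => (Y z)%:E) by exact/measurable_EFinP.
  have Ye0 z : 0 <= (Y z)%:E by rewrite lee_fin.
  exact: (fubini_tonelli _ mYE Ye0).
rewrite tonY; apply: (le_trans (leeD2l _ int2)).
have s1 : 0 <= \int[mu]_x A x by exact: integral_ge0.
have s2 : 0 <= \int[leb d]_v \int[mu]_x (E1 (x, v))%:E +
    \int[leb d]_v \int[mu]_x (J ord0 (x, v))%:E.
  by rewrite adde_ge0//; apply: integral_ge0 => v _; exact: I0'.
rewrite -(ge0_muleDr _ s1 s2) IA lee_wpmul2l//.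
by rewrite [leLHS]addeACA; apply: leeD; rewrite [leLHS]addeC; exact: lexx.
Qed.
End lsi.

(** * Short-time rate of the Ornstein-Uhlenbeck semigroup *)

Section fatou_lb.
Context d (T : measurableType d) (R : realType) (mu : {measure set T -> \bar R}).
Local Open Scope ereal_scope.

Lemma fatou_lb (f_ : nat -> T -> R) (f : T -> R) (L : R) :
  (forall n, measurable_fun setT (f_ n)) -> (forall n x, 0 <= f_ n x)%R ->
  measurable_fun setT f -> (forall x, 0 <= f x)%R ->
  (forall x e, (0 < e)%R -> \forall n \near \oo, (f x - e <= f_ n x)%R) ->
  L%:E <= \int[mu]_x (f x)%:E ->
  forall e, (0 < e)%R -> \forall n \near \oo, (L - e)%:E <= \int[mu]_x (f_ n x)%:E.
Proof.
move=> mf_ f_0 mf f0 lb Lf e e0.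
pose g n := fun x => (f_ n x)%:E.
have Lg : L%:E <= limn_einf (fun n => \int[mu]_x g n x).
  apply: (le_trans Lf); apply: (@le_trans _ _ (\int[mu]_x limn_einf (g ^~ x))).
    apply: ge0_le_integral => //=.
    - by move=> x _; rewrite lee_fin.
    - exact/measurable_EFinP.
    - rewrite /limn_einf; apply: measurableT_comp => //.
      by apply: measurable_fun_limn_esup => n; apply: measurableT_comp => //; exact/measurable_EFinP.
    - move=> x _; rewrite limn_einf_lim; apply/lee_subgt0Pr => a a0.
      apply: lime_ge; first exact: is_cvg_einfs.
      have [N _ HN] := lb x a a0; near=> n.
      apply: le_ereal_inf_tmp => _ [k /= nk <-]; rewrite -EFinB lee_fin.
      apply: HN => /=; apply: leq_trans nk.
      by near: n; exists N.
  apply: fatou => //=.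
  - by move=> n; exact/measurable_EFinP.
  - by move=> n x _; rewrite lee_fin.
move: Lg; rewrite limn_einf_lim (cvg_lim _ (@cvg_einfs_sup R _))// => Lg.
have /ereal_sup_gt[_ [N _ <-] LN] : (L - e)%:E < ereal_sup (range (einfs (fun n => \int[mu]_x g n x))).
  by apply: lt_le_trans Lg; rewrite lte_fin gtrBl.
exists N => // n /= Nn; apply: (le_trans (ltW LN)).
by apply: ereal_inf_lbound; exists n.
Unshelve. all: by end_near. Qed.
End fatou_lb.

(** * Gaussian smoothing at scale s *)

Section gconv.
Context {R : realType} {d : nat}.
Local Open Scope ereal_scope.
Implicit Types w : 'rV[R]_d -> R.

Lemma integral_gam_cst (c : R) : \int[gam d]_x c%:E = c%:E :> \bar R.
Proof. by rewrite integral_cst//= (_ : _ setT = 1) ?mule1//; exact: gamT. Qed.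

(** The tangent to z^p at v, written without division; it is Young's inequality for w and v^(p -
    1). *)
Lemma powR_tangent (w v p : R) : (1 < p)%R -> (0 <= w)%R -> (0 <= v)%R ->
  (p * v `^ (p - 1) * w <= w `^ p + (p - 1) * v `^ p)%R.
Proof.
move=> p1 w0 v0.
have p0 : (0 < p)%R by apply: lt_trans p1.
have p10 : (0 < p - 1)%R by rewrite subr_gt0.
have := @conjugate_powR R w (v `^ (p - 1))%R p (p / (p - 1))%R w0 (powR_ge0 _ _) p0.
rewrite divr_gt0// => /(_ isT).
have -> : (p^-1 + (p / (p - 1))^-1 = 1)%R by field; rewrite !gt_eqF.
move=> /(_ erefl); rewrite -powRrM.
have -> : ((p - 1) * (p / (p - 1)) = p)%R by field; rewrite gt_eqF.
move=> h; have := ler_wpM2l (ltW p0) h.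
have -> : (p * (w `^ p / p + v `^ p / (p / (p - 1))) = w `^ p + (p - 1) * v `^ p)%R.
  by field; rewrite !gt_eqF.
by apply: le_trans; rewrite mulrA mulrAC.
Qed.

Lemma powR_midpoint (a b p : R) : (1 < p)%R -> (0 <= a)%R -> (0 <= b)%R ->
  (((a + b) / 2) `^ p <= (a `^ p + b `^ p) / 2)%R.
Proof.
move=> p1 a0 b0; set m := ((a + b) / 2)%R.
have m0 : (0 <= m)%R by rewrite divr_ge0// addr_ge0.
have h1 := powR_tangent p1 a0 m0; have h2 := powR_tangent p1 b0 m0.
have h3 : (m * m `^ (p - 1) = m `^ p)%R by rewrite mulr_powRB1// (lt_trans _ p1).
have h4 : (a = 2 * m - b)%R by rewrite /m; field.
rewrite ler_pdivlMr//; move: h1; rewrite {1}h4 => h1.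
have : (p * m `^ (p - 1) * (2 * m - b) = 2 * p * (m * m `^ (p - 1)) - p * m `^ (p - 1) * b)%R by ring.
by rewrite h3 => h5; rewrite h5 in h1; lra.
Qed.

Lemma gam_jensen_powR w (v p : R) : (1 < p)%R -> measurable_fun setT w ->
  (forall x, 0 <= w x)%R -> \int[gam d]_x (w x)%:E = v%:E ->
  (v `^ p)%:E <= \int[gam d]_x (w x `^ p)%:E.
Proof.
move=> p1 mw w0 wv.
have v0 : (0 <= v)%R by rewrite -lee_fin -wv ge0_integral_real_ge0.
have p0 : (0 < p)%R by apply: lt_trans p1.
have p10 : (0 < p - 1)%R by rewrite subr_gt0.
have key x := powR_tangent p1 (w0 x) v0.
have : \int[gam d]_x (p * v `^ (p - 1) * w x)%:E <=
       \int[gam d]_x (w x `^ p + (p - 1) * v `^ p)%:E.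
  apply: ge0_le_integralr => //; try by meas.
  by move=> x; rewrite !mulr_ge0 ?powR_ge0// ltW.
rewrite ge0_integralZ//; last by rewrite mulr_ge0 ?powR_ge0// ltW.
rewrite ge0_integralDr//; [|by meas|by move=> x; nneg|by move=> x; nneg].
rewrite integral_gam_cst wv -EFinM -mulrA (mulrC _ v) mulr_powRB1//.
rewrite -leeBlDr// -EFinB; apply: le_trans.
by rewrite lee_fin; lra.
Qed.

Lemma gam_opp (F : 'rV[R]_d -> \bar R) : measurable_fun setT F -> (forall x, 0 <= F x) ->
  \int[gam d]_x F (- x)%R = \int[gam d]_x F x.
Proof.
move=> mF F0.
have mN : measurable_fun setT (fun x : 'rV[R]_d => (- x)%R).
  have -> : (fun x : 'rV[R]_d => (- x)%R) = (fun x => (- 1)%R *: x)%R by apply/funext => x; rewrite scaleN1r.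
  exact: measurable_rowZ.
have mF' : measurable_fun setT (fun x : 'rV[R]_d => F (- x)%R).
  exact: (measurableT_comp mF mN).
rewrite ge0_integral_gam// [RHS]ge0_integral_gam//.
rewrite -[RHS]ge0_leb_opp; last 2 first.
- by apply: emeasurable_funM => //; apply/measurable_EFinP; exact: measurable_phi.
- by move=> x; rewrite mule_ge0// lee_fin phi_ge0.
have e (x : 'rV[R]_d) : phi (- x)%R = phi x.
  suff e : sqn (- x)%R = sqn x by rewrite !phiE e.
  by rewrite /sqn; apply: eq_bigr => i _; rewrite mxE sqrrN.
by apply: eq_integral => x _; rewrite e.
Qed.

(** Positive part of x ln x, so that its integral makes sense in any case; convex and nondecreasing
    for x >= 0. *)
Definition lnp (x : R) : R := (x * Num.max (ln x) 0)%R.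

Lemma lnp_ge0 x : (0 <= x)%R -> (0 <= lnp x)%R.
Proof. by move=> x0; rewrite mulr_ge0// le_max lexx orbT. Qed.

Lemma measurable_lnp d' (T : measurableType d') (f : T -> R) :
  measurable_fun setT f -> measurable_fun setT (fun x => lnp (f x)).
Proof. by move=> mf; rewrite /lnp; meas. Qed.

(** For c > 1 the tangent to x ln x at c, which is [kl_ge0], lies below [lnp]; for c <= 1 the left
    side is 0. *)
Lemma gam_jensen_lnp w (c : R) : measurable_fun setT w ->
  (forall x, 0 <= w x)%R -> \int[gam d]_x (w x)%:E = c%:E ->
  (lnp c)%:E <= \int[gam d]_x (lnp (w x))%:E.
Proof.
move=> mw w0 wc.
have c0 : (0 <= c)%R by rewrite -lee_fin -wc ge0_integral_real_ge0.
have l0 x : (0 <= lnp (w x))%R by exact: lnp_ge0.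
have [c1|c1] := leP c 1%R.
  by rewrite /lnp max_r ?mulr0 ?ge0_integral_real_ge0// ln_le0.
have lc0 : (0 <= ln c)%R by rewrite ln_ge0// ltW.
have cgt : (0 < c)%R by apply: lt_trans c1.
rewrite {1}/lnp max_l//.
have key x : ((ln c + 1) * w x <= lnp (w x) + c)%R.
  have := kl_ge0 (w0 x) cgt; rewrite klE//.
  have : (w x * ln (w x) <= lnp (w x))%R by rewrite ler_wpM2l// le_max lexx.
  lra.
have : \int[gam d]_x ((ln c + 1) * w x)%:E <= \int[gam d]_x (lnp (w x) + c)%:E.
  apply: ge0_le_integralr => //.
  - by meas.
  - by apply: measurable_funD => //; exact: measurable_lnp.
  - by move=> x; rewrite mulr_ge0// addr_ge0.
rewrite ge0_integralZ//; last by rewrite addr_ge0.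
rewrite ge0_integralDr//; [|exact: measurable_lnp].
rewrite integral_gam_cst wc -EFinM -leeBlDr// -EFinB; apply: le_trans.
by rewrite lee_fin; lra.
Qed.

Definition gconv (s : R) w (x : 'rV[R]_d) : R := fine (\int[gam d]_y (w (x + s *: y)%R)%:E).

Lemma gconv_ge0 s w x : (forall x, 0 <= w x)%R -> (0 <= gconv s w x)%R.
Proof. by move=> w0; rewrite fine_ge0// ge0_integral_real_ge0. Qed.

Lemma measurable_gconvE s w : measurable_fun setT w -> (forall x, 0 <= w x)%R ->
  measurable_fun setT (fun x : 'rV[R]_d => \int[gam d]_y (w (x + s *: y)%R)%:E).
Proof.
move=> mw w0.
apply: (@measurable_fun_fubini_tonelli_F _ _ _ _ R (gam d) (fun z : 'rV[R]_d * 'rV[R]_d => (w (z.1 + s *: z.2)%R)%:E)).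
  by meas.
by move=> z; rewrite lee_fin.
Qed.

Lemma measurable_gconv s w : measurable_fun setT w -> (forall x, 0 <= w x)%R ->
  measurable_fun setT (gconv s w).
Proof. by move=> mw w0; apply: measurableT_comp => //; exact: measurable_gconvE. Qed.

Lemma leb_shift (a : 'rV[R]_d) w : measurable_fun setT w -> (forall x, 0 <= w x)%R ->
  \int[leb d]_x (w (x + a)%R)%:E = \int[leb d]_x (w x)%:E.
Proof.
move=> mw w0.
have mwE : measurable_fun setT (fun x => (w x)%:E) by exact/measurable_EFinP.
have := ge0_leb_affine a (@ltr01 R) mwE (fun x => w0 x : 0 <= (w x)%:E).
by rewrite expr1n mul1e => <-; apply: eq_integral => x _; rewrite scale1r.
Qed.

Lemma leb_scale (s : R) (a : 'rV[R]_d) w : (0 < s)%R -> measurable_fun setT w ->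
  (forall x, 0 <= w x)%R ->
  \int[leb d]_x (w (a + s *: x)%R)%:E = (s ^- d)%:E * \int[leb d]_x (w x)%:E.
Proof.
move=> s0 mw w0.
have mwE : measurable_fun setT (fun x => (w x)%:E) by exact/measurable_EFinP.
rewrite -(ge0_leb_affine a s0 mwE (fun x => w0 x : 0 <= (w x)%:E)).
rewrite muleA -EFinM mulVf ?mul1e ?expf_neq0 ?gt_eqF//.
by apply: eq_integral => x _; rewrite addrC.
Qed.

Section bounds.
Variables (w : 'rV[R]_d -> R) (W s : R).
Hypotheses (mw : measurable_fun setT w) (w0 : forall x, (0 <= w x)%R)
  (wW : \int[leb d]_x (w x)%:E = W%:E) (s0 : (0 < s)%R).

(** A crude bound by phi <= [Kd d]. Its growth s^-d will matter only through a logarithm multiplied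
    by a quantity of order s^2. *)
Lemma gconvE_le x : \int[gam d]_y (w (x + s *: y)%R)%:E <= (Kd d * s ^- d * W)%:E.
Proof.
have m1 : measurable_fun setT (fun y : 'rV[R]_d => w (x + s *: y)%R) by meas.
rewrite ge0_integral_gam; last 2 first.
- exact/measurable_EFinP.
- by move=> y; rewrite lee_fin.
apply: (@le_trans _ _ (\int[leb d]_y (Kd d * w (x + s *: y)%R)%:E)).
  under eq_integral do rewrite -EFinM.
  apply: ge0_le_integralr; try by meas.
  - by move=> y; nneg.
  - by move=> y; rewrite mulrC ler_wpM2r// phi_le.
rewrite ge0_integralZ//; last by nneg.
by rewrite leb_scale// wW -!EFinM mulrA.
Qed.

Lemma gconvK x : (gconv s w x)%:E = \int[gam d]_y (w (x + s *: y)%R)%:E.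
Proof.
rewrite fineK// ge0_fin_numE ?ge0_integral_real_ge0//.
by rewrite (le_lt_trans (gconvE_le x))// ltry.
Qed.

Lemma gconv_le x : (gconv s w x <= Kd d * s ^- d * W)%R.
Proof. by rewrite -lee_fin gconvK gconvE_le. Qed.

Lemma integral_gconv : \int[leb d]_x (gconv s w x)%:E = W%:E.
Proof.
under eq_integral do rewrite gconvK.
have mw2 : measurable_fun setT (fun z : 'rV[R]_d * 'rV[R]_d => (w (z.1 + s *: z.2)%R)%:E) by meas.
rewrite (fubini_tonelli _ mw2) /=; last by move=> z; rewrite lee_fin.
under eq_integral do rewrite leb_shift// wW.
exact: integral_gam_cst.
Qed.
End bounds.
End gconv.

(** * The Jensen gap of a power, to second order *)

Section gap.
Context {R : realType}.
Implicit Types p t y : R.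

Lemma sinh_ge y : 0 <= y -> 2 * y <= expR y - expR (- y).
Proof.
move=> y0.
have dF (x : R) : is_derive x 1 (fun z : R => expR z - expR (- z)) (expR x + expR (- x)).
  have dN : is_derive x 1 (expR \o -%R) (expR (- x) * -1).
    apply: is_derive1_comp; exact: is_deriveNid.
  by apply: (is_derive_eq (is_deriveB (is_derive_expR x) dN)); rewrite mulrN1 opprK.
have [|c _] := @MVT_segment R _ _ 0 y y0 (fun x _ => dF x).
  by apply: continuous_subspaceT; exact: continuous_is_derive dF.
rewrite oppr0 expR0 subrr !subr0 => ->.
by have := expR_ge1Dx c; have := expR_ge1Dx (- c); nra.
Qed.

(** The difference e^y + e^-y - 2 is the square of e^(y/2) - e^(-y/2), which is at least y for y >=
    0 by [sinh_ge]. *)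
Lemma cosh_ge y : 2 + y ^+ 2 <= expR y + expR (- y).
Proof.
wlog y0 : y / 0 <= y.
  move=> H; have [|/ltW y0] := leP 0 y; first exact: H.
  have := H (- y); rewrite oppr_ge0 sqrrN opprK [expR (- y) + _]addrC; exact.
have := sinh_ge (divr_ge0 y0 (ler0n R 2)) => h.
have e1 : expR y = expR (y / 2) ^+ 2 by rewrite -expRM_natl; congr expR; lra.
have e2 : expR (- y) = expR (- (y / 2)) ^+ 2 by rewrite -expRM_natl; congr expR; lra.
have e3 : expR (y / 2) * expR (- (y / 2)) = 1 by rewrite -expRD subrr expR0.
rewrite e1 e2; nra.
Qed.

(** The factor of t^2 tends to p (p - 1) / 2 as t -> 0. With X = ln (1 + t) and Y = ln (1 - t), the
    mean of the two powers is e^(p (X + Y) / 2) cosh (p (X - Y) / 2); the first factor is bounded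
    below by 1 + x <= e^x, the second by [cosh_ge]. The bound is explicit on the whole of [0, 1[,
    which replaces a Taylor expansion. *)
Lemma powR_midpoint_gap p t : 1 < p -> 0 <= t < 1 ->
  t ^+ 2 * (2^-1 * p ^+ 2 / (1 + t) ^+ 2 - p / 2 / (1 - t ^+ 2)
    - p ^+ 3 / 4 * t ^+ 2 / ((1 - t ^+ 2) * (1 + t) ^+ 2))
  <= ((1 + t) `^ p + (1 - t) `^ p) / 2 - 1.
Proof.
move=> p1 /andP[t0 t1]; have p0 : 0 < p by apply: lt_trans p1.
have t2 : 0 < 1 - t by rewrite subr_gt0.
have t3 : 0 < 1 + t by rewrite ltr_pwDl.
have t4 : 0 < 1 - t ^+ 2 by nra.
set X := ln (1 + t); set Y := ln (1 - t).
have XY : X + Y = ln (1 - t ^+ 2).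
  by rewrite -lnM ?posrE//; congr ln; ring.
have lnlb (z : R) : 0 < z -> 1 - z^-1 <= ln z.
  move=> z0; have := @ln_le_sub1 R z^-1; rewrite invr_gt0 => /(_ z0).
  by rewrite lnV//; lra.
have hge : t / (1 + t) <= (X - Y) / 2.
  have := lnlb _ t3; have := ln_le_sub1 t2; rewrite -/X -/Y => h1 h2.
  have e : 1 - (1 + t)^-1 = t / (1 + t) by field; rewrite gt_eqF.
  have : t / (1 + t) <= t by rewrite ler_pdivrMr//; nra.
  by rewrite e in h2; lra.
have eE : ((1 + t) `^ p + (1 - t) `^ p) / 2 =
    expR (p / 2 * (X + Y)) * ((expR (p * ((X - Y) / 2)) + expR (- (p * ((X - Y) / 2)))) / 2).
  rewrite /powR !gt_eqF// -/X -/Y mulrA mulrDr -!expRD.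
  by congr ((expR _ + expR _) / 2); field.
rewrite eE.
set H := p * ((X - Y) / 2).
have Hge : p ^+ 2 * t ^+ 2 / (1 + t) ^+ 2 <= H ^+ 2.
  have -> : p ^+ 2 * t ^+ 2 / (1 + t) ^+ 2 = (p * (t / (1 + t))) ^+ 2 by field; rewrite gt_eqF.
  rewrite ler_sqr ?nnegrE; last 2 first.
  - by nneg.
  - rewrite /H mulr_ge0 ?(ltW p0)//; apply: le_trans hge; nneg.
  by rewrite ler_wpM2l// ltW.
have c := cosh_ge H.
have el : 1 - p / 2 * (t ^+ 2 / (1 - t ^+ 2)) <= expR (p / 2 * (X + Y)).
  apply: le_trans (expR_ge1Dx _); rewrite XY lerD2l -mulrN ler_wpM2l//; first by nneg.
  have := lnlb _ t4.
  have -> : - (t ^+ 2 / (1 - t ^+ 2)) = 1 - (1 - t ^+ 2)^-1 by field; rewrite gt_eqF.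
  exact.
set K := p ^+ 2 * t ^+ 2 / (1 + t) ^+ 2 in Hge.
have K0 : 0 <= K by rewrite /K; nneg.
have step : (1 - p / 2 * (t ^+ 2 / (1 - t ^+ 2))) * (1 + K / 2) <=
   expR (p / 2 * (X + Y)) * ((expR H + expR (- H)) / 2).
  apply: (@le_trans _ _ (expR (p / 2 * (X + Y)) * (1 + K / 2))).
    by rewrite ler_wpM2r//; nneg.
  by rewrite ler_wpM2l ?expR_ge0//; lra.
apply: le_trans (lerB step (lexx 1)).
rewrite /K le_eqVlt; apply/orP; left; apply/eqP; field.
by rewrite !gt_eqF.
Qed.

Lemma cvg_seq_filter (F : R -> R) (s : R^nat) (a l : R) :
  F x @[x --> a^'] --> l -> (forall n, s n != a) -> s @ \oo --> a ->
  F (s n) @[n --> \oo] --> l.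
Proof.
move=> cF sa cs; apply: cvg_trans cF.
move=> A /= [e /= e0 eA]; have /cvgrPdist_lt/(_ e e0) := cs.
by apply: filterS => n /= h; apply: eA.
Qed.

Lemma is_derive_seq (F : R -> R) (a f1 : R) (s : R^nat) : is_derive a 1 F f1 ->
  (forall n, s n != 0) -> s @ \oo --> 0 ->
  (F (a + s n) - F a) / s n @[n --> \oo] --> f1.
Proof.
move=> [dF <-] s0 cs.
have : (h^-1 *: (F (h *: 1 + a) - F a)) @[h --> (0:R)^'] --> 'D_1 F a by exact: dF.
move=> /cvg_seq_filter /(_ s0 cs).
apply: cvg_trans; apply: near_eq_cvg; near=> n.
by rewrite /GRing.scale/= mulr1 (addrC (s n)) mulrC.
Unshelve. all: by end_near. Qed.

Lemma is_derive_powR (A : R -> R) (x a1 p : R) : 0 < A x -> is_derive x 1 A a1 ->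
  is_derive x 1 (fun s => A s `^ p) (p * A x `^ (p - 1) * a1).
Proof.
move=> A0 dA; have := @is_derive1_powR R p (A x) A0 => dp.
exact: (@is_derive1_comp R (fun z => z `^ p) A x _ _ dp dA).
Qed.

(** With F = A^(1/p) and m the mean of F(s) and F(-s), the gap is m^p (((1 + tau)^p + (1 - tau)^p) /
    2 - 1), where tau = |F(s) - F(-s)| / (F(s) + F(-s)) ~ s |F'(0)| / F(0). By [powR_midpoint_gap]
    the lower limit is F^p (F'/F)^2 p (p - 1) / 2, and F'/F = A' / (p A) turns this into (p - 1) /
    (2p) A'^2 / A. Pairing s with -s removes the second order term of A, so that a single derivative
    at 0 is enough. *)
Lemma gap_liminf (A : R -> R) (a1 p : R) (s : R^nat) : 1 < p -> (forall x, 0 <= A x) ->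
  0 < A 0 -> is_derive (0 : R) 1 A a1 -> (forall n, 0 < s n) -> s @ \oo --> 0 ->
  forall e, 0 < e -> \forall n \near \oo,
    2^-1 * ((p - 1) / p) * (a1 ^+ 2 / A 0) - e <=
    ((A (s n) + A (- s n)) / 2 - ((A (s n) `^ p^-1 + A (- s n) `^ p^-1) / 2) `^ p) / s n ^+ 2.
Proof.
move=> p1 A0 A00 dA s0 cs e e0.
have p0 : 0 < p by apply: lt_trans p1.
have pn : p != 0 by rewrite gt_eqF.
pose F x := A x `^ p^-1; set f1 := p^-1 * A 0 `^ (p^-1 - 1) * a1.
have dF : is_derive (0 : R) 1 F f1 by exact: is_derive_powR.
have F00 : 0 < F 0 by exact: powR_gt0.
have sn0 n : s n != 0 by rewrite gt_eqF.
have snN0 n : - s n != 0 by rewrite oppr_eq0.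
have csN : (fun n => - s n) @ \oo --> (0 : R) by rewrite -oppr0; exact: cvgN.
have d1 : (F (s n) - F 0) / s n @[n --> \oo] --> f1.
  by have := is_derive_seq dF sn0 cs; under eq_fun do rewrite add0r.
have d2 : (F (- s n) - F 0) / - s n @[n --> \oo] --> f1.
  by have := is_derive_seq dF snN0 csN; under eq_fun do rewrite add0r.
have cF : {for 0, continuous F}.
  by apply/differentiable_continuous/derivable1_diffP; case: dF.
pose a n := F (s n); pose b n := F (- s n).
have ca : a @ \oo --> F 0 by exact: (cvg_comp _ _ cs cF).
have cb : b @ \oo --> F 0 by exact: (cvg_comp _ _ csN cF).
pose m n := (a n + b n) / 2.
pose th n := (a n - b n) / s n / (a n + b n).
have cab : (a n + b n) @[n --> \oo] --> F 0 + F 0 by exact: cvgD.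
have cm : m @ \oo --> F 0.
  rewrite (_ : F 0 = (F 0 + F 0) / 2); last by field.
  by apply: cvgM => //; exact: cvg_cst.
have F2 : F 0 + F 0 != 0 by rewrite gt_eqF// addr_gt0.
have cth : th @ \oo --> f1 / F 0.
  rewrite (_ : f1 / F 0 = (f1 + f1) / (F 0 + F 0)); last first.
    by field; rewrite F2 gt_eqF.
  apply: cvgM; last exact: cvgV.
  have -> : (fun n => (a n - b n) / s n) = (fun n => (F (s n) - F 0) / s n) \+ (fun n => (F (- s n) - F 0) / - s n).
    by apply/funext => n /=; rewrite /a /b; field; rewrite sn0.
  exact: cvgD d1 d2.
pose tau n := `|s n * th n|.
have ctau : tau @ \oo --> (0 : R).
  have h := cvg_norm (cvgM cs cth).
  by move: h; rewrite mul0r normr0; exact.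
have ctau2 : tau n ^+ 2 @[n --> \oo] --> (0 : R).
  by rewrite -[X in _ --> X](expr0n R 2); exact: (cvg_comp _ _ ctau (@exprn_continuous _ 2 _)).
pose c (t : R) := 2^-1 * p ^+ 2 / (1 + t) ^+ 2 - p / 2 / (1 - t ^+ 2)
    - p ^+ 3 / 4 * t ^+ 2 / ((1 - t ^+ 2) * (1 + t) ^+ 2).
have c1 : (1 + tau n) ^+ 2 @[n --> \oo] --> ((1 + 0) ^+ 2 : R).
  apply: (cvg_comp (fun n => 1 + tau n) (fun z => z ^+ 2) _ (@exprn_continuous _ 2 _)).
  by apply: cvgD => //; exact: cvg_cst.
have c2 : (1 - tau n ^+ 2) @[n --> \oo] --> (1 - 0 : R).
  by apply: cvgB => //; exact: cvg_cst.
have cc : c (tau n) @[n --> \oo] --> 2^-1 * p * (p - 1).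
  rewrite (_ : 2^-1 * p * (p - 1) = 2^-1 * p ^+ 2 / (1 + 0) ^+ 2 - p / 2 / (1 - 0)
    - p ^+ 3 / 4 * 0 / ((1 - 0) * (1 + 0) ^+ 2)); last by field.
  apply: cvgB; last first.
    apply: cvgM; first by apply: cvgM => //; exact: cvg_cst.
    apply: cvgV; first by rewrite addr0 subr0 expr1n mulr1 oner_neq0.
    exact: cvgM.
  apply: cvgB; apply: cvgM; try exact: cvg_cst.
  - by apply: cvgV => //; rewrite addr0 expr1n oner_neq0.
  - by apply: cvgV => //; rewrite subr0 oner_neq0.
pose E n := m n `^ p * th n ^+ 2 * c (tau n).
have cE : E @ \oo --> 2^-1 * ((p - 1) / p) * (a1 ^+ 2 / A 0).
  rewrite (_ : 2^-1 * ((p - 1) / p) * (a1 ^+ 2 / A 0) =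
     F 0 `^ p * (f1 / F 0) ^+ 2 * (2^-1 * p * (p - 1))); last first.
    rewrite /F -powRrM mulVf// powRr1// /f1 powRD; last by apply/implyP => _; rewrite gt_eqF.
    rewrite powR_inv1 ?(ltW A00)//; field.
    by rewrite pn !gt_eqF// powR_gt0.
  have cmp : m n `^ p @[n --> \oo] --> F 0 `^ p.
    have dp := @is_derive1_powR R p (F 0) F00.
    have cp : {for F 0, continuous (fun z : R => z `^ p)}.
      by apply/differentiable_continuous/derivable1_diffP; case: dp.
    exact: (cvg_comp m (fun z => z `^ p) cm cp).
  have cth2 : th n ^+ 2 @[n --> \oo] --> (f1 / F 0) ^+ 2.
    exact: (cvg_comp _ _ cth (@exprn_continuous _ 2 _)).
  have h : m n `^ p * th n ^+ 2 @[n --> \oo] --> F 0 `^ p * (f1 / F 0) ^+ 2 by exact: cvgM.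
  exact: (cvgM h cc).
have apos : \forall n \near \oo, 0 < a n by apply: (cvgr_gt (F 0)).
have bpos : \forall n \near \oo, 0 < b n by apply: (cvgr_gt (F 0)).
have /cvgrPdist_le/(_ e e0) cEe := cE.
near=> n.
have an : 0 < a n by near: n.
have bn : 0 < b n by near: n.
have En : `|2^-1 * ((p - 1) / p) * (a1 ^+ 2 / A 0) - E n| <= e by near: n.
move: En; rewrite ler_distlC => /andP[En _].
apply: (le_trans En).
have ab0 : 0 < a n + b n by rewrite addr_gt0.
have mn : 0 < m n by rewrite /m divr_gt0.
have sE : s n * th n = (a n - b n) / (a n + b n).
  by rewrite /th; field; rewrite sn0 gt_eqF.
have t1 : tau n < 1.
  rewrite /tau sE normrM normfV (gtr0_norm ab0) ltr_pdivrMr// mul1r ltr_norml; lra.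
have t0 : 0 <= tau n by rewrite /tau.
have g := @powR_midpoint_gap p (tau n) p1.
rewrite t0 t1 in g; have {}g := g isT.
rewrite ler_pdivlMr ?exprn_gt0//.
have -> : E n * s n ^+ 2 = m n `^ p * (tau n ^+ 2 * c (tau n)).
  have tq : tau n ^+ 2 = s n ^+ 2 * th n ^+ 2 by rewrite /tau real_normK ?num_real// exprMn.
  by rewrite tq /E; move: (c (tau n)) => C; ring.
have -> : (A (s n) + A (- s n)) / 2 - ((F (s n) + F (- s n)) / 2) `^ p =
   m n `^ p * (((1 + tau n) `^ p + (1 - tau n) `^ p) / 2 - 1).
  have mp : (F (s n) + F (- s n)) / 2 = m n by [].
  have Ap x : A x = F x `^ p by rewrite /F -powRrM mulVf// powRr1.
  rewrite mp !Ap -/(a n) -/(b n).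
  have sym : (1 + tau n) `^ p + (1 - tau n) `^ p =
     (1 + s n * th n) `^ p + (1 - s n * th n) `^ p.
    rewrite /tau; have [_|_] := ger0P (s n * th n); first by [].
    by rewrite opprK addrC.
  rewrite sym.
  have ea : a n = m n * (1 + s n * th n) by rewrite sE /m; field; rewrite gt_eqF.
  have eb : b n = m n * (1 - s n * th n) by rewrite sE /m; field; rewrite gt_eqF.
  have pa : 0 <= 1 + s n * th n by rewrite -(pmulr_rge0 _ mn) -ea ltW.
  have pb : 0 <= 1 - s n * th n by rewrite -(pmulr_rge0 _ mn) -eb ltW.
  have ap : a n `^ p = m n `^ p * (1 + s n * th n) `^ p by rewrite {1}ea powRM ?(ltW mn).
  have bp : b n `^ p = m n `^ p * (1 - s n * th n) `^ p by rewrite {1}eb powRM ?(ltW mn).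
  by rewrite ap bp; field.
by rewrite ler_wpM2l ?powR_ge0.
Unshelve. all: by end_near. Qed.
End gap.

(** * Pointwise convergence of Gaussian smoothing *)

Section approx_id.
Context {R : realType} {d : nat}.
Variables (w : 'rV[R]_d -> R) (W : R) (s : R^nat).
Hypotheses (mw : measurable_fun setT w) (w0 : forall x, 0 <= w x)
  (s0 : forall n, 0 < s n) (cs : s @ \oo --> 0).
Local Open Scope ereal_scope.

Lemma cvg_shift_row (x y : 'rV[R]_d) : {for x, continuous w} ->
  w (x + s n *: y)%R @[n --> \oo] --> w x.
Proof.
move=> cw; apply: (cvg_comp (fun n => x + s n *: y)%R w); last exact: cw.
have h : (s n *: y @[n --> \oo] --> 0 *: y)%R by apply: cvgZl.
by rewrite scale0r in h; have := cvgD (cvg_cst x) h; rewrite addr0; exact.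
Qed.

Lemma approx_id_lb x e : {for x, continuous w} -> (0 < e)%R -> \forall n \near \oo,
  (w x - e)%:E <= \int[gam d]_y (w (x + s n *: y)%R)%:E.
Proof.
move=> cw; move: e; apply: (fatou_lb (f := cst (w x))) => //.

- by move=> n; meas.
- by move=> y; exact: w0.
- by move=> y e e0; have /cvgrPdist_le/(_ e e0) := cvg_shift_row y cw;
     apply: filterS => n; rewrite ler_distlC => /andP[].
- by rewrite integral_gam_cst.
Qed.

Hypothesis wW : \int[leb d]_x (w x)%:E = W%:E.

(** Fatou's lemma gives no upper bound, so the tail is estimated. In the cube where every |s y_i| <
    r/2 continuity applies; outside it phi <= Kd e^-z with z = r^2 / (8 s^2), while w contributes at
    most s^-d W. From e^-z <= (d + 1)! / z^(d + 1) the tail is at most C s^(d + 2). *)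
Lemma approx_id_ub x e : {for x, continuous w} -> (0 < e)%R -> \forall n \near \oo, (gconv (s n) w x <= w x + e)%R.
Proof.
move=> cw e0; have e2 : (0 < e / 2)%R by rewrite divr_gt0.
have W0 : (0 <= W)%R by rewrite -lee_fin -wW ge0_integral_real_ge0.
have /cvgrPdist_le/(_ _ e2) := cw; rewrite near_simpl => /nbhs_ballP[r /= r0 xr].
pose C : R := (Kd d * (d.+1)`!%:R * (8 / r ^+ 2) ^+ d.+1 * W)%R.
have C0 : (0 <= C)%R by rewrite /C; do 2 nneg; rewrite exprn_ge0//; nneg.
have C1 : (0 < C + 1)%R by rewrite ltr_wpDl.
have sC : \forall n \near \oo, (s n < e / 2 / (C + 1))%R.
  by apply: (cvgr_lt (0:R)) => //; rewrite !divr_gt0.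
have s1 : \forall n \near \oo, (s n < 1)%R by exact: (cvgr_lt (0:R)).
near=> n.
have sn := s0 n.
have sn1 : (s n < 1)%R by near: n.
have snC : (s n < e / 2 / (C + 1))%R by near: n.
rewrite -lee_fin (gconvK mw w0 wW sn).
set z := ((r / 2) ^+ 2 / (2 * s n ^+ 2))%R.
have z0 : (0 < z)%R by rewrite /z divr_gt0 ?exprn_gt0 ?mulr_gt0 ?divr_gt0 ?exprn_gt0.
have m1 : measurable_fun setT (fun y : 'rV[R]_d => w (x + s n *: y)%R) by meas.
rewrite ge0_integral_gam; last 2 first.
- exact/measurable_EFinP.
- by move=> y; rewrite lee_fin.
apply: (@le_trans _ _ (\int[leb d]_y ((w x + e / 2) * phi y + Kd d * expR (- z) * w (x + s n *: y))%R%:E)).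
  under eq_integral do rewrite -EFinM.
  have wx := w0 x.
  apply: ge0_le_integralr; try by meas.
    by move=> y; nneg.
  move=> y.
  have [yr|yr] := boolP [forall i, `|y 0%R i| < r / (2 * s n)]%R.
    have bt : ball x r (x + s n *: y)%R.
      rewrite /ball/= /mx_ball; split=> // i j; rewrite !ord1 /ball/= !mxE opprD addNKr normrN normrM.
      rewrite gtr0_norm//; move/forallP : yr => /(_ j).
      rewrite ltr_pdivlMr ?mulr_gt0// => h.
      by have := normr_ge0 (y 0%R j); nra.
    have := xr _ bt; rewrite /= ler_distl => /andP[h _].
    have h0 : (w (x + s n *: y) <= w x + e / 2)%R by lra.
    have h1 := ler_wpM2r (phi_ge0 y) h0.
    have h2 : (0 <= Kd d * expR (- z) * w (x + s n *: y))%R by nneg.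
    by lra.
  have h1 : (0 <= (w x + e / 2) * phi y)%R by apply: mulr_ge0; [lra|exact: phi_ge0].
  suff h2 : (phi y <= Kd d * expR (- z))%R by have := ler_wpM2r (w0 (x + s n *: y)%R) h2; lra.
  rewrite phiE ler_wpM2l ?(ltW (Kd_gt0 d))// ler_expR.
  move: yr => /forallPn[i]; rewrite -leNgt => yi.
  have : (y 0%R i ^+ 2 <= sqn y)%R.
    by rewrite /sqn (bigD1 i)//= lerDl sumr_ge0// => j _; exact: sqr_ge0.
  have : ((r / (2 * s n)) ^+ 2 <= y 0%R i ^+ 2)%R.
    rewrite -[leRHS]real_normK ?num_real// ler_sqr ?nnegrE//.
    by rewrite ltW// divr_gt0// mulr_gt0.
  have -> : ((r / (2 * s n)) ^+ 2 = 2 * z)%R by rewrite /z; field; rewrite gt_eqF.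
  by lra.
have wxe : (0 <= w x + e / 2)%R by rewrite addr_ge0// ltW.
rewrite ge0_integralDr//; [|by meas|by meas|by move=> y; nneg|by move=> y; nneg].
rewrite ge0_integralZ//; [|exact: measurable_phi|by move=> y; exact: phi_ge0].
rewrite integral_phi mule1 ge0_integralZ//; last by nneg.
rewrite leb_scale// wW -!EFinM -EFinD lee_fin.
suff : (Kd d * expR (- z) * (s n ^- d * W) <= e / 2)%R by lra.
have ez : (expR (- z) <= (d.+1)`!%:R / z ^+ d.+1)%R.
  rewrite expRN -[leRHS]invrK invf_div lef_pV2 ?posrE ?expR_gt0 ?divr_gt0 ?exprn_gt0// ?ltr0n ?fact_gt0//.
  by have := expR_ge1Dxn d (ltW z0); apply: le_trans; rewrite lerDr.
apply: (@le_trans _ _ (Kd d * ((d.+1)`!%:R / z ^+ d.+1) * (s n ^- d * W))%R).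
  rewrite ler_wpM2r//; first by rewrite mulr_ge0// invr_ge0 exprn_ge0// ltW.
  by rewrite ler_wpM2l// ltW// Kd_gt0.
have -> : (Kd d * ((d.+1)`!%:R / z ^+ d.+1) * (s n ^- d * W) = C * s n ^+ d * s n ^+ 2)%R.
  have zV : (z^-1 = 8 / r ^+ 2 * s n ^+ 2)%R by rewrite /z; field; rewrite !gt_eqF.
  have sE : ((s n ^+ 2) ^+ d.+1 = s n ^+ d * s n ^+ d * s n ^+ 2)%R.
    by rewrite -exprM -!exprD; congr (_ ^+ _)%R; rewrite mul2n -addnn addSn addnS addn2.
  have sd : (s n ^+ d != 0)%R by rewrite expf_neq0 ?gt_eqF.
  rewrite -exprVn zV [X in (_ * (_ * X) * _)%R]exprMn sE /C.
  move: ((8 / r ^+ 2) ^+ d.+1)%R (s n ^+ d)%R sd => A B B0.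
  by field.
apply: (@le_trans _ _ (C * s n)%R).
  rewrite -mulrA ler_wpM2l// expr2 mulrA ler_piMl ?(ltW sn)//.
  by rewrite mulr_ile1 ?exprn_ge0 ?(ltW sn)// ?(ltW sn1)// exprn_ile1 ?(ltW sn)// (ltW sn1).
apply: (@le_trans _ _ ((C + 1) * s n)%R); first by rewrite ler_wpM2r ?(ltW sn)// lerDl.
by rewrite mulrC -ler_pdivlMr// ltW.
Unshelve. all: by end_near. Qed.
End approx_id.

(** * Second moments of Gaussian linear forms *)

Section gaussian_quadratic.
Context {R : realType}.
Local Open Scope ereal_scope.
Local Notation mu := (@lebesgue_measure R).
Local Notation g1 := (normal_pdf (0 : R) 1).
Local Notation N01 := (normal_prob (0 : R) 1).

(** The logarithmic Sobolev inequality for g1 itself: the entropy is nonnegative, the mass is 1, and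
    both terms on the right equal the second moment. *)
Lemma normal_second_moment_ge1 : 1 <= \int[N01]_x (x ^+ 2)%:E.
Proof.
have mg : measurable_fun setT g1 by exact: measurable_normal_pdf.
have dg (x : R) := is_derive_normal_pdf x.
have cg : continuous g1 by exact: continuous_is_derive dg.
have cd : continuous (fun x : R => (- x * g1 x)%R).
  by move=> x; apply: cvgM; [exact: cvgN|exact: cg].
have g0 (x : R) : (0 <= g1 x)%R by exact: ltW (g1_gt0 x).
have := lsi1 dg cd g0 (integral_normal_pdf 0 1).
have -> : \int[mu]_x ((- x * g1 x) ^+ 2 / g1 x)%:E = \int[mu]_x (x ^+ 2 * g1 x)%:E.
  by apply: eq_integral => x _; congr EFin; field; rewrite gt_eqF// g1_gt0.
rewrite ge0_integral_normal; last 2 first.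
- by meas.
- by move=> x; rewrite lee_fin sqr_ge0.
have M0 : 0 <= \int[mu]_x (x ^+ 2 * g1 x)%:E.
  by apply: ge0_integral_real_ge0 => x; nneg.
have Mf : \int[mu]_x (x ^+ 2 * g1 x)%:E \is a fin_num.
  by rewrite ge0_fin_numE// normal_second_moment.
have K0 : 0 <= \int[mu]_x (kl (g1 x) (1 * g1 x))%:E.
  by apply: ge0_integral_real_ge0 => x; apply: kl_ge0; rewrite ?mul1r// g1_gt0.
have -> : \int[mu]_x ((x ^+ 2)%:E * (g1 x)%:E) = \int[mu]_x (x ^+ 2 * g1 x)%:E.
  by apply: eq_integral => x _; rewrite EFinM.
rewrite -(fineK Mf) -EFinD -EFinM => h.
have : 0 + 1%:E <= (2^-1 * (fine (\int[mu]_x (x ^+ 2 * g1 x)%:E) + fine (\int[mu]_x (x ^+ 2 * g1 x)%:E)))%:E.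
  by apply: le_trans h; rewrite leeD2r.
by rewrite add0e !lee_fin; lra.
Qed.

Lemma ge0_integral_normal_opp (F : R -> \bar R) : measurable_fun setT F ->
  (forall x, 0 <= F x) -> \int[N01]_x F (- x)%R = \int[N01]_x F x.
Proof.
move=> mF F0.
have mF' : measurable_fun setT (fun x : R => F (- x)%R) by apply: measurableT_comp.
have mg : measurable_fun setT (fun x : R => F x * (g1 x)%:E).
  by apply: emeasurable_funM => //; apply/measurable_EFinP; exact: measurable_normal_pdf.
have g0 (x : R) : 0 <= F x * (g1 x)%:E by rewrite mule_ge0// lee_fin normal_pdf_ge0.
rewrite !ge0_integral_normal// -[RHS](ge0_integral_oppr mg g0).
by apply: eq_integral => x _; rewrite !normal_pdf01E sqrrN.
Qed.

(** The half of E (a.y)^2 = |a|^2 that the Fatou argument calls for. In the induction, averaging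
    over x and -x cancels the cross term between the first coordinate and the others. *)
Lemma gam_quadratic_ge d (a : 'I_d -> R) :
  (\sum_i a i ^+ 2)%:E <= \int[gam d]_y ((\sum_i y 0%R i * a i) ^+ 2)%:E.
Proof.
elim: d a => [|d IH] a.
  by rewrite big_ord0; apply: ge0_integral_real_ge0 => y; exact: sqr_ge0.
have msum n (b : 'I_n -> R) : measurable_fun setT (fun y : 'rV[R]_n => (\sum_i y 0 i * b i)%R).
  by apply: measurable_sum => i; meas.
have mF : measurable_fun setT (fun y : 'rV[R]_d.+1 => ((\sum_i y 0 i * a i) ^+ 2)%:E).
  by apply/measurable_EFinP; apply: measurable_funX; exact: msum.
have F0 (y : 'rV[R]_d.+1) : 0 <= ((\sum_i y 0%R i * a i) ^+ 2)%:E by rewrite lee_fin sqr_ge0.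
rewrite (integral_powmS _ mF F0).
pose b i := a (lift ord0 i).
pose L (v : 'rV[R]_d) : R := (\sum_i v 0 i * b i)%R.
pose G (x : R) := \int[gam d]_v ((x * a ord0 + L v) ^+ 2)%:E.
have mL : measurable_fun setT L by exact: msum.
have GE x : \int[gam d]_v ((\sum_i (consr x v) 0%R i * a i) ^+ 2)%:E = G x.
  apply: eq_integral => v _; rewrite big_ord_recl consr0; congr ((_ + _) ^+ 2)%:E.
  by apply: eq_bigr => i _; rewrite consrS.
under eq_integral do rewrite GE.
have mG : measurable_fun setT G.
  have h := @measurable_powm_cons R N01 d _ mF F0.
  by apply: eq_measurable_fun h => x _; exact: GE.
have G0 x : 0 <= G x by apply: ge0_integral_real_ge0 => v; exact: sqr_ge0.
set c := (\sum_i b i ^+ 2)%R.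
have c0 : (0 <= c)%R by apply: sumr_ge0 => i _; exact: sqr_ge0.
have key (x : R) : (2 * a ord0 ^+ 2 * x ^+ 2 + 2 * c)%:E <= G x + G (- x)%R.
  rewrite /G -ge0_integralDr; last 4 first.
  - by meas.
  - by meas.
  - by move=> v; exact: sqr_ge0.
  - by move=> v; exact: sqr_ge0.
  have -> : \int[gam d]_v ((x * a ord0 + L v) ^+ 2 + (- x * a ord0 + L v) ^+ 2)%:E =
     \int[gam d]_v (2 * a ord0 ^+ 2 * x ^+ 2 + 2 * L v ^+ 2)%:E.
    by apply: eq_integral => v _; congr EFin; ring.
  rewrite ge0_integralDr//; last 3 first.
  - by meas.
  - by move=> v; nneg.
  - by move=> v; nneg.
  rewrite integral_gam_cst ge0_integralZ//; last 2 first.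
  - by meas.
  - by move=> v; exact: sqr_ge0.
  by rewrite EFinD leeD2l// EFinM; apply: lee_wpmul2l; [rewrite lee_fin|exact: IH].
have mG2 : measurable_fun setT (fun x : R => G (- x)%R) by apply: measurableT_comp.
have h : \int[N01]_x (2 * a ord0 ^+ 2 * x ^+ 2 + 2 * c)%:E <= \int[N01]_x G x + \int[N01]_x G x.
  have <- : \int[N01]_x (G x + G (- x)%R) = \int[N01]_x G x + \int[N01]_x G x.
    apply: etrans (ge0_integralDe N01 mG mG2 G0 (fun x : R => G0 (- x)%R)) _.
    by congr (_ + _); exact: ge0_integral_normal_opp.
  apply: ge0_le_integral => //.
  - by move=> x _; rewrite lee_fin; nneg.
  - by meas.
  - exact: emeasurable_funD.
have h2 : (2 * a ord0 ^+ 2 + 2 * c)%:E <= \int[N01]_x (2 * a ord0 ^+ 2 * x ^+ 2 + 2 * c)%:E.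
  rewrite ge0_integralDr//; last 3 first.
  - by meas.
  - by move=> x; nneg.
  - by move=> x; nneg.
  have mx2 : measurable_fun setT (fun x : R => (x ^+ 2)%R) by meas.
  have k0 : (0 <= 2 * a ord0 ^+ 2)%R by nneg.
  rewrite (ge0_integralZ N01 mx2 (fun x => sqr_ge0 x) k0).
  rewrite integral_cst//= [X in _ <= _ + _ * X](_ : _ = 1) ?mule1; last exact: probability_setT.
  rewrite EFinD leeD2r// -[leLHS]mule1; apply: lee_wpmul2l; first by rewrite lee_fin; nneg.
  exact: normal_second_moment_ge1.
have h3 := le_trans h2 h.
have -> : (\sum_(i < d.+1) a i ^+ 2 = a ord0 ^+ 2 + c)%R by rewrite big_ord_recl.
have I0 : 0 <= \int[N01]_x G x by exact: integral_ge0.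
have [/fin_numP[_ I1]|] := boolP (\int[N01]_x G x \is a fin_num); last first.
  by rewrite ge0_fin_numE// -leNgt leye_eq => /eqP ->; rewrite leey.
move: h3 I0 I1; case: (\int[N01]_x G x) => [r| |]//.
by rewrite -EFinD !lee_fin; lra.
Qed.
End gaussian_quadratic.

Section lnp_lnm.
Context {R : realType}.

Lemma continuous_lnp : continuous (@lnp R).
Proof.
move=> x; have [x1|x1] := ltP x 1.
  apply: cvg_near_cst.
  have l0 (z : R) : z <= 1 -> lnp z = 0 by move=> z1; rewrite /lnp max_r ?mulr0// ln_le0.
  near=> y; rewrite !l0// ltW//; near: y; exact: (cvgr_lt x).
have x0 : 0 < x by apply: lt_le_trans x1.
rewrite /lnp; apply: cvgM; first exact: cvg_id.
apply: (@continuous_max _ _ _ (fun=> 0)); first exact: continuous_ln.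
exact: cvg_cst.
Unshelve. all: by end_near. Qed.

Lemma lnp_le (x y : R) : 0 <= x -> x <= y -> lnp x <= lnp y.
Proof.
move=> x0 xy; have y0 := le_trans x0 xy.
apply: ler_pM => //; first by rewrite le_max lexx orbT.
have [->|xn] := eqVneq x 0; first by rewrite ln0// max_l// le_max lexx orbT.
rewrite ge_max !le_max lexx orbT andbT ler_ln ?xy// posrE.
  by rewrite lt_neqAle eq_sym xn.
by apply: lt_le_trans xy; rewrite lt_neqAle eq_sym xn.
Qed.

Definition lnm (x : R) : R := x * Num.max (- ln x) 0.

Lemma lnm_ge0 x : 0 <= x -> 0 <= lnm x.
Proof. by move=> x0; rewrite mulr_ge0// le_max lexx orbT. Qed.

Lemma measurable_lnm d' (T : measurableType d') (f : T -> R) :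
  measurable_fun setT f -> measurable_fun setT (fun x => lnm (f x)).
Proof. by move=> mf; rewrite /lnm; meas. Qed.

Lemma lnp_lnm x : lnp x - lnm x = x * ln x.
Proof.
rewrite /lnp /lnm -mulrBr; congr (_ * _).
have /orP[h|h] := le_total 0 (ln x).
  by rewrite max_l// max_r ?subr0// oppr_le0.
by rewrite max_r// max_l ?sub0r ?opprK// oppr_ge0.
Qed.
End lnp_lnm.

(** * Short-time expansion of the smoothed root of a density *)

Section smoothing_rate.
Context {R : realType} {d : nat}.
Local Open Scope ereal_scope.
Variables (rho : 'rV[R]_d -> R) (D : 'I_d -> 'rV[R]_d -> R) (p P B : R) (s dl : R^nat).
Hypotheses (p1 : (1 < p)%R) (crho : continuous rho) (rho0 : forall x, (0 <= rho x)%R)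
  (rho1 : \int[leb d]_x (rho x)%:E = 1)
  (drho : forall x y : 'rV[R]_d, is_derive (0%R : R) 1%R (fun s : R => rho (x + s *: y)%R)
     (\sum_i y 0%R i * D i x)%R)
  (mD : forall i, measurable_fun setT (D i))
  (rhoP : \int[leb d]_x (lnp (rho x))%:E = P%:E)
  (s0 : forall n, (0 < s n)%R) (cs : s @ \oo --> (0%R : R))
  (dl0 : forall n, (0 < dl n)%R) (cdl : (dl n / s n ^+ 2)%R @[n --> \oo] --> (p - 1)%R).

Let u x := (rho x `^ p^-1)%R.
Let v n := gconv (s n) u.
Let U n := gconv (s n) rho.
Let g n := gconv (s n) (fun x => lnp (rho x)).
(** Bound for v^(dl n), uniform in x: p ln v is at most ln (Kd s^-d), and ln (1/s) <= 1/s. It tends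
    to 1 because dl is of order s^2. *)
Let b n := expR (dl n / p * (`|ln (Kd d)| + d%:R / s n)).
Let c n := (dl n / s n ^+ 2)%R.

Let p0 : (0 < p)%R. Proof. exact: lt_trans p1. Qed.
Let mrho : measurable_fun setT rho := continuous_measurable_row crho.
Let mu : measurable_fun setT u. Proof. by rewrite /u; meas. Qed.
Let u0 x : (0 <= u x)%R. Proof. exact: powR_ge0. Qed.
Let up x : (u x `^ p = rho x)%R.
Proof. by rewrite /u -powRrM mulVf ?gt_eqF// powRr1. Qed.
Let clnp : continuous (fun x : 'rV[R]_d => lnp (rho x)).
Proof. by move=> x; apply: (cvg_comp rho (@lnp R)); [exact: crho|exact: continuous_lnp]. Qed.
Let l0 x : (0 <= lnp (rho x))%R. Proof. exact: lnp_ge0. Qed.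
Let ml : measurable_fun setT (fun x : 'rV[R]_d => lnp (rho x)).
Proof. exact: measurable_lnp. Qed.

Let UE n x : (U n x)%:E = \int[gam d]_y (rho (x + s n *: y)%R)%:E.
Proof. exact: (gconvK mrho rho0 rho1 (s0 n)). Qed.
Let gE n x : (g n x)%:E = \int[gam d]_y (lnp (rho (x + s n *: y)%R))%:E.
Proof. exact: (gconvK ml l0 rhoP (s0 n)). Qed.

Let u_le x : (u x <= 1 + rho x)%R.
Proof.
have [x1|x1] := leP (rho x) 1%R.
  apply: (@le_trans _ _ 1%R); last by rewrite lerDl.
  have pi0 : (0 <= p^-1)%R by rewrite invr_ge0 ltW.
  by have := ge0_ler_powR pi0 (rho0 x) ler01 x1; rewrite powR1.
rewrite /u; apply: (@le_trans _ _ (rho x)); last by rewrite lerDr.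
by rewrite ler1_powR ?(ltW x1)// invf_le1// ltW.
Qed.

Let vE n x : (v n x)%:E = \int[gam d]_y (u (x + s n *: y)%R)%:E.
Proof.
rewrite /v /gconv fineK// ge0_fin_numE ?ge0_integral_real_ge0//.
apply: (@le_lt_trans _ _ (1 + (U n x)%:E)); last by rewrite -EFinD ltry.
rewrite UE -(@integral_gam_cst R d 1) -ge0_integralDr//; last by meas.
by apply: ge0_le_integralr => //; meas.
Qed.

Let v0 n x : (0 <= v n x)%R. Proof. exact: gconv_ge0. Qed.
Let U0 n x : (0 <= U n x)%R. Proof. exact: gconv_ge0. Qed.
Let g0 n x : (0 <= g n x)%R. Proof. exact: gconv_ge0. Qed.

Let v_le_U n x : (v n x `^ p <= U n x)%R.
Proof.
rewrite -lee_fin UE.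
have mu' : measurable_fun setT (fun y : 'rV[R]_d => u (x + s n *: y)%R) by meas.
have := gam_jensen_powR p1 mu' (fun y => u0 _) (esym (vE n x)).
by under eq_integral do rewrite up.
Qed.

Let lnp_U n x : (lnp (U n x) <= g n x)%R.
Proof.
rewrite -lee_fin gE.
apply: (@gam_jensen_lnp R d (fun y => rho (x + s n *: y)%R) (U n x)) => //.
by meas.
Qed.

Let b_ge n x : (0 < v n x)%R -> (v n x `^ dl n <= b n)%R.
Proof.
move=> vx; rewrite /powR gt_eqF// /b ler_expR.
have -> : (dl n * ln (v n x) = dl n / p * (p * ln (v n x)))%R by field; rewrite gt_eqF.
rewrite ler_wpM2l//; first by rewrite divr_ge0// ltW.
rewrite -ln_powR; apply: (@le_trans _ _ (ln (Kd d * s n ^- d))%R).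
  rewrite ler_ln ?posrE ?powR_gt0//.
    apply: (le_trans (v_le_U n x)); rewrite -[leRHS]mulr1.
    exact: (gconv_le mrho rho0 rho1 (s0 n)).
  by rewrite mulr_gt0 ?Kd_gt0// invr_gt0 exprn_gt0.
rewrite lnM ?posrE ?Kd_gt0//; last by rewrite invr_gt0 exprn_gt0.
have e : (ln (s n ^- d) = d%:R * ln (s n)^-1)%R.
  by rewrite -exprVn lnXn ?invr_gt0// mulr_natl.
rewrite e lerD ?ler_norm//; apply: ler_wpM2l => //.
by have := @ln_le_sub1 R (s n)^-1; rewrite invr_gt0 s0 => /(_ isT); lra.
Qed.

Let b_ge1 n : (1 <= b n)%R.
Proof.
rewrite /b -[leLHS]expR0 ler_expR mulr_ge0//; first by rewrite divr_ge0// ltW.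
by rewrite addr_ge0// divr_ge0// ltW.
Qed.

(** The defect U - v^q over s^2, to which a multiple of the smoothed [lnp] is added to make it
    nonnegative. In the limit the added term combines with the contribution - (p - 1)/p rho ln rho
    of the exponent and leaves (p - 1)/p [lnm rho]. *)
Let Phi n x := ((U n x - v n x `^ (p + dl n)) / s n ^+ 2 + c n * b n * (p^-1 * g n x))%R.

Let vq n x : (v n x `^ (p + dl n) = v n x `^ p * v n x `^ dl n)%R.
Proof.
rewrite powRD//; apply/implyP; rewrite gt_eqF// addr_gt0//.
Qed.

Let c_gt0 n : (0 < c n)%R.
Proof. by rewrite /c divr_gt0// exprn_gt0. Qed.

(** Where v <= 1, the inequality v^q <= v^p <= U suffices. Where v > 1, the excess v^q - v^p is at
    most dl b v^p ln v, and p v^p ln v = [lnp (v^p)] <= [lnp U] <= g by monotonicity and Jensen's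
    inequality. *)
Let Phi0 n x : (0 <= Phi n x)%R.
Proof.
have s2 : (0 < s n ^+ 2)%R by rewrite exprn_gt0.
rewrite /Phi.
have -> : ((U n x - v n x `^ (p + dl n)) / s n ^+ 2 + c n * b n * (p^-1 * g n x) =
  (U n x + dl n * b n * (p^-1 * g n x) - v n x `^ (p + dl n)) / s n ^+ 2)%R.
  by rewrite /c; field; rewrite !gt_eqF.
apply: divr_ge0; last exact: ltW.
rewrite subr_ge0.
have b0 : (0 <= b n)%R := le_trans ler01 (b_ge1 n).
have g00 : (0 <= p^-1 * g n x)%R by rewrite mulr_ge0// invr_ge0 ltW.
have [v1|v1] := leP (v n x) 1%R.
  apply: (@le_trans _ _ (v n x `^ p)%R).
    rewrite vq ler_piMr ?powR_ge0//.
    by have := ge0_ler_powR (ltW (dl0 n)) (v0 n x) ler01 v1; rewrite powR1.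
  apply: (le_trans (v_le_U n x)); rewrite lerDl; nneg.
have vp : (0 < v n x)%R by apply: lt_trans v1.
have ln0 : (0 <= ln (v n x))%R by rewrite ln_ge0// ltW.
have h1 : (v n x `^ dl n <= 1 + dl n * ln (v n x) * b n)%R.
  have h := expR_ge1Dx (- (dl n * ln (v n x))).
  have e : (v n x `^ dl n = expR (dl n * ln (v n x)))%R by rewrite /powR gt_eqF.
  have h2 : (v n x `^ dl n * (1 - dl n * ln (v n x)) <= 1)%R.
    have := ler_wpM2l (expR_ge0 (dl n * ln (v n x))) h.
    by rewrite -expRD subrr expR0 e.
  have h3 := b_ge vp.
  have h4 : (0 <= dl n * ln (v n x))%R by rewrite mulr_ge0// ltW.
  have := ler_wpM2l h4 h3; nra.
have h2 : (v n x `^ p * ln (v n x) <= p^-1 * g n x)%R.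
  apply: (@le_trans _ _ (p^-1 * lnp (v n x `^ p))%R).
    rewrite /lnp max_l; last by rewrite ln_powR mulr_ge0// ltW.
    rewrite ln_powR le_eqVlt; apply/orP; left; apply/eqP; field; rewrite gt_eqF//.
  rewrite ler_wpM2l ?invr_ge0 ?(ltW p0)//.
  exact: le_trans (lnp_le (powR_ge0 _ _) (v_le_U n x)) (lnp_U n x).
rewrite vq; have := ler_wpM2l (powR_ge0 (v n x) p) h1.
have := ler_wpM2l (mulr_ge0 (ltW (dl0 n)) b0) h2.
by have := v_le_U n x; lra.
Qed.

Let mv n : measurable_fun setT (v n). Proof. exact: measurable_gconv. Qed.
Let mU n : measurable_fun setT (U n). Proof. exact: measurable_gconv. Qed.
Let mgg n : measurable_fun setT (g n). Proof. exact: measurable_gconv. Qed.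
Let mPhi n : measurable_fun setT (Phi n). Proof. by rewrite /Phi; meas. Qed.

Let integral_Phi n : (1 + s n ^+ 2 * B)%:E <= \int[leb d]_x (v n x `^ (p + dl n))%:E ->
  \int[leb d]_x (Phi n x)%:E <= (c n * b n * (p^-1 * P) - B)%:E.
Proof.
move=> hB.
have s2 : (0 < s n ^+ 2)%R by rewrite exprn_gt0.
have cb0 : (0 <= c n * b n * p^-1)%R.
  have bb0 : (0 <= b n)%R := le_trans ler01 (b_ge1 n).
  apply: mulr_ge0; last by rewrite invr_ge0 ltW.
  by apply: mulr_ge0 => //; exact: ltW.
have e1 : \int[leb d]_x (Phi n x + (s n ^+ 2)^-1 * v n x `^ (p + dl n))%:E =
   \int[leb d]_x ((s n ^+ 2)^-1 * U n x + c n * b n * p^-1 * g n x)%:E.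
  by apply: eq_integral => x _; congr EFin; rewrite /Phi; ring.
have IU : \int[leb d]_x (U n x)%:E = 1 by exact: (integral_gconv mrho rho0 rho1 (s0 n)).
have Ig : \int[leb d]_x (g n x)%:E = P%:E by exact: (integral_gconv ml l0 rhoP (s0 n)).
have vi0 x : (0 <= v n x `^ (p + dl n))%R by exact: powR_ge0.
have si0 : (0 <= (s n ^+ 2)^-1)%R by rewrite invr_ge0 ltW.
move: e1.
rewrite ge0_integralDr//; [|by meas|by move=> x; rewrite mulr_ge0].
have hU : measurable_fun setT (fun x => (s n ^+ 2)^-1 * U n x)%R by meas.
have hg : measurable_fun setT (fun x => c n * b n * p^-1 * g n x)%R by meas.
rewrite (ge0_integralDr (leb d) hU hg (fun x => mulr_ge0 si0 (U0 n x)) (fun x => mulr_ge0 cb0 (g0 n x))).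
rewrite !ge0_integralZ//; last by meas.
rewrite IU Ig mule1 -EFinM -EFinD.
set I := \int[leb d]_x (Phi n x)%:E; set J := \int[leb d]_x _ => e1.
have I0 : 0 <= I by exact: ge0_integral_real_ge0.
have J0 : (s n ^- 2)%:E * (1 + s n ^+ 2 * B)%:E <= (s n ^- 2)%:E * J.
  by apply: lee_wpmul2l; rewrite ?lee_fin.
have : I + (s n ^- 2)%:E * (1 + s n ^+ 2 * B)%:E <= ((s n ^+ 2)^-1 + c n * b n * p^-1 * P)%:E.
  by rewrite -e1 leeD2l.
rewrite -EFinM -leeBrDr// -EFinB => /le_trans; apply; rewrite lee_fin le_eqVlt; apply/orP; left.
by apply/eqP; field; rewrite !gt_eqF.
Qed.

Let cdl0 : dl @ \oo --> (0 : R)%R.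
Proof.
have e : dl = (fun n => c n * (s n * s n))%R.
  by apply/funext => n; rewrite /c; field; rewrite gt_eqF.
rewrite e; have := cvgM cdl (cvgM cs cs); rewrite !mulr0; exact.
Qed.

Let cb : b @ \oo --> (1 : R)%R.
Proof.
rewrite -(expR0 R).
apply: (cvg_comp (fun n => dl n / p * (`|ln (Kd d)| + d%:R / s n))%R (@expR R)); last exact: continuous_expR.
have e : (fun n => dl n / p * (`|ln (Kd d)| + d%:R / s n))%R =
   (fun n => dl n * (p^-1 * `|ln (Kd d)|) + c n * s n * (d%:R / p))%R.
  by apply/funext => n; rewrite /c; field; rewrite !gt_eqF.
rewrite e.
have := cvgD (cvgM cdl0 (cvg_cst (p^-1 * `|ln (Kd d)|)%R)) (cvgM (cvgM cdl cs) (cvg_cst (d%:R / p)%R)).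
rewrite mulr0 !mul0r addr0; exact.
Qed.

Let ccb : (c n * b n * (p^-1 * P) - B)%R @[n --> \oo] --> ((p - 1) / p * P - B)%R.
Proof.
have := cvgB (cvgM (cvgM cdl cb) (cvg_cst (p^-1 * P)%R)) (cvg_cst B).
rewrite mulr1 !mulrA; exact.
Qed.


Let cU x : U n x @[n --> \oo] --> rho x.
Proof.
apply/cvgrPdist_le => e e0; near=> n.
rewrite ler_distl; apply/andP; split.
  have : (U n x <= rho x + e)%R by near: n; exact: (approx_id_ub mrho rho0 s0 cs rho1 (@crho x)).
  lra.
suff : (rho x - e <= U n x)%R by lra.
rewrite -lee_fin UE; near: n; exact: (approx_id_lb mrho rho0 cs (@crho x)).
Unshelve. all: by end_near. Qed.

Let powR_cont (z r : R) : (0 < z)%R -> {for z, continuous (fun y : R => y `^ r)%R}.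
Proof.
move=> z0; have dp := @is_derive1_powR R r z z0.
by apply/differentiable_continuous/derivable1_diffP; case: dp.
Qed.

(** Integrability is known for rho and not for its root, so the upper bound does not come from
    [approx_id_ub] directly: it is Jensen's inequality v <= U^(1/p) together with the convergence of
    U. *)
Let cv x : (0 < rho x)%R -> v n x @[n --> \oo] --> u x.
Proof.
move=> rx; have ux : (0 < u x)%R by rewrite /u powR_gt0.
have cu : {for x, continuous u}.
  apply: (cvg_comp rho (fun y => y `^ p^-1)%R); first exact: crho.
  exact: powR_cont.
have cUp : (U n x `^ p^-1)%R @[n --> \oo] --> u x.
  by apply: (cvg_comp (fun n => U n x) (fun y => y `^ p^-1)%R (@cU x)); exact: powR_cont.
apply/cvgrPdist_le => e e0; have /cvgrPdist_le/(_ e e0) cUe := cUp.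
near=> n.
have h1 : (u x - e <= v n x)%R.
  by rewrite -lee_fin vE; near: n; exact: (approx_id_lb mu u0 cs cu).
have h2 : (v n x <= U n x `^ p^-1)%R.
  have -> : (v n x = (v n x `^ p) `^ p^-1)%R by rewrite -powRrM divff ?gt_eqF// powRr1.
  have pi0 : (0 <= p^-1)%R by rewrite invr_ge0 ltW.
  by apply: (ge0_ler_powR pi0); rewrite ?nnegrE ?powR_ge0.
have : (`|u x - U n x `^ p^-1| <= e)%R by near: n.
rewrite !ler_distl => /andP[h3 h4]; apply/andP; split; lra.
Unshelve. all: by end_near. Qed.

(** Averaging over y and -y writes U as the mean of midpoints of rho and v as the mean of midpoints
    m(y) of its root; Jensen's inequality in y bounds v^p by the mean of m(y)^p. What remains is a
    Gaussian average of one-dimensional gaps, treated by [gap_liminf] in each direction y, Fatou's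
    lemma, and [gam_quadratic_ge] for the average of (y.D)^2. *)
Let gap_lb x : (0 < rho x)%R -> forall e, (0 < e)%R -> \forall n \near \oo,
  (2^-1 * ((p - 1) / p) * ((\sum_i D i x ^+ 2) / rho x) - e <= (U n x - v n x `^ p) / s n ^+ 2)%R.
Proof.
move=> rx e e0.
pose f (y : 'rV[R]_d) := (2^-1 * ((p - 1) / p) * ((\sum_i y 0%R i * D i x) ^+ 2 / rho x))%R.
pose A (y : 'rV[R]_d) (t : R) := rho (x + t *: y)%R.
pose f_ n (y : 'rV[R]_d) := (((A y (s n) + A y (- s n)) / 2 -
   ((A y (s n) `^ p^-1 + A y (- s n) `^ p^-1) / 2) `^ p) / s n ^+ 2)%R.
have mA (t : R) : measurable_fun setT (fun y => A y t) by rewrite /A; meas.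
have mf_ n : measurable_fun setT (f_ n).
  have h1 := mA (s n); have h2 := mA (- s n)%R; rewrite /f_; meas.
have mS : measurable_fun setT (fun y : 'rV[R]_d => (\sum_i y 0 i * D i x)%R).
  by apply: measurable_sum => i; meas.
have mf : measurable_fun setT f by rewrite /f; meas.
have k0 : (0 <= 2^-1 * ((p - 1) / p))%R.
  by rewrite !mulr_ge0// ?invr_ge0 ?(ltW p0)// subr_ge0 ltW.
have f0 y : (0 <= f y)%R.
  by rewrite /f mulr_ge0// divr_ge0 ?sqr_ge0.
have A0 y t : (0 <= A y t)%R by exact: rho0.
have f_0 n y : (0 <= f_ n y)%R.
  rewrite /f_ divr_ge0 ?exprn_ge0 ?(ltW (s0 n))// subr_ge0.
  have := powR_midpoint p1 (powR_ge0 (A y (s n)) p^-1%R) (powR_ge0 (A y (- s n)%R) p^-1%R).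
  by rewrite -!powRrM mulVf ?gt_eqF// !powRr1.
have lb y e' : (0 < e')%R -> \forall n \near \oo, (f y - e' <= f_ n y)%R.
  move=> e'0.
  have A00 : (0 < A y 0)%R by rewrite /A scale0r addr0.
  have := gap_liminf p1 (A0 y) A00 (drho x y) s0 cs e'0.
  by rewrite /f /A scale0r addr0.
have If : (2^-1 * ((p - 1) / p) * ((\sum_i D i x ^+ 2) / rho x))%:E <= \int[gam d]_y (f y)%:E.
  have -> : \int[gam d]_y (f y)%:E = \int[gam d]_y ((2^-1 * ((p - 1) / p) / rho x) * (\sum_i y 0 i * D i x) ^+ 2)%:E.
    by apply: eq_integral => y _; congr EFin; rewrite /f; ring.
  have kr0 : (0 <= 2^-1 * ((p - 1) / p) / rho x)%R by rewrite divr_ge0.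
  have mS2 : measurable_fun setT (fun y : 'rV[R]_d => ((\sum_i y 0 i * D i x) ^+ 2)%R) by meas.
  rewrite (ge0_integralZ (gam d) mS2 (fun y => sqr_ge0 _) kr0).
  have -> : (2^-1 * ((p - 1) / p) * ((\sum_i D i x ^+ 2) / rho x) =
    2^-1 * ((p - 1) / p) / rho x * (\sum_i D i x ^+ 2))%R by ring.
  by rewrite EFinM; apply: lee_wpmul2l; rewrite ?lee_fin//; exact: gam_quadratic_ge.
have := fatou_lb mf_ f_0 mf f0 lb If e0; apply: filterS => n h.
rewrite -lee_fin; apply: (le_trans h).
have s2 : (0 < s n ^+ 2)%R by rewrite exprn_gt0.
have sy (F : 'rV[R]_d -> R) : measurable_fun setT F -> (forall y, 0 <= F y)%R ->
   \int[gam d]_y (F (x + - s n *: y)%R)%:E = \int[gam d]_y (F (x + s n *: y)%R)%:E.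
  move=> mF F0; rewrite -[RHS]gam_opp; last 2 first.
  - by meas.
  - by move=> y; rewrite lee_fin.
  by apply: eq_integral => y _; rewrite scalerN scaleNr.
have half (F : 'rV[R]_d -> R) : measurable_fun setT F -> (forall y, 0 <= F y)%R ->
   \int[gam d]_y ((F (x + s n *: y)%R + F (x + - s n *: y)%R) / 2)%:E =
   \int[gam d]_y (F (x + s n *: y)%R)%:E.
  move=> mF F0.
  have m1 : measurable_fun setT (fun y : 'rV[R]_d => F (x + s n *: y)%R) by meas.
  have m2 : measurable_fun setT (fun y : 'rV[R]_d => F (x + - s n *: y)%R) by meas.
  have -> : \int[gam d]_y ((F (x + s n *: y)%R + F (x + - s n *: y)%R) / 2)%:E =
    \int[gam d]_y (2^-1 * F (x + s n *: y) + 2^-1 * F (x + - s n *: y))%:E.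
    by apply: eq_integral => y _; congr EFin; ring.
  rewrite ge0_integralDr; [|by meas|by meas|by move=> y; nneg|by move=> y; nneg].
  rewrite !ge0_integralZ//.
  rewrite (sy F mF F0); move: (integral _ _ _) (ge0_integral_real_ge0 (gam d) (fun y => F0 (x + s n *: y)%R)).
  case=> [r| |]// _; first by rewrite -EFinM -EFinD; congr EFin; field.
  by rewrite mulry gtr0_sg ?invr_gt0// mul1e.
pose m (y : 'rV[R]_d) := ((A y (s n) `^ p^-1 + A y (- s n) `^ p^-1) / 2)%R.
have mm : measurable_fun setT m.
  have h1 := mA (s n); have h2 := mA (- s n)%R; rewrite /m; meas.
have m0 y : (0 <= m y)%R by rewrite /m divr_ge0// addr_ge0 ?powR_ge0.
have Im : \int[gam d]_y (m y)%:E = (v n x)%:E by rewrite vE -(half u mu u0).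
have Jm := gam_jensen_powR p1 mm m0 Im.
have IU : \int[gam d]_y ((A y (s n) + A y (- s n)) / 2)%:E = (U n x)%:E.
  by rewrite UE -(half rho mrho rho0).
have si0 : (0 <= (s n ^+ 2)^-1)%R by rewrite invr_ge0 ltW.
have : \int[gam d]_y (f_ n y)%:E + ((s n ^+ 2)^-1)%:E * \int[gam d]_y (m y `^ p)%:E =
   ((s n ^+ 2)^-1)%:E * (U n x)%:E.
  have mmp : measurable_fun setT (fun y => (m y `^ p)%R) by meas.
  have mAA : measurable_fun setT (fun y => (A y (s n) + A y (- s n)) / 2)%R.
    have h1 := mA (s n); have h2 := mA (- s n)%R; meas.
  have AA0 y : (0 <= (A y (s n) + A y (- s n)) / 2)%R by rewrite divr_ge0// addr_ge0.
  rewrite -IU -(ge0_integralZ _ mmp (fun y => powR_ge0 _ _) si0) -(ge0_integralZ _ mAA AA0 si0).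
  rewrite -ge0_integralDr//; last 2 first.
  - by meas.
  - by move=> y; rewrite mulr_ge0// powR_ge0.
  by apply: eq_integral => y _; congr EFin; rewrite /f_ /m; ring.
have : ((s n ^+ 2)^-1)%:E * (v n x `^ p)%:E <= ((s n ^+ 2)^-1)%:E * \int[gam d]_y (m y `^ p)%:E.
  by apply: lee_wpmul2l; rewrite ?lee_fin.
move: (\int[gam d]_y (f_ n y)%:E) => X h1 h2.
have : X + ((s n ^+ 2)^-1)%:E * (v n x `^ p)%:E <= ((s n ^+ 2)^-1)%:E * (U n x)%:E.
  by rewrite -h2 leeD2l.
rewrite -!EFinM -leeBrDr// -EFinB => /le_trans; apply; rewrite lee_fin.
by rewrite mulrBl !(mulrC _ (s n ^+ 2)^-1%R).
Qed.

(* Fatou's lemma for the nonnegative functions Phi n: the Jensen gap U - v^p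
   yields the Fisher information, the excess dl n of the exponent the entropy. *)
Lemma smoothing_rate :
  (\forall n \near \oo, (1 + s n ^+ 2 * B)%:E <= \int[leb d]_x (v n x `^ (p + dl n))%:E) ->
  \int[leb d]_x ((p - 1) / p * (2^-1 * ((\sum_i D i x ^+ 2) / rho x) + lnm (rho x)))%:E <=
  ((p - 1) / p * P - B)%:E.
Proof.
move=> hB.
have k0 : (0 <= (p - 1) / p)%R by rewrite divr_ge0 ?(ltW p0)// subr_ge0 ltW.
have S0 x : (0 <= (\sum_i D i x ^+ 2) / rho x)%R.
  by rewrite divr_ge0// sumr_ge0// => i _; exact: sqr_ge0.
have T0 x : (0 <= (p - 1) / p * (2^-1 * ((\sum_i D i x ^+ 2) / rho x) + lnm (rho x)))%R.
  by rewrite mulr_ge0// addr_ge0 ?lnm_ge0// mulr_ge0.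
apply: (fatou_bound mPhi Phi0) => //.
- have mlm := measurable_lnm mrho.
  have mS : measurable_fun setT (fun x : 'rV[R]_d => (\sum_i D i x ^+ 2)%R).
    by apply: measurable_sum => i; have h := mD i; meas.
  by meas.
- move=> x e e0.
  (* At a zero of rho the expected limit is 0, by the convention x / 0 = 0, and nonnegativity of Phi
     settles the matter. *)
  have [rx|rx] := eqVneq (rho x) 0%R.
    apply: nearW => n; rewrite rx invr0 mulr0 mulr0 /lnm mul0r addr0 mulr0.
    by apply: le_trans (Phi0 n x); rewrite sub0r oppr_le0 ltW.
  have {rx} : (0 < rho x)%R by rewrite lt_neqAle eq_sym rx rho0.
  move=> rx.
  have ux : (0 < u x)%R by rewrite /u powR_gt0.
  have e3 : (0 < e / 3)%R by rewrite divr_gt0.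
  have gl := gap_lb rx e3.
  pose H n := (- (c n * (v n x `^ p * ln (v n x) * expR (dl n * ln (v n x)))))%R.
  have cvp : (v n x `^ p)%R @[n --> \oo] --> (u x `^ p)%R.
    by apply: (cvg_comp (fun n => v n x) (fun y => y `^ p)%R (cv rx)); exact: powR_cont.
  have cln : ln (v n x) @[n --> \oo] --> ln (u x).
    by apply: (cvg_comp (fun n => v n x) (@ln R) (cv rx)); exact: continuous_ln.
  have cex : expR (dl n * ln (v n x)) @[n --> \oo] --> expR (0 * ln (u x)).
    apply: (cvg_comp (fun n => dl n * ln (v n x))%R (@expR R)); last exact: continuous_expR.
    exact: cvgM.
  have cH : H @ \oo --> (- ((p - 1) * (u x `^ p * ln (u x) * expR (0 * ln (u x)))))%R.
    by apply: cvgN; apply: cvgM => //; apply: cvgM => //; exact: cvgM.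
  have eH : (- ((p - 1) * (u x `^ p * ln (u x) * expR (0 * ln (u x)))) = - ((p - 1) / p * (rho x * ln (rho x))))%R.
    rewrite mul0r expR0 mulr1 up /u ln_powR; field; rewrite gt_eqF//.
  rewrite eH in cH; have /cvgrPdist_le/(_ _ e3) cHe := cH.
  have p10 : (0 < p - 1)%R by rewrite subr_gt0.
  have cg : \forall n \near \oo, ((p - 1) / p * lnp (rho x) - e / 3 <= c n * (p^-1 * g n x))%R.
    set e' := (e / 6 / ((p - 1) / p))%R.
    have e'0 : (0 < e')%R by rewrite !divr_gt0.
    have ccl : (c n * (p^-1 * (lnp (rho x) - e')))%R @[n --> \oo] --> ((p - 1) * (p^-1 * (lnp (rho x) - e')))%R.
      by apply: cvgM => //; exact: cvg_cst.
    have e6 : (0 < e / 6)%R by rewrite divr_gt0.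
    have /cvgrPdist_le/(_ _ e6) hc := ccl.
    have hg := approx_id_lb ml l0 cs (@clnp x) e'0.
    near=> n.
    have h1 : (lnp (rho x) - e' <= g n x)%R by rewrite -lee_fin gE; near: n.
    have : (`|(p - 1) * (p^-1 * (lnp (rho x) - e')) - c n * (p^-1 * (lnp (rho x) - e'))| <= e / 6)%R by near: n.
    have -> : ((p - 1) * (p^-1 * (lnp (rho x) - e')) = (p - 1) / p * lnp (rho x) - e / 6)%R.
      by rewrite /e'; field; rewrite !gt_eqF.
    rewrite ler_distl => /andP[_ h2].
    have h3 : (c n * (p^-1 * (lnp (rho x) - e')) <= c n * (p^-1 * g n x))%R.
      by rewrite ler_wpM2l ?(ltW (c_gt0 n))// ler_wpM2l// invr_ge0 ltW.
    lra.
  near=> n.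
  have cn := c_gt0 n.
  have vn : (0 < v n x)%R by near: n; exact: (cvgr_gt (u x) (cv rx)).
  have h1 : (2^-1 * ((p - 1) / p) * ((\sum_i D i x ^+ 2) / rho x) - e / 3 <= (U n x - v n x `^ p) / s n ^+ 2)%R.
    by near: n.
  have h2 : (`|- ((p - 1) / p * (rho x * ln (rho x))) - H n| <= e / 3)%R by near: n.
  have h3 : ((p - 1) / p * lnp (rho x) - e / 3 <= c n * (p^-1 * g n x))%R by near: n.
  have h4 : (c n * (p^-1 * g n x) <= c n * b n * (p^-1 * g n x))%R.
    have gp0 : (0 <= p^-1 * g n x)%R by apply: mulr_ge0; [rewrite invr_ge0 ltW|exact: g0].
    by rewrite ler_wpM2r// ler_peMr ?b_ge1// ltW.
  have s2 : (0 < s n ^+ 2)%R by rewrite exprn_gt0.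
  (* e^x - 1 <= x e^x holds whatever the sign of x = dl ln v. *)
  have h5 : (H n <= (v n x `^ p - v n x `^ (p + dl n)) / s n ^+ 2)%R.
    have vd : (v n x `^ dl n = expR (dl n * ln (v n x)))%R by rewrite /powR gt_eqF.
    rewrite ler_pdivlMr// vq vd.
    have z1 := expR_ge1Dx (- (dl n * ln (v n x))).
    have := ler_wpM2l (expR_ge0 (dl n * ln (v n x))) z1; rewrite -expRD subrr expR0.
    set E := expR (dl n * ln (v n x)) => z2.
    have -> : (H n * s n ^+ 2 = - (v n x `^ p * (dl n * ln (v n x) * E)))%R.
      by rewrite /H /c -/E; field; rewrite gt_eqF.
    have z3 : (E - 1 <= dl n * ln (v n x) * E)%R by lra.
    have := ler_wpM2l (powR_ge0 (v n x) p) z3; lra.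
  have h6 : (Phi n x = (U n x - v n x `^ p) / s n ^+ 2 +
     (v n x `^ p - v n x `^ (p + dl n)) / s n ^+ 2 + c n * b n * (p^-1 * g n x))%R.
    by rewrite /Phi; ring.
  have h7 : ((p - 1) / p * lnm (rho x) = (p - 1) / p * lnp (rho x) - (p - 1) / p * (rho x * ln (rho x)))%R.
    by rewrite -mulrBr -lnp_lnm; congr (_ * _)%R; ring.
  move: h2; rewrite ler_distlC => /andP[h2 _].
  by rewrite h6 mulrDr h7; lra.
- move=> e e0; have /cvgrPdist_le/(_ e e0) cCe := ccb.
  near=> n.
  apply: (le_trans (integral_Phi _)); first by near: n.
  have : (`|(p - 1) / p * P - B - (c n * b n * (p^-1 * P) - B)| <= e)%R by near: n.
  by rewrite ler_distl lee_fin => /andP[? ?]; lra.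
Unshelve. all: by end_near. Qed.
End smoothing_rate.

Section gconv_root.
Context {R : realType} {d : nat}.
Local Open Scope ereal_scope.
Variables (rho : 'rV[R]_d -> R) (p : R).
Hypotheses (p1 : (1 < p)%R) (mrho : measurable_fun setT rho) (rho0 : forall x, (0 <= rho x)%R)
  (rho1 : \int[leb d]_x (rho x)%:E = 1).

Lemma gconv_rootE (r : R) (x : 'rV[R]_d) : (0 < r)%R ->
  (gconv r (fun y => rho y `^ p^-1)%R x)%:E = \int[gam d]_y (rho (x + r *: y) `^ p^-1)%:E.
Proof.
move=> r0; have p0 : (0 < p)%R by exact: lt_trans p1.
have I0 : 0 <= \int[gam d]_y (rho (x + r *: y) `^ p^-1)%:E.
  by apply: ge0_integral_real_ge0 => y; exact: powR_ge0.
rewrite /gconv fineK; first by [].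
rewrite (ge0_fin_numE I0).
have u_le z : (rho z `^ p^-1 <= 1 + rho z)%R.
  have [x1|x1] := leP (rho z) 1%R.
    apply: (@le_trans _ _ 1%R); last by rewrite lerDl.
    have pi0 : (0 <= p^-1)%R by rewrite invr_ge0 ltW.
    by have := ge0_ler_powR pi0 (rho0 z) ler01 x1; rewrite powR1.
  apply: (@le_trans _ _ (rho z)); last by rewrite lerDr.
  by rewrite ler1_powR ?(ltW x1)// invf_le1// ltW.
apply: (@le_lt_trans _ _ (1 + (gconv r rho x)%:E)); last by rewrite -EFinD ltry.
rewrite (gconvK mrho rho0 rho1 r0) -(@integral_gam_cst R d 1) -ge0_integralDr//; last by meas.
by apply: ge0_le_integralr => //; [meas|meas|move=> y; exact: powR_ge0].
Qed.
End gconv_root.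

(** * Mehler's formula at the critical exponent *)

Section mehler.
Context {R : realType} {d : nat}.
Local Open Scope ereal_scope.
Definition rho_of (F : 'rV[R]_d -> R) (p : R) (x : 'rV[R]_d) : R := (F x `^ p * phi x)%R.

Variables (F : 'rV[R]_d -> R) (p c sg a s k q : R).
Hypotheses (p1 : (1 < p)%R) (c0 : (0 < c)%R) (sg0 : (0 < sg)%R)
  (csg : (c ^+ 2 + sg ^+ 2 = 1)%R) (a0 : (0 < a)%R) (aE : (a ^+ 2 = (p - 1 + c ^+ 2) / p)%R)
  (sE : s = (sg / a)%R) (kE : k = (c / a ^+ 2)%R) (qE : q = ((p - 1 + c ^+ 2) / c ^+ 2)%R)
  (mF : measurable_fun setT F) (F0 : forall x, (0 <= F x)%R).

Local Notation rho := (rho_of F p).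
Let u x := (rho x `^ p^-1)%R.

Let p0 : (0 < p)%R. Proof. exact: lt_trans p1. Qed.
Let pc0 : (0 < p - 1 + c ^+ 2)%R. Proof. by rewrite addr_gt0 ?exprn_gt0// subr_gt0. Qed.
Let s0 : (0 < s)%R. Proof. by rewrite sE divr_gt0. Qed.
Let k0 : (0 < k)%R. Proof. by rewrite kE divr_gt0// exprn_gt0. Qed.
Let q0 : (0 < q)%R. Proof. by rewrite qE divr_gt0// exprn_gt0. Qed.

Let rho0 x : (0 <= rho x)%R. Proof. by rewrite mulr_ge0 ?powR_ge0 ?phi_ge0. Qed.

Let mrho : measurable_fun setT rho.
Proof. by have mp := @measurable_phi R d; rewrite /rho_of; meas. Qed.

Let mu : measurable_fun setT u. Proof. by rewrite /u; meas. Qed.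
Let u0 x : (0 <= u x)%R. Proof. exact: powR_ge0. Qed.

Let uE x : (u x = F x * (Kd d `^ p^-1 * expR (- sqn x / 2 / p)))%R.
Proof.
rewrite /u /rho_of powRM ?powR_ge0 ?phi_ge0// -powRrM divff ?gt_eqF// powRr1//.
rewrite phiE powRM ?expR_ge0 ?(ltW (Kd_gt0 d))//.
have -> : (expR (- sqn x / 2) `^ p^-1 = expR (- sqn x / 2 / p))%R.
  by rewrite /powR gt_eqF ?expR_gt0// expRK mulrC.
by [].
Qed.

(** The factor in x alone that completing the square leaves. The coefficients of z^2, z x and x^2 in
    the exponents determine s, k and q in turn: 1/s^2 = 1/sg^2 - 1/p, then k = c s^2 / sg^2, and q
    comes out as 1 + (p - 1)/c^2, the critical exponent when c = e^-t. *)
Let C (x : 'rV[R]_d) : R := (Kd d `^ (- p^-1) * expR (sqn x / 2 / q))%R.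

(* Completion of squares. *)
Let kernel (x z : 'rV[R]_d) :
  (F z * phi (sg^-1 *: (z - c *: x)) = C x * (u z * phi (s^-1 *: (z - k *: x))))%R.
Proof.
rewrite uE /C !phiE.
have eK : (Kd d `^ (- p^-1) * Kd d `^ p^-1 = 1)%R.
  by rewrite -powRD ?addNr ?powRr0//; apply/implyP => _; rewrite gt_eqF// Kd_gt0.
have eX : (expR (- sqn (sg^-1 *: (z - c *: x)) / 2) =
   expR (sqn x / 2 / q) * expR (- sqn z / 2 / p) * expR (- sqn (s^-1 *: (z - k *: x)) / 2))%R.
  rewrite -!expRD; congr expR.
  have : (sqn (sg^-1 *: (z - c *: x)) + sqn x / q =
     sqn z / p + sqn (s^-1 *: (z - k *: x)))%R.
    rewrite /sqn !mulr_suml -!big_split/=; apply: eq_bigr => i _; rewrite !mxE.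
    have sgn : sg != 0%R by rewrite gt_eqF.
    have siE : (s^-1 ^+ 2 = a ^+ 2 / sg ^+ 2)%R by rewrite sE; field; rewrite sgn gt_eqF.
    rewrite !exprMn siE.
    have sg2 : (sg ^+ 2 = 1 - c ^+ 2)%R by rewrite -csg; ring.
    have h : (1 - c ^+ 2 != 0)%R by rewrite -sg2 expf_neq0.
    rewrite exprVn sg2 kE aE qE; field.
    by rewrite h !gt_eqF.
  by lra.
rewrite eX.
transitivity ((Kd d `^ (- p^-1) * Kd d `^ p^-1) * (F z * (Kd d * (expR (sqn x / 2 / q) * expR (- sqn z / 2 / p) * expR (- sqn (s^-1 *: (z - k *: x)) / 2)))))%R.
  by rewrite eK mul1r.
by ring.
Qed.

(** Substituting z = c x + sg y on the left and z = k x + s y on the right turns both sides into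
    Lebesgue integrals matched by [kernel]; a^-d is the quotient of the Jacobians s^d and sg^d. *)
Lemma mehler (x : 'rV[R]_d) : \int[gam d]_y (F (c *: x + sg *: y)%R)%:E =
  (C x * a ^- d)%:E * \int[gam d]_y (u (k *: x + s *: y)%R)%:E.
Proof.
have aff (G : 'rV[R]_d -> R) (r : R) (b : 'rV[R]_d) : (0 < r)%R -> measurable_fun setT G -> (forall x, 0 <= G x)%R ->
   (r ^+ d)%:E * \int[gam d]_y (G (b + r *: y)%R)%:E = \int[leb d]_z (G z * phi (r^-1 *: (z - b)))%:E.
  move=> r0 mG G0.
  have m1 : measurable_fun setT (fun y : 'rV[R]_d => G (b + r *: y)%R) by meas.
  have m2 : measurable_fun setT (fun z : 'rV[R]_d => (G z * phi (r^-1 *: (z - b)))%:E).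
    have h : measurable_fun setT (fun z : 'rV[R]_d => phi (r^-1 *: (z - b))).
      by apply: (measurableT_comp (@measurable_phi R d)); meas.
    by meas.
  rewrite ge0_integral_gam; last 2 first.
  - by apply/measurable_EFinP.
  - by move=> y; rewrite lee_fin.
  rewrite -(ge0_leb_affine b r0 m2); last by move=> z; rewrite lee_fin mulr_ge0// phi_ge0.
  congr (_ * _); apply: eq_integral => y _; rewrite -EFinM.
  have -> : (r^-1 *: (r *: y + b - b) = y)%R by rewrite addrK scalerA mulVf ?scale1r// gt_eqF.
  by rewrite (addrC b).
have h1 := aff F sg (c *: x)%R sg0 mF F0.
have h2 := aff u s (k *: x)%R s0 mu u0.
have C0 : (0 <= C x)%R by rewrite mulr_ge0 ?powR_ge0 ?expR_ge0.
have m3 : measurable_fun setT (fun z : 'rV[R]_d => (u z * phi (s^-1 *: (z - k *: x)))%R).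
  have h : measurable_fun setT (fun z : 'rV[R]_d => phi (s^-1 *: (z - k *: x))).
    by apply: (measurableT_comp (@measurable_phi R d)); meas.
  by meas.
have h3 : \int[leb d]_z (F z * phi (sg^-1 *: (z - c *: x)))%:E =
   (C x)%:E * \int[leb d]_z (u z * phi (s^-1 *: (z - k *: x)))%:E.
  rewrite -(ge0_integralZ (leb d) m3 (fun z => mulr_ge0 (u0 z) (phi_ge0 _)) C0).
  by apply: eq_integral => z _; rewrite kernel.
apply: (@pmule_inj _ (sg ^+ d)%R); first by rewrite exprn_gt0.
rewrite h1 h3 -h2 !muleA -!EFinM; congr (_%:E * _).
have -> : (s ^+ d = sg ^+ d * a ^- d)%R by rewrite sE exprMn exprVn.
by ring.
Qed.

Hypothesis rho1 : \int[leb d]_x (rho x)%:E = 1.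

Lemma mehler_fine x : \int[gam d]_y (F (c *: x + sg *: y)%R)%:E = (C x * a ^- d * gconv s u (k *: x))%:E.
Proof. by rewrite mehler EFinM -(gconv_rootE p1 mrho rho0 rho1). Qed.

(** The product C^q phi does not depend on x, so the Gaussian integral becomes a Lebesgue integral;
    k^-d is the Jacobian of x -> k x. *)
Lemma mehler_norm :
  \int[gam d]_x poweR (\int[gam d]_y (F (c *: x + sg *: y)%R)%:E) q =
  (Kd d `^ (1 - q / p) * (a ^- d) `^ q * k ^- d)%:E * \int[leb d]_x (gconv s u x `^ q)%:E.
Proof.
suff main (v : 'rV[R]_d -> R) : measurable_fun setT v -> (forall x, 0 <= v x)%R ->
    (forall x, \int[gam d]_y (F (c *: x + sg *: y)%R)%:E = (C x * a ^- d * v (k *: x))%:E) ->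
    \int[gam d]_x poweR (\int[gam d]_y (F (c *: x + sg *: y)%R)%:E) q =
    (Kd d `^ (1 - q / p) * (a ^- d) `^ q * k ^- d)%:E * \int[leb d]_x (v x `^ q)%:E.
  apply: main; [exact: measurable_gconv|by move=> x; exact: gconv_ge0|exact: mehler_fine].
move=> mv v0 vE.
have mC : measurable_fun setT C.
  have h := @measurable_sqn R d; rewrite /C; meas.
have C0 x : (0 <= C x)%R by rewrite mulr_ge0 ?powR_ge0 ?expR_ge0.
have ad0 : (0 <= a ^- d)%R by rewrite invr_ge0 exprn_ge0// ltW.
have mvk : measurable_fun setT (fun x : 'rV[R]_d => v (k *: x)).
  exact: (measurableT_comp mv (measurable_rowZ k (@measurable_id _ _ setT))).
under eq_integral do rewrite vE poweR_EFin.
rewrite ge0_integral_gam; last 2 first.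
- by meas.
- by move=> x; rewrite lee_fin powR_ge0.
have kd0 : (0 <= Kd d `^ (1 - q / p) * (a ^- d) `^ q)%R by rewrite mulr_ge0 ?powR_ge0.
transitivity (\int[leb d]_x (Kd d `^ (1 - q / p) * (a ^- d) `^ q * (v (0 + k *: x) `^ q))%:E).
  apply: eq_integral => x _; rewrite -EFinM; congr EFin.
  rewrite add0r (powRM q (mulr_ge0 (C0 x) ad0) (v0 _)) (powRM q (C0 x) ad0).
  have eC : (C x `^ q * phi x = Kd d `^ (1 - q / p))%R.
    rewrite /C powRM ?powR_ge0 ?expR_ge0// phiE -powRrM.
    rewrite [X in (_ * X * _)%R]/powR gt_eqF ?expR_gt0// expRK.
    rewrite mulrACA -expRD (_ : q * (sqn x / 2 / q) + - sqn x / 2 = 0)%R; last by field; rewrite gt_eqF.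
    rewrite expR0 mulr1 powRD; last by apply/implyP => _; rewrite gt_eqF// Kd_gt0.
    by rewrite powRr1 ?(ltW (Kd_gt0 d))// mulrC; congr (_ * _ `^ _)%R; ring.
  by rewrite -eC; ring.
have mvq : measurable_fun setT (fun x => (v x `^ q)%R) by meas.
have mi : measurable_fun setT (fun x : 'rV[R]_d => 0 + k *: x)%R.
  exact: (measurable_rowD (measurable_cst (0%R : 'rV[R]_d)) (measurable_rowZ k (@measurable_id _ _ setT))).
have mvqk := measurableT_comp mvq mi.
rewrite (ge0_integralZ (leb d) mvqk (fun x => powR_ge0 _ _) kd0).
rewrite (leb_scale 0 k0 mvq (fun x => powR_ge0 _ _)) muleA -EFinM.
by [].
Qed.
End mehler.

Lemma cvg_to_eq (R : realType) (f : R^nat) (a b : R) : f @ \oo --> a -> a = b -> f @ \oo --> b.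
Proof. by move=> h <-. Qed.

(** * From the smoothing rate to the semigroup *)

Section hyper_rate.
Context {R : realType} {d : nat}.
Local Open Scope ereal_scope.

(* || P_t F ||_q ^ q *)
Definition ouN (F : 'rV[R]_d -> R) (q t : R) : \bar R :=
  \int[gam d]_x poweR (\int[gam d]_y
    (F (expR (- t) *: x + Num.sqrt (1 - expR (- (2 * t))) *: y)%R)%:E) q.

Definition nelson (p t : R) : R := (1 + (p - 1) * expR (2 * t))%R.

Variables (F : 'rV[R]_d -> R) (D : 'I_d -> 'rV[R]_d -> R) (p P lam : R) (t : R^nat).
Local Notation rho := (rho_of F p).
Hypotheses (p1 : (1 < p)%R) (mF : measurable_fun setT F) (F0 : forall x, (0 <= F x)%R)
  (crho : continuous rho) (rho1 : \int[leb d]_x (rho x)%:E = 1)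
  (drho : forall x y : 'rV[R]_d, is_derive (0%R : R) 1%R (fun s : R => rho (x + s *: y)%R)
     (\sum_i y 0%R i * D i x)%R)
  (mD : forall i, measurable_fun setT (D i))
  (rhoP : \int[leb d]_x (lnp (rho x))%:E = P%:E)
  (t0 : forall n, (0 < t n)%R) (ct : t @ \oo --> (0%R : R))
  (hN : forall n, (expR (nelson p (t n) * t n * lam))%:E <= ouN F (nelson p (t n)) (t n)).

Let c n : R := expR (- t n).
Let sg n : R := Num.sqrt (1 - expR (- (2 * t n))).
Let a n : R := Num.sqrt ((p - 1 + c n ^+ 2) / p).
Let s n : R := (sg n / a n)%R.
Let k n : R := (c n / a n ^+ 2)%R.
Let q n : R := ((p - 1 + c n ^+ 2) / c n ^+ 2)%R.
Let dl n : R := (q n - p)%R.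

Let p0 : (0 < p)%R. Proof. exact: lt_trans p1. Qed.
Let p10 : (0 < p - 1)%R. Proof. by rewrite subr_gt0. Qed.
Let c0 n : (0 < c n)%R. Proof. exact: expR_gt0. Qed.
Let c2E n : (c n ^+ 2 = expR (- (2 * t n)))%R.
Proof. by rewrite /c -expRM_natl; congr expR; ring. Qed.
Let c21 n : (c n ^+ 2 < 1)%R.
Proof. by rewrite c2E expR_lt1 oppr_lt0 mulr_gt0. Qed.
Let sgE n : (sg n ^+ 2 = 1 - c n ^+ 2)%R.
Proof. by rewrite /sg -c2E sqr_sqrtr// subr_ge0 ltW. Qed.
Let sg0 n : (0 < sg n)%R.
Proof. by rewrite sqrtr_gt0 -c2E subr_gt0. Qed.
Let pc0 n : (0 < p - 1 + c n ^+ 2)%R. Proof. by rewrite addr_gt0 ?exprn_gt0. Qed.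
Let a0 n : (0 < a n)%R. Proof. by rewrite sqrtr_gt0 divr_gt0. Qed.
Let aE n : (a n ^+ 2 = (p - 1 + c n ^+ 2) / p)%R.
Proof. by rewrite sqr_sqrtr// divr_ge0 ?ltW. Qed.
Let s0 n : (0 < s n)%R. Proof. by rewrite divr_gt0. Qed.
Let k0 n : (0 < k n)%R. Proof. by rewrite divr_gt0// exprn_gt0. Qed.
Let qE n : q n = nelson p (t n).
Proof.
rewrite /q /nelson c2E expRN; have e0 := expR_gt0 (2 * t n).
by field; rewrite gt_eqF.
Qed.
Let s2E n : (s n ^+ 2 * a n ^+ 2 = 1 - c n ^+ 2)%R.
Proof. by rewrite /s -sgE; field; rewrite gt_eqF. Qed.
Let q0 n : (0 < q n)%R. Proof. by rewrite divr_gt0// exprn_gt0. Qed.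

Let dl0 n : (0 < dl n)%R.
Proof.
have -> : (dl n = (p - 1) * ((1 - c n ^+ 2) / c n ^+ 2))%R.
  by rewrite /dl /q; field; rewrite gt_eqF.
by rewrite mulr_gt0// divr_gt0 ?exprn_gt0// subr_gt0.
Qed.

Let dlE n : (dl n / s n ^+ 2 = (p - 1) * (a n ^+ 2 / c n ^+ 2))%R.
Proof.
have h : (s n ^+ 2 != 0)%R by rewrite gt_eqF// exprn_gt0.
apply: (mulIf h); rewrite divfK//.
transitivity ((p - 1) / c n ^+ 2 * (s n ^+ 2 * a n ^+ 2))%R; last by ring.
by rewrite s2E /dl /q; field; rewrite gt_eqF.
Qed.

Let cc2 : (c n ^+ 2)%R @[n --> \oo] --> (1%R : R).
Proof.
have cN : (- (2 * t n))%R @[n --> \oo] --> (- (2 * 0) : R)%R.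
  by apply: cvgN; apply: cvgM => //; exact: cvg_cst.
have h := cvg_comp _ _ cN (@continuous_expR R _).
under eq_fun do rewrite c2E.
by apply: (cvg_to_eq h); rewrite mulr0 oppr0 expR0.
Qed.

Let ca2 : (a n ^+ 2)%R @[n --> \oo] --> (1%R : R).
Proof.
under eq_fun do rewrite aE.
apply: (@cvg_to_eq _ _ ((p - 1 + 1) / p)%R); last by field; rewrite gt_eqF.
apply: cvgM; last exact: cvg_cst.
by apply: cvgD => //; exact: cvg_cst.
Qed.

Let cs : s @ \oo --> (0%R : R).
Proof.
have csg : sg @ \oo --> Num.sqrt (0%R : R).
  apply: (cvg_comp (fun n => 1 - expR (- (2 * t n)))%R Num.sqrt); last exact: sqrt_continuous.
  under eq_fun do rewrite -c2E.
  apply: (@cvg_to_eq _ _ (1 - 1)%R); last by rewrite subrr.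
  by apply: cvgB => //; exact: cvg_cst.
have ca : a @ \oo --> Num.sqrt (1%R : R).
  apply: (cvg_comp (fun n => (p - 1 + c n ^+ 2) / p)%R Num.sqrt); last exact: sqrt_continuous.
  by under eq_fun do rewrite -aE.
rewrite sqrtr0 in csg; rewrite sqrtr1 in ca.
have := cvgM csg (cvgV (oner_neq0 R) ca); rewrite mul0r; exact.
Qed.

Let cdl : (dl n / s n ^+ 2)%R @[n --> \oo] --> (p - 1)%R.
Proof.
under eq_fun do rewrite dlE.
apply: (@cvg_to_eq _ _ ((p - 1) * (1 / 1))%R); last by rewrite divr1 mulr1.
apply: cvgM; first exact: cvg_cst.
by apply: cvgM => //; exact: cvgV.
Qed.

(** s^2 a^2 = 1 - e^(-2t) ~ 2t, and a tends to 1. *)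
Let cts : (t n / s n ^+ 2)%R @[n --> \oo] --> (2^-1 : R)%R.
Proof.
have d1 : is_derive (0%R : R) 1%R (@expR R) 1%R by rewrite -[X in is_derive _ _ _ X]expR0; exact: is_derive_expR.
have tn n : (- (2 * t n) != 0)%R by rewrite oppr_eq0 gt_eqF// mulr_gt0.
have ct2 : (fun n => - (2 * t n))%R @ \oo --> (0%R : R).
  by rewrite -oppr0 -(mulr0 (2 : R)%R); apply: cvgN; apply: cvgM => //; exact: cvg_cst.
have h := is_derive_seq d1 tn ct2.
have e : (fun n => t n / s n ^+ 2)%R =
   (fun n => 2^-1 * (a n ^+ 2 / ((expR (0 + - (2 * t n)) - expR 0) / - (2 * t n))))%R.
  apply/funext => n; rewrite add0r expR0 -c2E.
  have -> : (c n ^+ 2 = 1 - s n ^+ 2 * a n ^+ 2)%R by rewrite s2E; ring.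
  field.
  have -> : (1 - (s n * a n) ^+ 2 - 1 = - (s n * a n) ^+ 2)%R by ring.
  have sa := mulr_gt0 (s0 n) (a0 n).
  by rewrite oppr_eq0 expf_neq0 !gt_eqF.
rewrite e.
apply: (@cvg_to_eq _ _ (2^-1 * (1 / 1))%R); last by rewrite divr1 mulr1.
apply: cvgM; first exact: cvg_cst.
by apply: cvgM => //; exact: cvgV.
Qed.

Let cq : q @ \oo --> p.
Proof.
apply: (@cvg_to_eq _ _ ((p - 1 + 1) / 1)%R); last by rewrite divr1; ring.
apply: cvgM; last by exact: cvgV.
by apply: cvgD => //; exact: cvg_cst.
Qed.

Let K := @Kd R d.
(** Coefficient of s^2 in the logarithm of the lower bound for the integral of v^q. The term p lam /
    2 is q t lam with t ~ s^2 / 2; K^(1 - q/p) contributes (p - 1)/p ln K, and the powers of a and k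
    contribute - (p - 1)/p d. *)
Let B := (p * lam / 2 + (p - 1) / p * (ln K - d%:R))%R.
Let L n : R := (q n * lam * (t n / s n ^+ 2) + dl n / s n ^+ 2 * (ln K / p) - q n * (d%:R / (2 * p)) +
   d%:R * (a n ^+ 2 * p^-1 - t n / s n ^+ 2))%R.

Let cL : L @ \oo --> B.
Proof.
have cql : (q n * lam)%R @[n --> \oo] --> (p * lam)%R.
  by apply: cvgM => //; exact: cvg_cst.
apply: (@cvg_to_eq _ _ (p * lam * 2^-1 + (p - 1) * (ln K / p) - p * (d%:R / (2 * p)) + d%:R * (1 * p^-1 - 2^-1))%R); last first.
  by rewrite /B; field; rewrite gt_eqF.
apply: cvgD.
  apply: cvgB.
    apply: cvgD; first exact: (cvgM cql cts).
    by apply: cvgM => //; exact: cvg_cst.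
  by apply: cvgM => //; exact: cvg_cst.
apply: cvgM; first exact: cvg_cst.
have cap : (a n ^+ 2 * p^-1)%R @[n --> \oo] --> (1 * p^-1)%R.
  by apply: cvgM => //; exact: cvg_cst.
exact: (cvgB cap cts).
Qed.

Let K0 : (0 < K)%R. Proof. exact: Kd_gt0. Qed.

(** An inequality for each n in place of an expansion: ln (a^2) is bounded on both sides by ln z <=
    z - 1 at a^2 and at 1/a^2, and both differences are explicit multiples of s^2. *)
Let Lub n : (s n ^+ 2 * L n <= q n * t n * lam -
   ((1 - q n / p) * ln K + q n * (- (d%:R * ln (a n))) - d%:R * ln (k n)))%R.
Proof.
have s2 : (s n ^+ 2 != 0)%R by rewrite gt_eqF// exprn_gt0.
have a2 : (0 < a n ^+ 2)%R by rewrite exprn_gt0.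
have lnk : (ln (k n) = - t n - ln (a n ^+ 2))%R.
  by rewrite /k lnM ?posrE ?invr_gt0// lnV// /c expRK.
have lna : (ln (a n) = 2^-1 * ln (a n ^+ 2))%R.
  by rewrite lnXn// mulr2n; field.
have a2p : (a n ^+ 2 = 1 - s n ^+ 2 * a n ^+ 2 / p)%R.
  by rewrite s2E aE; field; rewrite gt_eqF.
have h1 : (- ln (a n ^+ 2) >= s n ^+ 2 * (a n ^+ 2 * p^-1))%R.
  have := ln_le_sub1 a2; rewrite {2}a2p; lra.
have h2 : (ln (a n ^+ 2) >= - (s n ^+ 2 / p))%R.
  have := @ln_le_sub1 R (a n ^+ 2)^-1; rewrite invr_gt0 => /(_ a2); rewrite lnV//.
  have -> : ((a n ^+ 2)^-1 - 1 = s n ^+ 2 / p)%R.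
    apply: (mulIf (lt0r_neq0 a2)); rewrite mulrBl mulVf ?gt_eqF// mul1r {1}a2p; ring.
  lra.
have -> : (s n ^+ 2 * L n = q n * t n * lam + dl n * (ln K / p) - q n * d%:R * (s n ^+ 2 / p) / 2
   + d%:R * (s n ^+ 2 * (a n ^+ 2 * p^-1) - t n))%R.
  by rewrite /L; field; rewrite !gt_eqF.
rewrite lnk lna /dl.
have h3 := ler_wpM2l (mulr_ge0 (ltW (q0 n)) (ler0n R d)) h2.
have h4 := ler_wpM2l (ler0n R d) h1.
have h5 : ((q n - p) * (ln K / p) = - ((1 - q n / p) * ln K))%R by field; rewrite gt_eqF.
rewrite h5; lra.
Qed.

(** By [mehler_norm] the assumed lower bound on the norms is a lower bound e^(s^2 L n) on the
    integral of v^q, hence 1 + s^2 L n with L -> B. This is the assumption of [smoothing_rate] for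
    every constant below B. *)
Lemma hyper_rate :
  \int[leb d]_x ((p - 1) / p * (2^-1 * ((\sum_i D i x ^+ 2) / rho x) + lnm (rho x)))%:E <=
  ((p - 1) / p * (P - ln (Kd d) + d%:R) - p * lam / 2)%:E.
Proof.
have rho0 x : (0 <= rho x)%R by rewrite mulr_ge0 ?powR_ge0 ?phi_ge0.
have -> : ((p - 1) / p * (P - ln (Kd d) + d%:R) - p * lam / 2 = (p - 1) / p * P - B)%R.
  by rewrite /B /K; ring.
apply/lee_addgt0Pr => e e0.
have -> : ((p - 1) / p * P - B)%:E + e%:E = ((p - 1) / p * P - (B - e))%:E.
  by rewrite -EFinD; congr EFin; ring.
apply: (smoothing_rate p1 crho rho0 rho1 drho mD rhoP s0 cs dl0 cdl).
have /cvgrPdist_le/(_ e e0) hL := cL.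
near=> n.
have : (`|B - L n| <= e)%R by near: n.
rewrite ler_distl => /andP[_ hn].
have cs1 : (c n ^+ 2 + sg n ^+ 2 = 1)%R by rewrite sgE; ring.
have := hN n.
have -> : ouN F (nelson p (t n)) (t n) = _ := 
  @mehler_norm R d F p (c n) (sg n) (a n) (s n) (k n) (nelson p (t n)) p1 (c0 n) (sg0 n) cs1 (a0 n) (aE n) erefl erefl (esym (qE n)) mF F0 rho1.
rewrite -qE.
have -> : (p + dl n = q n)%R by rewrite /dl; ring.
set I := \int[leb d]_x _; set Cf := (_ * _ / _)%R => h.
have Cf0 : (0 < Cf)%R.
  by rewrite /Cf divr_gt0 ?exprn_gt0// mulr_gt0 ?powR_gt0 ?Kd_gt0// invr_gt0 exprn_gt0.
have lnC : (ln Cf = (1 - q n / p) * ln K + q n * (- (d%:R * ln (a n))) - d%:R * ln (k n))%R.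
  have ad : (0 < a n ^- d)%R by rewrite invr_gt0 exprn_gt0.
  rewrite /Cf lnM ?posrE ?mulr_gt0 ?powR_gt0 ?Kd_gt0 ?invr_gt0 ?exprn_gt0//.
  rewrite lnM ?posrE ?powR_gt0 ?Kd_gt0// !ln_powR !lnV ?posrE ?exprn_gt0//.
  by rewrite (lnXn d (a0 n)) (lnXn d (k0 n)) (mulr_natl (ln (a n)) d) (mulr_natl (ln (k n)) d).
have h2 : (expR (q n * t n * lam - ln Cf))%:E <= I.
  have Ci : (0 <= Cf^-1)%R by rewrite invr_ge0 ltW.
  have := @lee_wpmul2l R (Cf^-1)%:E; rewrite lee_fin => /(_ Ci _ _ h).
  rewrite muleA -!EFinM mulVf ?gt_eqF// mul1e; apply: le_trans.
  by rewrite lee_fin expRB lnK ?posrE// mulrC.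
apply: le_trans h2; rewrite lee_fin; apply: le_trans (expR_ge1Dx _); rewrite lerD2l lnC.
apply: le_trans (Lub n); rewrite ler_wpM2l ?exprn_ge0 ?(ltW (s0 n))//; lra.
Unshelve. all: by end_near. Qed.
End hyper_rate.

(** * Entropy of a rotated product *)

Section row_C1.
Context {R : realType}.
Local Open Scope ereal_scope.
Local Notation mu := (@lebesgue_measure R).

(* C^1 with gradient D.  The derivative along a line is only required at its
   origin x, which is no restriction since x is arbitrary. *)
Definition row_C1 d (r : 'rV[R]_d -> R) (D : 'I_d -> 'rV[R]_d -> R) : Prop :=
  [/\ continuous r, forall i, continuous (D i) &
    forall x y : 'rV[R]_d, is_derive (0%R : R) 1%R (fun s : R => r (x + s *: y)%R)
      (\sum_i y 0%R i * D i x)%R].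

Lemma continuous_line d (x y : 'rV[R]_d) : continuous (fun s : R => x + s *: y)%R.
Proof.
move=> s; apply: (@cvgD _ _ _ _ _ (cst x) (fun s => s *: y)%R); first exact: cvg_cst.
by apply: cvgZr_tmp; exact: cvg_id.
Qed.

Lemma is_derive_shift (f : R -> R) (s l : R) :
  is_derive (0%R : R) 1%R (fun u => f (s + u)%R) l -> is_derive s 1%R f l.
Proof.
move=> h.
have dT : is_derive s 1%R (fun u : R => u - s)%R 1%R.
  by apply: (is_derive_eq (is_deriveB (is_derive_id s 1%R) (is_derive_cst s s 1%R))); rewrite subr0.
have h' : is_derive (s - s)%R 1%R (fun u => f (s + u)%R) l by rewrite subrr.
have := @is_derive1_comp R (fun u => f (s + u)%R) (fun u => u - s)%R s _ _ h' dT.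
rewrite mulr1 (_ : (fun u => f (s + u)%R) \o (fun u => u - s)%R = f)//.
by apply/funext => u /=; congr f; ring.
Qed.

Lemma row_C1_line d (r : 'rV[R]_d -> R) D : row_C1 r D -> forall (x y : 'rV[R]_d) (s : R),
  is_derive s 1%R (fun s : R => r (x + s *: y)%R) (\sum_i y 0%R i * D i (x + s *: y))%R.
Proof.
move=> [_ _ h] x y s; apply: is_derive_shift.
have := h (x + s *: y)%R y.
rewrite (_ : (fun u => r (x + s *: y + u *: y)%R) = (fun u => r (x + (s + u) *: y)%R))//.
by apply/funext => u; rewrite -addrA scalerDl.
Qed.

Lemma sum_delta d (i : 'I_d) (G : 'I_d -> R) :
  (\sum_j (delta_mx 0%R i : 'rV[R]_d) 0 j * G j = G i)%R.
Proof.
rewrite (bigD1 i)//= mxE !eqxx mul1r big1 ?addr0// => j ji.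
by rewrite mxE (negbTE ji) andbF mul0r.
Qed.

Lemma row_C1_line_C1 d (r : 'rV[R]_d -> R) D : row_C1 r D -> line_C1 r D.
Proof.
move=> h; have [cr cD _] := h; split.
- exact: continuous_measurable_row.
- by move=> i; exact: continuous_measurable_row.
- move=> i x s; have := row_C1_line h x (delta_mx 0%R i) s.
  by rewrite (sum_delta i (fun j => D j (x + s *: delta_mx 0%R i)%R)).
- move=> i x s; apply: (cvg_comp (fun s : R => x + s *: delta_mx 0%R i)%R (D i)).
    exact: continuous_line.
  exact: cD.
Qed.

Lemma row_C1_affine d (r : 'rV[R]_d -> R) D (a : R) (b : 'rV[R]_d) : row_C1 r D ->
  row_C1 (fun x => r (b + a *: x)%R) (fun i x => a * D i (b + a *: x))%R.
Proof.
move=> h; have [cr cD dr] := h.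
have ca : continuous (fun x : 'rV[R]_d => b + a *: x)%R.
  by move=> x; exact: (cvgD (cvg_cst b) (@scaler_continuous _ _ a x)).
split.
- by move=> x; apply: (cvg_comp (fun x : 'rV[R]_d => b + a *: x)%R r); [exact: ca|exact: cr].
- move=> i x; have h1 := cvg_comp (fun x : 'rV[R]_d => b + a *: x)%R (D i) (ca x) (cD i _).
  exact: (cvgM (cvg_cst a) h1).
- move=> x y; have := dr (b + a *: x)%R (a *: y)%R.
  rewrite (_ : (fun s => r (b + a *: x + s *: (a *: y))%R) = (fun s => r (b + a *: (x + s *: y))%R)).
    by move=> h'; apply: (is_derive_eq h'); apply: eq_bigr => i _; rewrite mxE; ring.
  by apply/funext => s; congr r; rewrite scalerDr addrA !scalerA mulrC.
Qed.

Lemma row_C1M d (r1 r2 : 'rV[R]_d -> R) D1 D2 : row_C1 r1 D1 -> row_C1 r2 D2 ->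
  row_C1 (fun x => r1 x * r2 x)%R (fun i x => r1 x * D2 i x + r2 x * D1 i x)%R.
Proof.
move=> [c1 cD1 d1] [c2 cD2 d2]; split.
- by move=> x; exact: (cvgM (c1 x) (c2 x)).
- by move=> i x; exact: (cvgD (cvgM (c1 x) (cD2 i x)) (cvgM (c2 x) (cD1 i x))).
- move=> x y; apply: (is_derive_eq (is_deriveM (d1 x y) (d2 x y))).
  rewrite !scale0r !addr0 /GRing.scale/= !mulr_sumr -big_split/=.
  by apply: eq_bigr => i _; ring.
Qed.

Lemma row_C1_eq0 d (r : 'rV[R]_d -> R) D x i : row_C1 r D -> (forall x, 0 <= r x)%R ->
  r x = 0%R -> D i x = 0%R.
Proof.
move=> h r0 rx; pose f (s : R) := r (x + s *: delta_mx 0%R i)%R.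
have df (s : R) : is_derive s 1%R f (D i (x + s *: delta_mx 0%R i)%R).
  by have := row_C1_line h x (delta_mx 0%R i) s; rewrite (sum_delta i (fun j => D j _)).
have f0 : f 0%R = 0%R by rewrite /f scale0r addr0.
have d0 : D i x = D i (x + (0%R : R) *: delta_mx 0%R i)%R by rewrite scale0r addr0.
rewrite d0.
have := @derive1_at_min R f (- 1)%R 1%R 0%R _ _ _ _.
have [_ <-] := df 0%R; move=> [].
- by lra.
- by move=> t _; have [] := df t.
- by rewrite in_itv/=; lra.
- by move=> t _; rewrite f0; exact: r0.
- by [].
Qed.

(** * The integral of a partial derivative vanishes *)

Section divergence.
Context {d : nat}.
Variables (r : 'rV[R]_d -> R) (D : 'I_d -> 'rV[R]_d -> R) (m : R) (i : 'I_d).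
Hypotheses (rD : row_C1 r D) (r0 : forall x, (0 <= r x)%R) (rm : \int[leb d]_x (r x)%:E = m%:E).

Let e : 'rV[R]_d := delta_mx 0%R i.
Let Dp x := Num.max (D i x) 0%R.
Let Dn x := Num.max (- D i x)%R 0%R.
Let w (u : R) : R := \1_(`[0%R, 1%R] : set R) u.

Let mr : measurable_fun setT r.
Proof. by have [cr _ _] := rD; exact: continuous_measurable_row. Qed.
Let mD : measurable_fun setT (D i).
Proof. by have [_ cD _] := rD; exact: continuous_measurable_row. Qed.
Let mDp : measurable_fun setT Dp. Proof. by rewrite /Dp; meas. Qed.
Let mDn : measurable_fun setT Dn. Proof. by rewrite /Dn; meas. Qed.
Let Dp0 x : (0 <= Dp x)%R. Proof. by rewrite le_max lexx orbT. Qed.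
Let Dn0 x : (0 <= Dn x)%R. Proof. by rewrite le_max lexx orbT. Qed.
Let w0 u : (0 <= w u)%R. Proof. by rewrite /w indicE. Qed.
Let mw : measurable_fun setT w. Proof. exact: measurable_indic. Qed.

Let DpDn x : (Dp x - Dn x = D i x)%R.
Proof.
rewrite /Dp /Dn; have /orP[h|h] := le_total 0%R (D i x).
  by rewrite max_l// max_r ?subr0// oppr_le0.
by rewrite max_r// max_l ?sub0r ?opprK// oppr_ge0.
Qed.

Let integral_w (g : R -> R) : \int[mu]_(u in `[0%R, 1%R]) (g u)%:E = \int[mu]_u (w u * g u)%:E.
Proof.
rewrite integral_mkcond; apply: eq_integral => u _; rewrite patchE /w indicE.
by case: ifP => _; rewrite ?mul1r ?mul0r.
Qed.

Let step x : (r (x + e)%R)%:E + \int[mu]_u (w u * Dn (x + u *: e)%R)%:E =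
  (r x)%:E + \int[mu]_u (w u * Dp (x + u *: e)%R)%:E.
Proof.
have [cr cD _] := rD.
have cl := @continuous_line d x e.
have cDi : continuous (fun u : R => D i (x + u *: e)%R).
  by move=> u; apply: (cvg_comp (fun u : R => x + u *: e)%R (D i)); [exact: cl|exact: cD].
have cmax : continuous (fun z : R => Num.max z 0%R).
  by move=> z; apply: continuous_max; [exact: cvg_id|exact: cvg_cst].
have cDp : continuous (fun u : R => Dp (x + u *: e)%R).
  by move=> u; exact: (cvg_comp (fun u : R => D i (x + u *: e)%R) _ (cDi u) (cmax _)).
have cDn : continuous (fun u : R => Dn (x + u *: e)%R).
  have -> : (fun u : R => Dn (x + u *: e)%R) = (fun u => Dp (x + u *: e) - D i (x + u *: e))%R.
    by apply/funext => u; rewrite -DpDn; ring.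
  by move=> u; exact: (cvgB (cDp u) (cDi u)).
have int (f : R -> R) : continuous f -> mu.-integrable `[0%R, 1%R] (EFin \o f).
  move=> cf; apply: continuous_compact_integrable; first exact: segment_compact.
  exact: continuous_subspaceT.
have df (s : R) : is_derive s 1%R (fun s => r (x + s *: e)%R) (D i (x + s *: e)%R).
  by have := row_C1_line rD x e s; rewrite (sum_delta i (fun j => D j _)).
have FTC : \int[mu]_(u in `[0%R, 1%R]) (D i (x + u *: e)%R)%:E = (r (x + e) - r x)%:E.
  rewrite (continuous_FTC2 (F := fun s => r (x + s *: e)%R) (@ltr01 R)).
  - by rewrite scale1r scale0r addr0 EFinB.
  - exact: continuous_subspaceT.
  - have cG := continuous_is_derive df.
    split=> [u _||]; first by have [] := df u.
    + by apply: cvg_at_right_filter; exact: cG.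
    + by apply: cvg_at_left_filter; exact: cG.
  - by move=> u _; rewrite derive1E; have [] := df u.
have FTC2 : \int[mu]_(u in `[0%R, 1%R]) (Dp (x + u *: e)%R)%:E -
    \int[mu]_(u in `[0%R, 1%R]) (Dn (x + u *: e)%R)%:E = (r (x + e) - r x)%:E.
  rewrite -FTC -integralB_EFin//; [|exact: int|exact: int].
  by apply: eq_integral => u _; rewrite /= -EFinB DpDn.
have fp : \int[mu]_(u in `[0%R, 1%R]) (Dp (x + u *: e)%R)%:E \is a fin_num.
  by apply: integrable_fin_num => //; exact: int.
have fn : \int[mu]_(u in `[0%R, 1%R]) (Dn (x + u *: e)%R)%:E \is a fin_num.
  by apply: integrable_fin_num => //; exact: int.
rewrite -!integral_w.
move: FTC2; rewrite -(fineK fp) -(fineK fn) -EFinB -!EFinD => -[h].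
by congr EFin; lra.
Qed.

Let avg (g : 'rV[R]_d -> R) : measurable_fun setT g -> (forall x, 0 <= g x)%R ->
  \int[leb d]_x \int[mu]_u (w u * g (x + u *: e)%R)%:E = \int[leb d]_x (g x)%:E.
Proof.
move=> mg g0.
have mf : measurable_fun setT (fun z : 'rV[R]_d * measurableTypeR R => (w z.2 * g (z.1 + z.2 *: e)%R)%:E).
  have h : measurable_fun setT (fun z : 'rV[R]_d * measurableTypeR R => (z.1 + z.2 *: e)%R).
    apply: measurable_rowP => j; under eq_fun do rewrite !mxE.
    apply: measurable_funD; first exact: (measurableT_comp (measurable_coord j) measurable_fst).
    by apply: measurable_funM; [exact: measurable_snd|exact: measurable_cst].
  have h2 : measurable_fun setT (fun z : 'rV[R]_d * measurableTypeR R => w z.2).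
    exact: (measurableT_comp mw measurable_snd).
  by meas.
rewrite (fubini_tonelli _ mf) /=; last by move=> z; rewrite lee_fin mulr_ge0.
have e1 u : \int[leb d]_x (w u * g (x + u *: e)%R)%:E = \int[leb d]_x (g x)%:E * (w u)%:E.
  rewrite ge0_integralZ//; last by meas.
  by rewrite leb_shift// muleC.
under eq_integral do rewrite e1.
rewrite ge0_integralZl//; last 3 first.
- exact/measurable_EFinP.
- by move=> u _; rewrite lee_fin.
- exact: ge0_integral_real_ge0.
suff : \int[mu]_u (w u)%:E = 1 by move=> ->; rewrite mule1.
rewrite integral_indic// setIT; apply: etrans (lebesgue_measure_itv `[0%R, 1%R]) _.
by rewrite /= lte_fin ltr01 oppr0 adde0.
Qed.

(* Integrate r(x + e_i) - r(x) = int_0^1 D_i(x + u e_i) du in x and use the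
   translation invariance of Lebesgue measure. *)
Lemma divergence0 : \int[leb d]_x (Num.max (D i x) 0)%:E = \int[leb d]_x (Num.max (- D i x) 0)%:E.
Proof.
have mA (g : 'rV[R]_d -> R) : measurable_fun setT g -> (forall x, 0 <= g x)%R ->
    measurable_fun setT (fun x : 'rV[R]_d => \int[mu]_u (w u * g (x + u *: e)%R)%:E).
  move=> mg g0.
  apply: (@measurable_fun_fubini_tonelli_F _ _ _ _ R mu (fun z : 'rV[R]_d * measurableTypeR R => (w z.2 * g (z.1 + z.2 *: e)%R)%:E)).
    have h : measurable_fun setT (fun z : 'rV[R]_d * measurableTypeR R => (z.1 + z.2 *: e)%R).
      apply: measurable_rowP => j; under eq_fun do rewrite !mxE.
      apply: measurable_funD; first exact: (measurableT_comp (measurable_coord j) measurable_fst).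
      by apply: measurable_funM; [exact: measurable_snd|exact: measurable_cst].
    have h2 : measurable_fun setT (fun z : 'rV[R]_d * measurableTypeR R => w z.2).
      exact: (measurableT_comp mw measurable_snd).
    by meas.
  by move=> z; rewrite lee_fin mulr_ge0.
have A0 (g : 'rV[R]_d -> R) x : (forall x, 0 <= g x)%R -> 0 <= \int[mu]_u (w u * g (x + u *: e)%R)%:E.
  by move=> g0; apply: ge0_integral_real_ge0 => u; rewrite mulr_ge0.
have : \int[leb d]_x ((r (x + e)%R)%:E + \int[mu]_u (w u * Dn (x + u *: e)%R)%:E) =
   \int[leb d]_x ((r x)%:E + \int[mu]_u (w u * Dp (x + u *: e)%R)%:E).
  by apply: eq_integral => x _; exact: step.
have m1 : measurable_fun setT (fun x : 'rV[R]_d => (r (x + e)%R)%:E) by meas.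
have m2 : measurable_fun setT (fun x : 'rV[R]_d => (r x)%:E) by meas.
rewrite (ge0_integralDe (leb d) m1 (mA _ mDn Dn0) (fun x => r0 _ : 0 <= (r (x + e)%R)%:E) (fun x => A0 _ x Dn0)).
rewrite (ge0_integralDe (leb d) m2 (mA _ mDp Dp0) (fun x => r0 _ : 0 <= (r x)%:E) (fun x => A0 _ x Dp0)).
rewrite !avg// leb_shift// rm addeC [RHS]addeC => h.
by have := adde_fin_eq (esym h); rewrite subrr adde0.
Qed.
End divergence.
End row_C1.

(** * Cross terms and entropies of products *)

Section cross.
Context {R : realType} {d : nat}.
Local Open Scope ereal_scope.

Lemma ge0_integralZre (F : 'rV[R]_d -> R) (X : \bar R) : measurable_fun setT F ->
  (forall x, 0 <= F x)%R -> 0 <= X ->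
  \int[leb d]_x ((F x)%:E * X) = \int[leb d]_x (F x)%:E * X.
Proof.
move=> mF F0 X0; under eq_integral do rewrite muleC.
rewrite ge0_integralZl//; first by rewrite muleC.
- exact/measurable_EFinP.
- by move=> u _; rewrite lee_fin.
Qed.

(** The term k f g is signed, and integrability is only available for g. For fixed x the two parts
    of g have the same finite integral b; after f(x) and g are split into parts, adding the negative
    terms on both sides leaves equal real numbers, which cancel. *)
Lemma cross_integral (rX rY A B f g : 'rV[R]_d -> R) (k b : R) (Q : 'rV[R]_d -> 'rV[R]_d -> R) :
  measurable_fun setT rX -> measurable_fun setT rY -> measurable_fun setT A ->
  measurable_fun setT B -> measurable_fun setT f -> measurable_fun setT g ->
  (forall x, measurable_fun setT (Q x)) ->
  (forall x, 0 <= rX x)%R -> (forall x, 0 <= rY x)%R -> (forall x, 0 <= A x)%R ->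
  (forall x, 0 <= B x)%R -> (forall x y, 0 <= Q x y)%R -> (0 <= k)%R ->
  \int[leb d]_x (rX x)%:E = 1 -> \int[leb d]_x (rY x)%:E = 1 ->
  (forall x y, Q x y = A x * rY y + B y * rX x - k * (f x * g y))%R ->
  \int[leb d]_y (Num.max (g y) 0)%:E = b%:E -> \int[leb d]_y (Num.max (- g y) 0)%:E = b%:E ->
  \int[leb d]_x \int[leb d]_y (Q x y)%:E = \int[leb d]_x (A x)%:E + \int[leb d]_x (B x)%:E.
Proof.
move=> mX mY mA mB mf mg mQ X0 Y0 A0 B0 Q0 k0 X1 Y1 QE gp gn.
pose pp (z : R) := Num.max z 0%R; pose nn (z : R) := Num.max (- z)%R 0%R.
have pp0 z : (0 <= pp z)%R by rewrite le_max lexx orbT.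
have nn0 z : (0 <= nn z)%R by rewrite le_max lexx orbT.
have ppnn z : (z = pp z - nn z)%R.
  rewrite /pp /nn; have /orP[h|h] := le_total 0%R z.
    by rewrite max_l// max_r ?subr0// oppr_le0.
  by rewrite max_r// max_l ?sub0r ?opprK// oppr_ge0.
have mgp : measurable_fun setT (fun y => pp (g y)) by rewrite /pp; meas.
have mgn : measurable_fun setT (fun y => nn (g y)) by rewrite /nn; meas.
have B0' : 0 <= \int[leb d]_y (B y)%:E by exact: ge0_integral_real_ge0.
have inner x : \int[leb d]_y (Q x y)%:E = (A x)%:E + (rX x)%:E * \int[leb d]_y (B y)%:E.
  pose u := (k * pp (f x))%R; pose v := (k * nn (f x))%R.
  have u0 : (0 <= u)%R by rewrite mulr_ge0.
  have v0 : (0 <= v)%R by rewrite mulr_ge0.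
  have e1 : \int[leb d]_y (Q x y + (u * pp (g y) + v * nn (g y)))%:E =
     \int[leb d]_y ((A x * rY y + rX x * B y) + (u * nn (g y) + v * pp (g y)))%:E.
    apply: eq_integral => y _; congr EFin; rewrite QE {1}(ppnn (f x)) {1}(ppnn (g y)) /u /v.
    by ring.
  have mq := mQ x.
  have h1 : measurable_fun setT (fun y => u * pp (g y))%R by meas.
  have h2 : measurable_fun setT (fun y => v * nn (g y))%R by meas.
  have h3 : measurable_fun setT (fun y => u * nn (g y))%R by meas.
  have h4 : measurable_fun setT (fun y => v * pp (g y))%R by meas.
  have h5 : measurable_fun setT (fun y => A x * rY y)%R by meas.
  have h6 : measurable_fun setT (fun y => rX x * B y)%R by meas.
  have h12 := measurable_funD h1 h2; have h34 := measurable_funD h3 h4.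
  have h56 := measurable_funD h5 h6.
  have k1 y := mulr_ge0 u0 (pp0 (g y)); have k2 y := mulr_ge0 v0 (nn0 (g y)).
  have k3 y := mulr_ge0 u0 (nn0 (g y)); have k4 y := mulr_ge0 v0 (pp0 (g y)).
  have k5 y := mulr_ge0 (A0 x) (Y0 y); have k6 y := mulr_ge0 (X0 x) (B0 y).
  move: e1.
  rewrite (ge0_integralDr (leb d) mq h12 (Q0 x) (fun y => addr_ge0 (k1 y) (k2 y))).
  rewrite (ge0_integralDr (leb d) h56 h34 (fun y => addr_ge0 (k5 y) (k6 y)) (fun y => addr_ge0 (k3 y) (k4 y))).
  rewrite (ge0_integralDr (leb d) h1 h2 k1 k2) (ge0_integralDr (leb d) h3 h4 k3 k4) (ge0_integralDr (leb d) h5 h6 k5 k6).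
  rewrite (ge0_integralZ (leb d) mgp (fun y => pp0 _) u0) (ge0_integralZ (leb d) mgn (fun y => nn0 _) v0).
  rewrite (ge0_integralZ (leb d) mgn (fun y => nn0 _) u0) (ge0_integralZ (leb d) mgp (fun y => pp0 _) v0).
  rewrite gp gn (ge0_integralZ (leb d) mY Y0 (A0 x)) (ge0_integralZ (leb d) mB B0 (X0 x)) Y1 mule1.
  by rewrite -!EFinM -!EFinD => /adde_fin_eq ->; rewrite subrr adde0.
under eq_integral do rewrite inner.
rewrite ge0_integralDe.
- by rewrite (ge0_integralZre mX X0 B0') X1 mul1e.
- exact/measurable_EFinP.
- by apply: emeasurable_funM; [exact/measurable_EFinP|exact: measurable_cst].
- by move=> x; rewrite lee_fin.
- by move=> x; rewrite mule_ge0// lee_fin.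
Qed.

Lemma klM (m a b : R) : (0 <= m)%R -> (0 <= a)%R -> (0 < b)%R -> (kl (m * a) (m * b) = m * kl a b)%R.
Proof.
move=> m0 a0 b0; have [->|mn] := eqVneq m 0%R; first by rewrite !mul0r kl0.
have mp : (0 < m)%R by rewrite lt0r mn.
rewrite !klE ?mulr_ge0 ?mulr_gt0//.
have [->|an] := eqVneq a 0%R; first by rewrite !mulr0 !mul0r; ring.
have ap : (0 < a)%R by rewrite lt0r an.
by rewrite !lnM ?posrE//; ring.
Qed.

(** Chain rule in y: for fixed x the section rX(x) rY has mass rX(x), and its entropy relative to
    its mass times phi is rX(x) times that of rY. *)
Lemma kl_tensor (rX rY : 'rV[R]_d -> R) :
  measurable_fun setT rX -> measurable_fun setT rY ->
  (forall x, 0 <= rX x)%R -> (forall x, 0 <= rY x)%R ->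
  \int[leb d]_x (rX x)%:E = 1 -> \int[leb d]_x (rY x)%:E = 1 ->
  \int[leb d]_x \int[leb d]_y (kl (rX x * rY y) (phi x * phi y))%:E =
  \int[leb d]_x (kl (rX x) (phi x))%:E + \int[leb d]_x (kl (rY x) (phi x))%:E.
Proof.
move=> mX mY X0 Y0 X1 Y1.
have mp := @measurable_phi R d.
have mkY : measurable_fun setT (fun x : 'rV[R]_d => kl (rY x) (phi x)) by meas.
have kY0 x : (0 <= kl (rY x) (phi x))%R by rewrite kl_ge0// phi_gt0.
have IY0 : 0 <= \int[leb d]_x (kl (rY x) (phi x))%:E by exact: ge0_integral_real_ge0.
have inner x : \int[leb d]_y (kl (rX x * rY y) (phi x * phi y))%:E =
   (kl (rX x) (phi x))%:E + (rX x)%:E * \int[leb d]_x (kl (rY x) (phi x))%:E.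
  have m1 : measurable_fun setT (fun y => rX x * rY y)%R by meas.
  have I1 : \int[leb d]_y (rX x * rY y)%:E = (rX x)%:E.
    by rewrite (ge0_integralZ (leb d) mY Y0 (X0 x)) Y1 mule1.
  rewrite (kl_chain m1 (fun y => mulr_ge0 (X0 x) (Y0 y)) I1 mp (@phi_gt0 R d) (integral_phi d) (phi_gt0 x)).
  rewrite addeC; congr (_ + _).
  have [->|xn] := eqVneq (rX x) 0%R; first by rewrite mul0e.
  rewrite -(ge0_integralZ (leb d) mkY kY0 (X0 x)).
  by apply: eq_integral => y _; rewrite klM// phi_gt0.
under eq_integral do rewrite inner.
rewrite ge0_integralDe.
- by rewrite (ge0_integralZre mX X0 IY0) X1 mul1e.
- by meas.
- by apply: emeasurable_funM; [exact/measurable_EFinP|exact: measurable_cst].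
- by move=> x; rewrite lee_fin kl_ge0// phi_gt0.
- by move=> x; rewrite mule_ge0// lee_fin.
Qed.
End cross.

(** * The entropy inequality behind the mixture *)

Section static.
Context {R : realType} {d : nat}.
Local Open Scope ereal_scope.
Variables (rX rY : 'rV[R]_d -> R) (DX DY : 'I_d -> 'rV[R]_d -> R) (c s : R).
Hypotheses (cX : row_C1 rX DX) (cY : row_C1 rY DY)
  (X0 : forall x, (0 <= rX x)%R) (Y0 : forall x, (0 <= rY x)%R)
  (X1 : \int[leb d]_x (rX x)%:E = 1) (Y1 : \int[leb d]_x (rY x)%:E = 1)
  (c0 : (0 < c)%R) (s0 : (0 < s)%R) (cs : (c ^+ 2 + s ^+ 2 = 1)%R)
  (Yc : forall i, \int[leb d]_y (Num.max (y 0%R i * rY y) 0)%:E =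
     \int[leb d]_y (Num.max (- (y 0%R i * rY y)) 0)%:E)
  (Yf : forall i, \int[leb d]_y (Num.max (y 0%R i * rY y) 0)%:E < +oo)
  (IY : forall i, \int[leb d]_y (DY i y ^+ 2 / rY y)%:E < +oo).

(** For fixed z this is the function of w fed to the logarithmic Sobolev inequality; [Dh] is its
    gradient in w and [mixed_density] its integral. *)
Let h (z w : 'rV[R]_d) : R := (rX (c *: z + s *: w) * rY (s *: z - c *: w))%R.
Let Dh i (z w : 'rV[R]_d) : R := (s * DX i (c *: z + s *: w) * rY (s *: z - c *: w) -
   c * rX (c *: z + s *: w) * DY i (s *: z - c *: w))%R.
Let m2 (r : 'rV[R]_d -> R) i := \int[leb d]_x (x 0%R i ^+ 2 * r x)%:E.
Let fi (r : 'rV[R]_d -> R) (D : 'I_d -> 'rV[R]_d -> R) i := \int[leb d]_x (D i x ^+ 2 / r x)%:E.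

Definition mixed_density (z : 'rV[R]_d) : R :=
  fine (\int[leb d]_w (rX (c *: z + s *: w) * rY (s *: z - c *: w))%:E).

Let mX : measurable_fun setT rX. Proof. by case: cX => h1 _ _; exact: continuous_measurable_row. Qed.
Let mY : measurable_fun setT rY. Proof. by case: cY => h1 _ _; exact: continuous_measurable_row. Qed.
Let mDX i : measurable_fun setT (DX i). Proof. by case: cX => _ h1 _; exact: continuous_measurable_row. Qed.
Let mDY i : measurable_fun setT (DY i). Proof. by case: cY => _ h1 _; exact: continuous_measurable_row. Qed.

Let h0 z w : (0 <= h z w)%R. Proof. exact: mulr_ge0. Qed.

Let rowh z : row_C1 (h z) (fun i => Dh i z).
Proof.
have h1 := row_C1_affine s (c *: z) cX.
have h2 := row_C1_affine (- c) (s *: z) cY.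
have := row_C1M h1 h2.
have -> : (fun x => rX (c *: z + s *: x) * rY (s *: z + - c *: x))%R = h z.
  by apply/funext => w; rewrite scaleNr.
suff -> : (fun i x => rX (c *: z + s *: x) * (- c * DY i (s *: z + - c *: x)) +
   rY (s *: z + - c *: x) * (s * DX i (c *: z + s *: x)))%R = (fun i => Dh i z) by [].
by apply/funext => i; apply/funext => w; rewrite scaleNr /Dh; ring.
Qed.

Let mp1 : measurable_fun setT (fun u : 'rV[R]_d * 'rV[R]_d => c *: u.1 + s *: u.2)%R.
Proof. by meas. Qed.
Let mp2 : measurable_fun setT (fun u : 'rV[R]_d * 'rV[R]_d => s *: u.1 - c *: u.2)%R.
Proof. by meas. Qed.
Let mh : measurable_fun setT (fun u : 'rV[R]_d * 'rV[R]_d => h u.1 u.2).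
Proof. exact: (measurable_funM (measurableT_comp mX mp1) (measurableT_comp mY mp2)). Qed.
Let mhz z : measurable_fun setT (h z).
Proof. by case: (rowh z) => k1 _ _; exact: continuous_measurable_row. Qed.
Let mDhz i z : measurable_fun setT (Dh i z).
Proof. by case: (rowh z) => _ k1 _; exact: continuous_measurable_row. Qed.
Let mDh i : measurable_fun setT (fun u : 'rV[R]_d * 'rV[R]_d => Dh i u.1 u.2).
Proof.
have k1 := measurableT_comp mX mp1; have k2 := measurableT_comp mY mp2.
have k3 := measurableT_comp (mDX i) mp1; have k4 := measurableT_comp (mDY i) mp2.
exact: (measurable_funB (measurable_funM (measurable_funM (measurable_cst s) k3) k2)
  (measurable_funM (measurable_funM (measurable_cst c) k1) k4)).
Qed.

Let N z := \int[leb d]_w (h z w)%:E.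
Let N0 z : 0 <= N z. Proof. by apply: ge0_integral_real_ge0 => w. Qed.
Let mN : measurable_fun setT N.
Proof.
apply: (@measurable_fun_fubini_tonelli_F _ _ _ _ R (leb d) (fun u : 'rV[R]_d * 'rV[R]_d => (h u.1 u.2)%:E)).
  exact/measurable_EFinP.
by move=> u; rewrite lee_fin.
Qed.

Let refl (k : 'rV[R]_d -> 'rV[R]_d -> R) :
  measurable_fun setT (fun u : 'rV[R]_d * 'rV[R]_d => k u.1 u.2) -> (forall x y, 0 <= k x y)%R ->
  \int[leb d]_z \int[leb d]_w (k (c *: z + s *: w) (s *: z - c *: w))%:E =
  \int[leb d]_x \int[leb d]_y (k x y)%:E.
Proof.
move=> mk k0; apply: (@leb_reflection R d c s (fun u => (k u.1 u.2)%:E)) => //.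
  exact/measurable_EFinP.
by move=> u; rewrite lee_fin.
Qed.

Let mXY : measurable_fun setT (fun u : 'rV[R]_d * 'rV[R]_d => (rX u.1 * rY u.2)%R).
Proof.
exact: (measurable_funM (measurableT_comp mX measurable_fst) (measurableT_comp mY measurable_snd)).
Qed.

Let N1 : \int[leb d]_z N z = 1.
Proof.
rewrite (refl (k := fun x y => rX x * rY y)%R mXY); last by move=> x y; exact: mulr_ge0.
under eq_integral do rewrite (ge0_integralZ (leb d) mY Y0 (X0 _)) Y1 mule1.
exact: X1.
Qed.

Let Nfin : {ae leb d, forall z, N z \is a fin_num}.
Proof. by apply: ge0_integral_fin_ae => //; rewrite N1 ltry. Qed.

Let nr := mixed_density.
Let nr0 z : (0 <= nr z)%R. Proof. by rewrite fine_ge0//; exact: N0. Qed.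
Let mnr : measurable_fun setT nr. Proof. exact: measurableT_comp mN. Qed.
Let nr1 : \int[leb d]_z (nr z)%:E = 1.
Proof.
rewrite -N1; apply: ae_eq_integral => //.
- exact/measurable_EFinP.
- by apply: (ae_imp Nfin) => z fz _; rewrite fineK.
Qed.

Lemma mixed_density_ge0 z : (0 <= mixed_density z)%R. Proof. exact: nr0. Qed.
Lemma measurable_mixed_density : measurable_fun setT mixed_density. Proof. exact: mnr. Qed.
Lemma integral_mixed_density : \int[leb d]_z (mixed_density z)%:E = 1. Proof. exact: nr1. Qed.

(** The reflection is its own inverse: with x = c z + s w and y = s z - c w one has c x + s y = z,
    so integrating out w leaves the law of c X + s Y. *)
Lemma mixed_density_law (k : 'rV[R]_d -> R) : measurable_fun setT k -> (forall x, 0 <= k x)%R ->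
  \int[leb d]_x \int[leb d]_y (rX x * rY y * k (c *: x + s *: y)%R)%:E =
  \int[leb d]_z (mixed_density z * k z)%:E.
Proof.
move=> mk k0.
have zE (z w : 'rV[R]_d) : (c *: (c *: z + s *: w) + s *: (s *: z - c *: w) = z)%R.
  by apply/rowP => i; rewrite !mxE -[RHS]mul1r -cs; ring.
have mkp : measurable_fun setT (fun u : 'rV[R]_d * 'rV[R]_d => k (c *: u.1 + s *: u.2)%R).
  exact: (measurableT_comp mk mp1).
rewrite -(refl (k := fun x y => rX x * rY y * k (c *: x + s *: y))%R); last 2 first.
- exact: (measurable_funM mXY mkp).
- by move=> x y; rewrite !mulr_ge0.
transitivity (\int[leb d]_z (N z * (k z)%:E)).
  apply: eq_integral => z _; rewrite muleC -(ge0_integralZ (leb d) (mhz z) (h0 z) (k0 z)).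
  by apply: eq_integral => w _; rewrite zE mulrC.
have mkE : measurable_fun setT (fun z => (k z)%:E) by exact/measurable_EFinP.
have mnk : measurable_fun setT (fun z => mixed_density z * k z)%R := measurable_funM mnr mk.
apply: ae_eq_integral => //.
- exact: emeasurable_funM.
- exact/measurable_EFinP.
- by apply: (ae_imp Nfin) => z fz _; rewrite EFinM /mixed_density fineK.
Qed.

Let wE (i : 'I_d) (z w : 'rV[R]_d) : (w 0 i = s * (c *: z + s *: w)%R 0 i - c * (s *: z - c *: w)%R 0 i)%R.
Proof.
rewrite !mxE; transitivity ((c ^+ 2 + s ^+ 2) * w 0 i)%R; first by rewrite cs mul1r.
by ring.
Qed.

Let mc1 i : measurable_fun setT (fun u : 'rV[R]_d * 'rV[R]_d => u.1 0%R i).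
Proof. exact: (measurableT_comp (measurable_coord i) measurable_fst). Qed.
Let mc2 i : measurable_fun setT (fun u : 'rV[R]_d * 'rV[R]_d => u.2 0%R i).
Proof. exact: (measurableT_comp (measurable_coord i) measurable_snd). Qed.

(** Since w = s x - c y, the square expands into the two second moments and a cross term, which
    [cross_integral] removes by centring of Y. *)
Let second_moment i :
  \int[leb d]_z \int[leb d]_w (w 0%R i ^+ 2 * h z w)%:E = (s ^+ 2)%:E * m2 rX i + (c ^+ 2)%:E * m2 rY i.
Proof.
pose k (x y : 'rV[R]_d) : R := ((s * x 0 i - c * y 0 i) ^+ 2 * (rX x * rY y))%R.
have -> : \int[leb d]_z \int[leb d]_w (w 0%R i ^+ 2 * h z w)%:E =
   \int[leb d]_z \int[leb d]_w (k (c *: z + s *: w)%R (s *: z - c *: w)%R)%:E.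
  by apply: eq_integral => z _; apply: eq_integral => w _; rewrite /k -wE.
have mk : measurable_fun setT (fun u : 'rV[R]_d * 'rV[R]_d => k u.1 u.2).
  have a1 := mc1 i; have a2 := mc2 i; rewrite /k.
  apply: measurable_funM => //; apply: measurable_funX; apply: measurable_funB.
    by apply: measurable_funM => //; exact: measurable_cst.
  by apply: measurable_funM => //; exact: measurable_cst.
rewrite refl//; last by move=> x y; rewrite mulr_ge0 ?sqr_ge0// mulr_ge0.
have mi := @measurable_coord R d i.
have mA : measurable_fun setT (fun x : 'rV[R]_d => s ^+ 2 * (x 0 i ^+ 2 * rX x))%R by meas.
have mB : measurable_fun setT (fun x : 'rV[R]_d => c ^+ 2 * (x 0 i ^+ 2 * rY x))%R by meas.
have mf : measurable_fun setT (fun x : 'rV[R]_d => x 0 i * rX x)%R by meas.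
have mg : measurable_fun setT (fun x : 'rV[R]_d => x 0 i * rY x)%R by meas.
have gf : \int[leb d]_y (Num.max (y 0%R i * rY y) 0)%:E \is a fin_num.
  by rewrite ge0_fin_numE// ge0_integral_real_ge0// => y; rewrite le_max lexx orbT.
have sq0 (r : 'rV[R]_d -> R) (e : R) (x : 'rV[R]_d) : (forall x, 0 <= r x)%R -> (0 <= e ^+ 2 * (x 0 i ^+ 2 * r x))%R.
  by move=> r0; apply: mulr_ge0; rewrite ?sqr_ge0//; apply: mulr_ge0; rewrite ?sqr_ge0.
have mkx x : measurable_fun setT (k x) by rewrite /k; meas.
have kpos x y : (0 <= k x y)%R.
  by rewrite /k; apply: mulr_ge0; rewrite ?sqr_ge0//; exact: mulr_ge0.
have sc0 : (0 <= 2 * s * c)%R by rewrite !mulr_ge0// ltW.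
have kE x y : (k x y = s ^+ 2 * (x 0 i ^+ 2 * rX x) * rY y + c ^+ 2 * (y 0 i ^+ 2 * rY y) * rX x -
    2 * s * c * (x 0 i * rX x * (y 0 i * rY y)))%R by rewrite /k; ring.
rewrite (cross_integral mX mY mA mB mf mg mkx X0 Y0 (fun x => sq0 _ _ x X0) (fun x => sq0 _ _ x Y0)
  kpos sc0 X1 Y1 kE (esym (fineK gf)) (etrans (esym (Yc i)) (esym (fineK gf)))).
have mx2 : measurable_fun setT (fun x : 'rV[R]_d => x 0 i ^+ 2 * rX x)%R by meas.
have my2 : measurable_fun setT (fun x : 'rV[R]_d => x 0 i ^+ 2 * rY x)%R by meas.
by rewrite !ge0_integralZ ?sqr_ge0// => x; rewrite mulr_ge0 ?sqr_ge0.
Qed.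

(** 2 DY <= DY^2 / rY + rY, so a finite Fisher information makes DY integrable and the equal sides
    of [divergence0] finite. *)
Let divY i : \int[leb d]_y (Num.max (DY i y) 0)%:E \is a fin_num.
Proof.
rewrite ge0_fin_numE; last by apply: ge0_integral_real_ge0 => y; rewrite le_max lexx orbT.
have mDY2 : measurable_fun setT (fun y => DY i y ^+ 2 / rY y)%R by have k := mDY i; meas.
have q0 y : (0 <= DY i y ^+ 2 / rY y)%R by rewrite divr_ge0 ?sqr_ge0.
apply: (@le_lt_trans _ _ (\int[leb d]_y (DY i y ^+ 2 / rY y + rY y)%:E)).
  apply: ge0_le_integralr.
  - by have k := mDY i; meas.
  - by meas.
  - by move=> y; rewrite le_max lexx orbT.
  - move=> y; rewrite ge_max addr_ge0// andbT.
    have [y0|yn] := eqVneq (rY y) 0%R.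
      by rewrite (row_C1_eq0 i cY Y0 y0) expr0n/= mul0r add0r.
    have yp : (0 < rY y)%R by rewrite lt0r yn Y0.
    have : (0 <= (DY i y - rY y) ^+ 2 / rY y)%R by rewrite divr_ge0 ?sqr_ge0.
    have -> : ((DY i y - rY y) ^+ 2 / rY y = DY i y ^+ 2 / rY y + rY y - 2 * DY i y)%R by field.
    have := addr_ge0 (q0 y) (Y0 y).
    by have /orP[|] := le_total 0%R (DY i y); lra.
rewrite ge0_integralDr// Y1; have := IY i.
have : 0 <= \int[leb d]_y (DY i y ^+ 2 / rY y)%:E by exact: ge0_integral_real_ge0.
by case: (\int[leb d]_y _) => [r| |]//= _ _; rewrite -EFinD ltry.
Qed.

(** The same expansion for s DX rY - c rX DY. The cross term is DX(x) DY(y) and drops because the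
    integral of DY vanishes, by [divergence0]. *)
Let fisher i :
  \int[leb d]_z \int[leb d]_w (Dh i z w ^+ 2 / h z w)%:E = (s ^+ 2)%:E * fi rX DX i + (c ^+ 2)%:E * fi rY DY i.
Proof.
pose k (x y : 'rV[R]_d) : R := ((s * DX i x * rY y - c * rX x * DY i y) ^+ 2 / (rX x * rY y))%R.
rewrite -[LHS]/(\int[leb d]_z \int[leb d]_w (k (c *: z + s *: w)%R (s *: z - c *: w)%R)%:E).
have mk : measurable_fun setT (fun u : 'rV[R]_d * 'rV[R]_d => k u.1 u.2).
  have k1 := measurableT_comp mX (@measurable_fst _ _ 'rV[R]_d 'rV[R]_d).
  have k2 := measurableT_comp mY (@measurable_snd _ _ 'rV[R]_d 'rV[R]_d).
  have k3 := measurableT_comp (mDX i) (@measurable_fst _ _ 'rV[R]_d 'rV[R]_d).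
  have k4 := measurableT_comp (mDY i) (@measurable_snd _ _ 'rV[R]_d 'rV[R]_d).
  have k5 := measurable_funV (measurable_funM k1 k2).
  exact: (measurable_funM (measurable_funX 2 (measurable_funB (measurable_funM (measurable_funM (measurable_cst s) k3) k2)
  (measurable_funM (measurable_funM (measurable_cst c) k1) k4))) k5).
have k0 x y : (0 <= k x y)%R by rewrite divr_ge0 ?sqr_ge0// mulr_ge0.
rewrite refl//.
have mA : measurable_fun setT (fun x => s ^+ 2 * (DX i x ^+ 2 / rX x))%R by have kX := mDX i; meas.
have mB : measurable_fun setT (fun x => c ^+ 2 * (DY i x ^+ 2 / rY x))%R by have kY := mDY i; meas.
have A0 x : (0 <= s ^+ 2 * (DX i x ^+ 2 / rX x))%R by rewrite mulr_ge0 ?sqr_ge0// divr_ge0 ?sqr_ge0.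
have B0 x : (0 <= c ^+ 2 * (DY i x ^+ 2 / rY x))%R by rewrite mulr_ge0 ?sqr_ge0// divr_ge0 ?sqr_ge0.
have gf := divY i.
have mkx x : measurable_fun setT (k x).
  by have kX := mDX i; have kY := mDY i; rewrite /k; meas.
have sc0 : (0 <= 2 * s * c)%R by rewrite !mulr_ge0// ltW.
have kE x y : (k x y = s ^+ 2 * (DX i x ^+ 2 / rX x) * rY y + c ^+ 2 * (DY i y ^+ 2 / rY y) * rX x -
    2 * s * c * (DX i x * DY i y))%R.
  (* Where a density vanishes so does its gradient, and by x / 0 = 0 both sides are 0. *)
  rewrite /k; have [x0|xn] := eqVneq (rX x) 0%R.
    by rewrite (row_C1_eq0 i cX X0 x0) x0; rewrite !(mul0r, mulr0, expr0n, subrr, invr0, addr0)/=.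
  have [y0|yn] := eqVneq (rY y) 0%R.
    by rewrite (row_C1_eq0 i cY Y0 y0) y0; rewrite !(mul0r, mulr0, expr0n, subrr, invr0, addr0)/=.
  by field; rewrite xn yn.
have dv := etrans (esym (divergence0 i cY Y0 Y1)) (esym (fineK gf)).
rewrite (cross_integral mX mY mA mB (mDX i) (mDY i) mkx X0 Y0 A0 B0 k0 sc0 X1 Y1 kE (esym (fineK gf)) dv).
have mx2 : measurable_fun setT (fun x => DX i x ^+ 2 / rX x)%R by have kX := mDX i; meas.
have my2 : measurable_fun setT (fun x => DY i x ^+ 2 / rY x)%R by have kY := mDY i; meas.
by rewrite !ge0_integralZ ?sqr_ge0// => x; rewrite divr_ge0 ?sqr_ge0.
Qed.

Let mix (F : 'rV[R]_d -> 'rV[R]_d -> R) : measurable_fun setT (fun u : 'rV[R]_d * 'rV[R]_d => F u.1 u.2) ->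
  (forall z w, 0 <= F z w)%R -> measurable_fun setT (fun z => \int[leb d]_w (F z w)%:E).
Proof.
move=> mF F0.
apply: (@measurable_fun_fubini_tonelli_F _ _ _ _ R (leb d) (fun u : 'rV[R]_d * 'rV[R]_d => (F u.1 u.2)%:E)).
  exact/measurable_EFinP.
by move=> u; rewrite lee_fin.
Qed.

Let mD2 i : measurable_fun setT (fun u : 'rV[R]_d * 'rV[R]_d => (Dh i u.1 u.2 ^+ 2 / h u.1 u.2)%R).
Proof. exact: (measurable_funM (measurable_funX 2 (mDh i)) (measurable_funV mh)). Qed.
Let mw2 i : measurable_fun setT (fun u : 'rV[R]_d * 'rV[R]_d => (u.2 0 i ^+ 2 * h u.1 u.2)%R).
Proof. exact: (measurable_funM (measurable_funX 2 (mc2 i)) mh). Qed.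

Let Rz i z := \int[leb d]_w (w 0%R i ^+ 2 * h z w)%:E + \int[leb d]_w (Dh i z w ^+ 2 / h z w)%:E.

Let w20 i (z w : 'rV[R]_d) : (0 <= w 0 i ^+ 2 * h z w)%R.
Proof. by rewrite mulr_ge0 ?sqr_ge0. Qed.
Let D20 i z w : (0 <= Dh i z w ^+ 2 / h z w)%R.
Proof. by rewrite divr_ge0 ?sqr_ge0. Qed.

Let Rz0 i z : 0 <= Rz i z.
Proof. by apply: adde_ge0; apply: ge0_integral_real_ge0 => w. Qed.
Let mRz i : measurable_fun setT (Rz i).
Proof. exact: (emeasurable_funD (mix (mw2 i) (w20 i)) (mix (mD2 i) (D20 i))). Qed.

Let Sz z : \bar R := \sum_(i < d) Rz i z.
Let mSz : measurable_fun setT Sz. Proof. by apply: emeasurable_sum. Qed.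
Let Sz0 z : 0 <= Sz z. Proof. by apply: sume_ge0. Qed.

Let SzE : \int[leb d]_z Sz z = \sum_(i < d)
  ((s ^+ 2)%:E * m2 rX i + (c ^+ 2)%:E * m2 rY i + ((s ^+ 2)%:E * fi rX DX i + (c ^+ 2)%:E * fi rY DY i)).
Proof.
rewrite /Sz ge0_integral_sum//; apply: eq_bigr => i _.
rewrite /Rz (ge0_integralDe (leb d) (mix (mw2 i) (w20 i)) (mix (mD2 i) (D20 i))); last 2 first.
- by move=> z; exact: ge0_integral_real_ge0.
- by move=> z; exact: ge0_integral_real_ge0.
by rewrite second_moment fisher.
Qed.

Let kz z := \int[leb d]_w (kl (h z w) (phi z * phi w))%:E.

(** The chain rule splits the entropy of [h z] into that of its mass and that of the function
    relative to its mass times phi; [lsi] in w bounds the latter. *)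
Let step z : N z \is a fin_num ->
  kz z + (d%:R * nr z)%:E <= (kl (nr z) (phi z))%:E + 2^-1%:E * Sz z.
Proof.
move=> fz; have nE : \int[leb d]_w (h z w)%:E = (nr z)%:E by rewrite /nr /mixed_density fineK.
have mp := @measurable_phi R d.
rewrite /kz (kl_chain (mhz z) (h0 z) nE mp (@phi_gt0 R d) (integral_phi d) (phi_gt0 z)).
case: eqVneq => [n0|nn].
  by rewrite n0 mulr0 add0e adde0 leeDl// mule_ge0// lee_fin.
have np : (0 < nr z)%R by rewrite lt0r nn nr0.
have := lsi (row_C1_line_C1 (rowh z)) (h0 z) nE np.
have -> : \int[leb d]_w (sqn w * h z w)%:E + \sum_(i < d) \int[leb d]_w (Dh i z w ^+ 2 / h z w)%:E = Sz z.
  have e (a b : 'I_d -> \bar R) : \sum_(j < d) (a j + b j) = \sum_(j < d) a j + \sum_(j < d) b j.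
    exact: big_split.
  apply: etrans (esym (e (fun i => \int[leb d]_w (w 0%R i ^+ 2 * h z w)%:E)
    (fun i => \int[leb d]_w (Dh i z w ^+ 2 / h z w)%:E))).
  congr (_ + _)%E.
  have mi i : measurable_fun setT (fun w : 'rV[R]_d => (w 0 i ^+ 2 * h z w)%:E).
    have k1 := @measurable_coord R d i; have k2 := mhz z; meas.
  rewrite -ge0_integral_sum//; last by move=> i w _; rewrite lee_fin.
  by apply: eq_integral => w _; rewrite sumEFin /sqn mulr_suml.
by move=> hl; rewrite addeAC addeC; apply: leeD.
Qed.

(** [step] integrated over z. On the left the reflection, which preserves phi(z) phi(w), restores
    the product of rX and rY, whose entropy is additive by [kl_tensor]. *)
Lemma static_inequality :
  \int[leb d]_x (kl (rX x) (phi x))%:E + \int[leb d]_x (kl (rY x) (phi x))%:E + (d%:R)%:E <=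
  \int[leb d]_z (kl (mixed_density z) (phi z))%:E + 2^-1%:E *
  \sum_(i < d) ((s ^+ 2)%:E * m2 rX i + (c ^+ 2)%:E * m2 rY i +
                ((s ^+ 2)%:E * fi rX DX i + (c ^+ 2)%:E * fi rY DY i)).
Proof.
have mp := @measurable_phi R d.
have mp1' := measurableT_comp mp (@measurable_fst _ _ 'rV[R]_d 'rV[R]_d).
have mp2' := measurableT_comp mp (@measurable_snd _ _ 'rV[R]_d 'rV[R]_d).
have mk := measurable_kl mXY (measurable_funM mp1' mp2').
have mkh := measurable_kl mh (measurable_funM mp1' mp2').
have pp0 (z w : 'rV[R]_d) : (0 < phi z * phi w)%R by rewrite mulr_gt0 ?phi_gt0.
have kh0 z w : (0 <= kl (h z w) (phi z * phi w))%R by rewrite kl_ge0.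
rewrite -SzE -(kl_tensor mX mY X0 Y0 X1 Y1).
have -> : \int[leb d]_x \int[leb d]_y (kl (rX x * rY y) (phi x * phi y))%:E = \int[leb d]_z kz z.
  rewrite -(refl (k := fun x y => kl (rX x * rY y) (phi x * phi y)) mk); last first.
    by move=> x y; rewrite kl_ge0// mulr_ge0.
  apply: eq_integral => z _; apply: eq_integral => w _.
  by rewrite phi_reflection.
have mkz : measurable_fun setT kz by exact: mix mkh kh0.
have kz0 z : 0 <= kz z by exact: ge0_integral_real_ge0.
have mdn : measurable_fun setT (fun z => d%:R * nr z)%R by meas.
have mkn : measurable_fun setT (fun z => kl (nr z) (phi z)) by meas.
have dn0 z : (0 <= d%:R * nr z)%R by rewrite mulr_ge0.
have kn0 z : (0 <= kl (nr z) (phi z))%R by rewrite kl_ge0// phi_gt0.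
have -> : (d%:R : R)%:E = \int[leb d]_z (d%:R * nr z)%:E.
  by rewrite (ge0_integralZ (leb d) mnr nr0 (ler0n R d)) nr1 mule1.
rewrite -(ge0_integralZe (leb d) mSz Sz0 (k := 2^-1%R)); last by rewrite invr_ge0.
have mdnE : measurable_fun setT (fun z => (d%:R * nr z)%:E) by exact/measurable_EFinP.
have mknE : measurable_fun setT (fun z => (kl (nr z) (phi z))%:E) by exact/measurable_EFinP.
have mS2 : measurable_fun setT (fun z => 2^-1%:E * Sz z) by apply: emeasurable_funM => //; exact: measurable_cst.
have S20 z : 0 <= 2^-1%:E * Sz z by rewrite mule_ge0// lee_fin.
rewrite -(ge0_integralDe (leb d) mkz mdnE kz0 (fun z => dn0 z : 0 <= (d%:R * nr z)%:E)).
rewrite -(ge0_integralDe (leb d) mknE mS2 (fun z => kn0 z : 0 <= (kl (nr z) (phi z))%:E) S20).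
apply: ge0_ae_le.
- exact: emeasurable_funD.
- exact: emeasurable_funD.
- by move=> z; rewrite adde_ge0// lee_fin.
- by move=> z; rewrite adde_ge0// lee_fin.
- exact: (ae_imp Nfin step).
Qed.
End static.

(** * Nelson's hypercontractivity *)

Section gaussian_expectation.
Context {R : realType} {d : nat}.
Local Notation mu := (gam d : {measure set 'rV[R]_d -> \bar R}).
Implicit Types f g : 'rV[R]_d -> R.

Definition gexp f : R := fine (\int[gam d]_x (f x)%:E)%E.
Definition gintegrable f : Prop := mu.-integrable setT (EFin \o f).

Lemma gexpK f : gintegrable f -> ((gexp f)%:E = \int[gam d]_x (f x)%:E)%E.
Proof. by move=> h; rewrite fineK//; apply: integrable_fin_num. Qed.

Lemma gintegrable_le f g : measurable_fun setT f -> measurable_fun setT g ->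
  (forall x, `|f x| <= g x) -> (\int[gam d]_x (g x)%:E < +oo)%E -> gintegrable f.
Proof.
move=> mf mg fg gi; apply/integrableP; split; first exact/measurable_EFinP.
apply: le_lt_trans gi; apply: ge0_le_integral => //=.
- by apply/measurable_EFinP; apply: measurableT_comp => //; exact: measurable_normr.
- exact/measurable_EFinP.
- by move=> x _; rewrite lee_fin.
Qed.

Lemma gintegrable_bounded f (M : R) : measurable_fun setT f -> (forall x, `|f x| <= M) ->
  gintegrable f.
Proof.
move=> mf fM; apply: (gintegrable_le mf (measurable_cst M) fM).
by rewrite integral_gam_cst ltry.
Qed.

Lemma gintegrableD f g : gintegrable f -> gintegrable g -> gintegrable (fun x => f x + g x).
Proof. by move=> fi gi; have := @integrableD _ _ _ mu setT measurableT (EFin \o f) (EFin \o g) fi gi; exact. Qed.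

Lemma gintegrableZ k f : gintegrable f -> gintegrable (fun x => k * f x).
Proof. by move=> fi; exact: (@integrableZl _ _ _ mu setT _ k (EFin \o f)). Qed.

Lemma gexpD f g : gintegrable f -> gintegrable g -> gexp (fun x => f x + g x) = gexp f + gexp g.
Proof. exact: RintegralD. Qed.

Lemma gexpB f g : gintegrable f -> gintegrable g -> gexp (fun x => f x - g x) = gexp f - gexp g.
Proof. exact: RintegralB. Qed.

Lemma gexpZ k f : gintegrable f -> gexp (fun x => k * f x) = k * gexp f.
Proof. exact: RintegralZl. Qed.

Lemma le_gexp f g : gintegrable f -> gintegrable g -> (forall x, f x <= g x) -> gexp f <= gexp g.
Proof. by move=> fi gi fg; apply: le_Rintegral. Qed.

Lemma gexp_cst (c : R) : gexp (fun=> c) = c.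
Proof. by rewrite /gexp integral_gam_cst. Qed.

Lemma eq_gexp f g : f =1 g -> gexp f = gexp g.
Proof. by move=> fg; congr gexp; apply/funext. Qed.

Lemma gexp_sum (k : 'I_d -> R) (F : 'I_d -> 'rV[R]_d -> R) : (forall i, gintegrable (F i)) ->
  gintegrable (fun x => \sum_i k i * F i x) /\
  gexp (fun x => \sum_i k i * F i x) = \sum_i k i * gexp (F i).
Proof.
move=> Fi; elim: (index_enum 'I_d) => [|i r [IH1 IH2]].
  split; last by rewrite big_nil (eq_gexp (g := fun=> 0)) ?gexp_cst// => x; rewrite big_nil.
  rewrite (_ : (fun x => _) = fun=> 0); last by apply/funext => x; rewrite big_nil.
  by apply: (@gintegrable_bounded _ 0) => // x; rewrite normr0.
have e : (fun x => \sum_(j <- i :: r) k j * F j x) = (fun x => k i * F i x + \sum_(j <- r) k j * F j x).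
  by apply/funext => x; rewrite big_cons.
rewrite e; split; first by apply: gintegrableD => //; exact: gintegrableZ.
by rewrite gexpD// ?gexpZ// ?IH2 ?big_cons//; exact: gintegrableZ.
Qed.

Lemma gexp_bound f (M : R) : measurable_fun setT f -> (forall x, `|f x| <= M) -> `|gexp f| <= M.
Proof.
move=> mf fM; have fi := gintegrable_bounded mf fM.
have ci : gintegrable (fun=> M) by apply: (@gintegrable_bounded _ `|M|).
have cNi : gintegrable (fun=> - M) by apply: (@gintegrable_bounded _ `|M|) => // x; rewrite normrN.
rewrite ler_norml; apply/andP; split.
  by rewrite -[leLHS](gexp_cst (- M)); apply: le_gexp => // x; have := fM x; rewrite ler_norml => /andP[].
by rewrite -[leRHS](gexp_cst M); apply: le_gexp => // x; exact: le_trans (ler_norm _) (fM x).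
Qed.
End gaussian_expectation.

(** * Regularity of smoothed bounded functions *)

Section quadratic_expansion.
Context {R : realType}.

Lemma continuous_distP (T : topologicalType) (f : T -> R) (x : T) :
  (forall e : R, 0 < e -> \forall z \near x, `|f x - f z| <= e) -> {for x, continuous f}.
Proof. by move=> h; apply/cvgrPdist_le => e e0; exact: h. Qed.

Lemma continuous_sum_fun (T : topologicalType) (I : Type) (r : seq I) (F : I -> T -> R) :
  (forall i, continuous (F i)) -> continuous (fun x => \sum_(i <- r) F i x).
Proof.
move=> cF; elim: r => [|i r IH] x.
  rewrite (_ : (fun x => _) = fun=> 0); last by apply/funext => z; rewrite big_nil.
  exact: cst_continuous.
rewrite (_ : (fun x => _) = (fun x => F i x + \sum_(j <- r) F j x)); last first.
  by apply/funext => z; rewrite big_cons.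
exact: (cvgD (cF i x) (IH x)).
Qed.


Lemma is_derive_quad (f : R -> R) (l C : R) :
  (forall t, `|t| <= 1 -> `|f t - f 0 - t * l| <= C * t ^+ 2) -> is_derive (0 : R) 1 f l.
Proof.
move=> h.
have C0 : 0 <= C.
  have := h 1; rewrite normr1 expr1n mulr1 => /(_ (lexx _)); exact: le_trans.
have cl : h^-1 *: (f (h *: 1 + 0) - f 0) @[h --> (0:R)^'] --> l.
  apply/cvgrPdist_le => e e0; near=> t.
  have tn : t != 0 by near: t; exact: nbhs_dnbhs_neq.
  have t1 : `|t| <= 1 by near: t; apply: dnbhs0_le.
  have te : `|t| <= e / (C + 1) by near: t; apply: dnbhs0_le; rewrite divr_gt0// ltr_wpDl.
  rewrite addr0 /GRing.scale/= mulr1.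
  have -> : l - t^-1 * (f t - f 0) = - (t^-1 * (f t - f 0 - t * l)) by field.
  rewrite normrN normrM normfV -ler_pdivlMl ?invr_gt0 ?normr_gt0// invrK.
  apply: le_trans (h t t1) _; rewrite -[t ^+ 2]real_normK ?num_real// expr2 mulrCA.
  rewrite ler_wpM2l//; apply: (@le_trans _ _ ((C + 1) * `|t|)).
    by rewrite ler_wpM2r// lerDl.
  by rewrite mulrC -ler_pdivlMr// ltr_wpDl.
split; last exact/cvg_lim.
by apply/cvg_ex; exists l.
Unshelve. all: by end_near. Qed.

Lemma expR_sub1_le (x : R) : expR x - 1 <= x * expR x.
Proof.
have := ler_wpM2l (expR_ge0 x) (expR_ge1Dx (- x)); rewrite -expRD subrr expR0; lra.
Qed.

(** The Gaussian shift formula expands f(t) e^(r t^2) and not f(t); this lemma removes the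
    exponential at the cost of a larger constant in the quadratic error. *)
Lemma sandwich_quad (f : R -> R) (l r M L : R) : 0 <= r -> 0 <= M -> `|f 0| <= M -> `|l| <= L ->
  (forall t, 0 <= f t * expR (t ^+ 2 * r) - f 0 - t * l <= 2 * M * (expR (t ^+ 2 * r) - 1)) ->
  forall t, `|t| <= 1 -> `|f t - f 0 - t * l| <= (r * (M + L) + 2 * M * (r * expR r)) * t ^+ 2.
Proof.
move=> r0 M0 fM lL h t t1.
have t2 : 0 <= t ^+ 2 by exact: sqr_ge0.
have t21 : t ^+ 2 <= 1 by rewrite -real_normK ?num_real// expr_le1.
set x := t ^+ 2 * r; have x0 : 0 <= x by rewrite mulr_ge0.
have xr : x <= r by rewrite /x ler_piMl.
set e := f t * expR x - f 0 - t * l.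
have /andP[e0 eM] : 0 <= e <= 2 * M * (expR x - 1) by exact: h.
have E0 := expR_gt0 (- x).
have -> : f t - f 0 - t * l = (expR (- x) - 1) * (f 0 + t * l) + expR (- x) * e.
  have ee : expR (- x) * expR x = 1 by rewrite -expRD addNr expR0.
  transitivity (f t * (expR (- x) * expR x) - f 0 - t * l); first by rewrite ee mulr1.
  by rewrite /e; ring.
have Ex1 : expR (- x) <= 1 by rewrite -expR0 ler_expR oppr_le0.
have Exx : 1 - expR (- x) <= x by have := expR_ge1Dx (- x); lra.
have f0b : `|f 0 + t * l| <= M + L.
  apply: le_trans (ler_normD _ _) _; rewrite lerD// normrM.
  by apply: le_trans lL; rewrite ler_piMl.
apply: le_trans (ler_normD _ _) _; rewrite [leRHS]mulrDl; apply: lerD.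
  have ea : `|expR (- x) - 1| <= x by rewrite distrC ger0_norm; lra.
  rewrite normrM; apply: (@le_trans _ _ (x * (M + L))); last by rewrite /x; lra.
  exact: ler_pM.
rewrite ger0_norm ?mulr_ge0 ?(ltW E0)//.
apply: (@le_trans _ _ e); first by rewrite ler_piMl.
apply: le_trans eM _.
have k1 : expR x - 1 <= r * expR r * t ^+ 2.
  apply: le_trans (expR_sub1_le x) _.
  apply: (@le_trans _ _ (x * expR r)); first by rewrite ler_wpM2l// ler_expR.
  by rewrite /x; lra.
by have := ler_wpM2l (mulr_ge0 (ler0n R 2) M0) k1; lra.
Qed.
End quadratic_expansion.

Section gaussian_smoothing.
Context {R : realType} {d : nat}.
Local Notation mu := (gam d).

Definition dot (k w : 'rV[R]_d) : R := \sum_i k 0 i * w 0 i.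

Lemma measurable_dot k : measurable_fun setT (dot k).
Proof. by apply: measurable_sum => i; have h := @measurable_coord R d i; meas. Qed.

Lemma dotNl k w : dot (- k) w = - dot k w.
Proof. by rewrite /dot -sumrN; apply: eq_bigr => i _; rewrite mxE mulNr. Qed.

Lemma sqnN (k : 'rV[R]_d) : sqn (- k) = sqn k.
Proof. by rewrite /sqn; apply: eq_bigr => i _; rewrite mxE sqrrN. Qed.

Lemma sqnZ (a : R) (k : 'rV[R]_d) : sqn (a *: k) = a ^+ 2 * sqn k.
Proof. by rewrite /sqn mulr_sumr; apply: eq_bigr => i _; rewrite mxE exprMn. Qed.

Lemma sqnB (w k : 'rV[R]_d) : sqn (w - k) = sqn w - 2 * dot k w + sqn k.
Proof.
rewrite /sqn /dot mulr_sumr -sumrB -big_split/=; apply: eq_bigr => i _.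
by rewrite !mxE; ring.
Qed.

(** Cameron-Martin formula, from translation invariance of Lebesgue measure. *)
Lemma gam_shift (F : 'rV[R]_d -> R) (k : 'rV[R]_d) : measurable_fun setT F -> (forall x, 0 <= F x) ->
  (\int[gam d]_w (F (w + k))%:E = \int[gam d]_w (F w * expR (dot k w - sqn k / 2))%:E)%E.
Proof.
move=> mF F0.
have mp := @measurable_phi R d; have md := measurable_dot k.
have m1 : measurable_fun setT (fun w : 'rV[R]_d => F (w + k)) by meas.
have m2 : measurable_fun setT (fun w : 'rV[R]_d => F w * expR (dot k w - sqn k / 2)) by meas.
rewrite ge0_integral_gam; [|exact/measurable_EFinP|by move=> x; rewrite lee_fin].
rewrite ge0_integral_gam; [|exact/measurable_EFinP|by move=> x; rewrite lee_fin mulr_ge0 ?expR_ge0].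
have m3 : measurable_fun setT (fun w : 'rV[R]_d => F w * phi (w - k)) by meas.
have := leb_shift k m3; move/(_ (fun w => mulr_ge0 (F0 w) (phi_ge0 _))) => h.
transitivity (\int[leb d]_x (F (x + k) * phi (x + k - k))%:E)%E.
  by apply: eq_integral => x _; rewrite addrK -EFinM.
rewrite h; apply: eq_integral => x _; rewrite -EFinM; congr EFin.
rewrite !phiE sqnB -mulrA; congr (_ * _); rewrite mulrCA -expRD; congr (_ * expR _).
by field.
Qed.

Lemma gam_expR (k : 'rV[R]_d) : (\int[gam d]_w (expR (dot k w))%:E = (expR (sqn k / 2))%:E)%E.
Proof.
have md := measurable_dot k.
have m1 : measurable_fun setT (fun w : 'rV[R]_d => expR (dot k w)) by meas.
have h := @gam_shift (fun=> 1) k (measurable_cst (1 : R)) (fun=> ler01).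
rewrite integral_gam_cst in h.
transitivity (\int[gam d]_w (expR (sqn k / 2) * (1 * expR (dot k w - sqn k / 2)))%:E)%E.
  by apply: eq_integral => w _; rewrite mul1r -expRD; congr (expR _)%:E; ring.
rewrite ge0_integralZ ?expR_ge0//; first by rewrite -h mule1.
by meas.
Qed.

Lemma gintegrable_expR k : gintegrable (fun w => expR (dot k w)).
Proof.
have md := measurable_dot k; have m1 : measurable_fun setT (fun w : 'rV[R]_d => expR (dot k w)) by meas.
apply: (gintegrable_le m1 m1); last by rewrite gam_expR ltry.
by move=> w; rewrite ger0_norm ?expR_ge0.
Qed.

Variables (H : 'rV[R]_d -> R) (M : R).
Hypotheses (mH : measurable_fun setT H) (H0 : forall x, 0 <= H x) (HM : forall x, H x <= M).

Let M0 : 0 <= M. Proof. exact: le_trans (HM 0). Qed.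

Lemma gintegrable_mulr (f g : 'rV[R]_d -> R) : measurable_fun setT f -> measurable_fun setT g -> (forall w, `|f w| <= g w) ->
  gintegrable g -> gintegrable (fun w => H w * f w).
Proof.
move=> mf mg fg gi; apply: (@gintegrable_le R d _ (fun w => M * g w)).
- by meas.
- by meas.
- move=> w; rewrite normrM ger0_norm//; apply: ler_pM => //.
- by rewrite -gexpK ?ltry//; exact: gintegrableZ.
Qed.

Lemma abs_dot_le k w : `|dot k w| <= expR (dot k w) + expR (dot (- k) w).
Proof.
rewrite dotNl; set x := dot k w.
have := expR_ge1Dx x; have := expR_ge1Dx (- x).
have := expR_gt0 x; have := expR_gt0 (- x).
by case: (ger0P x); lra.
Qed.

Lemma gintegrable_dot k : gintegrable (fun w => H w * dot k w).
Proof.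
have md := measurable_dot k; have md' := measurable_dot (- k).
apply: (@gintegrable_mulr _ (fun w => expR (dot k w) + expR (dot (- k) w))) => //.
- by meas.
- by move=> w; exact: abs_dot_le.
- by apply: gintegrableD; exact: gintegrable_expR.
Qed.

Lemma gexp_dot_le k : `|gexp (fun w => H w * dot k w)| <= 2 * M * expR (sqn k / 2).
Proof.
have hi := gintegrable_dot k.
have e1 := gintegrable_expR k; have e2 := gintegrable_expR (- k).
have e12 := gintegrableD e1 e2.
have gE k' : gexp (fun w => expR (dot k' w)) = expR (sqn k' / 2) by rewrite /gexp gam_expR.
have ub : gexp (fun w => M * (expR (dot k w) + expR (dot (- k) w))) = 2 * M * expR (sqn k / 2).
  by rewrite gexpZ// gexpD// !gE sqnN; ring.
have key w : `|H w * dot k w| <= M * (expR (dot k w) + expR (dot (- k) w)).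
  by rewrite normrM ger0_norm//; apply: ler_pM => //; exact: abs_dot_le.
rewrite -ub ler_norml; apply/andP; split.
  rewrite -mulN1r -gexpZ; last exact: gintegrableZ.
  apply: le_gexp => //; first by apply: gintegrableZ; exact: gintegrableZ.
  by move=> w; rewrite mulN1r; have := key w; rewrite ler_norml => /andP[].
apply: le_gexp => //; first exact: gintegrableZ.
by move=> w; exact: le_trans (ler_norm _) (key w).
Qed.

(** After the Cameron-Martin shift this is 0 <= e^x - 1 - x <= e^x + e^-x - 2 at x = k.w, integrated
    against 0 <= H <= M; both exponentials have expectation e^(|k|^2 / 2). *)
Lemma gaussian_expansion k :
  0 <= gexp (fun w => H (w + k)) * expR (sqn k / 2) - gexp H - gexp (fun w => H w * dot k w)
    <= 2 * M * (expR (sqn k / 2) - 1).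
Proof.
have md := measurable_dot k; have md' := measurable_dot (- k).
have me : measurable_fun setT (fun w : 'rV[R]_d => expR (dot k w)) by meas.
have me' : measurable_fun setT (fun w : 'rV[R]_d => expR (dot (- k) w)) by meas.
have hi := gintegrable_dot k.
have e1 := gintegrable_expR k; have e2 := gintegrable_expR (- k).
have Hi : gintegrable H by apply: (@gintegrable_bounded _ _ _ M) => // x; rewrite ger0_norm.
have He : gintegrable (fun w => H w * expR (dot k w)).
  by apply: (@gintegrable_mulr _ (fun w => expR (dot k w))) => // w; rewrite ger0_norm ?expR_ge0.
have sh : gexp (fun w => H (w + k)) * expR (sqn k / 2) = gexp (fun w => H w * expR (dot k w)).
  have -> : gexp (fun w => H (w + k)) = gexp (fun w => expR (- (sqn k / 2)) * (H w * expR (dot k w))).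
    rewrite {1}/gexp gam_shift//; congr fine; apply: eq_integral => w _.
    by rewrite expRD; congr EFin; ring.
  by rewrite gexpZ// mulrAC -expRD addNr expR0 mul1r.
rewrite sh.
have gE k' : gexp (fun w => expR (dot k' w)) = expR (sqn k' / 2) by rewrite /gexp gam_expR.
have i1 : gintegrable (fun w => H w * expR (dot k w) - H w).
  by apply: gintegrableD => //; rewrite (_ : (fun x => - H x) = (fun x => -1 * H x)) ?funeqE;
    [exact: gintegrableZ|move=> x; rewrite mulN1r].
rewrite -gexpB// -gexpB//.
have i2 : gintegrable (fun w => H w * expR (dot k w) - H w - H w * dot k w).
  by apply: gintegrableD => //; rewrite (_ : (fun x => - (H x * dot k x)) = (fun x => -1 * (H x * dot k x))) ?funeqE;
    [exact: gintegrableZ|move=> x; rewrite mulN1r].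
apply/andP; split.
  rewrite -[leLHS](gexp_cst (d := d)); apply: le_gexp => //.
    by apply: (@gintegrable_bounded _ _ _ 0) => // x; rewrite normr0.
  move=> w; have := expR_ge1Dx (dot k w); have := H0 w; nra.
have i3 : gintegrable (fun w => expR (dot k w) + expR (dot (- k) w) + - 2).
  apply: gintegrableD; first exact: gintegrableD.
  by apply: (@gintegrable_bounded _ _ _ `|- 2|).
have -> : 2 * M * (expR (sqn k / 2) - 1) = gexp (fun w => M * (expR (dot k w) + expR (dot (- k) w) + - 2)).
  rewrite gexpZ// gexpD//; [|exact: gintegrableD|by apply: (@gintegrable_bounded _ _ _ `|- 2|)].
  by rewrite gexpD// !gE gexp_cst sqnN; ring.
apply: le_gexp => //; first exact: gintegrableZ.
move=> w; rewrite dotNl; have h1 := expR_ge1Dx (dot k w); have h2 := expR_ge1Dx (- dot k w).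
have h3 : 0 <= expR (dot k w) - 1 - dot k w by lra.
have := ler_wpM2r h3 (HM w).
have := mulr_ge0 M0 (_ : 0 <= expR (- dot k w) - 1 + dot k w); lra.
Qed.
End gaussian_smoothing.

Section smoothing_regular.
Context {R : realType} {d : nat}.
Variables (G : 'rV[R]_d -> R) (M a s : R).
Hypotheses (mG : measurable_fun setT G) (G0 : forall x, 0 <= G x) (GM : forall x, G x <= M)
  (s0 : 0 < s).

Definition smo (x : 'rV[R]_d) : R := gexp (fun w => G (a *: x + s *: w)).
(** Gradient by Gaussian integration by parts: the derivative falls on the Gaussian weight, so G
    itself is only asked to be bounded and measurable. *)
Definition smoD (i : 'I_d) (x : 'rV[R]_d) : R :=
  a / s * gexp (fun w => G (a *: x + s *: w) * w 0 i).

Let M0 : 0 <= M. Proof. exact: le_trans (GM 0). Qed.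

Let mH x : measurable_fun setT (fun w : 'rV[R]_d => G (a *: x + s *: w)).
Proof. by meas. Qed.

Let kk := a / s.
Let L := `|kk| * (2 * M * expR (1 / 2)).

Let dot_delta i (w : 'rV[R]_d) : dot (delta_mx 0 i) w = w 0 i.
Proof. by rewrite /dot (sum_delta i (fun j => w 0 j)). Qed.

Let sqn_delta (i : 'I_d) : sqn (delta_mx 0 i : 'rV[R]_d) = 1.
Proof.
rewrite /sqn (bigD1 i)//= mxE !eqxx expr1n big1 ?addr0// => j ji.
by rewrite mxE (negbTE ji) andbF expr0n.
Qed.

Lemma smoD_bound i x : `|smoD i x| <= L.
Proof.
rewrite /smoD normrM ler_wpM2l//.
have := gexp_dot_le (mH x) (fun w => G0 _) (fun w => GM _) (delta_mx 0 i).
by rewrite sqn_delta (eq_gexp (g := fun w => G (a *: x + s *: w) * w 0 i))// => w; rewrite dot_delta.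
Qed.

Lemma smo_ge0 x : 0 <= smo x.
Proof. by rewrite /smo fine_ge0// ge0_integral_real_ge0. Qed.

Lemma smo_bound x : `|smo x| <= M.
Proof. by apply: gexp_bound => // w; rewrite ger0_norm. Qed.

(** Moving x by h amounts to moving the Gaussian variable by (a/s) h, so [gaussian_expansion]
    applies with k = (a/s) h. *)
Lemma smo_expand x h : 0 <= smo (x + h) * expR (sqn (kk *: h) / 2) - smo x - \sum_i h 0 i * smoD i x
   <= 2 * M * (expR (sqn (kk *: h) / 2) - 1).
Proof.
have := gaussian_expansion (mH x) (fun w => G0 _) (fun w => GM _) (kk *: h).
have -> : gexp (fun w => G (a *: x + s *: (w + kk *: h))) = smo (x + h).
  apply: eq_gexp => w; congr G.
  have sk : s * kk = a by rewrite /kk; field; rewrite gt_eqF.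
  by rewrite !scalerDr scalerA sk addrA addrAC.
have mi i : measurable_fun setT (fun w : 'rV[R]_d => G (a *: x + s *: w) * w 0 i).
  by have m1 := mH x; have m2 := @measurable_coord R d i; meas.
have ii i : gintegrable (fun w : 'rV[R]_d => G (a *: x + s *: w) * w 0 i).
  have := gintegrable_dot (mH x) (fun w => G0 _) (fun w => GM _) (delta_mx 0 i).
  rewrite (_ : (fun w => _ * dot _ w) = (fun w : 'rV[R]_d => G (a *: x + s *: w) * w 0 i))//.
  by apply/funext => w; rewrite dot_delta.
have -> : gexp (fun w => G (a *: x + s *: w) * dot (kk *: h) w) = \sum_i h 0 i * smoD i x.
  have [_ e] := gexp_sum (fun i => kk * h 0 i) ii.
  rewrite (eq_gexp (g := fun w : 'rV[R]_d => \sum_i (kk * h 0 i) * (G (a *: x + s *: w) * w 0 i))).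
    by rewrite e; apply: eq_bigr => i _; rewrite /smoD -/kk; ring.
  by move=> w; rewrite /dot mulr_sumr; apply: eq_bigr => i _; rewrite mxE; ring.
by [].
Qed.

Let smo_line (x y : 'rV[R]_d) (l := \sum_i y 0 i * smoD i x) (r := kk ^+ 2 * sqn y / 2) t :
  0 <= smo (x + t *: y) * expR (t ^+ 2 * r) - smo x - t * l <= 2 * M * (expR (t ^+ 2 * r) - 1).
Proof.
have := smo_expand x (t *: y).
have -> : sqn (kk *: (t *: y)) / 2 = t ^+ 2 * r by rewrite !sqnZ /r; ring.
suff -> : \sum_i (t *: y) 0 i * smoD i x = t * l by [].
by rewrite /l mulr_sumr; apply: eq_bigr => i _; rewrite mxE mulrA.
Qed.

Lemma is_derive_smo (x y : 'rV[R]_d) :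
  is_derive (0 : R) 1 (fun t : R => smo (x + t *: y)) (\sum_i y 0 i * smoD i x).
Proof.
set l := \sum_i _; pose r := kk ^+ 2 * sqn y / 2.
have r0 : 0 <= r by rewrite /r divr_ge0// mulr_ge0 ?sqr_ge0 ?sqn_ge0.
pose f t := smo (x + t *: y).
have f0 : f 0 = smo x by rewrite /f scale0r addr0.
apply: (@is_derive_quad R f l (r * (M + `|l|) + 2 * M * (r * expR r))).
apply: sandwich_quad => //; first by rewrite f0 smo_bound.
by move=> t; rewrite f0; exact: smo_line.
Qed.

Let Q i x t : `|t| <= 1 -> `|smo (x + t *: delta_mx 0 i) - smo x - t * smoD i x| <=
  (kk ^+ 2 * 1 / 2 * (M + L) + 2 * M * (kk ^+ 2 * 1 / 2 * expR (kk ^+ 2 * 1 / 2))) * t ^+ 2.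
Proof.
move=> t1; pose f u := smo (x + u *: delta_mx 0 i).
have f0 : f 0 = smo x by rewrite /f scale0r addr0.
rewrite -f0; apply: (@sandwich_quad R f (smoD i x) _ M L) => //.
- by rewrite divr_ge0// mulr_ge0 ?sqr_ge0.
- by rewrite f0 smo_bound.
- exact: smoD_bound.
- move=> u; rewrite f0; have := smo_line x (delta_mx 0 i) u.
  by rewrite sqn_delta (sum_delta i (fun j => smoD j x)).
Qed.

Lemma continuous_coord (i : 'I_d) : continuous (fun x : 'rV[R]_d => x 0 i).
Proof. by move=> x; exact: coord_continuous. Qed.

Lemma continuous_smo : continuous smo.
Proof.
move=> x; pose B (z : 'rV[R]_d) := 3 * M * (expR (sqn (kk *: (z - x)) / 2) - 1) + \sum_i `|(z - x) 0 i| * L.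
have cc i : continuous (fun z : 'rV[R]_d => z 0 i - x 0 i).
  by move=> z; exact: (cvgB (@continuous_coord i z) (cvg_cst (x 0 i))).
have cB : B @ x --> B x.
  have c1 : continuous (fun z : 'rV[R]_d => sqn (kk *: (z - x))).
    apply: (@continuous_sum_fun R 'rV[R]_d _ _ (fun i (z : 'rV[R]_d) => (kk *: (z - x)) 0 i ^+ 2)) => i z.
    rewrite /= (_ : (fun y : 'rV[R]_d => (kk *: (y - x)) 0 i ^+ 2) = (fun y : 'rV[R]_d => (kk * (y 0 i - x 0 i)) ^+ 2)); last first.
      by apply/funext => y; rewrite !mxE.
    rewrite ?mxE; apply: (cvg_comp (fun y : 'rV[R]_d => kk * (y 0 i - x 0 i)) (fun u => u ^+ 2)).
      exact: (cvgM (cvg_cst kk) (cc i z)).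
    exact: exprn_continuous.
  have c2 : continuous (fun z : 'rV[R]_d => \sum_i `|(z - x) 0 i| * L).
    apply: (@continuous_sum_fun R 'rV[R]_d _ _ (fun i (z : 'rV[R]_d) => `|(z - x) 0 i| * L)) => i z.
    rewrite /= (_ : (fun y : 'rV[R]_d => `|(y - x) 0 i| * L) = (fun y : 'rV[R]_d => `|y 0 i - x 0 i| * L)); last first.
      by apply/funext => y; rewrite !mxE.
    rewrite ?mxE; exact: (cvgM (cvg_norm (cc i z)) (cvg_cst L)).
  have c4 : {for x, continuous (fun z : 'rV[R]_d => expR (sqn (kk *: (z - x)) / 2))}.
    apply: (@continuous_comp _ _ _ (fun z : 'rV[R]_d => sqn (kk *: (z - x)) / 2) (@expR R)).
      have h := @continuousM R 'rV[R]_d (fun z : 'rV[R]_d => sqn (kk *: (z - x))) (fun=> 2^-1) x (c1 x) (@cst_continuous 'rV[R]_d R _ x).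
      exact: h.
    exact: continuous_expR.
  have c5 : {for x, continuous (fun z : 'rV[R]_d => 3 * M * (expR (sqn (kk *: (z - x)) / 2) - 1))}.
    exact: (cvgM (cvg_cst (3 * M)) (cvgB c4 (cvg_cst (1 : R)))).
  exact: (cvgD c5 (c2 x)).
have B0 : B x = 0.
  rewrite /B subrr scaler0 /sqn big1 ?mul0r ?expR0 ?subrr ?mulr0 ?add0r; last first.
    by move=> i _; rewrite mxE expr0n.
  by rewrite big1// => i _; rewrite mxE normr0 mul0r.
rewrite B0 in cB; apply: (@continuous_distP R 'rV[R]_d smo x) => e e0.
have /cvgrPdist_le/(_ e e0) := cB; apply: filterS => z; rewrite sub0r normrN => hB.
rewrite distrC; apply: le_trans (le_trans (ler_norm _) hB).
have := smo_expand x (z - x); rewrite (addrC x) subrK.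
set E := expR _ => /andP[h1 h2].
have E1 : 1 <= E by rewrite /E -[leLHS]expR0 ler_expR divr_ge0// sqn_ge0.
have s1 := smo_ge0 z; have s2 := smo_bound z; rewrite ger0_norm// in s2.
have hs : `|\sum_i (z - x) 0 i * smoD i x| <= \sum_i `|(z - x) 0 i| * L.
  apply: le_trans (ler_norm_sum _ _ _) _; apply: ler_sum => i _.
  by rewrite normrM ler_wpM2l// smoD_bound.
have h3 : smo z * (E - 1) <= M * (E - 1) by rewrite ler_wpM2r// subr_ge0.
have h4 : 0 <= smo z * (E - 1) by rewrite mulr_ge0// subr_ge0.
have h5 : 0 <= M * (E - 1) by rewrite mulr_ge0// subr_ge0.
move: hs; rewrite /B -/E ler_norml => /andP[h6 h7].
by rewrite ler_norml; apply/andP; split; lra.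
Qed.

(** Difference quotients of [smo] with a fixed step t are continuous and approximate [smoD] within C
    t, with C independent of the point; t is chosen with C t <= e/4. *)
Lemma continuous_smoD (i : 'I_d) : continuous (fun x : 'rV[R]_d => smoD i x : R).
Proof.
move=> x; apply: (@continuous_distP R 'rV[R]_d (fun x => smoD i x) x) => e e0.
set C := kk ^+ 2 * 1 / 2 * (M + L) + 2 * M * (kk ^+ 2 * 1 / 2 * expR (kk ^+ 2 * 1 / 2)).
have C0 : 0 <= C.
  have h := @Q i x 1; rewrite normr1 -/C expr1n (mulr1 C) in h.
  exact: le_trans (normr_ge0 _) (h (lexx _)).
pose t := Num.min 1 (e / (4 * (C + 1))).
have C1 : 0 < 4 * (C + 1) by rewrite mulr_gt0// ltr_wpDl.
have t0 : 0 < t by rewrite lt_min ltr01 divr_gt0.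
have t1 : `|t| <= 1 by rewrite gtr0_norm// ge_min lexx.
have tC : C * t <= e / 4.
  apply: (@le_trans _ _ ((C + 1) * t)); first by rewrite ler_wpM2r ?(ltW t0)// lerDl.
  have : t <= e / (4 * (C + 1)) by rewrite ge_min lexx orbT.
  by rewrite ler_pdivlMr//; lra.
have te : 0 < t * (e / 4) by rewrite mulr_gt0// divr_gt0.
have cs : continuous (fun z : 'rV[R]_d => smo (z + t *: delta_mx 0 i)).
  move=> z; apply: (cvg_comp (fun z : 'rV[R]_d => z + t *: delta_mx 0 i) smo); last exact: continuous_smo.
  exact: (cvgD cvg_id (cvg_cst (t *: delta_mx 0 i))).
have /cvgrPdist_le/(_ _ te) c1 := @cs x.
have /cvgrPdist_le/(_ _ te) c2 := @continuous_smo x.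
near=> z.
have h1 : `|smo (x + t *: delta_mx 0 i) - smo (z + t *: delta_mx 0 i)| <= t * (e / 4) by near: z.
have h2 : `|smo x - smo z| <= t * (e / 4) by near: z.
have h3 := @Q i x t t1; have h4 := @Q i z t t1.
have ct : C * t ^+ 2 <= t * (e / 4) by rewrite expr2 mulrCA ler_wpM2l// ltW.
rewrite -/C in h3 h4.
have h3' := le_trans h3 ct; have h4' := le_trans h4 ct.
move: h1 h2 h3' h4'; rewrite !ler_norml => /andP[? ?] /andP[? ?] /andP[? ?] /andP[? ?].
have hu : t * (smoD i x - smoD i z) <= t * e by lra.
have hl : t * - e <= t * (smoD i x - smoD i z) by lra.
by apply/andP; split; [move: hl|move: hu]; rewrite ler_pM2l.
Unshelve. all: by end_near. Qed.

Lemma row_C1_smo : row_C1 smo smoD.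
Proof. by split; [exact: continuous_smo|exact: continuous_smoD|exact: is_derive_smo]. Qed.
End smoothing_regular.

(** * Consequences of finite entropy *)

Section entropy.
Context {R : realType} {d : nat}.
Local Open Scope ereal_scope.
Variable rho : 'rV[R]_d -> R.
Hypotheses (mrho : measurable_fun setT rho) (rho0 : forall x, (0 <= rho x)%R).

Lemma Kd_le1 : (Kd d <= 1 :> R)%R.
Proof.
rewrite /Kd exprn_ile1 ?invr_ge0 ?sqrtr_ge0// invf_le1 ?sqrtr_gt0 ?mulr_gt0 ?pi_gt0//.
rewrite -[leLHS]sqrtr1 ler_wsqrtr//; have := @pi_ge2 R; lra.
Qed.

Lemma lnphi (x : 'rV[R]_d) : (ln (phi x) = ln (Kd d) - sqn x / 2)%R.
Proof. by rewrite phiE lnM ?posrE ?Kd_gt0 ?expR_gt0// expRK mulNr. Qed.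

(** The tangent inequality with y = |x|^2 / 4: the function phi e^y is still integrable, being
    proportional to a Gaussian density of larger variance. *)
Lemma kl_second_moment : \int[leb d]_x (kl (rho x) (phi x))%:E < +oo ->
  \int[leb d]_x (sqn x * rho x)%:E < +oo.
Proof.
move=> kf.
have mp := @measurable_phi R d; have ms := @measurable_sqn R d.
have key x : (4^-1 * (sqn x * rho x) <= kl (rho x) (phi x) + Kd d * expR (- sqn x / 4))%R.
  have := kl_ge_tangent (sqn x / 4) (rho0 x) (phi_gt0 x).
  have -> : (phi x * (expR (sqn x / 4) - 1) = Kd d * expR (- sqn x / 4) - phi x)%R.
    rewrite phiE mulrBr mulr1 -mulrA -expRD.
    by have -> : (- sqn x / 2 + sqn x / 4 = - sqn x / 4)%R by field.
  by have := phi_ge0 x; lra.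
have kl0' x : (0 <= kl (rho x) (phi x))%R by rewrite kl_ge0// phi_gt0.
have me : measurable_fun setT (fun x : 'rV[R]_d => Kd d * expR (- sqn x / 4))%R by meas.
have e0 x : (0 <= Kd d * expR (- sqn x / 4))%R by rewrite mulr_ge0 ?expR_ge0 ?(ltW (Kd_gt0 d)).
have Ie : \int[@leb R d]_x (Kd d * expR (- sqn x / 4))%:E < +oo.
  pose a : R := Num.sqrt 2^-1.
  have a0 : (0 < a)%R by rewrite sqrtr_gt0 invr_gt0.
  have a2 : (a ^+ 2 = 2^-1)%R by rewrite sqr_sqrtr// invr_ge0.
  apply: (@le_lt_trans _ _ (\int[leb d]_x (phi (0 + a *: x)%R)%:E)).
    rewrite le_eqVlt; apply/orP; left; apply/eqP.
    by apply: eq_integral => x _; rewrite add0r phiE sqnZ a2; congr ((_ * expR _)%:E); field.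
  by rewrite (leb_scale 0%R a0 mp (@phi_ge0 R d)) integral_phi mule1 ltry.
have mk : measurable_fun setT (fun x : 'rV[R]_d => kl (rho x) (phi x)) by meas.
have h : \int[leb d]_x (4^-1 * (sqn x * rho x))%:E < +oo.
  apply: (@le_lt_trans _ _ (\int[leb d]_x (kl (rho x) (phi x) + Kd d * expR (- sqn x / 4))%:E)).
    apply: ge0_le_integralr => //; try by meas.
    by move=> x; rewrite !mulr_ge0 ?sqn_ge0 ?invr_ge0.
  by rewrite ge0_integralDr// lte_add_pinfty.
move: h; rewrite ge0_integralZ ?invr_ge0//.
- have : 0 <= \int[leb d]_x (sqn x * rho x)%:E.
    by apply: ge0_integral_real_ge0 => x; rewrite mulr_ge0// sqn_ge0.
  case: (\int[leb d]_x _) => [r| |]// _; first by move=> _; rewrite ltry.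
  by rewrite mulry gtr0_sg ?invr_gt0// mul1e.
- by meas.
- by move=> x; rewrite mulr_ge0// sqn_ge0.
Qed.

Hypothesis rho1 : \int[leb d]_x (rho x)%:E = 1.

(** Pointwise, kl + lnm + rho = lnp - ln (Kd) rho + |x|^2 rho / 2 + phi. With finite entropy the
    second moment is finite, then the integral of [lnm], then that of [lnp]; the integrated identity
    is thus one between real numbers. *)
Lemma entropy_reals : \int[leb d]_x (kl (rho x) (phi x))%:E < +oo ->
  exists E M N P : R, [/\ \int[leb d]_x (kl (rho x) (phi x))%:E = E%:E,
    \int[leb d]_x (sqn x * rho x)%:E = M%:E, \int[leb d]_x (lnm (rho x))%:E = N%:E,
    \int[leb d]_x (lnp (rho x))%:E = P%:E & (E + N = P - ln (Kd d) + M / 2)%R].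
Proof.
move=> kf; have Mf := kl_second_moment kf.
have mp := @measurable_phi R d; have ms := @measurable_sqn R d.
have lnK0 : (0 <= - ln (Kd d) :> R)%R by rewrite oppr_ge0 ln_le0// Kd_le1.
have kl0' x : (0 <= kl (rho x) (phi x))%R by rewrite kl_ge0// phi_gt0.
have mk : measurable_fun setT (fun x : 'rV[R]_d => kl (rho x) (phi x)) by meas.
have mlp := measurable_lnp mrho; have mlm := measurable_lnm mrho.
have lp0 x := lnp_ge0 (rho0 x); have lm0 x := lnm_ge0 (rho0 x).
have msr : measurable_fun setT (fun x => sqn x * rho x)%R by meas.
have sr0 x : (0 <= sqn x * rho x)%R by rewrite mulr_ge0// sqn_ge0.
have klE' x : (kl (rho x) (phi x) + lnm (rho x) + rho x =
    lnp (rho x) + - ln (Kd d) * rho x + 2^-1 * (sqn x * rho x) + phi x)%R.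
  by rewrite klE ?phi_gt0// lnphi; have := lnp_lnm (rho x); lra.
have mr1 : measurable_fun setT (fun x => - ln (Kd d) * rho x)%R by meas.
have mr2 : measurable_fun setT (fun x => 2^-1 * (sqn x * rho x))%R by meas.
have r10 x : (0 <= - ln (Kd d) * rho x)%R by rewrite mulr_ge0.
have r20 x : (0 <= 2^-1 * (sqn x * rho x))%R by rewrite mulr_ge0 ?invr_ge0.
have r12 x : (0 <= - ln (Kd d) * rho x + 2^-1 * (sqn x * rho x))%R by rewrite addr_ge0.
have Nf : \int[leb d]_x (lnm (rho x))%:E < +oo.
  have mh : measurable_fun setT (fun x => - ln (Kd d) * rho x + 2^-1 * (sqn x * rho x))%R by meas.
  apply: (@le_lt_trans _ _ (\int[leb d]_x ((- ln (Kd d) * rho x + 2^-1 * (sqn x * rho x)) + phi x)%:E)).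
    apply: ge0_le_integralr => //; first by meas.
    move=> x; have p0 := phi_ge0 x; have kx := kl0' x; have ex := klE' x; have rx := rho0 x; have hx := r12 x.
    have e := lnp_lnm (rho x).
    have [lx|lx] := leP 0%R (ln (rho x)).
      by rewrite {1}/lnm max_r ?oppr_le0// mulr0 addr_ge0.
    have lp : lnp (rho x) = 0%R by rewrite /lnp max_r ?mulr0// ltW.
    by rewrite lp in ex; lra.
  rewrite ge0_integralDr//; last by move=> x; exact: phi_ge0.
  rewrite ge0_integralDr// integral_phi !ge0_integralZ ?invr_ge0// rho1 mule1.
  move: Mf; have : 0 <= \int[leb d]_x (sqn x * rho x)%:E by exact: ge0_integral_real_ge0.
  by case: (\int[leb d]_x _) => [r| |]//= _ _; rewrite -EFinM -!EFinD ltry.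
have tot : \int[leb d]_x (kl (rho x) (phi x) + lnm (rho x) + rho x)%:E =
    \int[leb d]_x (lnp (rho x) + - ln (Kd d) * rho x + 2^-1 * (sqn x * rho x) + phi x)%:E.
  by apply: eq_integral => x _; rewrite klE'.
have mkm : measurable_fun setT (fun x => kl (rho x) (phi x) + lnm (rho x))%R by meas.
have mp1 : measurable_fun setT (fun x => lnp (rho x) + - ln (Kd d) * rho x)%R by meas.
have mp2 : measurable_fun setT (fun x => lnp (rho x) + - ln (Kd d) * rho x + 2^-1 * (sqn x * rho x))%R by meas.
move: tot.
rewrite (ge0_integralDr _ mkm mrho (fun x => addr_ge0 (kl0' x) (lm0 x)) rho0) (ge0_integralDr _ mk mlm kl0' lm0).
rewrite (ge0_integralDr _ mp2 mp (fun x => addr_ge0 (addr_ge0 (lp0 x) (r10 x)) (r20 x)) (@phi_ge0 R d)).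
rewrite (ge0_integralDr _ mp1 mr2 (fun x => addr_ge0 (lp0 x) (r10 x)) r20) (ge0_integralDr _ mlp mr1 lp0 r10).
rewrite (ge0_integralZ _ mrho rho0 lnK0) (ge0_integralZ _ msr sr0) ?invr_ge0// rho1 integral_phi mule1.
move: kf Mf Nf.
have := ge0_integral_real_ge0 (leb d) kl0'; have := ge0_integral_real_ge0 (leb d) sr0.
have := ge0_integral_real_ge0 (leb d) lm0; have := ge0_integral_real_ge0 (leb d) lp0.
case: (\int[leb d]_x (kl _ _)%:E) => [E| |]//; case: (\int[leb d]_x (sqn _ * _)%:E) => [M| |]//.
case: (\int[leb d]_x (lnm _)%:E) => [N| |]//; case: (\int[leb d]_x (lnp _)%:E) => [P| |]//.
move=> _ _ _ _ _ _ _; rewrite -EFinM -!EFinD => -[h].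
by exists E, M, N, P; split => //; lra.
Qed.
End entropy.

Section row_C1_more.
Context {R : realType} {d : nat}.

Lemma row_C1_powR (F : 'rV[R]_d -> R) D (p : R) : row_C1 F D -> (forall x, 0 < F x) ->
  row_C1 (fun x => F x `^ p) (fun i x => p * F x `^ (p - 1) * D i x).
Proof.
move=> [cF cD dF] F0.
have cp r : continuous (fun x => F x `^ r).
  move=> x; apply: (@continuous_comp _ _ _ F (fun y => y `^ r)); first exact: cF.
  have dp := @is_derive1_powR R r (F x) (F0 x).
  by apply/differentiable_continuous/derivable1_diffP; case: dp.
split.
- exact: cp.
- move=> i x; have h : {for x, continuous (fun x => p * F x `^ (p - 1))}.
    by have := @continuousM R 'rV[R]_d (fun=> p) _ x (@cst_continuous 'rV[R]_d R p x) (cp (p - 1) x); exact.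
  exact: (cvgM h (cD i x)).
- move=> x y; have F00 : 0 < F (x + (0 : R) *: y) by [].
  apply: (is_derive_eq (@is_derive_powR R (fun s => F (x + s *: y)) 0 _ p F00 (dF x y))).
  by rewrite scale0r addr0 mulr_sumr; apply: eq_bigr => i _; ring.
Qed.

Lemma continuous_sqn : continuous (@sqn R d).
Proof.
apply: (@continuous_sum_fun R 'rV[R]_d _ _ (fun i (z : 'rV[R]_d) => z 0 i ^+ 2)) => i z.
apply: (@continuous_comp 'rV[R]_d R R (fun z : 'rV[R]_d => z 0 i) (fun u => u ^+ 2)).
  exact: continuous_coord.
exact: exprn_continuous.
Qed.

Lemma continuous_phi : continuous (@phi R d).
Proof.
move=> x; rewrite (_ : @phi R d = fun x => Kd d * expR (2^-1 * (-1 * sqn x))); last first.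
  by apply/funext => z; rewrite phiE; congr (_ * expR _); field.
have c1 := @continuousM R 'rV[R]_d (fun=> -1) _ x (@cst_continuous 'rV[R]_d R _ x) (@continuous_sqn x).
have c2 := @continuousM R 'rV[R]_d (fun=> 2^-1) _ x (@cst_continuous 'rV[R]_d R _ x) c1.
have c3 := @continuous_comp 'rV[R]_d R R _ (@expR R) x c2 (@continuous_expR R _).
have := @continuousM R 'rV[R]_d (fun=> Kd d) _ x (@cst_continuous 'rV[R]_d R _ x) c3; exact.
Qed.

Lemma row_C1_phi : row_C1 (@phi R d) (fun i x => - x 0 i * phi x).
Proof.
split.
- exact: continuous_phi.
- move=> i x; have c1 := @continuousM R 'rV[R]_d (fun=> -1) _ x (@cst_continuous 'rV[R]_d R _ x) (@continuous_coord R d i x).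
  have c2 := @continuousM R 'rV[R]_d _ _ x c1 (@continuous_phi x).
  rewrite (_ : (fun x : 'rV[R]_d => - x 0 i * phi x) = ((fun=> -1) \* (fun x : 'rV[R]_d => x 0 i)) \* @phi R d); first exact: c2.
  by apply/funext => z /=; rewrite mulN1r.
- move=> x y.
  have e (s : R) : phi (x + s *: y) = Kd d * expR (- (sqn x) / 2 + - s * dot x y - s ^+ 2 * sqn y / 2).
    rewrite phiE; congr (_ * expR _).
    have -> : x + s *: y = x - (- s *: y) by rewrite scaleNr opprK.
    rewrite sqnB sqnZ; have -> : dot (- s *: y) x = - s * dot x y.
      by rewrite /dot mulr_sumr; apply: eq_bigr => i _; rewrite mxE; ring.
    by rewrite sqrrN; field.
  pose g (s : R) := - (sqn x) / 2 + - s * dot x y - s ^+ 2 * sqn y / 2.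
  have dg : is_derive (0 : R) 1 g (- dot x y).
    apply: (@is_derive_quad R g _ (sqn y)) => t t1.
    have -> : g t - g 0 - t * - dot x y = - (t ^+ 2 * sqn y / 2) by rewrite /g; ring.
    have h := mulr_ge0 (sqr_ge0 t) (sqn_ge0 y).
    by rewrite normrN ger0_norm; lra.
  have de := @is_derive1_comp R (@expR R) g 0 _ _ (is_derive_expR (g 0)) dg.
  have dk := is_deriveZ (Kd d) de.
  have -> : (fun s : R => phi (x + s *: y)) = Kd d \*: (@expR R \o g).
    by apply/funext => s; rewrite e.
  apply: (is_derive_eq dk); rewrite /GRing.scale/=.
  have -> : Kd d * (expR (g 0) * - dot x y) = - dot x y * phi x.
    rewrite phiE /g oppr0 mul0r addr0 expr0n/= !mul0r subr0; ring.
  by rewrite /dot mulNr mulr_suml -sumrN; apply: eq_bigr => i _; ring.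
Qed.
End row_C1_more.

(** * The upper rate at a fixed density *)

Section rate.
Context {R : realType} {d : nat}.
Local Open Scope ereal_scope.

(** Failure of an eventual property as t -> 0+, in the sequential form that the Fatou argument takes
    as input. *)
Lemma not_near_right_seq (Q : R -> Prop) : ~ (\forall t \near (0%R : R)^'+, Q t) ->
  exists t : R^nat, [/\ forall n, (0 < t n)%R, t @ \oo --> (0%R : R) & forall n, ~ Q (t n)].
Proof.
move=> nQ.
have h n : exists x : R, [/\ (0 < x)%R, (x < n.+1%:R^-1)%R & ~ Q x].
  apply: contrapT => hn; apply: nQ; near=> x.
  have xn : (x < n.+1%:R^-1)%R by near: x; apply: nbhs_right_lt; rewrite invr_gt0.
  have x0 : (0 < x)%R by near: x; exact: nbhs_right_gt.
  by apply: contrapT => nx; apply: hn; exists x.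
have [t ht] := choice h; exists t; split.
- by move=> n; case: (ht n).
- apply/cvgrPdist_lt => e e0; have := @near_infty_natSinv_lt R (PosNum e0).
  apply: filterS => n /= hn; case: (ht n) => t0 tn _.
  by rewrite sub0r normrN gtr0_norm//; apply: lt_trans tn hn.
- by move=> n; case: (ht n).
Unshelve. all: by end_near. Qed.

Variables (F : 'rV[R]_d -> R) (D : 'I_d -> 'rV[R]_d -> R) (p : R).
Local Notation rho := (rho_of F p).
Hypotheses (p1 : (1 < p)%R) (mF : measurable_fun setT F) (F0 : forall x, (0 <= F x)%R)
  (rD : row_C1 rho D) (rho1 : \int[leb d]_x (rho x)%:E = 1)
  (entf : \int[leb d]_x (kl (rho x) (phi x))%:E < +oo).

Let rho0 x : (0 <= rho x)%R. Proof. by rewrite mulr_ge0 ?powR_ge0 ?phi_ge0. Qed.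
Let mrho : measurable_fun setT rho.
Proof. by case: rD => h _ _; exact: continuous_measurable_row. Qed.
Let mD i : measurable_fun setT (D i).
Proof. by case: rD => _ h _; exact: continuous_measurable_row. Qed.

(** If the bound fails, a sequence of violations is fed to [hyper_rate]; its conclusion, divided by
    (p - 1)/p and rewritten by [entropy_reals], is the second alternative, in which p^2 / (p - 1)
    lam / 2 is lam / kap. When the Fisher information is infinite this alternative is impossible for
    every lam. *)
Lemma rate_dichotomy (E M lam : R) : \int[leb d]_x (kl (rho x) (phi x))%:E = E%:E ->
  \int[leb d]_x (sqn x * rho x)%:E = M%:E ->
  (\forall t \near (0%R : R)^'+, ouN F (nelson p t) t < (expR (nelson p t * t * lam))%:E) \/
  2^-1%:E * \sum_(i < d) \int[leb d]_x (D i x ^+ 2 / rho x)%:E <=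
    (E - M / 2 + d%:R - p ^+ 2 / (p - 1) * lam / 2)%:E.
Proof.
move=> EE ME; have [E' [M' [N [P [hE hM hN hP hid]]]]] := entropy_reals mrho rho0 rho1 entf.
have {hE}EE' : E' = E by have := etrans (esym hE) EE => -[].
have {hM}MM' : M' = M by have := etrans (esym hM) ME => -[].
subst E' M'.
have [|h] := pselect (\forall t \near (0%R : R)^'+, ouN F (nelson p t) t < (expR (nelson p t * t * lam))%:E).
  by left.
right; have [t [t0 ct ht]] := not_near_right_seq h.
have [cr cD dr] := rD.
have hN' n : (expR (nelson p (t n) * t n * lam))%:E <= ouN F (nelson p (t n)) (t n).
  by rewrite leNgt; apply/negP; exact: ht.
have := hyper_rate p1 mF F0 cr rho1 dr mD hP t0 ct hN'.
have p10 : (0 < p - 1)%R by rewrite subr_gt0.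
have p0 : (0 < p)%R by apply: lt_trans p1.
have k0 : (0 < (p - 1) / p)%R by rewrite divr_gt0.
have mS i : measurable_fun setT (fun x => D i x ^+ 2 / rho x)%R by have hD := mD i; meas.
have S0 i x : (0 <= D i x ^+ 2 / rho x)%R by rewrite divr_ge0 ?sqr_ge0.
have mSS : measurable_fun setT (fun x : 'rV[R]_d => 2^-1 * ((\sum_i D i x ^+ 2) / rho x))%R.
  have mSum : measurable_fun setT (fun x : 'rV[R]_d => (\sum_i D i x ^+ 2)%R).
    by apply: measurable_sum => i; have hD := mD i; meas.
  by meas.
have SS0 x : (0 <= 2^-1 * ((\sum_i D i x ^+ 2) / rho x))%R.
  by rewrite mulr_ge0 ?invr_ge0// divr_ge0// sumr_ge0// => i _; exact: sqr_ge0.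
have mlm := measurable_lnm mrho; have lm0 x := lnm_ge0 (rho0 x).
have mtot : measurable_fun setT (fun x => 2^-1 * ((\sum_i D i x ^+ 2) / rho x) + lnm (rho x))%R by meas.
rewrite (ge0_integralZ _ mtot (fun x => addr_ge0 (SS0 x) (lm0 x)) (ltW k0)) (ge0_integralDr _ mSS mlm SS0 lm0) hN.
have -> : \int[leb d]_x (2^-1 * ((\sum_i D i x ^+ 2) / rho x))%:E =
    2^-1%:E * \sum_(i < d) \int[leb d]_x (D i x ^+ 2 / rho x)%:E.
  rewrite -ge0_integral_sum//; last 2 first.
  - by move=> i; exact/measurable_EFinP.
  - by move=> i x _; rewrite lee_fin.
  have sumE x : ((\sum_i D i x ^+ 2) / rho x = \sum_i (D i x ^+ 2 / rho x))%R by rewrite mulr_suml.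
  rewrite -ge0_integralZe ?invr_ge0//.
  - by apply: eq_integral => x _; rewrite EFinM sumE -sumEFin.
  - by apply: emeasurable_sum => i; exact/measurable_EFinP.
  - by move=> x; apply: sume_ge0 => i _; rewrite lee_fin.
set I := 2^-1%:E * _ => hI.
have : ((p - 1) / p)%:E^-1 * (((p - 1) / p)%:E * (I + N%:E)) <= ((p - 1) / p)%:E^-1 * ((p - 1) / p * (P - ln (Kd d) + d%:R) - p * lam / 2)%:E.
  by apply: lee_wpmul2l => //; rewrite inver gt_eqF// lee_fin invr_ge0 ltW.
rewrite inver gt_eqF// muleA -EFinM mulVf ?gt_eqF// mul1e -EFinM => h2.
have -> : (E - M / 2 + d%:R - p ^+ 2 / (p - 1) * lam / 2 =
   ((p - 1) / p)^-1 * ((p - 1) / p * (P - ln (Kd d) + d%:R) - p * lam / 2) - N)%R.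
  have -> : E = (P - ln (Kd d) + M / 2 - N)%R by lra.
  by field; rewrite !gt_eqF.
by rewrite EFinB leeBrDr.
Qed.

(** For lam > 0 the second alternative says J/2 < E - M/2 + d, with J the Fisher information,
    against the logarithmic Sobolev inequality E + d <= (M + J)/2. *)
Lemma rate_nonpos (lam : R) : (0 < lam)%R ->
  \forall t \near (0%R : R)^'+, ouN F (nelson p t) t < (expR (nelson p t * t * lam))%:E.
Proof.
move=> l0; have [E [M [N [P [hE hM _ _ _]]]]] := entropy_reals mrho rho0 rho1 entf.
have [//|h] := rate_dichotomy lam hE hM.
have := lsi (row_C1_line_C1 rD) rho0 rho1 ltr01.
have -> : \int[leb d]_x (kl (rho x) (1 * phi x))%:E = E%:E.
  by rewrite -hE; apply: eq_integral => x _; rewrite mul1r.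
have p10 : (0 < p - 1)%R by rewrite subr_gt0.
have pl : (0 < p ^+ 2 / (p - 1) * lam / 2)%R.
  by rewrite !divr_gt0// mulr_gt0// divr_gt0// exprn_gt0// (lt_trans _ p1).
have S0 : 0 <= \sum_(i < d) \int[leb d]_x (D i x ^+ 2 / rho x)%:E.
  by apply: sume_ge0 => i _; apply: ge0_integral_real_ge0 => x; rewrite divr_ge0 ?sqr_ge0.
rewrite hM; move: h S0; case: (\sum_(i < d) _) => [S| |]//; last first.
  by rewrite mulry gtr0_sg ?invr_gt0// mul1e.
by rewrite -!EFinD -!EFinM !lee_fin; lra.
Qed.
End rate.

(** * Monotonicity from a Dini derivative *)

Section dini.
Context {R : realType}.

(** Continuity will be checked along sequences because dominated convergence is a statement on
    sequences. *)
Lemma seq_continuous (f : R -> R) (a : R) :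
  (forall u : R^nat, u @ \oo --> a -> f (u n) @[n --> \oo] --> f a) -> {for a, continuous f}.
Proof.
move=> h; apply/cvgrPdist_le => e e0; apply: contrapT => hn.
have hx n : exists x : R, `|a - x| < n.+1%:R^-1 /\ ~ (`|f a - f x| <= e).
  apply: contrapT => nx; apply: hn; near=> x.
  have xn : `|a - x| < n.+1%:R^-1 by near: x; apply: cvgr_dist_lt; rewrite ?invr_gt0//; exact: cvg_id.
  by apply: contrapT => hx; apply: nx; exists x.
have [u hu] := choice hx.
have cu : u @ \oo --> a.
  apply/cvgrPdist_lt => r r0; have := @near_infty_natSinv_lt R (PosNum r0).
  by apply: filterS => n /= hr; case: (hu n) => h1 _; exact: lt_trans h1 hr.
have /cvgrPdist_le/(_ e e0) [N _ hN] := h u cu.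
by case: (hu N) => _; apply; exact: (hN N (leqnn N)).
Unshelve. all: by end_near. Qed.

(** After tilting by an arbitrary slope l > 0, let s be the supremum of the points of [a, b] where
    the tilted function g is at most g(a). Continuity puts s in this set, and the hypothesis at s
    pushes past it unless s = b. *)
Lemma dini_le (f : R -> R) (a b : R) : continuous f -> a <= b ->
  (forall t, a <= t -> forall l, 0 < l -> \forall s \near (0 : R)^'+, f (t + s) <= f t + l * s) ->
  f b <= f a.
Proof.
move=> cf ab hd.
suff key l : 0 < l -> f b <= f a + l * (b - a).
  apply/ler_addgt0Pr => e e0.
  have ba : 0 < b - a + 1 by rewrite ltr_wpDl// subr_ge0.
  have le0 : 0 < e / (b - a + 1) by rewrite divr_gt0.
  apply: le_trans (key _ le0) _; rewrite lerD2l mulrAC ler_pdivrMr// ler_wpM2l ?(ltW e0)//.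
  by rewrite lerDl.
move=> l0; pose g x := f x - l * x.
suff : g b <= g a by rewrite /g; lra.
have cg : continuous g.
  by move=> x; exact: (cvgB (cf x) (cvgM (cvg_cst l) cvg_id)).
pose S := [set x | a <= x <= b /\ g x <= g a].
have Sa : S a by split; rewrite ?lexx.
have hS : has_sup S by split; [exists a|exists b => x [/andP[_ xb] _]].
set s := sup S.
have sa : a <= s by apply: sup_upper_bound.
have sb : s <= b by apply: sup_le_ub; [exists a|move=> x [/andP[]]].
have gs : g s <= g a.
  rewrite leNgt; apply/negP => gas.
  have /cvgrPdist_lt/(_ (g s - g a)) := cg s; rewrite subr_gt0 => /(_ gas).
  move=> /nbhs_ballP[r /= r0 hr].
  have [x Sx xs] := sup_adherent r0 hS.
  have xs' : x <= s by apply: sup_upper_bound.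
  have := hr x; rewrite /ball/= => /(_ _).
  have xr : `|s - x| < r by rewrite ger0_norm ?subr_ge0//; rewrite -/s in xs; lra.
  move=> /(_ xr); rewrite ltr_norml => /andP[_].
  by case: Sx => _; lra.
have [bs|bs] := leP b s; first by have <- : s = b by apply/eqP; rewrite eq_le sb bs.
have near1 := hd s sa l l0.
have near2 : \forall u \near (0 : R)^'+, u < b - s by apply: nbhs_right_lt; rewrite subr_gt0.
have near3 : \forall u \near (0 : R)^'+, 0 < u by exact: nbhs_right_gt.
have [u [h1 h2 h3]] : exists u, [/\ f (s + u) <= f s + l * u, u < b - s & 0 < u].
  near ((0 : R)^'+) => u; exists u; split; by near: u.
have Su : S (s + u).
  split; first by apply/andP; split; lra.
  by apply: le_trans gs; rewrite /g; lra.
have := sup_upper_bound hS Su; rewrite -/s; lra.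
Unshelve. all: by end_near. Qed.
End dini.

(** * The semigroup on functions bounded above and away from 0 *)

Section nelson_bounded.
Context {R : realType} {d : nat}.
Implicit Types F : 'rV[R]_d -> R.

Lemma gexp_cvg (f_ : nat -> 'rV[R]_d -> R) (f : 'rV[R]_d -> R) (C : R) :
  (forall n, measurable_fun setT (f_ n)) -> measurable_fun setT f ->
  (forall n x, `|f_ n x| <= C) -> (forall x, `|f x| <= C) ->
  (forall x, f_ n x @[n --> \oo] --> f x) -> gexp (f_ n) @[n --> \oo] --> gexp f.
Proof.
move=> mf_ mf b_ bf cf; apply: fine_cvg; rewrite -/(gexp f) (gexpK (gintegrable_bounded mf bf)).
apply: (@dominated_cvg _ _ _ (gam d) setT measurableT (fun n x => (f_ n x)%:E) (fun x => (f x)%:E) (cst C%:E)).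
- by move=> n; exact/measurable_EFinP.
- by move=> x _; apply: cvg_EFin; [exact: nearW|exact: cf].
- by [].
- by have := @gintegrable_bounded R d (fun=> C) `|C| (measurable_cst C) (fun=> lexx _); exact.
- by move=> n x _; rewrite /= lee_fin.
Qed.

Definition ou F (t : R) : 'rV[R]_d -> R := smo F (expR (- t)) (Num.sqrt (1 - expR (- (2 * t)))).

Lemma measurable_smo F (a s : R) : measurable_fun setT F -> (forall x, 0 <= F x) ->
  measurable_fun setT (smo F a s).
Proof.
move=> mF F0; apply: measurableT_comp => //.
apply: (@measurable_fun_fubini_tonelli_F _ _ _ _ R (gam d) (fun z : 'rV[R]_d * 'rV[R]_d => (F (a *: z.1 + s *: z.2))%:E)).
  by meas.
by move=> z; rewrite lee_fin.
Qed.

Section fixed.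
Variables (F : 'rV[R]_d -> R) (e M : R).
Hypotheses (mF : measurable_fun setT F) (e0 : 0 < e) (eF : forall x, e <= F x) (FM : forall x, F x <= M).

Let F0 x : 0 <= F x. Proof. exact: le_trans (ltW e0) (eF x). Qed.
Let eM : e <= M. Proof. exact: le_trans (eF 0) (FM 0). Qed.

Lemma measurable_ou t : measurable_fun setT (ou F t).
Proof. exact: measurable_smo. Qed.

Lemma ou_shift_measurable t x : measurable_fun setT
  (fun w : 'rV[R]_d => F (expR (- t) *: x + Num.sqrt (1 - expR (- (2 * t))) *: w)).
Proof. by meas. Qed.

Lemma ou_le t x : ou F t x <= M.
Proof. by apply: le_trans (ler_norm _) _; exact: smo_bound. Qed.

Lemma ou_ge t x : e <= ou F t x.
Proof.
rewrite -[leLHS](gexp_cst (d := d)); apply: le_gexp.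
- by apply: (@gintegrable_bounded _ _ _ `|e|).
- apply: (@gintegrable_bounded _ _ _ M); first exact: ou_shift_measurable.
  by move=> w; rewrite ger0_norm.
- by move=> w.
Qed.

Lemma ouK t x : ((ou F t x)%:E = \int[gam d]_y
  (F (expR (- t) *: x + Num.sqrt (1 - expR (- (2 * t))) *: y))%:E)%E.
Proof.
apply: gexpK; apply: (@gintegrable_bounded _ _ _ M); first exact: ou_shift_measurable.
by move=> w; rewrite ger0_norm.
Qed.

Definition ouPow (q t : R) : R := gexp (fun x => ou F t x `^ q).

Lemma ou_powR_bound q Q t x : 0 <= q <= Q -> 0 <= ou F t x `^ q <= (1 + M) `^ Q.
Proof.
move=> /andP[q0 qQ]; rewrite powR_ge0/=.
have M0 : 0 <= M := le_trans (ltW e0) eM.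
apply: (@le_trans _ _ ((1 + M) `^ q)).
  apply: (ge0_ler_powR q0); rewrite ?nnegrE ?addr_ge0//.
    exact: le_trans (ltW e0) (ou_ge t x).
  by apply: le_trans (ou_le t x) _; rewrite lerDr.
by apply: ler_powR => //; rewrite lerDl.
Qed.

Let mpow q t : measurable_fun setT (fun x => ou F t x `^ q).
Proof. by have h := measurable_ou t; meas. Qed.

Let ipow q t : 0 <= q -> gintegrable (fun x => ou F t x `^ q).
Proof.
move=> q0; apply: (@gintegrable_bounded _ _ _ ((1 + M) `^ q)); first exact: mpow.
by move=> x; have /andP[h1 h2] : 0 <= ou F t x `^ q <= (1 + M) `^ q by [apply: ou_powR_bound; rewrite q0 lexx];
  rewrite ger0_norm.
Qed.

Lemma ouN_ouPow q t : 0 <= q -> (ouN F q t = (ouPow q t)%:E)%E.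
Proof.
move=> q0; rewrite /ouPow gexpK; last exact: ipow.
by apply: eq_integral => x _; rewrite -ouK poweR_EFin.
Qed.

Lemma ouPow_gt0 q t : 0 <= q -> 0 < ouPow q t.
Proof.
move=> q0; apply: (@lt_le_trans _ _ (e `^ q)); first exact: powR_gt0.
rewrite -[leLHS](gexp_cst (d := d)); apply: le_gexp; [|exact: ipow|].
  by apply: (@gintegrable_bounded _ _ _ `|e `^ q|).
move=> x; apply: (ge0_ler_powR q0); rewrite ?nnegrE ?(ltW e0)//; last exact: ou_ge.
exact: le_trans (ltW e0) (ou_ge t x).
Qed.
End fixed.

(** The combined noise c1 s2 y + s1 z is sg times the first component of a reflected pair;
    [gam_reflection] makes that component standard normal again. *)
Lemma ou_semigroup F (e M t s : R) x : measurable_fun setT F -> 0 < e ->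
  (forall x, e <= F x) -> (forall x, F x <= M) -> 0 < t -> 0 < s ->
  ou (ou F t) s x = ou F (t + s) x.
Proof.
move=> mF e0 eF FM t0 s0.
have F0 y : 0 <= F y := le_trans (ltW e0) (eF y).
have mou := measurable_ou mF e0 eF t.
apply: EFin_inj; rewrite (ouK mF e0 eF FM) (ouK mou e0 (ou_ge mF e0 eF FM t) (ou_le mF e0 eF FM t)).
under eq_integral do rewrite (ouK mF e0 eF FM).
pose c1 := expR (- t); pose c2 := expR (- s); pose c := expR (- (t + s)).
have cE : c = c1 * c2 by rewrite /c1 /c2 -expRD /c; congr expR; ring.
have sq u : expR (- (2 * u)) = expR (- u) ^+ 2 by rewrite -expRM_natl; congr expR; ring.
have lt1 u : 0 < u -> 0 < 1 - expR (- u) ^+ 2.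
  by move=> u0; rewrite subr_gt0 -sq expR_lt1 oppr_lt0 mulr_gt0.
have ts0 : 0 < t + s by rewrite addr_gt0.
pose s1 := Num.sqrt (1 - c1 ^+ 2); pose s2 := Num.sqrt (1 - c2 ^+ 2); pose sg := Num.sqrt (1 - c ^+ 2).
have s1E : s1 ^+ 2 = 1 - c1 ^+ 2 by rewrite sqr_sqrtr// ltW// lt1.
have s2E : s2 ^+ 2 = 1 - c2 ^+ 2 by rewrite sqr_sqrtr// ltW// lt1.
have sgE : sg ^+ 2 = 1 - c ^+ 2 by rewrite sqr_sqrtr// ltW// lt1.
have s10 : 0 < s1 by rewrite sqrtr_gt0 lt1.
have s20 : 0 < s2 by rewrite sqrtr_gt0 lt1.
have sg0 : 0 < sg by rewrite sqrtr_gt0 lt1.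
have c10 : 0 < c1 by exact: expR_gt0.
rewrite !sq -/c1 -/c2 -/c -/s1 -/s2 -/sg.
pose al := c1 * s2 / sg; pose be := s1 / sg.
have al0 : 0 < al by rewrite /al divr_gt0// mulr_gt0.
have ab : al ^+ 2 + be ^+ 2 = 1.
  have -> : al ^+ 2 + be ^+ 2 = (c1 ^+ 2 * s2 ^+ 2 + s1 ^+ 2) / sg ^+ 2.
    by rewrite /al /be; field; rewrite gt_eqF.
  have n0 : sg ^+ 2 != 0 by rewrite gt_eqF// exprn_gt0.
  rewrite s2E s1E; apply: (mulIf n0); rewrite divfK// mul1r sgE cE; ring.
pose k (z : 'rV[R]_d * 'rV[R]_d) : \bar R := (F (c *: x + sg *: z.1))%:E.
have mk : measurable_fun setT k.
  have h1 : measurable_fun setT (fun z : 'rV[R]_d * 'rV[R]_d => c *: x + sg *: z.1) by meas.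
  by apply/measurable_EFinP; exact: (measurableT_comp mF h1).
have k0 z : (0 <= k z)%E by rewrite lee_fin.
have := gam_reflection al0 ab mk k0; rewrite /k /=.
under [X in _ = X -> _]eq_integral do rewrite integral_cst//= (_ : gam d setT = 1%E) ?mule1 ?gamT//.
move=> <-; apply: eq_integral => y _; apply: eq_integral => z _; congr (F _)%:E.
rewrite !scalerDr !scalerA -addrA; congr (_ *: _ + (_ *: _ + _ *: _)).
- by rewrite cE.
- by rewrite /al; field; rewrite gt_eqF.
- by rewrite /be; field; rewrite gt_eqF.
Qed.
End nelson_bounded.

Section nelson.
Context {R : realType} {d : nat}.

Lemma nelson_gt1 (p t : R) : 1 < p -> 1 < nelson p t.
Proof. by move=> p1; rewrite /nelson ltrDl mulr_gt0 ?expR_gt0// subr_gt0. Qed.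

Lemma nelsonD (p t s : R) : nelson (nelson p t) s = nelson p (t + s).
Proof. by rewrite /nelson addrAC subrr add0r mulrDr expRD; ring. Qed.

Lemma continuous_nelson (p : R) : continuous (nelson p).
Proof.
move=> t; have c1 : {for t, continuous (fun t : R => expR (2 * t))}.
  apply: (@continuous_comp R R R (fun t : R => 2 * t) (@expR R)); last exact: continuous_expR.
  exact: mulrl_continuous.
exact: (cvgD (cvg_cst (1 : R)) (cvgM (cvg_cst (p - 1)) c1)).
Qed.

Section bounded_below.
Variables (F : 'rV[R]_d -> R) (e M p : R).
Hypotheses (cF : continuous F) (e0 : 0 < e) (eF : forall x, e <= F x) (FM : forall x, F x <= M)
  (p1 : 1 < p).

Let mF : measurable_fun setT F := continuous_measurable_row cF.
Let F0 x : 0 <= F x. Proof. exact: le_trans (ltW e0) (eF x). Qed.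
Let eM : e <= M. Proof. exact: le_trans (eF 0) (FM 0). Qed.
Let M0 : 0 <= M. Proof. exact: le_trans (ltW e0) eM. Qed.

Definition lnou (t : R) : R := ln (ouPow F (nelson p t) t) / nelson p t.

Let q0 t : 0 < nelson p t. Proof. exact: lt_trans (nelson_gt1 t p1). Qed.

Lemma continuous_lnou : continuous lnou.
Proof.
move=> t; apply: seq_continuous => u ut.
have cq : nelson p (u n) @[n --> \oo] --> nelson p t.
  exact: (cvg_comp u (nelson p) ut (@continuous_nelson p t)).
have [Q [Q0 hQ]] := pinfty_ex_gt0 (cvg_seq_bounded (cvgP _ cq)).
have cou x : ou F (u n) x @[n --> \oo] --> ou F t x.
  apply: (gexp_cvg (C := M)).
  - by move=> n; exact: ou_shift_measurable.
  - exact: ou_shift_measurable.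
  - by move=> n w; rewrite ger0_norm.
  - by move=> w; rewrite ger0_norm.
  - move=> w; have cN : - u n @[n --> \oo] --> - t by exact: cvgN.
    have cN2 : - (2 * u n) @[n --> \oo] --> - (2 * t).
      by apply: cvgN; apply: cvgM => //; exact: cvg_cst.
    have c1 : expR (- u n) @[n --> \oo] --> expR (- t).
      exact: (cvg_comp _ _ cN (@continuous_expR R _)).
    have c2 : Num.sqrt (1 - expR (- (2 * u n))) @[n --> \oo] --> Num.sqrt (1 - expR (- (2 * t))).
      have cE := cvg_comp _ _ cN2 (@continuous_expR R _).
      have cB : 1 - expR (- (2 * u n)) @[n --> \oo] --> 1 - expR (- (2 * t)).
        by apply: cvgB; [exact: cvg_cst|exact: cE].
      exact: (cvg_comp _ _ cB (@sqrt_continuous R _)).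
    have c3 : expR (- u n) *: x @[n --> \oo] --> expR (- t) *: x by exact: cvgZr_tmp.
    have c4 : Num.sqrt (1 - expR (- (2 * u n))) *: w @[n --> \oo] -->
        Num.sqrt (1 - expR (- (2 * t))) *: w by exact: cvgZr_tmp.
    have c5 : expR (- u n) *: x + Num.sqrt (1 - expR (- (2 * u n))) *: w @[n --> \oo] -->
        expR (- t) *: x + Num.sqrt (1 - expR (- (2 * t))) *: w by exact: cvgD.
    have cFp : F @ nbhs (expR (- t) *: x + Num.sqrt (1 - expR (- (2 * t))) *: w) -->
        F (expR (- t) *: x + Num.sqrt (1 - expR (- (2 * t))) *: w) by exact: cF.
    have c6 := cvg_comp _ _ c5 cFp. exact: c6.
have cpow : ouPow F (nelson p (u n)) (u n) @[n --> \oo] --> ouPow F (nelson p t) t.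
  apply: (gexp_cvg (C := Num.max ((1 + M) `^ Q) ((1 + M) `^ nelson p t))).
  - by move=> n; have h := measurable_ou mF e0 eF (u n); meas.
  - by have h := measurable_ou mF e0 eF t; meas.
  - move=> n x; have hq : 0 <= nelson p (u n) <= Q.
      by rewrite (ltW (q0 _))/=; apply: le_trans (ler_norm _) _; exact: hQ.
    have /andP[h1 h2] := ou_powR_bound mF e0 eF FM (u n) x hq.
    by rewrite ger0_norm// le_max h2.
  - move=> x; have hq : 0 <= nelson p t <= nelson p t by rewrite (ltW (q0 _)) lexx.
    have /andP[h1 h2] := ou_powR_bound mF e0 eF FM t x hq.
    by rewrite ger0_norm// le_max h2 orbT.
  - move=> x; have ou0 s : 0 < ou F s x by exact: lt_le_trans e0 (ou_ge mF e0 eF FM s x).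
    have pE s r : ou F s x `^ r = expR (r * ln (ou F s x)) by rewrite /powR gt_eqF.
    have -> : (fun n => ou F (u n) x `^ nelson p (u n)) =
        (fun n => expR (nelson p (u n) * ln (ou F (u n) x))) by apply/funext => n; exact: pE.
    rewrite pE.
    have cl : ln (ou F (u n) x) @[n --> \oo] --> ln (ou F t x).
      exact: (cvg_comp _ _ (cou x) (continuous_ln (ou0 t))).
    have cqM : nelson p (u n) * ln (ou F (u n) x) @[n --> \oo] -->
      nelson p t * ln (ou F t x) by exact: cvgM.
    exact: (cvg_comp _ _ cqM (@continuous_expR R _)).
have N0 : 0 < ouPow F (nelson p t) t by apply: (ouPow_gt0 mF e0 eF FM); exact: ltW.
have c1 : ln (ouPow F (nelson p (u n)) (u n)) @[n --> \oo] --> ln (ouPow F (nelson p t) t).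
  exact: (cvg_comp _ _ cpow (continuous_ln N0)).
have c2 : (nelson p (u n))^-1 @[n --> \oo] --> (nelson p t)^-1.
  by apply: cvgV => //; rewrite gt_eqF.
exact: (cvgM c1 c2).
Qed.

(** Restart at time t: G is P_t F divided by its norm, and it is C^1 because t > 0. By
    [ou_semigroup] and [nelsonD] the norm of P_(t+s) F at its critical exponent is that of P_s G at
    the critical exponent started from q, up to the factor k, so [rate_nonpos] applies to G. *)
Lemma lnou_dini t l : 0 < t -> 0 < l -> \forall s \near (0 : R)^'+, lnou (t + s) <= lnou t + l * s.
Proof.
move=> t0 l0; pose q := nelson p t; pose k := expR (- lnou t).
have q1 : 1 < q by exact: nelson_gt1.
have q00 : 0 < q by exact: lt_trans q1.
have k0 : 0 < k by exact: expR_gt0.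
pose F' x := k * F x.
have mF' : measurable_fun setT F' by rewrite /F'; meas.
have e0' : 0 < k * e by rewrite mulr_gt0.
have eF' x : k * e <= F' x by rewrite ler_wpM2l ?(ltW k0).
have FM' x : F' x <= k * M by rewrite ler_wpM2l ?(ltW k0).
have F0' x : 0 <= F' x by rewrite mulr_ge0 ?(ltW k0).
have ouE s x : ou F' s x = k * ou F s x.
  rewrite /ou /smo gexpZ//; apply: (@gintegrable_bounded _ _ _ M); first exact: ou_shift_measurable.
  by move=> w; rewrite ger0_norm.
pose G := ou F' t.
have mG : measurable_fun setT G by exact: (measurable_ou mF' e0' eF').
have eG x : k * e <= G x by exact: (ou_ge mF' e0' eF' FM').
have GM x : G x <= k * M by exact: (ou_le mF' e0' eF' FM').
have Gpos x : 0 < G x by exact: lt_le_trans e0' (eG x).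
have G0 x : 0 <= G x := ltW (Gpos x).
pose sg := Num.sqrt (1 - expR (- (2 * t))).
have sg0 : 0 < sg by rewrite sqrtr_gt0 subr_gt0 expR_lt1 oppr_lt0 mulr_gt0.
have rG : row_C1 G (smoD F' (expR (- t)) sg) by exact: (row_C1_smo (expR (- t)) mF' F0' FM' sg0).
have rR := row_C1M (row_C1_powR q rG Gpos) (@row_C1_phi R d).
have powE r s : 0 <= r -> gexp (fun x => (k * ou F s x) `^ r) = k `^ r * ouPow F r s.
  move=> r0; rewrite /ouPow -gexpZ.
    apply: eq_gexp => x; rewrite powRM ?(ltW k0)//.
    exact: le_trans (ltW e0) (ou_ge mF e0 eF FM s x).
  apply: (@gintegrable_bounded _ _ _ ((1 + M) `^ r)).
    by have h := measurable_ou mF e0 eF s; meas.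
  move=> x; have hr : 0 <= r <= r by rewrite r0 lexx.
  by have /andP[h1 h2] := ou_powR_bound mF e0 eF FM s x hr; rewrite ger0_norm.
have Npos s r : 0 <= r -> 0 < ouPow F r s by move=> r0; exact: (ouPow_gt0 mF e0 eF FM).
have kq : k `^ q * ouPow F q t = 1.
  rewrite /k /powR gt_eqF ?expR_gt0// expRK.
  rewrite -[X in _ * X](lnK (x := ouPow F q t)) ?posrE; last exact/Npos/ltW.
  rewrite -expRD /lnou -/q (_ : _ + _ = 0) ?expR0//.
  by field; rewrite gt_eqF.
have mGq : measurable_fun setT (fun x => G x `^ q) by meas.
have rho1 : (\int[leb d]_x (rho_of G q x)%:E = 1)%E.
  transitivity (\int[gam d]_x (G x `^ q)%:E)%E.
    rewrite ge0_integral_gam; [|exact/measurable_EFinP|by move=> x; rewrite lee_fin powR_ge0].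
    by apply: eq_integral => x _; rewrite EFinM.
  rewrite -(gexpK (f := fun x => G x `^ q)).
    rewrite (eq_gexp (g := fun x => (k * ou F t x) `^ q)); last by move=> x; rewrite /G ouE.
    by rewrite powE ?(ltW q00)// kq.
  apply: (@gintegrable_bounded _ _ _ ((1 + k * M) `^ q)) => // x.
  have hr : 0 <= q <= q by rewrite (ltW q00) lexx.
  by have /andP[h1 h2] := ou_powR_bound mF' e0' eF' FM' t x hr; rewrite ger0_norm.
have mp := @measurable_phi R d.
(* kl z 1 <= (z - 1)^2, and z = G^q is bounded by C. *)
have entf : (\int[leb d]_x (kl (rho_of G q x) (phi x))%:E < +oo)%E.
  pose C := (1 + k * M) `^ q.
  have C0 : 0 <= C by exact: powR_ge0.
  apply: (@le_lt_trans _ _ (\int[leb d]_x ((C + 1) ^+ 2 * phi x)%:E)%E).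
    have mrho : measurable_fun setT (rho_of G q) by rewrite /rho_of; meas.
    apply: ge0_le_integralr; try by meas.
      by move=> x; rewrite kl_ge0 ?phi_gt0// mulr_ge0 ?powR_ge0 ?phi_ge0.
    move=> x; have g0 : 0 < G x `^ q by exact: powR_gt0.
    have gC : G x `^ q <= C.
      have hr : 0 <= q <= q by rewrite (ltW q00) lexx.
      by have /andP[] := ou_powR_bound mF' e0' eF' FM' t x hr.
    rewrite /rho_of mulrC -{2}(mulr1 (phi x)) klM ?phi_ge0 ?(ltW g0)// [leRHS]mulrC ler_wpM2l ?phi_ge0//.
    rewrite klE ?(ltW g0)// ln1 subr0; have := ler_wpM2l (ltW g0) (ln_le_sub1 g0); nra.
  by rewrite ge0_integralZ ?sqr_ge0 ?integral_phi ?mule1 ?ltry//; move=> x; exact: phi_ge0.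
have := rate_nonpos q1 mG G0 rR rho1 entf l0.
apply: filterS2 (nbhs_right_gt 0) => s s0.
pose q' := nelson p (t + s).
have q'0 : 0 < q' by exact: q0.
rewrite nelsonD -/q' (ouN_ouPow mG e0' eG GM s (ltW q'0)) lte_fin.
have -> : ouPow G q' s = k `^ q' * ouPow F q' (t + s).
  rewrite -(powE _ _ (ltW q'0)); apply: eq_gexp => x.
  by rewrite /G (ou_semigroup x mF' e0' eF' FM' t0 s0) ouE.
have N'0 := Npos (t + s) q' (ltW q'0).
rewrite -ltr_ln ?posrE ?expR_gt0 ?mulr_gt0 ?powR_gt0// expRK lnM ?posrE ?powR_gt0// ln_powR expRK.
rewrite {2}/lnou -/q'.
move: (ln _) (lnou t) => a b h; rewrite ler_pdivrMr; last by [].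
rewrite (_ : (b + l * s) * q' = q' * b + q' * s * l); last by ring.
by move: h; rewrite mulrN addrC ltrBlDl => /ltW.
Qed.

(** The Dini bound holds for positive times, where the semigroup has smoothed F; the inequality from
    s to t is carried to s = 0 by continuity. *)
Lemma lnou_le t : 0 <= t -> lnou t <= lnou 0.
Proof.
rewrite le_eqVlt => /predU1P[<-//|t0].
apply/ler_addgt0Pr => r r0.
have /cvgrPdist_le/(_ r r0) h := @continuous_lnou 0.
have h' : \forall s \near (0 : R)^'+, `|lnou 0 - lnou s| <= r.
  by apply: cvg_within; exact: h.
have h1 : \forall s \near (0 : R)^'+, 0 < s by exact: nbhs_right_gt.
have h2 : \forall s \near (0 : R)^'+, s < t by exact: nbhs_right_lt.
have [s [k1 k2 k3]] : exists s, [/\ `|lnou 0 - lnou s| <= r, 0 < s & s < t].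
  by near ((0 : R)^'+) => s; exists s; split; near: s.
have : lnou t <= lnou s.
  apply: (dini_le continuous_lnou (ltW k3)) => u su l l0.
  by apply: lnou_dini => //; exact: lt_le_trans k2 su.
by move: k1; rewrite ler_distl => /andP[? ?]; lra.
Unshelve. all: by end_near. Qed.

Lemma nelson_bounded_below t : 0 <= t ->
  ouPow F (nelson p t) t <= gexp (fun x => F x `^ p) `^ (nelson p t / p).
Proof.
move=> t0; have h := lnou_le t0.
have p0 : 0 < p by exact: lt_trans p1.
have n0 : nelson p 0 = p by rewrite /nelson mulr0 expR0 mulr1 addrC subrK.
have o0 x : ou F 0 x = F x.
  rewrite /ou /smo oppr0 mulr0 oppr0 expR0 subrr sqrtr0.
  rewrite (eq_gexp (g := fun=> F x)) ?gexp_cst// => w.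
  by rewrite scale1r scale0r addr0.
have e1 : ouPow F p 0 = gexp (fun x => F x `^ p) by apply: eq_gexp => x; rewrite o0.
have Npos s r : 0 <= r -> 0 < ouPow F r s by move=> r0; exact: (ouPow_gt0 mF e0 eF FM).
rewrite -e1 -ler_ln ?posrE ?powR_gt0 ?Npos ?(ltW p0) ?(ltW (q0 t))//.
rewrite ln_powR; move: h; rewrite {2}/lnou n0 /lnou ler_pdivrMr//.
by move=> h; apply: le_trans h _; rewrite le_eqVlt; apply/orP; left; apply/eqP; field; rewrite gt_eqF.
Qed.
End bounded_below.
End nelson.

(** * Hypercontractivity for continuous nonnegative functions *)

Section nelson_general.
Context {R : realType} {d : nat}.
Local Open Scope ereal_scope.

Lemma ou_fine (F : 'rV[R]_d -> R) (p t : R) (x : 'rV[R]_d) : (1 < p)%R -> measurable_fun setT F ->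
  (forall x, 0 <= F x)%R -> \int[leb d]_x (rho_of F p x)%:E = 1 -> (0 < t)%R ->
  (ou F t x)%:E = \int[gam d]_y (F (expR (- t) *: x + Num.sqrt (1 - expR (- (2 * t))) *: y)%R)%:E.
Proof.
move=> p1 mF F0 rho1 t0.
have p0 : (0 < p)%R by exact: lt_trans p1.
have c2 : (expR (- t) ^+ 2 = expR (- (2 * t)))%R by rewrite -expRM_natl mulrN mulr_natl.
have h1 : (expR (- (2 * t)) < 1)%R by rewrite expR_lt1 oppr_lt0 mulr_gt0.
have pc : (0 < p - 1 + expR (- t) ^+ 2)%R by rewrite addr_gt0 ?subr_gt0// exprn_gt0 ?expR_gt0.
have sg0 : (0 < Num.sqrt (1 - expR (- (2 * t))))%R by rewrite sqrtr_gt0 subr_gt0.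
have csg : (expR (- t) ^+ 2 + Num.sqrt (1 - expR (- (2 * t))) ^+ 2 = 1)%R.
  by rewrite sqr_sqrtr ?subr_ge0 ?(ltW h1)// c2 addrC subrK.
have a0 : (0 < Num.sqrt ((p - 1 + expR (- t) ^+ 2) / p))%R by rewrite sqrtr_gt0 divr_gt0.
have aE : (Num.sqrt ((p - 1 + expR (- t) ^+ 2) / p) ^+ 2 = (p - 1 + expR (- t) ^+ 2) / p)%R.
  by rewrite sqr_sqrtr// ltW// divr_gt0.
have h := mehler_fine p1 (expR_gt0 _) sg0 csg a0 aE erefl erefl erefl mF F0 rho1 x.
by rewrite /ou /smo /gexp h.
Qed.

(* Truncate F to [1/(k+1), k+1] and pass to the limit by Fatou's lemma. *)
Lemma nelson_le1 (F : 'rV[R]_d -> R) (p t : R) : (1 < p)%R -> continuous F ->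
  (forall x, 0 <= F x)%R -> \int[leb d]_x (rho_of F p x)%:E = 1 -> (0 < t)%R ->
  ouN F (nelson p t) t <= 1.
Proof.
move=> p1 cF F0 rho1 t0; have mF := continuous_measurable_row cF.
have p0 : (0 < p)%R by exact: lt_trans p1.
have q1 := nelson_gt1 t p1; set q := nelson p t in q1 *.
have q0 : (0 < q)%R by exact: lt_trans q1.
pose e n : R := (n.+1%:R^-1)%R; pose M n : R := n.+1%:R%R.
have e0 n : (0 < e n)%R by rewrite invr_gt0.
have eM n : (e n <= M n)%R.
  by rewrite (@le_trans _ _ 1%R)// ?ler1n// invf_le1// ler1n.
pose T n (z : R) : R := Num.max (Num.min z (M n)) (e n).
have cT n : continuous (T n).
  move=> z; have cm : {for z, continuous (fun z : R => Num.min z (M n))}.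
    exact: (@continuous_min R R id (fun=> M n) z cvg_id (cvg_cst _)).
  exact: (@continuous_max R R _ (fun=> e n) z cm (cvg_cst _)).
pose Fk n x := T n (F x).
have cFk n : continuous (Fk n).
  by move=> x; apply: (@continuous_comp 'rV[R]_d R R F (T n)); [exact: cF|exact: cT].
have mFk n := continuous_measurable_row (cFk n).
have eF n x : (e n <= Fk n x)%R by rewrite /Fk /T le_max lexx orbT.
have FM n x : (Fk n x <= M n)%R by rewrite /Fk /T ge_max eM andbT ge_min lexx orbT.
have Fk0 n x : (0 <= Fk n x)%R := le_trans (ltW (e0 n)) (eF n x).
have Fpow : \int[gam d]_x (F x `^ p)%:E = 1.
  rewrite -rho1 ge0_integral_gam; [|by meas|by move=> x; rewrite lee_fin powR_ge0].
  by apply: eq_integral => x _; rewrite EFinM.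
(* Cutting at the top only lowers the function; where the cut at the bottom raises it, the new value
   is e n, so the integral grows by at most (e n)^p. *)
have FkP n : (gexp (fun x => Fk n x `^ p) <= 1 + e n `^ p)%R.
  have ig : gintegrable (fun x => Fk n x `^ p)%R.
    apply: (@gintegrable_bounded _ _ _ (M n `^ p)%R); first by have h := mFk n; meas.
    move=> x; rewrite ger0_norm ?powR_ge0// ge0_ler_powR ?nnegrE ?(ltW p0)//.
  rewrite -lee_fin gexpK// EFinD -Fpow -(integral_gam_cst (d := d) (e n `^ p)).
  rewrite -(ge0_integralDr (gam d)); [|by meas|by meas|by move=> x; exact: powR_ge0|by move=> x; exact: powR_ge0].
  apply: ge0_le_integralr; [by have h := mFk n; meas|by meas|by move=> x; exact: powR_ge0|].
  move=> x; have [h|h] := leP (Fk n x) (F x).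
    by rewrite (le_trans (y := F x `^ p)%R) ?lerDl ?powR_ge0// ge0_ler_powR ?nnegrE ?(ltW p0).
  have -> : Fk n x = e n.
    by move: h; rewrite /Fk /T lt_max => /orP[|h]; [rewrite lt_min ltxx|rewrite max_r// ge_min (ltW h)].
  by rewrite lerDr powR_ge0.
have ouF x := ou_fine x p1 mF F0 rho1 t0.
have -> : ouN F q t = \int[gam d]_x (ou F t x `^ q)%:E.
  by apply: eq_integral => x _; rewrite -ouF.
have mou : measurable_fun setT (ou F t) by exact: measurable_smo.
have ou0 x : (0 <= ou F t x)%R by exact: smo_ge0.
have mouk n : measurable_fun setT (ou (Fk n) t) by exact: measurable_smo.
apply: (fatou_bound (f_ := fun n x => ou (Fk n) t x `^ q)%R).
- by move=> n; have h := mouk n; meas.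
- by move=> n x; exact: powR_ge0.
- by meas.
- by move=> x; exact: powR_ge0.
- move=> x r r0.
  have low eps : (0 < eps)%R -> \forall n \near \oo, (ou F t x - eps <= ou (Fk n) t x)%R.
    move=> eps0.
    pose sh (y : 'rV[R]_d) := (expR (- t) *: x + Num.sqrt (1 - expR (- (2 * t))) *: y)%R.
    have msh (G : 'rV[R]_d -> R) : measurable_fun setT G -> measurable_fun setT (fun y => G (sh y)).
      by move=> mG; apply: (measurableT_comp mG); rewrite /sh; meas.
    have := fatou_lb (mu := gam d) (f_ := fun n y => Fk n (sh y)) (f := fun y => F (sh y)) (L := ou F t x)
      (fun n => msh _ (mFk n)) (fun n y => Fk0 n _) (msh _ mF) (fun y => F0 _) _ _ eps0.
    rewrite ouF => /(_ _ (lexx _)) h.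
    have {}h := h _.
    have : \forall n \near \oo, (ou F t x - eps)%:E <= \int[gam d]_y (Fk n (sh y))%:E.
      apply: h => y e1 e10.
      have := @nbhs_infty_ger R (F (sh y)); apply: filterS => n /= hn.
      rewrite /Fk /T le_max min_l; first by rewrite gerBl ltW.
      by rewrite (le_trans hn)// ler_nat.
    apply: filterS => n; rewrite -lee_fin.
    by rewrite -(ouK (mFk n) (e0 n) (eF n) (FM n)).
  (* Slope of z^q at the limit value: the tangent line carries the lower bound for P_t F_n over to
     its q-th power. *)
  pose k := (q * ou F t x `^ (q - 1))%R.
  have k0 : (0 <= k)%R by rewrite mulr_ge0 ?powR_ge0// ltW.
  have k1 : (0 < k + 1)%R by rewrite ltr_wpDl.
  have ek : (0 < r / (k + 1))%R by rewrite divr_gt0.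
  have := low _ ek; apply: filterS => n h.
  have hw : (0 <= ou (Fk n) t x)%R by exact: smo_ge0.
  have tg := powR_tangent q1 hw (ou0 x).
  have kL : (k * ou F t x = q * ou F t x `^ q)%R by rewrite /k -mulrA [(_ `^ _ * _)%R]mulrC mulr_powRB1.
  rewrite -/k in tg; have kh := ler_wpM2l k0 h.
  have kr : (k * (r / (k + 1)) <= r)%R.
    by rewrite mulrA ler_pdivrMr// [(k * r)%R]mulrC ler_wpM2l ?(ltW r0)// lerDl.
  move: tg kh kr kL; rewrite mulrBr; lra.
- move=> r r0.
  have qp0 : (0 <= q / p)%R by rewrite divr_ge0 ?ltW.
  have ce : e @ \oo --> (0 : R)%R.
    exact: cvg_harmonic.
  have c1 : (q / p * e n)%R @[n --> \oo] --> (q / p * 0)%R by apply: cvgM => //; exact: cvg_cst.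
  have c2 : expR (q / p * e n) @[n --> \oo] --> expR (q / p * 0).
    exact: (cvg_comp _ _ c1 (@continuous_expR R _)).
  rewrite mulr0 expR0 in c2.
  have /cvgrPdist_le/(_ r r0) := c2; apply: filterS => n hn.
  have e1 : (e n <= 1)%R by rewrite invf_le1// ler1n.
  have -> : \int[gam d]_x (ou (Fk n) t x `^ q)%:E = (ouPow (Fk n) q t)%:E.
    rewrite -(ouN_ouPow (mFk n) (e0 n) (eF n) (FM n) t (ltW q0)).
    by apply: eq_integral => x _; rewrite -(ouK (mFk n) (e0 n) (eF n) (FM n)).
  have g0 : (0 <= gexp (fun x => Fk n x `^ p))%R.
    by apply/fine_ge0/integral_ge0 => x _; rewrite lee_fin powR_ge0.
  have ep : (e n `^ p <= e n)%R.
    by rewrite ge1r_powR ?e0 ?e1// ltW.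
  rewrite lee_fin; apply: le_trans (nelson_bounded_below (cFk n) (e0 n) (eF n) (FM n) p1 (ltW t0)) _.
  rewrite -/q; apply: (@le_trans _ _ (expR (q / p * e n))); last first.
    by move: hn; rewrite ler_distl => /andP[]; lra.
  apply: (@le_trans _ _ ((1 + e n) `^ (q / p))%R).
    rewrite ge0_ler_powR ?nnegrE//; first by rewrite addr_ge0 ?ltW.
    by apply: le_trans (FkP n) _; rewrite lerD2l.
  rewrite /powR gt_eqF ?addr_gt0// ler_expR ler_wpM2l//.
  by apply: le_trans (ln_le_sub1 _) _; rewrite ?addr_gt0// addrC addKr.
Qed.

End nelson_general.

(** * Laws and their relative entropies *)

Section gint_theory.
Context {R : realType}.
Local Open Scope ereal_scope.
Let N : {measure set (measurableTypeR R) -> \bar R} := normal_prob (0 : R) 1.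

(** Positive and negative parts are treated separately, each by Tonelli's theorem; the semigroup
    applies the iterated integral to functions of arbitrary sign. *)
Lemma measurable_integral_signed d (T : measurableType d) (f : T * measurableTypeR R -> \bar R) :
  measurable_fun setT f ->
  measurable_fun setT (fun x => \int[normal_prob (0 : R) 1]_y f (x, y)).
Proof.
move=> mf; under eq_fun do rewrite integralE.
have h (g : T * measurableTypeR R -> \bar R) : measurable_fun setT g -> (forall z, 0 <= g z) ->
    measurable_fun setT (fun x => \int[normal_prob (0 : R) 1]_y g (x, y)).
  by move=> mg g0; apply: (@measurable_fun_fubini_tonelli_F _ _ _ _ R (normal_prob (0 : R) 1) g).
apply: emeasurable_funB.
  under eq_fun do under eq_integral do rewrite funeposE.
  apply: (h (fun z => maxe (f z) 0)) => [|z]; last by rewrite le_max lexx orbT.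
  by apply: measurable_maxe.
under eq_fun do under eq_integral do rewrite funenegE.
apply: (h (fun z => maxe (- f z) 0)) => [|z]; last by rewrite le_max lexx orbT.
by apply: measurable_maxe => //; exact: measurableT_comp.
Qed.

Lemma gint0 (F : 'rV[R]_0 -> \bar R) : gint F = F 0%R.
Proof. by rewrite /gint /=; congr F; apply/rowP => -[]. Qed.

Lemma gintS d (F : 'rV[R]_d.+1 -> \bar R) :
  gint F = \int[normal_prob (0 : R) 1]_x gint (fun v => F (consr x v)).
Proof.
rewrite /gint /=; apply: eq_integral => x _.
by congr gint_tuple; apply/funext => v; rewrite row_of_tuple_cons.
Qed.

Lemma measurable_gint d d' (T : measurableType d') (F : T -> 'rV[R]_d -> \bar R) :
  measurable_fun setT (fun z : T * 'rV[R]_d => F z.1 z.2) ->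
  measurable_fun setT (fun x => gint (F x)).
Proof.
elim: d d' T F => [|d IH] d' T F mF.
  under eq_fun do rewrite gint0.
  apply: (measurableT_comp (f := fun z : T * 'rV[R]_0 => F z.1 z.2) (g := fun x => (x, 0%R))) => //.
under eq_fun do rewrite gintS.
apply: (measurable_integral_signed (f := fun z : T * measurableTypeR R =>
  gint (fun v => F z.1 (consr z.2 v)))).
apply: IH; apply: (measurableT_comp (f := fun z : T * 'rV[R]_d.+1 => F z.1 z.2)
  (g := fun w : (T * measurableTypeR R) * 'rV[R]_d => (w.1.1, consr w.1.2 w.2))) => //.
apply: measurable_fun_pair => /=.
  exact: (measurableT_comp measurable_fst measurable_fst).
apply: measurable_consr; first exact: (measurableT_comp measurable_snd measurable_fst).
exact: measurable_snd.
Qed.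

Lemma measurable_gint_cons d (F : 'rV[R]_d.+1 -> \bar R) : measurable_fun setT F ->
  measurable_fun setT (fun x : measurableTypeR R => gint (fun v => F (consr x v))).
Proof.
move=> mF; apply: (measurable_gint (F := fun (x : measurableTypeR R) v => F (consr x v))).
by apply: measurableT_comp => //; exact: measurable_consr2.
Qed.

Lemma abs_gint_le d (F : 'rV[R]_d -> \bar R) : measurable_fun setT F ->
  `|gint F| <= gint (fun x => `|F x|).
Proof.
elim: d F => [|d IH] F mF; first by rewrite !gint0.
rewrite !gintS; apply: le_trans (le_abse_integral N measurableT _) _.
  exact: measurable_gint_cons.
apply: ge0_le_integral => //.
- by apply: measurableT_comp => //; exact: measurable_gint_cons.
- by apply: (@measurable_gint_cons d (fun x => `|F x|)); exact: measurableT_comp.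
- move=> x _; apply: IH; exact: measurable_consl.
Qed.

(** The negative part of g is at most c, hence has a finite integral, and can be cancelled after c
    is added on both sides. *)
Lemma integral_lower (c : R) (g : measurableTypeR R -> \bar R) : (0 <= c)%R -> measurable_fun setT g ->
  (forall x, - c%:E <= g x) -> \int[N]_x g x + c%:E = \int[N]_x (g x + c%:E).
Proof.
move=> c0 mg cg.
have cst : \int[N]_x c%:E = c%:E by rewrite integral_cst//= probability_setT mule1.
have mp := measurable_funepos mg; have mn := measurable_funeneg mg.
have gc0 x : 0 <= g x + c%:E by rewrite -leeBlDr// sub0e.
have nc x : g^\- x <= c%:E by rewrite funenegE ge_max leeNl cg lee_fin.
have nfin : \int[N]_x g^\- x <= c%:E.
  rewrite -cst; apply: ge0_le_integral => //; by move=> x _; exact: funeneg_ge0.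
have n0 : 0 <= \int[N]_x g^\- x by apply: integral_ge0 => x _; exact: funeneg_ge0.
have nf : \int[N]_x g^\- x \is a fin_num.
  by rewrite ge0_fin_numE//; apply: le_lt_trans nfin (ltry _).
have E : \int[N]_x g^\+ x + c%:E = \int[N]_x (g x + c%:E) + \int[N]_x g^\- x.
  rewrite -{1}cst.
  have mgc : measurable_fun setT (fun x => g x + c%:E) by apply: emeasurable_funD.
  rewrite -(ge0_integralDe N mp (measurable_cst c%:E) (fun x => funepos_ge0 _ _)); last first.
    by move=> x; rewrite lee_fin.
  rewrite -(ge0_integralDe N mgc mn gc0 (fun x => funeneg_ge0 _ _)).
  apply: eq_integral => x _; rewrite funeposE funenegE.
  have := cg x; case: (g x) => [r _| _|]//; last by rewrite max_l ?leey// max_r ?leNye// adde0.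
  rewrite -EFinN -!EFin_max -!EFinD; congr EFin.
  by case: (leP r 0%R) => h1; case: (leP (- r) 0)%R => h2; lra.
rewrite integralE; move: E nf; set X := \int[N]_x g^\+ x; set Y := \int[N]_x (g x + _).
set n := \int[N]_x g^\- x; case: n => // m /adde_fin_eq -> _.
by case: Y => [y| |]//=; rewrite -!EFinD; congr EFin; ring.
Qed.

(** Gives access to iterated integrals of functions bounded below, such as rho ln rho >= -1. At
    every level of the iteration the inner integral is again at least -c. *)
Lemma gint_lower d (c : R) (F : 'rV[R]_d -> \bar R) : (0 <= c)%R -> measurable_fun setT F ->
  (forall x, - c%:E <= F x) -> gint F + c%:E = \int[gam d]_x (F x + c%:E).
Proof.
move=> c0 mF cF.
have mFc n (G : 'rV[R]_n -> \bar R) : measurable_fun setT G -> measurable_fun setT (fun x => G x + c%:E).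
  by move=> mG; apply: emeasurable_funD.
have Fc0 (y : \bar R) : - c%:E <= y -> 0 <= y + c%:E by move=> h; rewrite -leeBlDr// sub0e.
rewrite -gintE; [|exact: mFc|by move=> x; exact: Fc0].
elim: d F mF cF => [|d IH] F mF cF; first by rewrite !gint0.
have IHx x : gint (fun v => F (consr x v)) + c%:E = gint (fun v => F (consr x v) + c%:E).
  by apply: IH => //; exact: measurable_consl.
rewrite !gintS integral_lower//; last 2 first.
- exact: measurable_gint_cons.
- move=> x; rewrite -(sub0e c%:E) leeBlDr// IHx gintE; last 2 first.
  + by apply: mFc; exact: measurable_consl.
  + by move=> v; exact: Fc0.
  by apply: integral_ge0 => v _; exact: Fc0.
by apply: eq_integral => x _; rewrite IHx.
Qed.

End gint_theory.

(** * Relative entropy of a law with a density *)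

Section relative_entropy.
Context {R : realType} {d : nat}.
Local Open Scope ereal_scope.

Lemma gdensity_unique (r1 r2 : 'rV[R]_d -> R) : measurable_fun setT r1 -> measurable_fun setT r2 ->
  (forall x, 0 <= r1 x)%R -> (forall x, 0 <= r2 x)%R -> \int[gam d]_x (r1 x)%:E = 1 ->
  (forall h : 'rV[R]_d -> R, measurable_fun setT h -> (forall x, 0 <= h x)%R ->
     \int[gam d]_x (r1 x * h x)%:E = \int[gam d]_x (r2 x * h x)%:E) ->
  ae_eq (gam d) setT (EFin \o r1) (EFin \o r2).
Proof.
move=> m1 m2 r10 r20 i1 H; apply: integral_ae_eq => //.
- apply/integrableP; split; first exact/measurable_EFinP.
  rewrite (eq_integral (fun x => (r1 x)%:E)) ?i1 ?ltry// => x _.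
  by rewrite /= ger0_norm.
- exact/measurable_EFinP.
move=> E _ mE; rewrite integral_mkcond [RHS]integral_mkcond !epatch_indic.
exact: (H (\1_E) (measurable_indic mE)).
Qed.

(** [Dent] takes an unspecified density, but two densities of the same law agree almost everywhere,
    so the given one may be used. Both rho and 1 have Gaussian integral 1, whence the integral of
    rho ln rho is that of [kl rho 1]; [gint_lower] relates it to the iterated integral. *)
Lemma Dent_kl (Ex : ('rV[R]_d -> R) -> \bar R) (r : 'rV[R]_d -> R) :
  measurable_fun setT r -> (forall x, 0 <= r x)%R -> \int[leb d]_x (r x)%:E = 1 ->
  (forall h : 'rV[R]_d -> R, measurable_fun setT h -> (forall x, 0 <= h x)%R ->
     Ex h = \int[leb d]_x (r x * h x)%:E) ->
  Dent Ex = \int[leb d]_x (kl (r x) (phi x))%:E.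
Proof.
move=> mr r0 r1 ExE.
have mp := @measurable_phi R d.
have phin0 (x : 'rV[R]_d) : (phi x != 0)%R by rewrite gt_eqF ?phi_gt0.
pose rho0 x := (r x / phi x)%R.
have mrho0 : measurable_fun setT rho0 by rewrite /rho0; meas.
have rho00 x : (0 <= rho0 x)%R by rewrite divr_ge0 ?phi_ge0.
have toleb (F : 'rV[R]_d -> R) : measurable_fun setT F -> (forall x, 0 <= F x)%R ->
    \int[gam d]_x (F x)%:E = \int[leb d]_x (F x * phi x)%:E.
  move=> mF F0; rewrite ge0_integral_gam; [|exact/measurable_EFinP|by move=> x; rewrite lee_fin].
  by apply: eq_integral => x _; rewrite EFinM.
have gE (F : 'rV[R]_d -> R) : measurable_fun setT F -> (forall x, 0 <= F x)%R ->
    gint (EFin \o F) = \int[gam d]_x (F x)%:E.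
  by move=> mF F0; rewrite gintE//; exact/measurable_EFinP.
have dens (h : 'rV[R]_d -> R) : measurable_fun setT h -> (forall x, 0 <= h x)%R ->
    Ex h = \int[gam d]_x (rho0 x * h x)%:E.
  move=> mh h0; rewrite toleb; [|by meas|by move=> x; rewrite mulr_ge0].
  by rewrite ExE//; apply: eq_integral => x _; rewrite /rho0 mulrAC divfK.
have H : exists rho, is_gdensity Ex rho.
  exists rho0; split; [exact/gmeasurableE|split => //] => h /gmeasurableE mh h0.
  by rewrite dens// -gE//; [meas|move=> x; rewrite mulr_ge0].
rewrite /Dent; case: pselect => // H'.
case: (cid H') => rho [/gmeasurableE mrho [rho_ge0 rhoE]] /=.
have rhoE' (h : 'rV[R]_d -> R) : measurable_fun setT h -> (forall x, 0 <= h x)%R ->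
    Ex h = \int[gam d]_x (rho x * h x)%:E.
  move=> mh h0; rewrite -gE; [|by meas|by move=> x; rewrite mulr_ge0].
  by apply: rhoE => //; exact/gmeasurableE.
have rho1 : \int[gam d]_x (rho x)%:E = 1.
  rewrite -r1; transitivity (Ex (fun=> 1%R)).
    by rewrite rhoE'//; apply: eq_integral => x _; rewrite mulr1.
  by rewrite ExE//; apply: eq_integral => x _; rewrite mulr1.
have ae : ae_eq (gam d) setT (EFin \o rho) (EFin \o rho0).
  by apply: gdensity_unique => // h mh h0; rewrite -rhoE'// -dens.
have m1 : measurable_fun setT (fun x => kl (rho x) 1) by meas.
have m0 : measurable_fun setT (fun x => kl (rho0 x) 1) by meas.
have k1 x : (0 <= kl (rho x) 1)%R by exact: kl_ge0.
have k0 x : (0 <= kl (rho0 x) 1)%R by exact: kl_ge0.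
have -> : \int[leb d]_x (kl (r x) (phi x))%:E = \int[gam d]_x (kl (rho0 x) 1)%:E.
  rewrite toleb//; apply: eq_integral => x _.
  rewrite mulrC -klM ?phi_ge0//; first by rewrite mulr1 /rho0 mulrC divfK.
have -> : \int[gam d]_x (kl (rho0 x) 1)%:E = \int[gam d]_x (kl (rho x) 1)%:E.
  apply: ae_eq_integral => //; [exact/measurable_EFinP|exact/measurable_EFinP|].
  by apply: filterS ae => x /= h /h [->].
have mln : measurable_fun setT (fun x => rho x * ln (rho x))%R by meas.
have lnE x : (rho x * ln (rho x) + 1 = kl (rho x) 1 + rho x)%R.
  by rewrite klE// ln1 subr0; ring.
have low x : - 1%:E <= (rho x * ln (rho x))%:E.
  rewrite -EFinN lee_fin; have := lnE x; have := k1 x; have := rho_ge0 x; lra.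
have mlnE : measurable_fun setT (fun x => (rho x * ln (rho x))%:E) by meas.
have := gint_lower ler01 mlnE low.
have -> : \int[gam d]_x ((rho x * ln (rho x))%:E + 1%:E) = \int[gam d]_x (kl (rho x) 1)%:E + 1%:E.
  rewrite -[in RHS]rho1 -(ge0_integralDr (gam d) m1 mrho k1 rho_ge0).
  by apply: eq_integral => x _; rewrite -EFinD lnE.
by move=> /adde_fin_eq ->; rewrite subrr adde0.
Qed.

End relative_entropy.

(** * Differentiability of |z|^p at every point *)

Section abs_power.
Context {R : realType}.

Lemma continuous_pos_powR (r : R) : 0 < r -> continuous (fun z : R => Num.max z 0 `^ r).
Proof.
move=> r0 z; have [z0|z0] := leP z 0.
  apply: (@continuous_distP R R _ z) => e e0.
  have h : z < e `^ r^-1 by exact: le_lt_trans z0 (powR_gt0 _ e0).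
  near=> y; rewrite max_r// powR0 ?gt_eqF// sub0r normrN ger0_norm ?powR_ge0//.
  have yh : y < e `^ r^-1 by near: y; exact: lt_nbhsl.
  have [y0|y0] := leP y 0; first by rewrite powR0 ?gt_eqF// ltW.
  have -> : e = (e `^ r^-1) `^ r by rewrite -powRrM mulVf ?gt_eqF// powRr1 ?ltW.
  by rewrite ge0_ler_powR ?nnegrE ?powR_ge0 ?(ltW r0) ?(ltW y0) ?(ltW yh).
have cm : {for z, continuous (fun z : R => Num.max z 0)}.
  exact: (@continuous_max R R id (fun=> 0) z cvg_id (cvg_cst _)).
have cp : {for Num.max z 0, continuous (fun y : R => y `^ r)}.
  have m0 : 0 < Num.max z 0 by rewrite lt_max z0.
  have dp := @is_derive1_powR R r _ m0.
  by apply/differentiable_continuous/derivable1_diffP; case: dp.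
exact: (@continuous_comp R R R (fun z : R => Num.max z 0) (fun y => y `^ r) z cm cp).
Unshelve. all: by end_near. Qed.

(** The derivative p |z|^(p - 1) sign z of |z|^p, written with positive parts: its continuity, also
    at 0, is that of the power of a positive part. *)
Definition dabs_powR (p z : R) : R := p * (Num.max z 0 `^ (p - 1) - Num.max (- z) 0 `^ (p - 1)).

Lemma continuous_dabs_powR p : 1 < p -> continuous (dabs_powR p).
Proof.
move=> p1; have p10 : 0 < p - 1 by rewrite subr_gt0.
move=> z; have cN : {for z, continuous (fun z : R => Num.max (- z) 0 `^ (p - 1))}.
  have c0 : - y @[y --> z] --> - z by apply: cvgN; exact: cvg_id.
  have c1 : Num.max y 0 `^ (p - 1) @[y --> - z] --> Num.max (- z) 0 `^ (p - 1).
    exact: continuous_pos_powR.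
  exact: (cvg_comp _ _ c0 c1).
have c2 : Num.max y 0 `^ (p - 1) @[y --> z] --> Num.max z 0 `^ (p - 1) by exact: continuous_pos_powR.
have c3 : Num.max y 0 `^ (p - 1) - Num.max (- y) 0 `^ (p - 1) @[y --> z] -->
  Num.max z 0 `^ (p - 1) - Num.max (- z) 0 `^ (p - 1) by exact: (cvgB c2 cN).
exact: (cvgM (cvg_cst p) c3).
Qed.

Lemma abs_powR_subgradient (p y z : R) : 1 < p ->
  dabs_powR p z * (y - z) <= `|y| `^ p - `|z| `^ p.
Proof.
move=> p1; have p0 : 0 < p by exact: lt_trans p1.
have p10 : p - 1 != 0 by rewrite gt_eqF// subr_gt0.
have tg := powR_tangent p1 (normr_ge0 y) (normr_ge0 z).
have zz : `|z| * `|z| `^ (p - 1) = `|z| `^ p by rewrite mulr_powRB1.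
have k0 : 0 <= p * `|z| `^ (p - 1) by rewrite mulr_ge0 ?powR_ge0 ?ltW.
have pz : p * `|z| `^ (p - 1) * `|z| = p * `|z| `^ p by rewrite -mulrA [_ `^ _ * _]mulrC zz.
apply: (@le_trans _ _ (p * `|z| `^ (p - 1) * (`|y| - `|z|))); last first.
  by move: tg pz; rewrite mulrBr; lra.
rewrite /dabs_powR; have /orP[z0|z0] := le_total z 0.
  rewrite (max_r z0) max_l ?oppr_ge0// powR0// sub0r; rewrite (ler0_norm z0) in k0 *.
  have -> : p * - (- z) `^ (p - 1) * (y - z) = p * (- z) `^ (p - 1) * (- y - - z) by ring.
  by rewrite ler_wpM2l// lerD2r; rewrite -normrN ler_norm.
rewrite (max_l z0) max_r ?oppr_le0// powR0// subr0; rewrite (ger0_norm z0) in k0 *.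
by rewrite ler_wpM2l// lerD2r ler_norm.
Qed.

(* A convex function with a continuous subgradient is differentiable: this
   avoids treating the point 0 separately. *)
Lemma is_derive_abs_powR (p z : R) : 1 < p -> is_derive z 1 (fun y => `|y| `^ p) (dabs_powR p z).
Proof.
move=> p1; set g := fun y : R => `|y| `^ p; set l := dabs_powR p z.
have c0 : u + z @[u --> (0 : R)] --> 0 + z by apply: cvgD; [exact: cvg_id|exact: cvg_cst].
have c1 : dabs_powR p (u + z) @[u --> (0 : R)] --> l.
  have c2 : dabs_powR p @ (0 + z) --> dabs_powR p (0 + z) by exact: continuous_dabs_powR.
  by have c3 := cvg_comp _ _ c0 c2; rewrite add0r in c3; exact: c3.
have cl : h^-1 *: (g (h *: 1 + z) - g z) @[h --> (0:R)^'] --> l.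
  apply/cvgrPdist_le => e e0; near=> t.
  have tn : t != 0 by near: t; exact: nbhs_dnbhs_neq.
  have te : `|l - dabs_powR p (t + z)| <= e.
    by near: t; apply: cvg_within; move/cvgrPdist_le: c1; exact.
  rewrite /GRing.scale/= mulr1.
  have h1 := abs_powR_subgradient (t + z) z p1; have h2 := abs_powR_subgradient z (t + z) p1.
  rewrite -/(g _) -/(g _) -/l in h1 h2.
  have -> : l - t^-1 * (g (t + z) - g z) = - (t^-1 * (g (t + z) - g z - t * l)) by field.
  rewrite normrN normrM normfV -ler_pdivlMl ?invr_gt0 ?normr_gt0// invrK.
  apply: (@le_trans _ _ (`|t| * `|l - dabs_powR p (t + z)|)); last by rewrite ler_wpM2l.
  rewrite -normrM ger0_norm; last by move: h1; lra.
  by rewrite -normrN; apply: le_trans (ler_norm _); move: h2; lra.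
split; last exact/cvg_lim.
by apply/cvg_ex; exists l.
Unshelve. all: by end_near. Qed.

End abs_power.

Section smooth_functions.
Context {R : realType} {d : nat}.

Lemma row_C1_comp (f : 'rV[R]_d -> R) D (g g' : R -> R) : row_C1 f D ->
  (forall z : R, is_derive z 1 g (g' z)) -> continuous g' ->
  row_C1 (fun x => g (f x)) (fun i x => g' (f x) * D i x).
Proof.
move=> [cf cD df] dg cg'.
have cg : continuous g.
  by move=> z; apply/differentiable_continuous/derivable1_diffP; case: (dg z).
split.
- move=> x; exact: (@continuous_comp 'rV[R]_d R R f g x (cf x) (cg _)).
- move=> i x; have h := @continuous_comp 'rV[R]_d R R f g' x (cf x) (cg' _).
  exact: (cvgM h (cD i x)).
- move=> x y; have d0 : is_derive ((fun s : R => f (x + s *: y)) 0) 1 g (g' (f x)).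
    by rewrite scale0r addr0; exact: dg.
  apply: (is_derive_eq (@is_derive1_comp R g (fun s => f (x + s *: y)) 0 _ _ d0 (df x y))).
  by rewrite mulr_sumr; apply: eq_bigr => i _; ring.
Qed.

Lemma smooth_row_C1 (f : 'rV[R]_d -> R) : smooth f ->
  row_C1 f (fun i x => 'D_(delta_mx 0 i) f x).
Proof.
move=> sf; have df x : differentiable f x := sf [::] x.
split.
- by move=> x; exact: differentiable_continuous.
- by move=> i x; apply: differentiable_continuous; exact: (sf [:: delta_mx 0 i] x).
- move=> x y; have dy := diff_derivable (v := y) (df x).
  have E : 'D_y f x = \sum_i y 0 i * 'D_(delta_mx 0 i) f x.
    rewrite deriveE// {1}(row_sum_delta y) linear_sum; apply: eq_bigr => i _.
    by rewrite linearZ deriveE.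
  rewrite -E.
  have qE : (fun h : R => h^-1 *: (f (x + (h *: (1 : R) + 0) *: y) - f (x + (0 : R) *: y))) =
     (fun h : R => h^-1 *: (f (h *: y + x) - f x)).
    by apply/funext => h; rewrite scale0r addr0 addr0 [h *: 1]mulr1 [x + _]addrC.
  split; first by rewrite /derivable qE.
  by rewrite /derive qE.
Qed.

Lemma row_C1_abs_powR (f : 'rV[R]_d -> R) D (p : R) : 1 < p -> row_C1 f D ->
  row_C1 (fun x => `|f x| `^ p) (fun i x => dabs_powR p (f x) * D i x).
Proof.
move=> p1 h; apply: (row_C1_comp h (fun z => is_derive_abs_powR z p1)).
exact: continuous_dabs_powR.
Qed.

Lemma row_C1Z (f : 'rV[R]_d -> R) D (k : R) : row_C1 f D ->
  row_C1 (fun x => k * f x) (fun i x => k * D i x).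
Proof.
move=> h; apply: (row_C1_comp (g := fun z => k * z) (g' := fun=> k) h) => [z|]; last exact: cst_continuous.
by apply: (is_derive_eq (is_deriveZ k (is_derive_id z 1))); rewrite /GRing.scale/= mulr1.
Qed.

Lemma coord_le_norm (x : 'rV[R]_d) i : `|x 0 i| <= `|x|.
Proof.
rewrite [leRHS]/Num.norm/= mx_normrE.
exact: (le_bigmax_cond _ (fun ij : 'I_1 * 'I_d => `|x ij.1 ij.2|) (j := (0, i))).
Qed.

End smooth_functions.

Lemma ae_imp2 d (T : measurableType d) (R : realType) (mu : {measure set T -> \bar R})
  (P1 P2 Q : T -> Prop) : {ae mu, forall x, P1 x} -> {ae mu, forall x, P2 x} ->
  (forall x, P1 x -> P2 x -> Q x) -> {ae mu, forall x, Q x}.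
Proof. by move=> a1 a2 PQ; apply: filterS2 a1 a2 => x; exact: PQ. Qed.

Section signed_gint.
Context {R : realType}.
Local Open Scope ereal_scope.

(** Meant for the mean, whose integrand is bounded on neither side. In the induction the inner
    integrals are finite for almost every x only, which is enough to subtract under the outer
    one. *)
Lemma gint_sub d (A B : 'rV[R]_d -> R) : measurable_fun setT A -> measurable_fun setT B ->
  (forall x, 0 <= A x)%R -> (forall x, 0 <= B x)%R ->
  \int[gam d]_x (A x)%:E < +oo -> \int[gam d]_x (B x)%:E < +oo ->
  gint (fun x => (A x - B x)%:E) = \int[gam d]_x (A x)%:E - \int[gam d]_x (B x)%:E.
Proof.
elim: d A B => [|d IH] A B mA mB A0 B0 fA fB.
  have mAE : measurable_fun setT (EFin \o A) by exact/measurable_EFinP.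
  have mBE : measurable_fun setT (EFin \o B) by exact/measurable_EFinP.
  by rewrite gint0 (integral_powm0 _ mAE) (integral_powm0 _ mBE).
have step (F : 'rV[R]_d.+1 -> R) : measurable_fun setT F -> (forall x, 0 <= F x)%R ->
    \int[gam d.+1]_x (F x)%:E < +oo ->
    [/\ measurable_fun setT (fun x : measurableTypeR R => \int[gam d]_v (F (consr x v))%:E),
      \int[gam d.+1]_x (F x)%:E = \int[normal_prob (0 : R) 1]_x \int[gam d]_v (F (consr x v))%:E,
      (normal_prob (0 : R) 1).-integrable setT (fun x => \int[gam d]_v (F (consr x v))%:E) &
      {ae normal_prob (0 : R) 1, forall x, \int[gam d]_v (F (consr x v))%:E \is a fin_num}].
  move=> mF F0 fF; have mFE : measurable_fun setT (EFin \o F) by exact/measurable_EFinP.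
  have F0E x : 0 <= (EFin \o F) x by rewrite lee_fin.
  have m := measurable_powm_cons (normal_prob (0 : R) 1) mFE F0E.
  have E := integral_powmS (normal_prob (0 : R) 1) mFE F0E.
  have i0 (x : R) : 0 <= \int[gam d]_v (F (consr x v))%:E by exact: ge0_integral_real_ge0.
  split => //.
    apply/integrableP; split => //.
    by under eq_integral do rewrite gee0_abs//; rewrite -E.
  by apply: ge0_integral_fin_ae => //; rewrite -E.
have [mA' EA iA aA] := step A mA A0 fA; have [mB' EB iB aB] := step B mB B0 fB.
have mAB : measurable_fun setT (fun x => (A x - B x)%:E) by meas.
rewrite EA EB -integralB// gintS; apply: ae_eq_integral => //.
- exact: (measurable_gint_cons mAB).
- exact: emeasurable_funB.
apply: (ae_imp2 aA aB) => x fa fb _.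
have ge0 (F : 'rV[R]_d.+1 -> R) : (forall x, 0 <= F x)%R -> 0 <= \int[gam d]_v (F (consr x v))%:E.
  by move=> F0; exact: ge0_integral_real_ge0.
apply: IH.
- by apply: measurableT_comp => //; exact: measurable_consr.
- by apply: measurableT_comp => //; exact: measurable_consr.
- by [].
- by [].
- by rewrite -ge0_fin_numE// ge0.
- by rewrite -ge0_fin_numE// ge0.
Qed.

End signed_gint.

(** * Translation of a density *)

Section densities.
Context {R : realType} {d : nat}.
Local Open Scope ereal_scope.
Implicit Types r : 'rV[R]_d -> R.

Let pp (z : R) := Num.max z 0%R.
Let nn (z : R) := Num.max (- z)%R 0%R.
Let pp0 z : (0 <= pp z)%R. Proof. by rewrite le_max lexx orbT. Qed.
Let nn0 z : (0 <= nn z)%R. Proof. by rewrite le_max lexx orbT. Qed.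
Let ppnn z : (z = pp z - nn z)%R.
Proof.
rewrite /pp /nn; have /orP[h|h] := le_total 0%R z.
  by rewrite max_l// max_r ?subr0// oppr_le0.
by rewrite max_r// max_l ?sub0r ?opprK// oppr_ge0.
Qed.

(** The equation says that the i-th mean is 0 after the shift by m, in the form that
    [static_inequality] takes. It follows from (x_i - m_i) r = x_i r - m_i r, each of the three
    products being split into its parts. *)
Lemma centered_shift r (m : 'rV[R]_d) (i : 'I_d) (a b : R) : measurable_fun setT r ->
  (forall x, 0 <= r x)%R -> \int[leb d]_x (r x)%:E = 1 ->
  \int[leb d]_x (Num.max (x 0%R i * r x) 0)%:E = a%:E ->
  \int[leb d]_x (Num.max (- (x 0%R i * r x)) 0)%:E = b%:E -> m 0%R i = (a - b)%R ->
  \int[leb d]_y (Num.max (y 0%R i * r (y + m)%R) 0)%:E =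
    \int[leb d]_y (Num.max (- (y 0%R i * r (y + m)%R)) 0)%:E /\
  \int[leb d]_y (Num.max (y 0%R i * r (y + m)%R) 0)%:E < +oo.
Proof.
move=> mr r0 r1 ia ib mi.
have mx : measurable_fun setT (fun x : 'rV[R]_d => x 0%R i * r x)%R by meas.
have mxm : measurable_fun setT (fun x : 'rV[R]_d => (x 0%R i - m 0%R i) * r x)%R by meas.
have sh (F : R -> R) : measurable_fun setT (fun x : 'rV[R]_d => F ((x 0%R i - m 0%R i) * r x)%R) ->
    (forall z, 0 <= F z)%R ->
    \int[leb d]_y (F (y 0%R i * r (y + m)%R))%:E = \int[leb d]_x (F ((x 0%R i - m 0%R i) * r x)%R)%:E.
  move=> mF F0; rewrite -(leb_shift m mF (fun x => F0 _)).
  by apply: eq_integral => y _; rewrite !mxE addrK.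
have mppm : measurable_fun setT (fun x : 'rV[R]_d => pp ((x 0%R i - m 0%R i) * r x)) by rewrite /pp; meas.
have mnnm : measurable_fun setT (fun x : 'rV[R]_d => nn ((x 0%R i - m 0%R i) * r x)) by rewrite /nn; meas.
have mppx : measurable_fun setT (fun x : 'rV[R]_d => pp (x 0%R i * r x)) by rewrite /pp; meas.
have mnnx : measurable_fun setT (fun x : 'rV[R]_d => nn (x 0%R i * r x)) by rewrite /nn; meas.
rewrite (sh pp mppm pp0) (sh nn mnnm nn0).
set A := \int[leb d]_x (pp _)%:E; set B := \int[leb d]_x (nn _)%:E.
have lin (k1 k2 : 'rV[R]_d -> R) (u v : R) K : measurable_fun setT k1 -> measurable_fun setT k2 ->
    (forall x, 0 <= k1 x)%R -> (forall x, 0 <= k2 x)%R -> \int[leb d]_x (k1 x)%:E = K ->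
    \int[leb d]_x (k2 x)%:E = u%:E -> (0 <= v)%R ->
    \int[leb d]_x (k1 x + (k2 x + v * r x))%:E = K + (u + v)%:E.
  move=> m1 m2 k10 k20 i1 i2 v0.
  have mv : measurable_fun setT (fun x => v * r x)%R by meas.
  have v0' x : (0 <= v * r x)%R by rewrite mulr_ge0.
  have m2v : measurable_fun setT (fun x => k2 x + v * r x)%R by meas.
  have m2v0 x : (0 <= k2 x + v * r x)%R by rewrite addr_ge0.
  rewrite (ge0_integralDr (leb d) m1 m2v k10 m2v0) i1 (ge0_integralDr (leb d) m2 mv k20 v0') i2.
  by rewrite (ge0_integralZ (leb d) mr r0 v0) r1 mule1 EFinD.
have E : A + (b + pp (m 0%R i))%:E = B + (a + nn (m 0%R i))%:E.
  rewrite -(lin _ _ _ _ _ mppm mnnx (fun=> pp0 _) (fun=> nn0 _) erefl ib (pp0 _)).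
  rewrite -(lin _ _ _ _ _ mnnm mppx (fun=> nn0 _) (fun=> pp0 _) erefl ia (nn0 _)).
  apply: eq_integral => x _; congr EFin.
  have h1 := ppnn ((x 0 i - m 0 i) * r x)%R; have h2 := ppnn (x 0 i * r x)%R; have h3 := ppnn (m 0 i)%R.
  have h4 : (m 0 i * r x = pp (m 0 i) * r x - nn (m 0 i) * r x)%R by rewrite {1}h3 mulrBl.
  move: h1 h2 h4; rewrite mulrBl; lra.
have Af : A < +oo.
  apply: (@le_lt_trans _ _ (a + b + `|m 0%R i|)%:E); last exact: ltry.
  have mmr : measurable_fun setT (fun x => `|m 0%R i| * r x)%R by meas.
  have <- : \int[leb d]_x (pp (x 0%R i * r x) + (nn (x 0%R i * r x) + `|m 0%R i| * r x))%:E = (a + b + `|m 0%R i|)%:E.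
    by rewrite (lin _ _ _ _ _ mppx mnnx (fun=> pp0 _) (fun=> nn0 _) ia ib (normr_ge0 _)) -EFinD addrA.
  apply: ge0_le_integralr => //.
    by apply: measurable_funD => //; apply: measurable_funD.
  move=> x; rewrite {1}/pp ge_max addr_ge0 ?pp0// ?addr_ge0 ?nn0 ?mulr_ge0// andbT.
  have h2 := ppnn (x 0 i * r x)%R; have h4 := nn0 (x 0 i * r x)%R.
  have h3 : (- (m 0 i * r x) <= `|m 0 i| * r x)%R by rewrite -mulNr ler_wpM2r// -normrN ler_norm.
  by rewrite mulrBl; lra.
split => //; move/adde_fin_eq: E => ->.
have -> : (a + nn (m 0%R i) - (b + pp (m 0%R i)) = 0)%R.
  by have := ppnn (m 0 i)%R; lra.
by rewrite adde0.
Qed.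

(** By [entropy_reals], E - M/2 equals P - N - ln (Kd), and the integrals P and N of [lnp] and [lnm]
    do not change under translation. The second moment stays finite by |x - m|^2 <= 2 |x|^2 + 2
    |m|^2, and the entropy with it. *)
Lemma entropy_unshift r (m : 'rV[R]_d) : measurable_fun setT r ->
  (forall x, 0 <= r x)%R -> \int[leb d]_x (r x)%:E = 1 ->
  \int[leb d]_x (kl (r (x + m)%R) (phi x))%:E < +oo ->
  exists E M E' M' : R, [/\ \int[leb d]_x (kl (r (x + m)%R) (phi x))%:E = E%:E,
    \int[leb d]_x (sqn x * r (x + m)%R)%:E = M%:E, \int[leb d]_x (kl (r x) (phi x))%:E = E'%:E,
    \int[leb d]_x (sqn x * r x)%:E = M'%:E & (E - M / 2 = E' - M' / 2)%R].
Proof.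
move=> mr r0 r1 fin.
have mrm : measurable_fun setT (fun x : 'rV[R]_d => r (x + m)%R) by meas.
have r1m : \int[leb d]_x (r (x + m)%R)%:E = 1 by rewrite (leb_shift m mr r0).
have [E [M [N [P [hE hM hN hP EQ]]]]] := entropy_reals mrm (fun x => r0 _) r1m fin.
have mlm : measurable_fun setT (fun x => lnm (r x)) by exact: measurable_lnm.
have mlp : measurable_fun setT (fun x => lnp (r x)) by exact: measurable_lnp.
have lm0 (x : 'rV[R]_d) : (0 <= lnm (r x))%R by exact: lnm_ge0.
have lp0 (x : 'rV[R]_d) : (0 <= lnp (r x))%R by exact: lnp_ge0.
have hN' : \int[leb d]_x (lnm (r x))%:E = N%:E by rewrite -hN (leb_shift m mlm lm0).
have hP' : \int[leb d]_x (lnp (r x))%:E = P%:E by rewrite -hP (leb_shift m mlp lp0).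
have mp := @measurable_phi R d; have ms := @measurable_sqn R d.
have msr : measurable_fun setT (fun x => sqn x * r x)%R by meas.
have sr0 (x : 'rV[R]_d) : (0 <= sqn x * r x)%R by rewrite mulr_ge0// sqn_ge0.
have Mfin : \int[leb d]_x (sqn x * r x)%:E < +oo.
  rewrite -(leb_shift m msr sr0).
  have mb1 : measurable_fun setT (fun x : 'rV[R]_d => sqn x * r (x + m)%R)%R by meas.
  apply: (@le_lt_trans _ _ (\int[leb d]_x (2 * (sqn x * r (x + m)) + 2 * sqn m * r (x + m))%R%:E)).
    apply: ge0_le_integralr; try by meas.
    move=> x; rewrite mulrA -mulrDl ler_wpM2r//.
    rewrite /sqn !mulr_sumr -big_split/= ler_sum// => i _; rewrite !mxE.
    have := sqr_ge0 (x 0%R i - m 0%R i)%R; nra.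
  have e1 (x : 'rV[R]_d) : (0 <= 2 * (sqn x * r (x + m)))%R by rewrite !mulr_ge0// sqn_ge0.
  have e2 (x : 'rV[R]_d) : (0 <= 2 * sqn m * r (x + m))%R by rewrite !mulr_ge0// sqn_ge0.
  have e3 : (0 <= 2 * sqn m)%R by rewrite mulr_ge0// sqn_ge0.
  have mA : measurable_fun setT (fun x : 'rV[R]_d => 2 * (sqn x * r (x + m)))%R by meas.
  have mB : measurable_fun setT (fun x : 'rV[R]_d => 2 * sqn m * r (x + m))%R by meas.
  rewrite (ge0_integralDr (leb d) mA mB e1 e2).
  rewrite (ge0_integralZ (leb d) mrm (fun x => r0 _) e3) r1m mule1.
  rewrite (ge0_integralZ (leb d) mb1 (fun x => mulr_ge0 (sqn_ge0 x) (r0 _)) (ler0n _ 2)) hM.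
  by rewrite -EFinM -EFinD ltry.
have kfin : \int[leb d]_x (kl (r x) (phi x))%:E < +oo.
  have K0 : (0 <= - ln (Kd d : R))%R by rewrite oppr_ge0 ln_le0// Kd_le1.
  have m1 : measurable_fun setT (fun x => - ln (Kd d) * r x)%R by meas.
  have m2 : measurable_fun setT (fun x => 2^-1 * (sqn x * r x))%R by meas.
  have p1 (x : 'rV[R]_d) : (0 <= - ln (Kd d) * r x)%R by rewrite mulr_ge0.
  have p2 (x : 'rV[R]_d) : (0 <= 2^-1 * (sqn x * r x))%R by rewrite mulr_ge0.
  have p3 (x : 'rV[R]_d) : (0 <= 2^-1 * (sqn x * r x) + phi x)%R by rewrite addr_ge0// phi_ge0.
  have p4 (x : 'rV[R]_d) : (0 <= - ln (Kd d) * r x + (2^-1 * (sqn x * r x) + phi x))%R by rewrite addr_ge0.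
  have m3 : measurable_fun setT (fun x => 2^-1 * (sqn x * r x) + phi x)%R by meas.
  have m4 : measurable_fun setT (fun x => - ln (Kd d) * r x + (2^-1 * (sqn x * r x) + phi x))%R by meas.
  apply: (@le_lt_trans _ _ (\int[leb d]_x (lnp (r x) + (- ln (Kd d) * r x + (2^-1 * (sqn x * r x) + phi x)))%R%:E)).
    apply: ge0_le_integralr; [by have h := measurable_kl mr mp; meas|exact: measurable_funD| |].
      by move=> x; rewrite kl_ge0 ?phi_gt0.
    move=> x; rewrite klE ?phi_gt0// lnphi.
    have h : (r x * ln (r x) <= lnp (r x))%R by rewrite /lnp ler_wpM2l// le_max lexx.
    have := r0 x; move: h; lra.
  rewrite (ge0_integralDr (leb d) mlp m4 lp0 p4) hP'.
  rewrite (ge0_integralDr (leb d) m1 m3 p1 p3) (ge0_integralZ (leb d) mr r0 K0) r1 mule1.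
  rewrite (ge0_integralDr (leb d) m2 mp p2 (@phi_ge0 R d)) integral_phi.
  rewrite (ge0_integralZ (leb d) msr sr0); last by rewrite invr_ge0.
  have : \int[leb d]_x (sqn x * r x)%:E \is a fin_num.
    by rewrite ge0_fin_numE//; exact: ge0_integral_real_ge0.
  by case: (integral _ _ _) => // z _; rewrite -EFinM -!EFinD ltry.
have [E' [M' [N' [P' [hE' hM' hN2 hP2 EQ']]]]] := entropy_reals mr r0 r1 kfin.
exists E, M, E', M'; split => //.
have [e1] : N'%:E = N%:E by rewrite -hN2 hN'.
have [e2] : P'%:E = P%:E by rewrite -hP2 hP'.
by move: EQ EQ'; rewrite e1 e2; lra.
Qed.

End densities.

(** * The law attached to one function *)

Section law.
Context {R : realType} {d : nat}.
Local Open Scope ereal_scope.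

Lemma gam_leb (F : 'rV[R]_d -> R) : measurable_fun setT F -> (forall x, 0 <= F x)%R ->
  \int[gam d]_x (F x)%:E = \int[leb d]_x (F x * phi x)%:E.
Proof.
move=> mF F0; rewrite ge0_integral_gam; [|exact/measurable_EFinP|by move=> x; rewrite lee_fin].
by apply: eq_integral => x _; rewrite EFinM.
Qed.

Lemma gint_gam (F : 'rV[R]_d -> R) : measurable_fun setT F -> (forall x, 0 <= F x)%R ->
  gint (fun x => (F x)%:E) = \int[gam d]_x (F x)%:E.
Proof. by move=> mF F0; rewrite gintE//; exact/measurable_EFinP. Qed.

Lemma leb_shiftE (F : 'rV[R]_d -> \bar R) (a : 'rV[R]_d) : measurable_fun setT F ->
  (forall x, 0 <= F x) -> \int[leb d]_x F (x + a)%R = \int[leb d]_x F x.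
Proof.
move=> mF F0; rewrite -(ge0_leb_affine (a := 1%R) a ltr01 mF F0) expr1n mul1e.
by apply: eq_integral => x _; rewrite scale1r.
Qed.

Definition law_density (p : R) (f : 'rV[R]_d -> R) (x : 'rV[R]_d) : R := (pdens p f x * phi x)%R.
Definition centered_density (p : R) (f : 'rV[R]_d -> R) (x : 'rV[R]_d) : R :=
  law_density p f (x + gmean (pdens p f))%R.
(** |f| divided by its L^p norm. Passing to the modulus is harmless, since |P_t f| <= P_t |f|. *)
Definition normalized (p : R) (f : 'rV[R]_d -> R) (x : 'rV[R]_d) : R :=
  (fine (gint (fun y => (`|f y| `^ p)%:E)) `^ (- p^-1) * `|f x|)%R.

Section one_function.
Variables (p : R) (f : 'rV[R]_d -> R).
Hypotheses (p1 : (1 < p)%R) (sf : smooth f)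
  (If : 0 < gint (fun x => (`|f x| `^ p)%:E) < +oo).
Let I := fine (gint (fun y => (`|f y| `^ p)%:E)).
Let F := normalized p f.
Let rho := law_density p f.
Let p0 : (0 < p)%R. Proof. exact: lt_trans p1. Qed.
Let cf : continuous f. Proof. by case: (smooth_row_C1 sf). Qed.
Let mf : measurable_fun setT f. Proof. exact: continuous_measurable_row. Qed.

Lemma gint_powK : gint (fun y => (`|f y| `^ p)%:E) = I%:E.
Proof. by rewrite /I fineK// ge0_fin_numE; case/andP: If => // h _; exact: ltW. Qed.

Lemma gint_pow_gt0 : (0 < I)%R.
Proof. by case/andP: If => h _; rewrite -lte_fin -gint_powK. Qed.
Let I0 := gint_pow_gt0.

Lemma measurable_pdens : measurable_fun setT (pdens p f).
Proof. by rewrite /pdens -/I; meas. Qed.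

Lemma pdens_ge0 x : (0 <= pdens p f x)%R.
Proof. by rewrite /pdens -/I divr_ge0 ?powR_ge0// ltW. Qed.

Lemma law_density_ge0 x : (0 <= rho x)%R.
Proof. by rewrite mulr_ge0 ?pdens_ge0 ?phi_ge0. Qed.

Lemma measurable_law_density : measurable_fun setT rho.
Proof. by rewrite /rho /law_density; have h := measurable_pdens; meas. Qed.

Lemma normalized_ge0 x : (0 <= F x)%R.
Proof. by rewrite mulr_ge0 ?powR_ge0. Qed.

Lemma continuous_normalized : continuous F.
Proof.
move=> x; have h : {for x, continuous (fun x : 'rV[R]_d => `|f x|%R)}.
  apply: (@continuous_distP R 'rV[R]_d (fun x => `|f x|%R) x) => e e0.
  have /cvgrPdist_le/(_ e e0) := @cf x; apply: filterS => y.
  exact: le_trans (ler_dist_dist _ _).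
exact: (cvgM (cvg_cst _) h).
Qed.

Lemma normalized_powE x : (F x `^ p = pdens p f x)%R.
Proof.
rewrite /F /normalized /pdens -/I powRM ?powR_ge0// -powRrM mulNr mulVf ?gt_eqF//.
by rewrite powR_inv1 ?ltW// mulrC.
Qed.

Lemma rho_of_normalized : rho_of F p = rho.
Proof. by apply/funext => x; rewrite /rho_of normalized_powE. Qed.

Lemma integral_law_density : \int[leb d]_x (rho x)%:E = 1.
Proof.
rewrite -(gam_leb measurable_pdens pdens_ge0).
have mp : measurable_fun setT (fun x => `|f x| `^ p)%R by meas.
have -> : \int[gam d]_x (pdens p f x)%:E = \int[gam d]_x (I^-1 * `|f x| `^ p)%:E.
  by apply: eq_integral => x _; rewrite /pdens -/I mulrC.
have Iv : (0 <= I^-1)%R by rewrite invr_ge0 ltW.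
rewrite (ge0_integralZ (gam d) mp (fun x => powR_ge0 _ _) Iv).
by rewrite -(gint_gam mp (fun x => powR_ge0 _ _)) gint_powK -EFinM mulVf// gt_eqF.
Qed.

Lemma row_C1_law_density : exists D, row_C1 rho D.
Proof.
have h := row_C1M (row_C1Z I^-1 (row_C1_abs_powR p1 (smooth_row_C1 sf))) (@row_C1_phi R d).
have -> : rho = (fun x => I^-1 * `|f x| `^ p * phi x)%R.
  by apply/funext => x; rewrite /rho /law_density /pdens -/I [(_ / I)%R]mulrC.
by eexists; exact: h.
Qed.

Lemma law_hatE (h : 'rV[R]_d -> R) : measurable_fun setT h -> (forall x, 0 <= h x)%R ->
  law_hat p f h = \int[leb d]_x (centered_density p f x * h x)%:E.
Proof.
move=> mh h0; rewrite /law_hat; set m := gmean _; have mp := measurable_pdens.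
have mF : measurable_fun setT (fun x => pdens p f x * h (x - m))%R by meas.
have F0 x : (0 <= pdens p f x * h (x - m))%R by rewrite mulr_ge0// pdens_ge0.
rewrite (gint_gam mF F0) (gam_leb mF F0).
have mG : measurable_fun setT (fun x => rho x * h (x - m))%R.
  by have h' : measurable_fun setT rho := measurable_law_density; meas.
have G0 x : (0 <= rho x * h (x - m))%R by rewrite mulr_ge0// law_density_ge0.
transitivity (\int[leb d]_x (rho x * h (x - m))%:E).
  by apply: eq_integral => x _; rewrite /rho /law_density mulrAC.
by rewrite -(leb_shift m mG G0); apply: eq_integral => x _; rewrite addrK.
Qed.

Lemma measurable_centered_density : measurable_fun setT (centered_density p f).
Proof. by rewrite /centered_density; have h : measurable_fun setT (law_density p f) := measurable_law_density; meas. Qed.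

Lemma centered_density_ge0 x : (0 <= centered_density p f x)%R.
Proof. exact: law_density_ge0. Qed.

Lemma integral_centered_density : \int[leb d]_x (centered_density p f x)%:E = 1.
Proof.
rewrite -integral_law_density; exact: (leb_shift _ measurable_law_density law_density_ge0).
Qed.

Lemma Dent_hat : Dent (law_hat p f) = \int[leb d]_x (kl (centered_density p f x) (phi x))%:E.
Proof.
apply: Dent_kl.
- exact: measurable_centered_density.
- exact: centered_density_ge0.
- exact: integral_centered_density.
- exact: law_hatE.
Qed.

Lemma row_C1_centered D : row_C1 rho D ->
  row_C1 (centered_density p f) (fun i x => D i (x + gmean (pdens p f))%R).
Proof.
move=> h; have := row_C1_affine 1 (gmean (pdens p f)) h.
have -> : (fun x => rho (gmean (pdens p f) + 1 *: x))%R = centered_density p f.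
  by apply/funext => x; rewrite scale1r addrC.
have -> // : (fun i (x : 'rV[R]_d) => 1 * D i (gmean (pdens p f) + 1 *: x))%R =
  (fun i x => D i (x + gmean (pdens p f)))%R.
by apply/funext => i; apply/funext => x; rewrite scale1r mul1r addrC.
Qed.

Hypothesis Mf : gint (fun x => (`|x| * pdens p f x)%:E) < +oo.

Lemma centered_mean (i : 'I_d) :
  \int[leb d]_y (Num.max (y 0%R i * centered_density p f y) 0)%:E =
    \int[leb d]_y (Num.max (- (y 0%R i * centered_density p f y)) 0)%:E /\
  \int[leb d]_y (Num.max (y 0%R i * centered_density p f y) 0)%:E < +oo.
Proof.
have mr := measurable_law_density; have md := measurable_pdens.
have mn : measurable_fun setT (fun x : 'rV[R]_d => `|x|%R).
  by apply: continuous_measurable_row => x; exact: norm_continuous.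
have mnd : measurable_fun setT (fun x : 'rV[R]_d => `|x| * pdens p f x)%R by meas.
have nd0 (x : 'rV[R]_d) : (0 <= `|x| * pdens p f x)%R by rewrite mulr_ge0// pdens_ge0.
pose A (x : 'rV[R]_d) := Num.max (x 0%R i * pdens p f x)%R 0%R.
pose B (x : 'rV[R]_d) := Num.max (- (x 0%R i * pdens p f x))%R 0%R.
have mA : measurable_fun setT A by rewrite /A; meas.
have mB : measurable_fun setT B by rewrite /B; meas.
have A0 x : (0 <= A x)%R by rewrite le_max lexx orbT.
have B0 x : (0 <= B x)%R by rewrite le_max lexx orbT.
have bd (G : 'rV[R]_d -> R) : measurable_fun setT G -> (forall x, 0 <= G x)%R ->
    (forall x, G x <= `|x| * pdens p f x)%R -> \int[gam d]_x (G x)%:E < +oo.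
  move=> mG G0 Gn; apply: le_lt_trans (ge0_le_integralr (gam d) mG mnd G0 Gn) _.
  by rewrite -(gint_gam mnd nd0).
have xn (x : 'rV[R]_d) : (`|x 0%R i * pdens p f x| <= `|x| * pdens p f x)%R.
  by rewrite normrM (ger0_norm (pdens_ge0 x)) ler_wpM2r ?pdens_ge0 ?coord_le_norm.
have fA : \int[gam d]_x (A x)%:E < +oo.
  by apply: bd => // x; rewrite ge_max nd0 andbT; apply: le_trans (ler_norm _) (xn x).
have fB : \int[gam d]_x (B x)%:E < +oo.
  by apply: bd => // x; rewrite ge_max nd0 andbT; apply: le_trans (ler_norm _) _; rewrite normrN.
have ge0 (G : 'rV[R]_d -> R) : (forall x, 0 <= G x)%R -> 0 <= \int[gam d]_x (G x)%:E.
  by move=> G0; exact: ge0_integral_real_ge0.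
have gm := gint_sub mA mB A0 B0 fA fB.
have [a aE] : exists a : R, \int[gam d]_x (A x)%:E = a%:E.
  by exists (fine (\int[gam d]_x (A x)%:E)); rewrite fineK// ge0_fin_numE// ge0.
have [b bE] : exists b : R, \int[gam d]_x (B x)%:E = b%:E.
  by exists (fine (\int[gam d]_x (B x)%:E)); rewrite fineK// ge0_fin_numE// ge0.
apply: (@centered_shift _ _ rho (gmean (pdens p f)) i a b) => //.
- exact: law_density_ge0.
- exact: integral_law_density.
- rewrite -aE (gam_leb mA A0); apply: eq_integral => x _; congr EFin.
  by rewrite /A maxr_pMl ?phi_ge0// mul0r mulrA.
- rewrite -bE (gam_leb mB B0); apply: eq_integral => x _; congr EFin.
  by rewrite /B maxr_pMl ?phi_ge0// mul0r mulNr mulrA.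
rewrite mxE (_ : (fun x => _) = (fun x => (A x - B x)%:E)) ?gm ?aE ?bE//.
apply/funext => x; congr EFin; rewrite /A /B; have /orP[h|h] := le_total 0%R (x 0%R i * pdens p f x)%R.
  by rewrite max_l// max_r ?subr0// oppr_le0.
by rewrite max_r// max_l ?sub0r ?opprK// oppr_ge0.
Qed.

End one_function.
End law.

(** * Reduction of all admissible exponents to the critical one *)

Section norm.
Context {R : realType} {d : nat}.
Local Open Scope ereal_scope.

(** Jensen's inequality with exponent q'/q, the Gaussian measure having total mass 1; finiteness at
    q follows from w^q <= w^q' + 1. *)
Lemma gam_powR_mono (w : 'rV[R]_d -> R) (q q' V : R) : measurable_fun setT w ->
  (forall x, 0 <= w x)%R -> (0 < q)%R -> (q <= q')%R -> \int[gam d]_x (w x `^ q')%:E = V%:E ->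
  exists2 S, \int[gam d]_x (w x `^ q)%:E = S%:E & (0 <= S <= V `^ (q / q'))%R.
Proof.
move=> mw w0 q0; have mq : measurable_fun setT (fun x => w x `^ q)%R by meas.
have ge0 : 0 <= \int[gam d]_x (w x `^ q)%:E.
  by apply: ge0_integral_real_ge0 => x; exact: powR_ge0.
rewrite le_eqVlt => /predU1P[<-|qq'] E.
  exists V => //; have V0 : (0 <= V)%R by rewrite -lee_fin -E.
  by rewrite divff ?gt_eqF// powRr1// V0 lexx.
have q'0 : (0 < q')%R by exact: lt_trans qq'.
have mq' : measurable_fun setT (fun x => w x `^ q')%R by meas.
have fin : \int[gam d]_x (w x `^ q)%:E < +oo.
  have m1 : measurable_fun setT (fun x => w x `^ q' + 1)%R by meas.
  apply: (@le_lt_trans _ _ (\int[gam d]_x (w x `^ q' + 1)%:E)).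
    apply: ge0_le_integralr => //; first by move=> x; exact: powR_ge0.
    move=> x; have [h|h] := leP 1%R (w x).
      by apply: le_trans (ler_powR h (ltW qq')) _; rewrite lerDl.
    apply: (@le_trans _ _ 1%R); last by rewrite lerDr powR_ge0.
    have -> : 1%R = (1 `^ q)%R :> R by rewrite powR1.
    by rewrite ge0_ler_powR ?nnegrE ?(ltW q0) ?(ltW h).
  have m2 : measurable_fun setT (fun _ : 'rV[R]_d => 1%R : R) by exact: measurable_cst.
  rewrite (ge0_integralDr (gam d) mq' m2 (fun x => powR_ge0 _ _) (fun=> ler01)).
  by rewrite E integral_gam_cst -EFinD ltry.
have [S SE] : exists S : R, \int[gam d]_x (w x `^ q)%:E = S%:E.
  by exists (fine (\int[gam d]_x (w x `^ q)%:E)); rewrite fineK// ge0_fin_numE.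
have S0 : (0 <= S)%R by rewrite -lee_fin -SE.
exists S => //; rewrite S0/=.
have r1 : (1 < q' / q)%R by rewrite ltr_pdivlMr// mul1r.
have := gam_jensen_powR r1 mq (fun x => powR_ge0 _ _) SE.
have -> : \int[gam d]_x ((w x `^ q) `^ (q' / q))%:E = V%:E.
  by rewrite -E; apply: eq_integral => x _; rewrite -powRrM mulrC divfK// gt_eqF.
rewrite lee_fin => h.
have -> : S = ((S `^ (q' / q)) `^ (q / q'))%R.
  by rewrite -powRrM (_ : (q' / q * (q / q') = 1)%R) ?powRr1//; field; rewrite !gt_eqF.
have V0 : (0 <= V)%R by rewrite -lee_fin -E; apply: ge0_integral_real_ge0 => x; exact: powR_ge0.
by rewrite ge0_ler_powR ?nnegrE ?powR_ge0// divr_ge0 ?ltW.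
Qed.

Variables (p : R) (f : 'rV[R]_d -> R).
Hypotheses (p1 : (1 < p)%R) (sf : smooth f)
  (If : 0 < gint (fun x => (`|f x| `^ p)%:E) < +oo).
Let I := fine (gint (fun y => (`|f y| `^ p)%:E)).
Let F := normalized p f.
Let p0 : (0 < p)%R. Proof. exact: lt_trans p1. Qed.
Let I0 : (0 < I)%R := gint_pow_gt0 If.
Let cF : continuous F := continuous_normalized (p := p) sf.
Let mF : measurable_fun setT F := continuous_measurable_row cF.
Let F0 x : (0 <= F x)%R := normalized_ge0 p f x.
Let rho1 : \int[leb d]_x (rho_of F p x)%:E = 1.
Proof. by rewrite (rho_of_normalized p1 If) (integral_law_density sf If). Qed.
Let mf : measurable_fun setT f.
Proof. by case: (smooth_row_C1 sf) => h _ _; exact: continuous_measurable_row. Qed.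

Lemma gaussLnorm_self : gaussLnorm p (fun x => (f x)%:E) = (I `^ p^-1)%:E.
Proof.
rewrite /gaussLnorm (_ : (fun x => _) = (fun x => (`|f x| `^ p)%:E)).
  by rewrite (gint_powK If) poweR_EFin.
by apply/funext => x; rewrite abse_EFin poweR_EFin.
Qed.

(** Norm of P_t at the critical exponent, applied to [normalized p f]. It is the only norm whose
    rate is studied, as the bounds for all q between p and the critical exponent go through it. *)
Definition ounorm (t : R) : R := fine (ouN F (nelson p t) t) `^ (nelson p t)^-1.

Lemma ouN_fineE t : (0 < t)%R -> exists2 V, ouN F (nelson p t) t = V%:E & (0 <= V <= 1)%R.
Proof.
move=> t0; have h := nelson_le1 p1 cF F0 rho1 t0.
have ge0 : 0 <= ouN F (nelson p t) t by apply: integral_ge0 => x _; exact: poweR_ge0.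
exists (fine (ouN F (nelson p t) t)); last first.
  by rewrite fine_ge0//= -lee_fin fineK// ge0_fin_numE//; apply: le_lt_trans h (ltry _).
by rewrite fineK// ge0_fin_numE//; apply: le_lt_trans h (ltry _).
Qed.

Lemma ounorm_le t lam : (0 < t)%R -> ouN F (nelson p t) t < (expR (nelson p t * t * lam))%:E ->
  (ounorm t <= expR (t * lam))%R.
Proof.
move=> t0; have [V VE /andP[V0 V1]] := ouN_fineE t0; rewrite /ounorm VE lte_fin /= => h.
have q0 : (0 < nelson p t)%R by exact: lt_trans (nelson_gt1 t p1).
have -> : expR (t * lam) = (expR (nelson p t * t * lam) `^ (nelson p t)^-1)%R.
  rewrite /powR gt_eqF ?expR_gt0// expRK; congr expR; field; by rewrite gt_eqF.
by rewrite ge0_ler_powR ?nnegrE ?expR_ge0 ?(ltW h)// invr_ge0 ltW.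
Qed.

Lemma ounorm_le1 t : (0 < t)%R -> (0 <= ounorm t <= 1)%R.
Proof.
move=> t0; have [V VE /andP[V0 V1]] := ouN_fineE t0; rewrite /ounorm VE /= powR_ge0/=.
have q0 : (0 < nelson p t)%R by exact: lt_trans (nelson_gt1 t p1).
have -> : 1%R = (1 `^ (nelson p t)^-1)%R :> R by rewrite powR1.
by rewrite ge0_ler_powR ?nnegrE ?invr_ge0 ?(ltW q0).
Qed.

(** |P_t f| <= P_t |f|, which is the L^p norm of f times P_t F, and norms for a probability measure
    increase with the exponent. *)
Lemma gaussLnorm_OU_le q t : (0 < t)%R -> (p <= q)%R -> (q <= nelson p t)%R ->
  gaussLnorm q (OU t f) <= (I `^ p^-1 * ounorm t)%:E.
Proof.
move=> t0 pq qq; have q0 : (0 < q)%R by exact: lt_le_trans pq.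
pose J := (I `^ p^-1)%R; have J0 : (0 <= J)%R by exact: powR_ge0.
pose sh (x y : 'rV[R]_d) := (expR (- t) *: x + Num.sqrt (1 - expR (- (2 * t))) *: y)%R.
have msh2 : measurable_fun setT (fun z : 'rV[R]_d * 'rV[R]_d => f (sh z.1 z.2)).
  by apply: (measurableT_comp mf); rewrite /sh; meas.
have msh x : measurable_fun setT (sh x) by rewrite /sh; meas.
have fE x : (`|f x| = J * F x)%R.
  by rewrite /F /normalized -/I mulrA /J powRN divff ?mul1r// gt_eqF// powR_gt0.
have mOU : measurable_fun setT (OU t f).
  apply: (measurable_gint (F := fun x y => (f (sh x y))%:E)).
  exact/measurable_EFinP.
have ou0 x : (0 <= ou F t x)%R by exact: smo_ge0.
have mou : measurable_fun setT (ou F t) by exact: measurable_smo.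
have OUle x : `|OU t f x| <= (J * ou F t x)%:E.
  have mfx : measurable_fun setT (fun y => f (sh x y)) by exact: (measurableT_comp mf (msh x)).
  have mFx : measurable_fun setT (fun y => F (sh x y)) by exact: (measurableT_comp mF (msh x)).
  have mfxE : measurable_fun setT (fun y => (f (sh x y))%:E) by exact/measurable_EFinP.
  apply: le_trans (abs_gint_le mfxE) _.
  rewrite EFinM (ou_fine x p1 mF F0 rho1 t0) -(ge0_integralZ (gam d) mFx (fun y => F0 _) J0).
  have mJ : measurable_fun setT (fun y => J * F (sh x y))%R by meas.
  rewrite -(gint_gam mJ (fun y => mulr_ge0 J0 (F0 _))) le_eqVlt; apply/orP; left; apply/eqP.
  by congr gint; apply/funext => y; rewrite abse_EFin fE.
pose g x := fine (OU t f x).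
have gE x : OU t f x = (g x)%:E.
  by rewrite /g fineK// fin_num_abs; apply: le_lt_trans (OUle x) (ltry _).
have mg : measurable_fun setT g by exact: measurableT_comp mOU.
have gle x : (`|g x| <= J * ou F t x)%R by rewrite -lee_fin -abse_EFin -gE.
have [V VE /andP[V0 V1]] := ouN_fineE t0.
have VE' : \int[gam d]_x (ou F t x `^ nelson p t)%:E = V%:E.
  by rewrite -VE; apply: eq_integral => x _; rewrite -(ou_fine x p1 mF F0 rho1 t0).
have [S SE /andP[S0 SV]] := gam_powR_mono mou ou0 q0 qq VE'.
have qb0 : (0 < nelson p t)%R by exact: lt_le_trans qq.
have Jq0 : (0 <= J `^ q)%R by exact: powR_ge0.
have mgq : measurable_fun setT (fun x => `|g x| `^ q)%R by meas.
have mouq : measurable_fun setT (fun x => ou F t x `^ q)%R by meas.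
have mJouq : measurable_fun setT (fun x => J `^ q * ou F t x `^ q)%R by meas.
have bound : \int[gam d]_x (`|g x| `^ q)%:E <= (J `^ q * S)%:E.
  rewrite EFinM -SE -(ge0_integralZ (gam d) mouq (fun x => powR_ge0 _ _) Jq0).
  apply: ge0_le_integralr => // x; rewrite -powRM//; rewrite ge0_ler_powR ?nnegrE ?(ltW q0)//.
  by rewrite mulr_ge0.
have ge0 : 0 <= \int[gam d]_x (`|g x| `^ q)%:E.
  by apply: ge0_integral_real_ge0 => x; exact: powR_ge0.
rewrite /gaussLnorm (_ : (fun x => _) = (fun x => (`|g x| `^ q)%:E)); last first.
  by apply/funext => x; rewrite gE abse_EFin poweR_EFin.
rewrite (gint_gam mgq (fun x => powR_ge0 _ _)).
have qi : (0 <= q^-1)%R by rewrite invr_ge0 ltW.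
apply: le_trans (gt0_ler_poweR qi _ _ bound) _.
- by rewrite in_itv/= ge0 leey.
- by rewrite in_itv/= leey lee_fin mulr_ge0.
rewrite poweR_EFin lee_fin powRM// -powRrM divff ?gt_eqF// powRr1//.
rewrite ler_wpM2l// /ounorm VE /=.
have -> : (V `^ (nelson p t)^-1 = (V `^ (q / nelson p t)) `^ q^-1)%R.
  by rewrite -powRrM; congr powR; field; rewrite !gt_eqF.
by rewrite ge0_ler_powR ?nnegrE ?powR_ge0.
Qed.

End norm.

(** * The law of the mixture *)

Section mix.
Context {R : realType} {d : nat}.
Local Open Scope ereal_scope.
Variables (p th : R) (f g : 'rV[R]_d -> R).
Hypotheses (p1 : (1 < p)%R) (sf : smooth f) (sg : smooth g)
  (If : 0 < gint (fun x => (`|f x| `^ p)%:E) < +oo)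
  (Ig : 0 < gint (fun x => (`|g x| `^ p)%:E) < +oo).
Let rX := centered_density p f.
Let rY := centered_density p g.

Lemma law_mixE (h : 'rV[R]_d -> R) : measurable_fun setT h -> (forall x, 0 <= h x)%R ->
  law_mix p th f g h =
  \int[leb d]_x \int[leb d]_y (rX x * rY y * h (Num.sqrt th *: x + Num.sqrt (1 - th) *: y)%R)%:E.
Proof.
move=> mh h0; rewrite /law_mix; set mx := gmean (pdens p f); set my := gmean (pdens p g).
pose hh (x y : 'rV[R]_d) := h (Num.sqrt th *: (x - mx) + Num.sqrt (1 - th) *: (y - my))%R.
have mpf := measurable_pdens p sf; have mpg := measurable_pdens p sg.
have f0 := pdens_ge0 If; have g0 := pdens_ge0 Ig.
have hh0 x y : (0 <= hh x y)%R by exact: h0.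
have mhh : measurable_fun setT (fun z : 'rV[R]_d * 'rV[R]_d => hh z.1 z.2).
  by apply: (measurableT_comp mh); meas.
have mp := @measurable_phi R d.
pose T x y := (law_density p f x * law_density p g y * hh x y)%R.
have T0 x y : (0 <= T x y)%R.
  by rewrite mulr_ge0// mulr_ge0// (law_density_ge0 If, law_density_ge0 Ig).
have mf2 : measurable_fun setT (fun z : 'rV[R]_d * 'rV[R]_d => pdens p f z.1) by exact: (measurableT_comp mpf).
have mg2 : measurable_fun setT (fun z : 'rV[R]_d * 'rV[R]_d => pdens p g z.2) by exact: (measurableT_comp mpg).
have mp1 : measurable_fun setT (fun z : 'rV[R]_d * 'rV[R]_d => phi z.1) by exact: (measurableT_comp mp).
have mp2 : measurable_fun setT (fun z : 'rV[R]_d * 'rV[R]_d => phi z.2) by exact: (measurableT_comp mp).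
have mT : measurable_fun setT (fun z : 'rV[R]_d * 'rV[R]_d => T z.1 z.2).
  exact: (measurable_funM (measurable_funM (measurable_funM mf2 mp1) (measurable_funM mg2 mp2)) mhh).
have mK : measurable_fun setT (fun z : 'rV[R]_d * 'rV[R]_d => (pdens p f z.1 * pdens p g z.2 * hh z.1 z.2)%R).
  exact: (measurable_funM (measurable_funM mf2 mg2) mhh).
have sec (G : 'rV[R]_d -> 'rV[R]_d -> R) x :
    measurable_fun setT (fun z : 'rV[R]_d * 'rV[R]_d => G z.1 z.2) -> measurable_fun setT (G x).
  by move=> mG; exact: (measurableT_comp mG (pair1_measurable x)).
have K0 x y : (0 <= pdens p f x * pdens p g y * hh x y)%R by rewrite mulr_ge0// mulr_ge0.
have mKE : measurable_fun setT (fun z : 'rV[R]_d * 'rV[R]_d => (pdens p f z.1 * pdens p g z.2 * hh z.1 z.2)%:E).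
  exact/measurable_EFinP.
have iK x : gint (fun y => (pdens p f x * pdens p g y * hh x y)%:E) =
    \int[gam d]_y (pdens p f x * pdens p g y * hh x y)%:E.
  exact: (gint_gam (sec (fun x y => pdens p f x * pdens p g y * hh x y)%R x mK) (K0 x)).
have iK0 x : 0 <= gint (fun y => (pdens p f x * pdens p g y * hh x y)%:E).
  by rewrite iK; exact: ge0_integral_real_ge0.
have miK : measurable_fun setT (fun x => gint (fun y => (pdens p f x * pdens p g y * hh x y)%:E)).
  exact: (measurable_gint (F := fun x y => (pdens p f x * pdens p g y * hh x y)%:E) mKE).
rewrite (gintE miK iK0) (ge0_integral_gam miK iK0).
have mTi : measurable_fun setT (fun x : 'rV[R]_d => \int[leb d]_y (T x y)%:E).
  apply: (@measurable_fun_fubini_tonelli_F _ _ _ _ R (leb d) (fun u : 'rV[R]_d * 'rV[R]_d => (T u.1 u.2)%:E)).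
    exact/measurable_EFinP.
  by move=> u; rewrite lee_fin.
have Ti0 x : 0 <= \int[leb d]_y (T x y)%:E by exact: ge0_integral_real_ge0.
transitivity (\int[leb d]_x \int[leb d]_y (T x y)%:E).
  apply: eq_integral => x _; rewrite iK (gam_leb (sec (fun x y => pdens p f x * pdens p g y * hh x y)%R x mK) (K0 x)) muleC.
  have mKp : measurable_fun setT (fun y => pdens p f x * pdens p g y * hh x y * phi y)%R.
    by apply: measurable_funM => //; exact: (sec (fun x y => pdens p f x * pdens p g y * hh x y)%R x mK).
  rewrite -(ge0_integralZ (leb d) mKp (fun y => mulr_ge0 (K0 x y) (phi_ge0 y)) (phi_ge0 x)).
  by apply: eq_integral => y _; congr EFin; rewrite /T /law_density; ring.
rewrite -(leb_shiftE mx mTi Ti0); apply: eq_integral => x _.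
rewrite -(leb_shift my (sec T (x + mx)%R mT) (T0 _)); apply: eq_integral => y _.
by rewrite /T /hh !addrK.
Qed.

End mix.

Section rate_of_function.
Context {R : realType} {d : nat}.
Local Open Scope ereal_scope.
Variables (p : R) (f : 'rV[R]_d -> R).
Hypotheses (p1 : (1 < p)%R) (sf : smooth f)
  (If : 0 < gint (fun x => (`|f x| `^ p)%:E) < +oo).

Lemma ounorm_rate (E : R) :
  \int[leb d]_x (kl (centered_density p f x) (phi x))%:E = E%:E ->
  exists (D : 'I_d -> 'rV[R]_d -> R) (M : R), [/\ row_C1 (centered_density p f) D,
    \int[leb d]_x (sqn x * centered_density p f x)%:E = M%:E &
    forall lam : R, (\forall t \near (0%R : R)^'+, ounorm p f t <= expR (t * lam))%R \/
      2^-1%:E * \sum_(i < d) \int[leb d]_x (D i x ^+ 2 / centered_density p f x)%:E <=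
        (E - M / 2 + d%:R - p ^+ 2 / (p - 1) * lam / 2)%:E].
Proof.
move=> hE; set m := gmean (pdens p f).
have [D rD] := row_C1_law_density p1 sf.
have mr := measurable_law_density p sf; have r0 := law_density_ge0 If.
have r1 := integral_law_density sf If.
have fin : \int[leb d]_x (kl (law_density p f (x + m)%R) (phi x))%:E < +oo by rewrite hE ltry.
have [E0 [M [E' [M' [hE0 hM hE' hM' EQ]]]]] := entropy_unshift mr r0 r1 fin.
have EE : E0 = E by move: hE0; rewrite hE => -[].
exists (fun i x => D i (x + m)%R), M; split => //; first exact: row_C1_centered.
move=> lam.
have cF := continuous_normalized (p := p) sf; have mF := continuous_measurable_row cF.
have F0 x : (0 <= normalized p f x)%R := normalized_ge0 p f x.
have rE := rho_of_normalized p1 If.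
have rD' : row_C1 (rho_of (normalized p f) p) D by rewrite rE.
have r1' : \int[leb d]_x (rho_of (normalized p f) p x)%:E = 1 by rewrite rE.
have hE2 : \int[leb d]_x (kl (rho_of (normalized p f) p x) (phi x))%:E = E'%:E by rewrite rE.
have hM2 : \int[leb d]_x (sqn x * rho_of (normalized p f) p x)%:E = M'%:E by rewrite rE.
have fin' : \int[leb d]_x (kl (rho_of (normalized p f) p x) (phi x))%:E < +oo by rewrite hE2 ltry.
have [h|h] := rate_dichotomy p1 mF F0 rD' r1' fin' lam hE2 hM2; [left|right].
  by apply: filterS2 (nbhs_right_gt 0) h => t t0; exact: ounorm_le.
have mD i : measurable_fun setT (D i) by case: rD => _ h' _; exact: continuous_measurable_row.
have -> : \sum_(i < d) \int[leb d]_x (D i (x + m)%R ^+ 2 / centered_density p f x)%:E =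
    \sum_(i < d) \int[leb d]_x (D i x ^+ 2 / rho_of (normalized p f) p x)%:E.
  apply: eq_bigr => i _; rewrite rE.
  have mq : measurable_fun setT (fun x => D i x ^+ 2 / law_density p f x)%R by have h' := mD i; meas.
  have q0 x : (0 <= D i x ^+ 2 / law_density p f x)%R by rewrite divr_ge0// sqr_ge0.
  by rewrite -(leb_shift m mq q0).
by rewrite (_ : (E - M / 2 = E' - M' / 2)%R)// -EE.
Qed.

End rate_of_function.

(** * Rate of the product of the two norms *)

Section mixture_rate.
Context {R : realType} {d : nat}.
Local Open Scope ereal_scope.
Variables (p th : R) (f g : 'rV[R]_d -> R).
Hypotheses (p1 : (1 < p)%R) (sf : smooth f) (sg : smooth g)
  (If : 0 < gint (fun x => (`|f x| `^ p)%:E) < +oo)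
  (Ig : 0 < gint (fun x => (`|g x| `^ p)%:E) < +oo).
Let rX := centered_density p f.
Let rY := centered_density p g.
Let kap : R := (2 * (p - 1) / p ^+ 2)%R.

Lemma sum_second_moment (r : 'rV[R]_d -> R) (M : R) : measurable_fun setT r ->
  (forall x, 0 <= r x)%R -> \int[leb d]_x (sqn x * r x)%:E = M%:E ->
  exists2 a : 'I_d -> R, (forall i, \int[leb d]_x (x 0%R i ^+ 2 * r x)%:E = (a i)%:E) & (\sum_i a i = M)%R.
Proof.
move=> mr r0 hM.
have mi (i : 'I_d) : measurable_fun setT (fun x : 'rV[R]_d => (x 0%R i ^+ 2 * r x)%:E) by meas.
have i0 (i : 'I_d) (x : 'rV[R]_d) : 0 <= (x 0%R i ^+ 2 * r x)%:E.
  by rewrite lee_fin mulr_ge0// sqr_ge0.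
have S : \sum_(i < d) \int[leb d]_x (x 0%R i ^+ 2 * r x)%:E = M%:E.
  rewrite -hM -ge0_integral_sum//.
  by apply: eq_integral => x _; rewrite sumEFin /sqn mulr_suml.
have I0 (i : 'I_d) : 0 <= \int[leb d]_x (x 0%R i ^+ 2 * r x)%:E by exact: integral_ge0.
have fin i : \int[leb d]_x (x 0%R i ^+ 2 * r x)%:E \is a fin_num.
  have : \sum_(i < d) \int[leb d]_x (x 0%R i ^+ 2 * r x)%:E \is a fin_num by rewrite S.
  by move/sum_fin_numP; apply => //; rewrite mem_index_enum.
exists (fun i => fine (\int[leb d]_x (x 0%R i ^+ 2 * r x)%:E)); first by move=> i; rewrite fineK.
apply: EFin_inj; rewrite -S -sumEFin; apply: eq_bigr => i _; exact: fineK.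
Qed.

Lemma Dent_mix : (0 < th < 1)%R -> Dent (law_mix p th f g) =
  \int[leb d]_z (kl (mixed_density rX rY (Num.sqrt th) (Num.sqrt (1 - th)) z) (phi z))%:E.
Proof.
move=> /andP[t0 t1].
have [DX cX0] := row_C1_law_density p1 sf; have [DY cY0] := row_C1_law_density p1 sg.
have cX := row_C1_centered cX0; have cY := row_C1_centered cY0.
have X0 := centered_density_ge0 If; have Y0 := centered_density_ge0 Ig.
have X1 := integral_centered_density sf If; have Y1 := integral_centered_density sg Ig.
have c0 : (0 < Num.sqrt th)%R by rewrite sqrtr_gt0.
have cs : (Num.sqrt th ^+ 2 + Num.sqrt (1 - th) ^+ 2 = 1)%R.
  by rewrite !sqr_sqrtr ?subr_ge0 ?ltW// addrC subrK.
apply: Dent_kl.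
- exact: (measurable_mixed_density _ _ cX cY X0 Y0).
- exact: (@mixed_density_ge0 R d rX rY _ _ X0 Y0).
- exact: (integral_mixed_density cX cY X0 Y0 X1 Y1 c0 cs).
- move=> h mh h0; rewrite (law_mixE th sf sg If Ig mh h0).
  exact: (mixed_density_law cX cY X0 Y0 X1 Y1 c0 cs mh h0).
Qed.

Hypothesis Mg : gint (fun x => (`|x| * pdens p g x)%:E) < +oo.

Lemma near_product (a b lf lg L : R) (u v : R -> R) : (0 <= a)%R -> (0 <= b)%R ->
  (forall t, 0 < t -> 0 <= u t)%R -> (forall t, 0 < t -> 0 <= v t)%R ->
  (\forall t \near (0%R : R)^'+, u t <= expR (t * lf))%R ->
  (\forall t \near (0%R : R)^'+, v t <= expR (t * lg))%R -> (a * lf + b * lg <= L)%R ->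
  (\forall t \near (0%R : R)^'+, u t `^ a * v t `^ b <= expR (t * L))%R.
Proof.
move=> a0 b0 u0 v0 hu hv hL.
have hp : \forall t \near (0%R : R)^'+, (0 < t)%R by exact: nbhs_right_gt.
near=> t; have t0 : (0 < t)%R by near: t.
have pE (z k : R) : (expR z `^ k = expR (k * z))%R by rewrite /powR gt_eqF ?expR_gt0// expRK.
apply: (@le_trans _ _ (expR (t * lf) `^ a * expR (t * lg) `^ b)%R).
  apply: ler_pM; rewrite ?powR_ge0//; apply: ge0_ler_powR; rewrite ?nnegrE ?expR_ge0 ?u0 ?v0//.
    by near: t.
  by near: t.
rewrite !pE -expRD ler_expR; have := ler_wpM2l (ltW t0) hL; lra.
Unshelve. all: by end_near. Qed.

Lemma mixture_rate (EX EY EZ eps : R) : (0 < th < 1)%R -> (0 < eps)%R ->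
  Dent (law_hat p f) = EX%:E -> Dent (law_hat p g) = EY%:E ->
  Dent (law_mix p th f g) = EZ%:E ->
  (\forall t \near (0%R : R)^'+, ounorm p f t `^ (1 - th) * ounorm p g t `^ th <=
     expR (t * (eps - kap * (th * EX + (1 - th) * EY - EZ))))%R.
Proof.
move=> th01 eps0; rewrite (Dent_mix th01) (Dent_hat sf If) (Dent_hat sg Ig) => hX hY hZ.
have /andP[t0 t1] := th01.
have ot0 : (0 < 1 - th)%R by rewrite subr_gt0.
have [DX [MX [cX hMX rateX]]] := ounorm_rate p1 sf If hX.
have [DY [MY [cY hMY rateY]]] := ounorm_rate p1 sg Ig hY.
have X0 := centered_density_ge0 If; have Y0 := centered_density_ge0 Ig.
have X1 := integral_centered_density sf If; have Y1 := integral_centered_density sg Ig.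
have mX := measurable_centered_density p sf; have mY := measurable_centered_density p sg.
have uf t : (0 < t)%R -> (0 <= ounorm p f t)%R by move=> h; case/andP: (ounorm_le1 p1 sf If h).
have ug t : (0 < t)%R -> (0 <= ounorm p g t)%R by move=> h; case/andP: (ounorm_le1 p1 sg Ig h).
set L := (eps - _)%R.
have zero (k : 'rV[R]_d -> R) : smooth k -> 0 < gint (fun x => (`|k x| `^ p)%:E) < +oo ->
    (\forall t \near (0%R : R)^'+, ounorm p k t <= expR (t * 0))%R.
  move=> sk Ik; have hp : \forall t \near (0%R : R)^'+, (0 < t)%R by exact: nbhs_right_gt.
  apply: filterS hp => t tp; rewrite mulr0 expR0.
  by case/andP: (ounorm_le1 p1 sk Ik tp).
have fi0 (r : 'rV[R]_d -> R) (D : 'I_d -> 'rV[R]_d -> R) i : (forall x, 0 <= r x)%R ->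
    0 <= \int[leb d]_x (D i x ^+ 2 / r x)%:E.
  by move=> r0; apply: ge0_integral_real_ge0 => x; rewrite divr_ge0// sqr_ge0.
have sfi0 (r : 'rV[R]_d -> R) (D : 'I_d -> 'rV[R]_d -> R) : (forall x, 0 <= r x)%R ->
    0 <= \sum_(i < d) \int[leb d]_x (D i x ^+ 2 / r x)%:E.
  by move=> r0; apply: sume_ge0 => i _; exact: fi0.
have dich (r : 'rV[R]_d -> R) (D : 'I_d -> 'rV[R]_d -> R) : (forall x, 0 <= r x)%R ->
    \sum_(i < d) \int[leb d]_x (D i x ^+ 2 / r x)%:E = +oo \/
    exists2 a : 'I_d -> R, (forall i, \int[leb d]_x (D i x ^+ 2 / r x)%:E = (a i)%:E) &
      \sum_(i < d) \int[leb d]_x (D i x ^+ 2 / r x)%:E = (\sum_i a i)%:E.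
  move=> r0; have h := sfi0 r D r0.
  have [fin|] := boolP (\sum_(i < d) \int[leb d]_x (D i x ^+ 2 / r x)%:E \is a fin_num); last first.
    by rewrite ge0_fin_numE// -leNgt leye_eq => /eqP; left.
  right; exists (fun i => fine (\int[leb d]_x (D i x ^+ 2 / r x)%:E)) => [i|].
    by rewrite fineK//; move/sum_fin_numP: fin; apply => //; rewrite mem_index_enum.
  rewrite -sumEFin; apply: eq_bigr => i _; rewrite fineK//.
  by move/sum_fin_numP: fin; apply => //; rewrite mem_index_enum.
have half : 2^-1%:E * +oo = +oo :> \bar R by rewrite gt0_muley// lte_fin invr_gt0.
(* If X has infinite Fisher information, the first alternative holds for every lam; lam = L / (1 -
   th) lets this factor alone supply e^(t L), the other being at most 1. Likewise for Y with L /
   th. *)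
have [iX|[JX hJX sJX]] := dich _ DX X0.
  have [h|] := rateX (L / (1 - th))%R; last by rewrite iX half leye_eq.
  apply: (near_product (ltW ot0) (ltW t0) uf ug h (zero g sg Ig)).
  by rewrite mulr0 addr0 mulrC divfK// gt_eqF.
have [iY|[JY hJY sJY]] := dich _ DY Y0.
  have [h|] := rateY (L / th)%R; last by rewrite iY half leye_eq.
  apply: (near_product (ltW ot0) (ltW t0) uf ug (zero f sf If) h).
  by rewrite mulr0 add0r mulrC divfK// gt_eqF.
have [aX haX saX] := sum_second_moment mX X0 hMX.
have [aY haY saY] := sum_second_moment mY Y0 hMY.
have p0 : (0 < p)%R by exact: lt_trans p1.
have p10 : (0 < p - 1)%R by rewrite subr_gt0.
have kap0 : (0 < kap)%R by rewrite divr_gt0 ?mulr_gt0 ?exprn_gt0.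
have kapE (lam : R) : (kap * (p ^+ 2 / (p - 1) * lam / 2) = lam)%R.
  by rewrite /kap; field; rewrite !gt_eqF.
(* The slack eps excludes the second alternative of the dichotomy, which for lam = lf would read lf
   <= lf - eps. Since the weights sum to 1, the two slacks recombine to eps. *)
pose lf := (kap * (EX - MX / 2 + d%:R - (\sum_i JX i) / 2) + eps)%R.
pose lg := (kap * (EY - MY / 2 + d%:R - (\sum_i JY i) / 2) + eps)%R.
have absurd (E M J lam : R) : (lam = kap * (E - M / 2 + d%:R - J / 2) + eps)%R ->
    2^-1%:E * J%:E <= (E - M / 2 + d%:R - p ^+ 2 / (p - 1) * lam / 2)%:E -> False.
  move=> lE; rewrite -EFinM lee_fin => h.
  have := ler_wpM2l (ltW kap0) h; rewrite [X in (_ <= X)%R]mulrBr kapE lE !mulrBr; lra.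
have [hf|] := rateX lf; last by rewrite sJX => /(absurd _ _ _ _ erefl).
have [hg|] := rateY lg; last by rewrite sJY => /(absurd _ _ _ _ erefl).
apply: (near_product (ltW ot0) (ltW t0) uf ug hf hg).
have c0 : (0 < Num.sqrt th)%R by rewrite sqrtr_gt0.
have s0 : (0 < Num.sqrt (1 - th))%R by rewrite sqrtr_gt0.
have c2 : (Num.sqrt th ^+ 2 = th)%R by rewrite sqr_sqrtr// ltW.
have s2 : (Num.sqrt (1 - th) ^+ 2 = 1 - th)%R by rewrite sqr_sqrtr// ltW.
have cs : (Num.sqrt th ^+ 2 + Num.sqrt (1 - th) ^+ 2 = 1)%R by rewrite c2 s2 addrC subrK.
have Yc i := (centered_mean sg Ig Mg i).1; have Yf i := (centered_mean sg Ig Mg i).2.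
have IY i : \int[leb d]_y (DY i y ^+ 2 / rY y)%:E < +oo by rewrite hJY ltry.
pose S := ((1 - th) * MX + th * MY + ((1 - th) * \sum_i JX i + th * \sum_i JY i))%R.
have lin (a b a' b' : \bar R) (x y z w : R) : a = x%:E -> b = y%:E -> a' = z%:E -> b' = w%:E ->
    (1 - th)%:E * a + th%:E * b + ((1 - th)%:E * a' + th%:E * b') =
    ((1 - th) * x + th * y + ((1 - th) * z + th * w))%:E.
  by move=> -> -> -> ->; rewrite -!EFinM -!EFinD.
have SE : \sum_(i < d) ((Num.sqrt (1 - th) ^+ 2)%:E * \int[leb d]_x (x 0%R i ^+ 2 * rX x)%:E +
    (Num.sqrt th ^+ 2)%:E * \int[leb d]_x (x 0%R i ^+ 2 * rY x)%:E +
    ((Num.sqrt (1 - th) ^+ 2)%:E * \int[leb d]_x (DX i x ^+ 2 / rX x)%:E +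
     (Num.sqrt th ^+ 2)%:E * \int[leb d]_x (DY i x ^+ 2 / rY x)%:E)) = S%:E.
  rewrite s2 c2 /S -saX -saY !mulr_sumr -!big_split/= -sumEFin; apply: eq_bigr => i _.
  exact: lin (haX i) (haY i) (hJX i) (hJY i).
(* The weighted rates add up to kap ((1 - th) EX + th EY + d - S/2) + eps, and this inequality
   bounds d - S/2 by EZ - EX - EY. *)
have : EX%:E + EY%:E + (d%:R)%:E <= EZ%:E + 2^-1%:E * S%:E.
  rewrite -hX -hY -hZ -SE.
  exact: (static_inequality cX cY X0 Y0 X1 Y1 c0 s0 cs Yc Yf IY).
rewrite -EFinM -!EFinD lee_fin => st.
rewrite /S in st; rewrite /L /lf /lg; move: (\sum_i JX i)%R (\sum_i JY i)%R st => jx jy st.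
have := ler_wpM2l (ltW kap0) st; lra.
Qed.

End mixture_rate.

(** [+oo - +oo] is -oo in the extended reals, so an infinite entropy can never be compensated:
    finiteness of the combination makes each of the three entropies finite. *)
Lemma fin_num_convex_sub (R : realType) (a b : R) (A B C : \bar R) : (0 < a)%R -> (0 < b)%R ->
  (0 <= A)%E -> (0 <= B)%E -> (a%:E * A + b%:E * B - C)%E \is a fin_num ->
  exists x y z : R, [/\ A = x%:E, B = y%:E & C = z%:E].
Proof.
move=> a0 b0; case: A => [x| |]//; case: B => [y| |]//; case: C => [z| |]//;
  try (by rewrite ?gt0_muley ?lte_fin).
by move=> _ _ _; exists x, y, z.
Qed.

Lemma lee_powRM_pair (R : realType) (a b x y u v X : R) : 0 <= x -> 0 <= y -> 0 <= u -> 0 <= v ->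
  u `^ a * v `^ b <= X ->
  (((x * u) `^ a * (y * v) `^ b)%:E <= X%:E * poweR x%:E a * poweR y%:E b)%E.
Proof.
move=> x0 y0 u0 v0 h; rewrite !poweR_EFin -!EFinM lee_fin !powRM// mulrACA.
by rewrite mulrC -[leRHS]mulrA ler_wpM2r// mulr_ge0 ?powR_ge0.
Qed.

(** * Endpoint cases and the final estimate *)

Section assembly.
Context {R : realType} {d : nat}.
Local Open Scope ereal_scope.
Variables (p : R) (f g : 'rV[R]_d -> R).
Hypotheses (p1 : (1 < p)%R) (sf : smooth f) (sg : smooth g)
  (If : 0 < gint (fun x => (`|f x| `^ p)%:E) < +oo)
  (Ig : 0 < gint (fun x => (`|g x| `^ p)%:E) < +oo).

Lemma Dent_mix0 : Dent (law_mix p 0 f g) = Dent (law_hat p g).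
Proof.
have mX := measurable_centered_density p sf; have mY := measurable_centered_density p sg.
have X0 := centered_density_ge0 If; have Y0 := centered_density_ge0 Ig.
have X1 := integral_centered_density sf If; have Y1 := integral_centered_density sg Ig.
rewrite (Dent_hat sg Ig); apply: Dent_kl => // h mh h0.
rewrite (law_mixE 0 sf sg If Ig mh h0).
have mYh : measurable_fun setT (fun y => centered_density p g y * h y)%R by meas.
have Yh0 y : (0 <= centered_density p g y * h y)%R by rewrite mulr_ge0.
have I0 : 0 <= \int[leb d]_y (centered_density p g y * h y)%:E by exact: ge0_integral_real_ge0.
transitivity (\int[leb d]_x ((centered_density p f x)%:E * \int[leb d]_y (centered_density p g y * h y)%:E)).
  apply: eq_integral => x _.
  rewrite -(ge0_integralZ (leb d) mYh Yh0 (X0 x)); apply: eq_integral => y _.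
  by rewrite sqrtr0 subr0 sqrtr1 scale0r scale1r add0r mulrA.
by rewrite (ge0_integralZre mX X0 I0) X1 mul1e.
Qed.

Lemma Dent_mix1 : Dent (law_mix p 1 f g) = Dent (law_hat p f).
Proof.
have mX := measurable_centered_density p sf; have mY := measurable_centered_density p sg.
have X0 := centered_density_ge0 If; have Y0 := centered_density_ge0 Ig.
have X1 := integral_centered_density sf If; have Y1 := integral_centered_density sg Ig.
rewrite (Dent_hat sf If); apply: Dent_kl => // h mh h0.
rewrite (law_mixE 1 sf sg If Ig mh h0); apply: eq_integral => x _.
transitivity (\int[leb d]_y (centered_density p f x * h x * centered_density p g y)%:E).
  apply: eq_integral => y _.
  by rewrite subrr sqrtr0 sqrtr1 scale0r scale1r addr0 mulrAC.
by rewrite (ge0_integralZ (leb d) mY Y0 (mulr_ge0 (X0 x) (h0 x))) Y1 mule1.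
Qed.

Hypothesis Mg : gint (fun x => (`|x| * pdens p g x)%:E) < +oo.

Lemma Dent_hat_ge0 : 0 <= Dent (law_hat p f).
Proof.
rewrite (Dent_hat sf If); apply: ge0_integral_real_ge0 => x.
by rewrite kl_ge0 ?phi_gt0// (centered_density_ge0 If).
Qed.

Lemma ounorm_product_rate (th eps : R) : (0 <= th <= 1)%R -> Ept p th f g \is a fin_num ->
  (0 < eps)%R -> 0 <= Dent (law_hat p g) -> 
  (\forall t \near (0%R : R)^'+, ounorm p f t `^ (1 - th) * ounorm p g t `^ th <=
     expR (t * (eps - 2 * (p - 1) / p ^+ 2 * fine (Ept p th f g))))%R.
Proof.
move=> /andP[th0 th1] Efin eps0 Dg0.
have hp : \forall t \near (0%R : R)^'+, (0 < t)%R by exact: nbhs_right_gt.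
have Df0 := Dent_hat_ge0.
move: th0; rewrite le_eqVlt => /predU1P[th0|th0].
  have E0 : Ept p th f g = 0.
    move: Efin; rewrite -th0 /Ept Dent_mix0 subr0 mul0e add0e mul1e => h.
    by rewrite subee//; move: h; case: (Dent _).
  rewrite E0 -th0; apply: filterS hp => t t0.
  have /andP[u0 u1] := ounorm_le1 p1 sf If t0.
  have -> : (ounorm p f t `^ (1 - 0) * ounorm p g t `^ 0 = ounorm p f t)%R.
    by move: (ounorm p f t) (ounorm p g t) u0 => a b a0; rewrite subr0 powRr1// powRr0 mulr1.
  apply: le_trans u1 _; rewrite [fine _]/= mulr0 subr0.
  by rewrite -expR0 ler_expR mulr_ge0 ?ltW.
move: th1; rewrite le_eqVlt => /predU1P[th1|th1].
  have E0 : Ept p th f g = 0.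
    move: Efin; rewrite th1 /Ept Dent_mix1 subrr mul0e adde0 mul1e => h.
    by rewrite subee//; move: h; case: (Dent _).
  rewrite E0 th1; apply: filterS hp => t t0.
  have /andP[u0 u1] := ounorm_le1 p1 sg Ig t0.
  have -> : (ounorm p f t `^ (1 - 1) * ounorm p g t `^ 1 = ounorm p g t)%R.
    by move: (ounorm p f t) (ounorm p g t) u0 => a b b0; rewrite subrr powRr1// powRr0 mul1r.
  apply: le_trans u1 _; rewrite [fine _]/= mulr0 subr0.
  by rewrite -expR0 ler_expR mulr_ge0 ?ltW.
have th01 : (0 < th < 1)%R by rewrite th0 th1.
have ot0 : (0 < 1 - th)%R by rewrite subr_gt0.
have [EX [EY [EZ [hX hY hZ]]]] := fin_num_convex_sub th0 ot0 Df0 Dg0 Efin.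
have hE : Ept p th f g = (th * EX + (1 - th) * EY - EZ)%:E by rewrite /Ept hX hY hZ.
rewrite hE; exact: (mixture_rate p1 sf sg If Ig Mg th01 eps0 hX hY hZ).
Qed.

End assembly.

Theorem theorem7 (R : realType) (d : nat) (p th : R) (f g : 'rV[R]_d -> R) :
  1 < p -> 0 <= th <= 1 ->
  smooth f -> smooth g ->
  (* f, g in L^p(gamma), not identically zero (so that X, Y are defined) *)
  (0 < gint (fun x => (`|f x| `^ p)%:E) < +oo)%E ->
  (0 < gint (fun x => (`|g x| `^ p)%:E) < +oo)%E ->
  (* X and Y have finite means (so that hat X, hat Y are defined) *)
  (gint (fun x => (`|x| * pdens p f x)%:E) < +oo)%E ->
  (gint (fun x => (`|x| * pdens p g x)%:E) < +oo)%E ->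
  (* E_{p,theta}(f,g) is a well-defined real number *)
  Ept p th f g \is a fin_num ->
  let p' := p / (p - 1) in
  exists r : R -> R,
    (fun t => r t / t) @ 0^'+ --> 0 /\
    \forall t \near 0^'+, forall q : R, p <= q -> q <= 1 + (p - 1) * expR (2 * t) ->
      (poweR (gaussLnorm q (OU t f)) (1 - th) * poweR (gaussLnorm q (OU t g)) th
       <= (expR (- (2 * t / (p * p')) * fine (Ept p th f g) + r t))%:E
          * poweR (gaussLnorm p (fun x => (f x)%:E)) (1 - th)
          * poweR (gaussLnorm p (fun x => (g x)%:E)) th)%E.
Proof.
move=> p1 /andP[th0 th1] sf sg If Ig Mf Mg Efin p'.
have p0 : 0 < p by exact: lt_trans p1.
have p10 : 0 < p - 1 by rewrite subr_gt0.
have ot0 : 0 <= 1 - th by rewrite subr_ge0.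
pose K := 2 * (p - 1) / p ^+ 2 * fine (Ept p th f g).
have KE t : - (2 * t / (p * p')) * fine (Ept p th f g) = - (t * K).
  by rewrite /K /p'; field; rewrite !gt_eqF.
pose B t := ounorm p f t `^ (1 - th) * ounorm p g t `^ th.
have B0 t : 0 <= B t by rewrite mulr_ge0 ?powR_ge0.
(* ln 0 = 0, hence the case distinction. *)
pose r t := if B t == 0 then 0 else Num.max 0 (ln (B t) + t * K).
have hp : \forall t \near (0 : R)^'+, 0 < t by exact: nbhs_right_gt.
(* The maximum with 0 makes r nonnegative, so that only an upper bound for r t / t has to be
   found. *)
have r0 t : 0 <= r t by rewrite /r; case: ifP => // _; rewrite le_max lexx.
have Br t : B t <= expR (- (t * K) + r t).
  rewrite /r; case: eqP => [->|/eqP Bn]; first exact: expR_ge0.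
  have Bp : 0 < B t by rewrite lt0r Bn B0.
  rewrite -{1}(lnK (x := B t)) ?posrE// ler_expR addrC -lerBlDr opprK le_max lexx orbT//.
exists r; split.
  apply/cvgrPdist_le => e e0.
  have th01 : 0 <= th <= 1 by rewrite th0 th1.
  (* With slack e the rate reads ln (B t) + t K <= t e, which is r t / t <= e for small t. *)
  have h := ounorm_product_rate p1 sf sg If Ig Mg th01 Efin e0 (Dent_hat_ge0 sg Ig).
  apply: filterS2 hp h => t t0; rewrite -/(B t) -/K => h.
  rewrite sub0r normrN ger0_norm ?divr_ge0 ?(ltW t0)// ler_pdivrMr//.
  rewrite /r; case: eqP => [_|/eqP Bn]; first by rewrite mulr_ge0 ?ltW.
  have Bp : 0 < B t by rewrite lt0r Bn B0.
  have := h; rewrite -{1}(lnK (x := B t)) ?posrE// ler_expR => h'.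
  rewrite ge_max (mulr_ge0 (ltW e0) (ltW t0))/=; move: h'; rewrite mulrBr [e * t]mulrC; lra.
apply: filterS hp => t t0 q pq qq.
have hf := gaussLnorm_OU_le p1 sf If t0 pq qq.
have hg := gaussLnorm_OU_le p1 sg Ig t0 pq qq.
rewrite (gaussLnorm_self If) (gaussLnorm_self Ig) KE.
have /andP[uf _] := ounorm_le1 p1 sf If t0; have /andP[ug _] := ounorm_le1 p1 sg Ig t0.
move: hf hg; set Jf := (fine _ `^ p^-1); set Jg := (fine _ `^ p^-1) => hf hg.
have Jf0 : 0 <= Jf by exact: powR_ge0.
have Jg0 : 0 <= Jg by exact: powR_ge0.
have mono (x : \bar R) (y k : R) : 0 <= k -> (0 <= x)%E -> 0 <= y -> (x <= y%:E)%E -> (poweR x k <= (y `^ k)%:E)%E.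
  move=> k0 x0 y0 xy; rewrite -poweR_EFin; apply: gt0_ler_poweR => //.
    by rewrite in_itv/= x0 leey.
  by rewrite in_itv/= lee_fin y0 leey.
apply: (@le_trans _ _ ((Jf * ounorm p f t) `^ (1 - th) * (Jg * ounorm p g t) `^ th)%:E).
  have h1 := mono _ _ _ ot0 (poweR_ge0 _ _) (mulr_ge0 Jf0 uf) hf.
  have h2 := mono _ _ _ th0 (poweR_ge0 _ _) (mulr_ge0 Jg0 ug) hg.
  by rewrite EFinM; exact: (lee_pmul (poweR_ge0 _ _) (poweR_ge0 _ _) h1 h2).
exact: lee_powRM_pair (Br t).
Qed.
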